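(* Let $V$ be a strongly rational vertex operator algebra and $W$ an irreducible $V$-module. For a section $\varphi\in\Gamma(\mathbb H,\mathscr C_{\mathbb H}(W))$ and $\xi=q\frac d{dq}=\frac1{2\pi i}\frac d{d\tau}$ ($q=e^{2\pi i\tau}$), define $\nabla_\xi\varphi:\mathbb H\to W^*$ by $$\langle\nabla_\xi\varphi(\tau)\,|\,v\rangle:=\Big(q\frac d{dq}\Big)\langle\varphi(\tau)|v\rangle-\frac1{(2\pi i)^2}\langle\varphi(\tau)\,|\,T(\tau)v\rangle,\qquad v\in W,$$ where $T(\tau)=L[-2]-\sum_{k\ge1}G_{2k}(\tau)L[2k-2]$. Then $\nabla_\xi\varphi$ is a section of conformal blocks, i.e. of $\mathscr C_{\mathbb H}(W)$. In particular, $\nabla_\xi:\mathscr C_{\mathbb H}(W)\to\mathscr C_{\mathbb H}(W)$ is a well-defined $\mathbb C$-linear operator (on sections), which defines a flat connection $\nabla$ on the vector bundle $\mathscr C_{\mathbb H}(W)$.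
   Context: A vertex operator algebra (VOA) is $(V,Y(\cdot,z),\mathbf 1,\omega)$, $V=\bigoplus_{n\ge0}V_n$, $\dim V_n<\infty$, with the usual axioms; $Y(a,z)=\sum a_{(n)}z^{-n-1}$, $Y(\omega,z)=\sum L(n)z^{-n-2}$, central charge $c$. An admissible module is a weak module $M=\bigoplus_{n\in\mathbb N}M(n)$ with $a_{(m)}M(n)\subseteq M(\mathrm{wt}\,a-m-1+n)$; conformal weight $h_M$ means $L(0)$ is semisimple with $M(n)$ the eigenspace of eigenvalue $h_M+n$; $M'=\bigoplus M(n)^*$. $V$ is strongly rational if it is simple, of CFT type ($V_0=\mathbb C\mathbf1$), rational (every admissible module is a direct sum of simple ones), $C_2$-cofinite ($\dim V/\mathrm{span}\{a_{(-2)}b\}<\infty$), self-dual ($V\cong V'$), and a sum of Virasoro highest-weight modules. $Y_W[a,z]=Y_W(a,e^{2\pi iz}-1)e^{2\pi iz\,\mathrm{wt}\,a}=\sum a[n]z^{-n-1}$, $\tilde\omega=(2\pi i)^2(\omega-\frac c{24}\mathbf1)$, $L[n]=\tilde\omega[n+1]$. $G_{2k}(\tau)=2\zeta(2k)+\frac{2(2\pi i)^{2k}}{(2k-1)!}\sum_{n\ge1}\sigma_{2k-1}(n)q^n$, $k\ge1$. With $E_\tau=\mathbb C/(\mathbb Z+\mathbb Z\tau)$, $\mathsf p=[0]$, $z$ the coordinate from $\mathbb C$, $\mathscr C(E_\tau,\mathsf p,z,W)$ is the space of linear functionals $\varphi(\tau)=\langle\varphi(\tau)|\cdot\rangle$ on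 $W$ vanishing on all $a[0]v$ and all $a[-m]v+(-1)^m\sum_{k\ge1}\binom{2k-1}{m-1}G_{2k}(\tau)a[2k-m]v$ ($a\in V$, $v\in W$, $m\ge2$). $\mathscr C_{\mathbb H}(W)$ is the pullback along $\pi:\mathbb H\to\mathscr M_{1,1}=[\mathrm{SL}(2,\mathbb Z)\backslash\!\backslash\mathbb H]$ of the finite-rank bundle of VOA-conformal blocks of Damiolini–Gibney–Tarasca attached to $W$. Its fiber at $\tau$ is $\mathscr C(E_\tau,\mathsf p,z,W)$, and its sections over an open set (called sections of conformal blocks) are the maps $\tau\mapsto\varphi(\tau)\in\mathscr C(E_\tau,\mathsf p,z,W)\subseteq W^*$ with $\tau\mapsto\langle\varphi(\tau)|v\rangle$ holomorphic for every $v\in W$. Since $\xi$ is a nowhere vanishing vector field with $\mathscr T_{\mathbb H}=\mathcal O_{\mathbb H}\xi$, a connection on a bundle over $\mathbb H$ is determined by a $\mathbb C$-linear operator $\nabla_\xi$ on local sections with $\nabla_\xi(fs)=\xi(f)s+f\nabla_\xi s$ (and $\nabla_{f\xi}=f\nabla_\xi$). *)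

(* Defs.v *)
Set Warnings "-all".
From mathcomp Require Import all_boot all_order all_algebra.
From mathcomp Require Import all_classical all_reals all_analysis.
From mathcomp Require Import complex.
Set Implicit Arguments.
Unset Strict Implicit.
Unset Printing Implicit Defensive.
Import Order.TTheory GRing.Theory Num.Theory numFieldNormedType.Exports.
Local Open Scope classical_set_scope.
Local Open Scope ring_scope.

(** * Complex numbers, holomorphic functions, Eisenstein series *)

(* [R[i]] seen as a [numClosedFieldType], so that it carries the topology and
   the differential calculus of [numFieldType]; in particular [derivable f t 1]
   is differentiability in the complex sense. *)
Definition cplx (R : realType) : numClosedFieldType := R[i].

Definition of_real (R : realType) (x : R) : cplx R := Complex x 0.

Definition two_pi_i (R : realType) : cplx R := Complex 0 (2 * pi).

Definition cexp (R : realType) (z : cplx R) : cplx R :=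
  Complex (expR (complex.Re z) * cos (complex.Im z))
          (expR (complex.Re z) * sin (complex.Im z)).

Definition upper_half_plane (R : realType) : set (cplx R) :=
  [set t | 0 < complex.Im t].

Definition holomorphic_on (R : realType) (U : set (cplx R))
    (f : cplx R -> cplx R) : Prop :=
  forall t, U t -> derivable f t 1.

Definition nome (R : realType) (t : cplx R) : cplx R := cexp (two_pi_i R * t).

Definition sigma (s n : nat) : nat := (\sum_(d <- divisors n) d ^ s)%N.

Definition zeta (R : realType) (s : nat) : R :=
  limn (series (fun n : nat => (n.+1%:R ^+ s)^-1 : R)).

(* [eisenstein k] is G_{2k}. *)
Definition eisenstein (R : realType) (k : nat) (t : cplx R) : cplx R :=
  2 * of_real (zeta R (2 * k)) +
  2 * two_pi_i R ^+ (2 * k) / ((2 * k - 1)`!)%:R *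
    limn (series (fun n : nat =>
      (sigma (2 * k - 1) n.+1)%:R * nome t ^+ n.+1 : cplx R)).

(** * Formal power series *)

(* A power series is its sequence of coefficients. *)
Definition fps_mul (F : fieldType) (f g : nat -> F) : nat -> F :=
  fun n => \sum_(i < n.+1) f i * g (n - i)%N.

Definition fps_one (F : fieldType) : nat -> F := fun n => (n == 0)%:R.

(* 1/f = f_0^-1 * \sum_k (1 - f/f_0)^k, for f_0 <> 0; only the terms k <= n
   contribute to the n-th coefficient. *)
Definition fps_inv (F : fieldType) (f : nat -> F) : nat -> F :=
  fun n => (f 0%N)^-1 *
    \sum_(k < n.+1)
      iter k (fps_mul (fun j => fps_one F j - f j / f 0%N)) (fps_one F) n.

Definition fps_expz (F : fieldType) (f : nat -> F) (p : int) : nat -> F :=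
  match p with
  | Posz n => iter n (fps_mul f) (fps_one F)
  | Negz n => iter n.+1 (fps_mul (fps_inv f)) (fps_one F)
  end.

(* exp(a z) *)
Definition fps_expc (F : fieldType) (a : F) : nat -> F :=
  fun n => a ^+ n / (n`!)%:R.

(* (e^{2 pi i z} - 1) / z *)
Definition fps_coord (R : realType) : nat -> cplx R :=
  fun n => two_pi_i R ^+ n.+1 / (n.+1`!)%:R.

(** * Linear algebra *)

Definition subspace (F : fieldType) (M : lmodType F) (A : set M) : Prop :=
  A 0 /\ forall (c : F) u v, A u -> A v -> A (c *: u + v).

Definition lin_span (F : fieldType) (M : lmodType F) (A : set M) : set M :=
  smallest (@subspace F M) A.

Definition finite_dim (F : fieldType) (M : lmodType F) (A : set M) : Prop :=
  exists s : seq M, A `<=` lin_span [set` s].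

Definition finite_codim (F : fieldType) (M : lmodType F) (A : set M) : Prop :=
  exists s : seq M, lin_span (A `|` [set` s]) = [set: M].

Definition is_direct_sum (F : fieldType) (M : lmodType F) (I : choiceType)
    (N : I -> set M) : Prop :=
  (forall v, exists (s : seq I) (u : I -> M),
     (forall i, N i (u i)) /\ v = \sum_(i <- s) u i) /\
  (forall (s : seq I) (u : I -> M), uniq s -> (forall i, N i (u i)) ->
     \sum_(i <- s) u i = 0 -> forall i, i \in s -> u i = 0).

(* A decomposition M = \bigoplus_(n : nat) M_n, given by its projections. *)
Record grading (F : fieldType) (M : lmodType F) := Grading {
  component : nat -> M -> M;
  component_linear : forall n, linear (component n);
  component_proj : forall m n v,
    component m (component n v) = if m == n then component n v else 0;
  component_sum : forall v, exists N : nat, v = \sum_(n < N) component n v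
}.

Definition piece (F : fieldType) (M : lmodType F) (G : grading M) (n : nat) :
  set M := [set v | component G n v = v].

Definition piecez (F : fieldType) (M : lmodType F) (G : grading M) (z : int) :
  set M := if z is Posz n then piece G n else [set 0].

(** * Vertex operator algebras and their modules *)

Section WeakModule.
Variables (F : fieldType) (V M : lmodType F).

(* The vertex operators are given by their modes: [Y a n u] is a_(n) u. *)
Variables (YV : V -> int -> V -> V) (vac : V) (Y : V -> int -> M -> M).

Definition binz (m : int) (j : nat) : F :=
  (\prod_(i < j) (m%:~R - i%:R)) / (j`!)%:R.

(* The Jacobi identity in terms of modes.  All sums below have finite support
   because of the truncation property. *)
Definition jacobi_identity : Prop := forall (a b : V) (u : M) (l m n : int),
  \sum_(j \in [set: nat])
     binz m j *: Y (YV a (l + j%:Z) b) (m + n - j%:Z) u =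
  \sum_(j \in [set: nat])
     ((-1) ^+ j * binz l j) *:
       (Y a (m + l - j%:Z) (Y b (n + j%:Z) u) -
        ((-1) ^ l) *: Y b (n + l - j%:Z) (Y a (m + j%:Z) u)).

Record weak_module_axioms : Prop := WeakModuleAxioms {
  wm_linear_l : forall n u, linear (fun a => Y a n u);
  wm_linear_r : forall a n, linear (Y a n);
  wm_truncation : forall a u, exists N : int, forall n, N <= n -> Y a n u = 0;
  wm_vacuum : forall n u, Y vac n u = if n == -1 then u else 0;
  wm_jacobi : jacobi_identity
}.

End WeakModule.

Record voa (R : realType) := VOA {
  voa_space :> lmodType (cplx R);
  voa_grading : grading voa_space;
  voa_mode : voa_space -> int -> voa_space -> voa_space;
  vacuum : voa_space;
  conformal_vector : voa_space;
  central_charge : cplx R;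
  voa_finite_dim : forall n, finite_dim (piece voa_grading n);
  voa_vacuum_weight : piece voa_grading 0 vacuum;
  voa_conformal_weight : piece voa_grading 2 conformal_vector;
  voa_axioms : weak_module_axioms voa_mode vacuum voa_mode;
  voa_creation : forall (a : voa_space) (n : int),
    -1 <= n -> voa_mode a n vacuum = if n == -1 then a else 0;
  voa_virasoro : let L (n : int) := voa_mode conformal_vector (n + 1) in
    forall (m n : int) (v : voa_space),
    L m (L n v) - L n (L m v) =
      (m - n)%:~R *: L (m + n) v +
      (if m + n == 0 then ((m ^+ 3 - m)%:~R / 12 * central_charge) *: v else 0);
  voa_L0 : forall (n : nat) (v : voa_space),
    piece voa_grading n v -> voa_mode conformal_vector 1 v = n%:R *: v;
  voa_derivative : forall (a v : voa_space) (n : int),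
    voa_mode (voa_mode conformal_vector 0 a) n v = - n%:~R *: voa_mode a (n - 1) v
}.

Definition voa_L (R : realType) (V : voa R) (n : int) (v : V) : V :=
  voa_mode (conformal_vector V) (n + 1) v.

Record admissible_module (R : realType) (V : voa R) := AdmissibleModule {
  am_space :> lmodType (cplx R);
  am_grading : grading am_space;
  am_mode : V -> int -> am_space -> am_space;
  am_axioms : weak_module_axioms (@voa_mode R V) (vacuum V) am_mode;
  am_graded : forall (h n : nat) (m : int) (a : V) (u : am_space),
    piece (voa_grading V) h a -> piece am_grading n u ->
    piecez am_grading (h%:Z - m - 1 + n%:Z) (am_mode a m u)
}.

Definition admissible_submodule (R : realType) (V : voa R)
    (M : admissible_module V) (N : set M) : Prop :=
  [/\ subspace N,
      forall a n u, N u -> N (am_mode a n u) &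
      forall n u, N u -> N (component (am_grading M) n u)].

Definition simple_submodule (R : realType) (V : voa R)
    (M : admissible_module V) (N : set M) : Prop :=
  [/\ admissible_submodule N, N <> [set 0] &
      forall K : set M, admissible_submodule K -> K `<=` N ->
        K = [set 0] \/ K = N].

Definition irreducible_module (R : realType) (V : voa R)
    (M : admissible_module V) : Prop := simple_submodule [set: M].

(** * Strong rationality *)

Definition rational (R : realType) (V : voa R) : Prop :=
  forall M : admissible_module V, exists (I : choiceType) (N : I -> set M),
    (forall i, simple_submodule (N i)) /\ is_direct_sum N.

(* An ideal is a subspace stable under all a_(n); by skew-symmetry and
   stability under L(-1) it is automatically two-sided. *)
Definition voa_simple (R : realType) (V : voa R) : Prop :=
  [set: V] <> [set 0] /\
  forall I : set V, subspace I ->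
    (forall (a : V) n u, I u -> I (voa_mode a n u)) ->
    I = [set 0] \/ I = [set: V].

Definition CFT_type (R : realType) (V : voa R) : Prop :=
  piece (voa_grading V) 0 = [set c *: vacuum V | c in [set: cplx R]].

Definition C2_cofinite (R : realType) (V : voa R) : Prop :=
  finite_codim (lin_span [set v : V | exists a b : V, v = voa_mode a (-2) b]).

(* V' = \bigoplus_n V_n^*, as functionals on V vanishing on almost all V_n. *)
Definition graded_dual (R : realType) (V : voa R) : set (V -> cplx R) :=
  [set f | scalar f /\
     exists N : nat, forall n v, (N <= n)%N -> piece (voa_grading V) n v ->
       f v = 0].

(* The modes of Y', from
   <Y'(a,z)f, v> = <f, Y(e^{zL(1)} (-z^{-2})^{L(0)} a, z^{-1}) v>:
   for a of weight h, the right-hand side is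
   \sum_j (-1)^h z^{j-2h}/j! <f, Y(L(1)^j a, z^{-1}) v>,
   in which (L(1)^j a)_(m) comes with z^{j-2h+m+1}. *)
Definition contragredient_mode (R : realType) (V : voa R) (a : V) (n : int)
    (f : V -> cplx R) : V -> cplx R :=
  fun v => \sum_(h \in [set: nat]) \sum_(j < h.+1)
    (-1) ^+ h / (j`!)%:R *
      f (voa_mode (iter j (voa_L 1) (component (voa_grading V) h a))
                  (2 * h%:Z - j%:Z - n - 2) v).

Definition self_dual (R : realType) (V : voa R) : Prop :=
  exists theta : V -> (V -> cplx R),
    [/\ forall v, scalar (theta^~ v),
        injective theta,
        range theta = @graded_dual R V &
        forall a n u,
          theta (voa_mode a n u) = contragredient_mode a n (theta u)].

Definition virasoro_submodule (R : realType) (V : voa R) (N : set V) : Prop :=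
  subspace N /\ forall n u, N u -> N (voa_L n u).

Definition highest_weight_vector (R : realType) (V : voa R) : set V :=
  [set v | (forall n : int, 0 < n -> voa_L n v = 0) /\
           exists h : cplx R, voa_L 0 v = h *: v].

Definition sum_of_highest_weight_modules (R : realType) (V : voa R) : Prop :=
  lin_span (\bigcup_(v in @highest_weight_vector R V)
          smallest (@virasoro_submodule R V) [set v]) = [set: V].

Record strongly_rational (R : realType) (V : voa R) : Prop := StronglyRational {
  sr_simple : voa_simple V;
  sr_CFT_type : CFT_type V;
  sr_rational : rational V;
  sr_C2_cofinite : C2_cofinite V;
  sr_self_dual : self_dual V;
  sr_virasoro : sum_of_highest_weight_modules V
}.

(** * Modes in the coordinate e^{2 pi i z} - 1, and conformal blocks *)

(* The coefficient of z^{j-m-1} in (e^{2 pi i z} - 1)^{-m-1} e^{2 pi i z h}. *)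
Definition square_coef (R : realType) (h : nat) (m : int) (j : nat) : cplx R :=
  fps_mul (fps_expz (fps_coord R) (- m - 1)) (fps_expc (two_pi_i R * h%:R)) j.

(* a[n] u, the coefficient of z^{-n-1} in
   \sum_m (e^{2 pi i z} - 1)^{-m-1} e^{2 pi i z wt a} a_(m) u, extended linearly
   to all a.  Only the m = n + j with j >= 0 contribute, finitely many of them
   nontrivially. *)
Definition square_mode (R : realType) (V : voa R) (W : admissible_module V)
    (a : V) (n : int) (u : W) : W :=
  \sum_(h \in [set: nat]) \sum_(j \in [set: nat])
    square_coef R h (n + j%:Z) j *:
      am_mode (component (voa_grading V) h a) (n + j%:Z) u.

Definition square_conformal_vector (R : realType) (V : voa R) : V :=
  two_pi_i R ^+ 2 *: (conformal_vector V - (central_charge V / 24) *: vacuum V).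

Definition square_L (R : realType) (V : voa R) (W : admissible_module V)
    (n : int) (u : W) : W :=
  square_mode (square_conformal_vector V) (n + 1) u.

(* The space C(E_t, [0], z, W). *)
Definition conformal_block (R : realType) (V : voa R) (W : admissible_module V)
    (t : cplx R) : set (W -> cplx R) :=
  [set phi |
    [/\ scalar phi,
        forall (a : V) (v : W), phi (square_mode a 0 v) = 0 &
        forall (a : V) (v : W) (m : nat), (2 <= m)%N ->
          phi (square_mode a (- m%:Z) v + (-1) ^+ m *:
            \sum_(k \in [set k : nat | (1 <= k)%N])
              ('C(2 * k - 1, m - 1)%:R * eisenstein k t) *:
                square_mode a ((2 * k)%:Z - m%:Z) v) = 0]].

(* Sections over an open U of the upper half plane are represented by functions
   defined everywhere, considered up to equality on U. *)
Definition block_section (R : realType) (V : voa R) (W : admissible_module V)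
    (U : set (cplx R)) : set (cplx R -> W -> cplx R) :=
  [set phi | (forall t, U t -> conformal_block t (phi t)) /\
             (forall v, holomorphic_on U (fun t => phi t v))].

(** * The connection *)

(* xi = q d/dq *)
Definition xi (R : realType) (f : cplx R -> cplx R) : cplx R -> cplx R :=
  fun t => (two_pi_i R)^-1 * derive1 f t.

Definition T_operator (R : realType) (V : voa R) (W : admissible_module V)
    (t : cplx R) (v : W) : W :=
  square_L (-2) v -
  \sum_(k \in [set k : nat | (1 <= k)%N])
    eisenstein k t *: square_L ((2 * k)%:Z - 2) v.

Definition nabla_xi (R : realType) (V : voa R) (W : admissible_module V)
    (phi : cplx R -> W -> cplx R) : cplx R -> W -> cplx R :=
  fun t v => xi (fun s => phi s v) t -
    (two_pi_i R ^+ 2)^-1 * phi t (T_operator t v).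

Section Connections.
Variables (R : realType) (E : Type).
Local Notation C := (cplx R).
Local Notation field := (C -> E -> C).

(* [S U s] means that s is a section over U, for U open in the upper half
   plane; sections are functions with values in E -> C. *)
Variable S : set C -> set field.

Definition scale_section (f : C -> C) (s : field) : field :=
  fun t v => f t * s t v.

Record is_sheaf_operator (D : field -> field) : Prop := IsSheafOperator {
  so_section : forall U s, open U -> U `<=` @upper_half_plane R ->
    S U s -> S U (D s);
  so_local : forall U s s', open U -> U `<=` @upper_half_plane R ->
    S U s -> S U s' -> {in U, s =1 s'} -> {in U, D s =1 D s'};
  so_linear : forall U (c : C) s s', open U -> U `<=` @upper_half_plane R ->
    S U s -> S U s' ->
    {in U, D (fun t v => c * s t v + s' t v) =1
           (fun t v => c * D s t v + D s' t v)}
}.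

(* A holomorphic vector field X * xi on U is represented by its coefficient X;
   it acts on functions by f |-> X * xi f, and [X xi, Y xi] = lie_bracket X Y * xi. *)
Definition lie_bracket (X Y : C -> C) : C -> C :=
  fun t => X t * xi Y t - Y t * xi X t.

Record is_connection (nabla : (C -> C) -> field -> field) : Prop :=
  IsConnection {
  conn_operator : forall X U s, open U -> U `<=` @upper_half_plane R ->
    holomorphic_on U X -> S U s -> S U (nabla X s);
  conn_local : forall X X' U s s', open U -> U `<=` @upper_half_plane R ->
    holomorphic_on U X -> holomorphic_on U X' -> S U s -> S U s' ->
    {in U, X =1 X'} -> {in U, s =1 s'} -> {in U, nabla X s =1 nabla X' s'};
  conn_linear_vf : forall f X Y U s, open U -> U `<=` @upper_half_plane R ->
    holomorphic_on U f -> holomorphic_on U X -> holomorphic_on U Y -> S U s ->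
    {in U, nabla (fun t => f t * X t + Y t) s =1
           (fun t v => f t * nabla X s t v + nabla Y s t v)};
  conn_linear : forall X U (c : C) s s', open U ->
    U `<=` @upper_half_plane R -> holomorphic_on U X -> S U s -> S U s' ->
    {in U, nabla X (fun t v => c * s t v + s' t v) =1
           (fun t v => c * nabla X s t v + nabla X s' t v)};
  conn_leibniz : forall X f U s, open U -> U `<=` @upper_half_plane R ->
    holomorphic_on U X -> holomorphic_on U f -> S U s ->
    {in U, nabla X (scale_section f s) =1
           (fun t v => X t * xi f t * s t v + f t * nabla X s t v)}
}.

Definition is_flat (nabla : (C -> C) -> field -> field) : Prop :=
  forall X Y U s, open U -> U `<=` @upper_half_plane R ->
    holomorphic_on U X -> holomorphic_on U Y -> S U s ->
    {in U, (fun t v => nabla X (nabla Y s) t v - nabla Y (nabla X s) t v) =1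
           nabla (lie_bracket X Y) s}.

End Connections.

(* The connection determined by its value on xi: nabla_{X xi} = X nabla_xi. *)
Definition block_connection (R : realType) (V : voa R)
    (W : admissible_module V) (X : cplx R -> cplx R)
    (phi : cplx R -> W -> cplx R) : cplx R -> W -> cplx R :=
  scale_section X (nabla_xi phi).

(* Main.v *)
(** The modes [a[n]] and the relations defining conformal blocks are all of the
    form [b{g} = sum_m Res(g w^h (w - 1)^(-m-1)) b_(m)], with [w = exp(2 pi i z)],
    [b] of weight [h] and [g] a Laurent series in [z].  With
    [P = z^-1 - sum_k G_2k z^(2k-1)] a functional [phi] is a conformal block iff it
    kills [b{1}] and all [b{P^(n)}], [n >= 1], and
    [T = (2 pi i)^2 (omega{P} - c/24)].  The series [g] such that [phi] kills every
    [b{g}] are stable under d/dz; since [p = -P'] satisfies the second order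
    Weierstrass equation, they contain [C[p, p']].  Deriving [phi(b{P^(n)} v) = 0]
    along [xi] and computing [[omega{P}, b{P^(n)}]] reduces the theorem to
    [xi P^(n) - (2 pi i)^-2 P P^(n+1) in C[p, p']], which follows from the heat
    equation [(2 pi i)^2 xi P = P P' + P''/2].

    The Weierstrass and heat equations are limits of finite identities between
    Lambert sums in [x_d = q^d / (1 - q^d)], which only use
    [x_a x_b = x_(a+b) (1 + x_a + x_b)].  Their polar part is the expansion
    [z^-1 - 2 sum_k zeta(2k) z^(2k-1)] of [pi cot(pi z)]: both sides satisfy the same
    Riccati equation.  That [xi] preserves holomorphy is Cauchy's formula, proved
    from Goursat's theorem on rectangles. *)
Require Import Defs.
From HB Require Import structures.
From mathcomp Require Import all_boot all_order all_algebra.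
From mathcomp Require Import all_classical all_reals all_analysis.
From mathcomp Require Import complex.
From mathcomp Require Import ring lra zify.
Set Implicit Arguments.
Unset Strict Implicit.
Unset Printing Implicit Defensive.
Import Order.TTheory GRing.Theory Num.Theory numFieldNormedType.Exports.
Local Open Scope classical_set_scope.
Local Open Scope ring_scope.

(** * Complex differentiability *)

(** The series killed by a block are stable under sums and d/dz but not visibly under products. They
    still fill [C[p, p']]: each [p^n p'] is a derivative, and [(p^n p')'] has leading term
    [(4 n + 6) p^(n+2)], so [1] and [p] suffice as a start. [P] itself is not elliptic, only its
    derivatives are. In the commutator of [omega{P}] with [b{g}] the undifferentiated [P] survives
    only in the terms from [omega_(0) b] and [omega_(1) b], because the exponent of [w] in [P w^2]
    (2 is the weight of [omega]) makes a coefficient [1 - j] vanish at [j = 1]; the parts of these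
    two terms that depend on the weight of [b] then cancel, and [P g'] remains. At a finite level
    [N] the identities for [P] are exact up to terms with [a + b > N], of size a polynomial in [N]
    times [|q|^N] in each Laurent coefficient. Constants of integration that depend on [N] are
    removed by one more d/dz and recovered after the limit. Flatness follows from the Leibniz rule
    alone, all vector fields being multiples of [xi]. *)

Section Modulus.
Variable R : realType.
Local Notation C := (cplx R).
Implicit Types z w t l : C.

(** The modulus as a real number; the norm of [cplx R] takes complex values. *)
Definition md (z : C) : R := complex.Re `|z|.

Lemma normE z : `|z| = of_real (md z).
Proof. by rewrite /md normc_def. Qed.

Lemma md_sqrt z : md z = Num.sqrt (complex.Re z ^+ 2 + complex.Im z ^+ 2).
Proof. by rewrite /md normc_def. Qed.

Lemma of_realD (x y : R) : of_real (x + y) = of_real x + of_real y :> C.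
Proof. by apply/eqP; rewrite eq_complex /= addr0 !eqxx. Qed.
Lemma of_realM (x y : R) : of_real (x * y) = of_real x * of_real y :> C.
Proof. by apply/eqP; rewrite eq_complex /= !(mulr0, mul0r, addr0, subr0) !eqxx. Qed.
Lemma of_realN (x : R) : of_real (- x) = - of_real x :> C.
Proof. by apply/eqP; rewrite eq_complex /= oppr0 !eqxx. Qed.
Lemma of_real_le (x y : R) : (of_real x <= of_real y :> C) = (x <= y).
Proof. exact: lecR. Qed.
Lemma of_real_lt (x y : R) : (of_real x < of_real y :> C) = (x < y).
Proof. exact: ltcR. Qed.
Lemma of_real_inj : injective (@of_real R).
Proof. by move=> x y []. Qed.

Lemma md_ge0 z : 0 <= md z. Proof. by rewrite md_sqrt sqrtr_ge0. Qed.
Lemma mdM z w : md (z * w) = md z * md w.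
Proof. by apply: of_real_inj; rewrite of_realM -!normE normrM. Qed.
Lemma md_triangle z w : md (z + w) <= md z + md w.
Proof. by rewrite -of_real_le of_realD -!normE ler_normD. Qed.
Lemma mdN z : md (- z) = md z.
Proof. by apply: of_real_inj; rewrite -!normE normrN. Qed.
Lemma mdB z w : md (z - w) = md (w - z).
Proof. by rewrite -mdN opprB. Qed.
Lemma md0 : md 0 = 0. Proof. by rewrite /md normr0. Qed.
Lemma md1 : md 1 = 1. Proof. by rewrite /md normr1. Qed.
Lemma md_eq0 z : (md z == 0) = (z == 0).
Proof. by rewrite -[RHS]normr_eq0 normE; apply/eqP/eqP => [->|[]]. Qed.
Lemma md_gt0 z : (0 < md z) = (z != 0).
Proof. by rewrite lt_def md_ge0 andbT md_eq0. Qed.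
Lemma mdV z : md z^-1 = (md z)^-1.
Proof.
have [->|z0] := eqVneq z 0; first by rewrite invr0 md0 invr0.
have m0 : md z != 0 by rewrite md_eq0.
by apply: (mulfI m0); rewrite -mdM divff// divff// md1.
Qed.
Lemma mdX z n : md (z ^+ n) = md z ^+ n.
Proof. by elim: n => [|n IH]; rewrite ?expr0 ?md1// !exprS mdM IH. Qed.
Lemma md_sum (I : Type) (s : seq I) (P : pred I) (F : I -> C) :
  md (\sum_(i <- s | P i) F i) <= \sum_(i <- s | P i) md (F i).
Proof.
elim/big_ind2 : _ => //; first by rewrite md0.
by move=> a b c d ab cd; apply: (le_trans (md_triangle _ _)); exact: lerD.
Qed.
Lemma md_of_real (x : R) : md (of_real x) = `|x|.
Proof. by rewrite md_sqrt /= expr0n /= addr0 sqrtr_sqr. Qed.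
Lemma md_Re z : `|complex.Re z| <= md z.
Proof. by rewrite md_sqrt -sqrtr_sqr ler_wsqrtr// lerDl sqr_ge0. Qed.
Lemma md_Im z : `|complex.Im z| <= md z.
Proof. by rewrite md_sqrt -sqrtr_sqr ler_wsqrtr// lerDr sqr_ge0. Qed.
Lemma md_ReIm z : md z <= `|complex.Re z| + `|complex.Im z|.
Proof.
case: z => a b; have -> : (Complex a b : C) = of_real a + Complex 0 1 * of_real b.
  by apply/eqP; rewrite eq_complex /=; apply/andP; split; apply/eqP; ring.
apply: (le_trans (md_triangle _ _)); rewrite mdM !md_of_real.
rewrite (_ : md (Complex 0 1) = 1); last first.
  by rewrite md_sqrt /= expr0n expr1n /= add0r sqrtr1.
by rewrite mul1r /= !(mul0r, mulr0, addr0, subr0, mul1r, add0r).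
Qed.

Lemma cReD z w : complex.Re (z + w : C) = complex.Re z + complex.Re w.
Proof. by case: z w => [? ?] [? ?]. Qed.
Lemma cImD z w : complex.Im (z + w : C) = complex.Im z + complex.Im w.
Proof. by case: z w => [? ?] [? ?]. Qed.
Lemma cReN z : complex.Re (- z : C) = - complex.Re z.
Proof. by case: z. Qed.
Lemma cImN z : complex.Im (- z : C) = - complex.Im z.
Proof. by case: z. Qed.
Lemma cReM z w : complex.Re (z * w : C) =
  complex.Re z * complex.Re w - complex.Im z * complex.Im w.
Proof. by case: z w => [? ?] [? ?]. Qed.
Lemma cImM z w : complex.Im (z * w : C) =
  complex.Re z * complex.Im w + complex.Im z * complex.Re w.
Proof. by case: z w => [? ?] [? ?]. Qed.

Lemma nbhs_md (t : C) (P : C -> Prop) :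
  (\forall z \near t, P z) <->
  exists2 d : R, 0 < d & forall z, md (z - t) < d -> P z.
Proof.
split.
  move=> /nbhs_ballP [e /= e0 He].
  have e1 : complex.Re e = md e by rewrite /md ger0_norm// ltW.
  exists (md e); first by rewrite md_gt0 gt_eqF.
  move=> z zt; apply: He; rewrite /ball /= distrC normE.
  rewrite -(ger0_norm (ltW e0)) normE.
  by rewrite of_real_lt.
move=> [d d0 H]; apply/nbhs_ballP; exists (of_real d); first by rewrite /= -[0]/(of_real 0) of_real_lt.
by move=> z; rewrite /ball /= distrC normE of_real_lt; apply: H.
Qed.

(** Differentiability as a first-order expansion: without a quotient the point [z = t] is no
    exception, and error terms simply add up. *)
Definition cdiff (f : C -> C) (t l : C) := forall e : R, 0 < e -> exists2 d : R, 0 < d &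
  forall z, md (z - t) < d -> md (f z - f t - l * (z - t)) <= e * md (z - t).

Definition ccont (f : C -> C) (t : C) := forall e : R, 0 < e -> exists2 d : R, 0 < d &
  forall z, md (z - t) < d -> md (f z - f t) < e.

Lemma ccont_continuous f t : ccont f t <-> {for t, continuous f}.
Proof.
split=> H.
  apply/(@cvgrPdist_lt _ C C (nbhs t) _ f (f t)) => e e0.
  have e1 : e = of_real (md e) by rewrite -normE ger0_norm// ltW.
  have [|d d0 Hd] := H (md e); first by rewrite md_gt0 gt_eqF.
  apply: (proj2 (@nbhs_md t _)); exists d => // z /Hd.
  by rewrite mdB => h; rewrite e1 normE of_real_lt.
move=> e e0.
have /(@cvgrPdist_lt _ C C (nbhs t) _ f (f t)) := H => /(_ (of_real e)).
rewrite -[0]/(of_real 0) of_real_lt => /(_ e0) /(@nbhs_md t)[d d0 Hd].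
by exists d => // z /Hd; rewrite mdB normE of_real_lt.
Qed.

Lemma derive_cvgE (f : C -> C) t l :
  ((fun h : C => h^-1 *: (f (h *: 1 + t) - f t)) @ 0^' --> l) <-> cdiff f t l.
Proof.
have -> : (fun h : C => h^-1 *: (f (h *: 1 + t) - f t)) =
          (fun h : C => h^-1 * (f (h + t) - f t)).
  by apply/funext => h; congr (_ * (f (_ + _) - _)); exact: mulr1.
have key (h : C) : h != 0 ->
    f (h + t) - f t - l * h = - (h * (l - h^-1 * (f (h + t) - f t))).
  by move=> h0; rewrite mulrBr mulrA divff// mul1r opprB mulrC.
split=> H.
  move=> e e0.
  have := H => /(@cvgrPdist_lt _ C C _ _ _ l)/(_ (of_real e)).
  rewrite -[X in X < _]/(of_real 0) of_real_lt => /(_ e0).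
  rewrite near_withinE => /(@nbhs_md 0)[d d0 Hd]; exists d => // z zt.
  have [->|zt0] := eqVneq z t; first by rewrite !subrr mulr0 subr0 md0 mulr0.
  have h0 : z - t != 0 by rewrite subr_eq0.
  have := Hd (z - t); rewrite subr0 => /(_ zt h0).
  rewrite normE of_real_lt => Hlt.
  have := key _ h0; rewrite subrK => ->.
  by rewrite subrK in Hlt; rewrite mdN mdM mulrC ler_wpM2r ?md_ge0// ltW.
apply/(@cvgrPdist_lt _ C C _ _ _ l) => e e0.
have e1 : e = of_real (md e) by rewrite -normE ger0_norm// ltW.
have me0 : 0 < md e by rewrite md_gt0 gt_eqF.
rewrite near_withinE; apply: (proj2 (@nbhs_md 0 _)).
have [|d d0 Hd] := H (md e / 2); first by rewrite divr_gt0.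
exists d => // h; rewrite subr0 => hd h0.
have := Hd (h + t); rewrite addrK => /(_ hd).
have := key _ h0 => ->.
rewrite mdN mdM mulrC ler_pM2r ?md_gt0// => Hle.
rewrite e1 normE of_real_lt; apply: (le_lt_trans Hle).
by rewrite ltr_pdivrMr// mulrDr mulr1 ltrDl.
Qed.

Lemma is_derive_cdiff (f : C -> C) t l : is_derive t (1 : C) f l <-> cdiff f t l.
Proof.
split; first by move=> [df <-]; apply/derive_cvgE.
move/derive_cvgE => H; split; first by apply/cvg_ex; exists l.
by apply: cvg_lim.
Qed.

Lemma derivable_cdiff (f : C -> C) t : derivable f t 1 <-> exists l, cdiff f t l.
Proof.
split; first by move=> /derivableP/is_derive_cdiff H; eexists; exact: H.
by move=> [l /is_derive_cdiff []].
Qed.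

Lemma derive1_cdiff (f : C -> C) t l : cdiff f t l -> derive1 f t = l.
Proof. by move=> /is_derive_cdiff H; rewrite derive1E; apply: derive_val. Qed.

Lemma cdiff_ccont f t l : cdiff f t l -> ccont f t.
Proof.
move=> H; apply/ccont_continuous; apply: differentiable_continuous.
by apply/derivable1_diffP; apply/derivable_cdiff; exists l.
Qed.

Lemma cdiff_near (f g : C -> C) t l (r : R) : 0 < r ->
  (forall z, md (z - t) < r -> f z = g z) -> cdiff f t l -> cdiff g t l.
Proof.
move=> r0 fg H e e0; have [d d0 Hd] := H e e0.
exists (Num.min d r); first by rewrite lt_min d0.
move=> z; rewrite lt_min => /andP[zd zr].
by rewrite -!fg// ?subrr ?md0//; apply: Hd.
Qed.

Lemma cdiff_cst (c t : C) : cdiff (fun=> c) t 0.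
Proof. by move=> e e0; exists e => // z _; rewrite subrr mul0r subr0 md0 mulr_ge0 ?md_ge0// ltW. Qed.
Lemma cdiff_id (t : C) : cdiff id t 1.
Proof. by move=> e e0; exists e => // z _; rewrite mul1r subrr md0 mulr_ge0 ?md_ge0// ltW. Qed.
Lemma cdiffD (f g : C -> C) t l m : cdiff f t l -> cdiff g t m ->
  cdiff (fun z => f z + g z) t (l + m).
Proof.
move=> /is_derive_cdiff h1 /is_derive_cdiff h2; exact/is_derive_cdiff.
Qed.
Lemma cdiffM (f g : C -> C) t l m : cdiff f t l -> cdiff g t m ->
  cdiff (fun z => f z * g z) t (l * g t + f t * m).
Proof.
move=> /is_derive_cdiff h1 /is_derive_cdiff h2; apply/is_derive_cdiff.
have -> : l * g t + f t * m = f t *: m + g t *: l.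
  by rewrite -[_ *: m]/(f t * m) -[_ *: l]/(g t * l) [g t * l]mulrC addrC.
exact: (@is_deriveM C C f g t 1 l m h1 h2).
Qed.
End Modulus.

(** * Integrals along the boundary of a rectangle *)

Section ComplexIntegral.
Variable R : realType.
Local Notation C := (cplx R).
Local Notation mu := (@lebesgue_measure R).

Definition rint (f : R -> R) (a b : R) : R := \int[mu]_(x in `[a, b]) f x.
Definition icont (f : R -> R) (a b : R) := {within `[a, b], continuous f}.

Lemma icont_integrable f a b : icont f a b -> mu.-integrable `[a, b] (EFin \o f).
Proof. by move=> H; apply: continuous_compact_integrable => //; exact: segment_compact. Qed.

Lemma rintD f g a b : icont f a b -> icont g a b ->
  rint (fun x => f x + g x) a b = rint f a b + rint g a b.
Proof. by move=> *; rewrite /rint RintegralD//; exact: icont_integrable. Qed.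

Lemma rintZ c f a b : icont f a b -> rint (fun x => c * f x) a b = c * rint f a b.
Proof. by move=> *; rewrite /rint RintegralZl//; exact: icont_integrable. Qed.

Lemma icontD f g a b : icont f a b -> icont g a b -> icont (fun x => f x + g x) a b.
Proof. by move=> ? ?; exact: within_continuousD. Qed.

Lemma icontZ c f a b : icont f a b -> icont (fun x => c * f x) a b.
Proof.
move=> H x; apply: (@continuousM _ (subspace `[a, b]) (fun=> c) f); last exact: H.
exact: cst_continuous.
Qed.

Lemma rint_eq f g a b : (forall x, a <= x <= b -> f x = g x) -> rint f a b = rint g a b.
Proof.
move=> H; apply: eq_Rintegral => x; rewrite inE /= in_itv /= => ?; exact: H.
Qed.

Lemma rint_cst c a b : a <= b -> rint (fun=> c) a b = c * (b - a).
Proof.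
move=> ab; rewrite /rint Rintegral_cst//= lebesgue_measure_itv/= lte_fin.
move: ab; rewrite le_eqVlt => /predU1P[->|->]; last by rewrite -EFinD.
by rewrite ltxx subrr mulr0.
Qed.

Lemma rint_le f g a b : icont f a b -> icont g a b ->
  (forall x, a <= x <= b -> f x <= g x) -> rint f a b <= rint g a b.
Proof.
move=> cf cg H; apply: le_Rintegral; [by []|exact: icont_integrable|exact: icont_integrable|].
by move=> x /=; rewrite in_itv /= => ?; exact: H.
Qed.

Lemma icont_cst c a b : icont (fun=> c) a b.
Proof. by move=> x; exact: cst_continuous. Qed.

Lemma rint_bound f a b M : a <= b -> icont f a b ->
  (forall x, a <= x <= b -> `|f x| <= M) -> `|rint f a b| <= M * (b - a).
Proof.
move=> ab cf H; rewrite ler_norml; apply/andP; split.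
  rewrite -mulNr -rint_cst//; apply: rint_le => //; first exact: icont_cst.
  by move=> x /H; rewrite ler_norml => /andP[].
rewrite -rint_cst//; apply: rint_le => //; first exact: icont_cst.
by move=> x /H; rewrite ler_norml => /andP[].
Qed.

Lemma rint_split f a c b : a <= c <= b -> icont f a b ->
  rint f a b = rint f a c + rint f c b.
Proof.
move=> /andP[ac cb] /icont_integrable H; apply/eqP; rewrite addrC -subr_eq; apply/eqP.
rewrite /rint Rintegral_itvB//.
rewrite Rintegral_itv_obnd_cbnd//.
by apply: integrableS H => //; apply: subset_itvr; rewrite bnd_simp.
Qed.

Definition cint (g : R -> C) (a b : R) : C :=
  Complex (rint (fun x => complex.Re (g x)) a b) (rint (fun x => complex.Im (g x)) a b).
Definition scont (g : R -> C) (a b : R) :=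
  icont (fun x => complex.Re (g x)) a b /\ icont (fun x => complex.Im (g x)) a b.

Lemma cintD f g a b : scont f a b -> scont g a b ->
  cint (fun x => f x + g x) a b = cint f a b + cint g a b.
Proof.
move=> [f1 f2] [g1 g2]; apply/eqP; rewrite eq_complex /= -!rintD//.
by apply/andP; split; apply/eqP; apply: rint_eq => x _; rewrite (cReD, cImD).
Qed.

Lemma cintZ c f a b : scont f a b -> cint (fun x => c * f x) a b = c * cint f a b.
Proof.
move=> [f1 f2]; apply/eqP; rewrite eq_complex cReM cImM /=.
rewrite -!mulNr -!rintZ// -!rintD//; try exact: icontZ.
by apply/andP; split; apply/eqP; apply: rint_eq => x _; rewrite (cReM, cImM) ?mulNr.
Qed.

Lemma cint_eq f g a b : (forall x, a <= x <= b -> f x = g x) -> cint f a b = cint g a b.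
Proof.
by move=> H; congr (Complex _ _); apply: rint_eq => x /H ->.
Qed.

Lemma cint_split f a c b : a <= c <= b -> scont f a b ->
  cint f a b = cint f a c + cint f c b.
Proof.
move=> acb [f1 f2]; apply/eqP; rewrite eq_complex /=.
by rewrite -!rint_split// !eqxx.
Qed.

(** The factor 2 comes from bounding real and imaginary parts separately. Below only the order of
    such bounds in the side lengths matters. *)
Lemma cint_bound f a b M : a <= b -> scont f a b ->
  (forall x, a <= x <= b -> md (f x) <= M) -> md (cint f a b) <= 2 * M * (b - a).
Proof.
move=> ab [f1 f2] H; apply: (le_trans (md_ReIm _)).
rewrite -mulrA (_ : 2 * _ = M * (b - a) + M * (b - a)); last by ring.
apply: lerD; apply: rint_bound => // x /H; apply: le_trans; [exact: md_Re|exact: md_Im].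
Qed.

Lemma scontZ c f a b : scont f a b -> scont (fun x => c * f x) a b.
Proof.
move=> [f1 f2]; split.
  under [X in icont X]eq_fun do rewrite cReM -mulNr.
  by apply: icontD; exact: icontZ.
under [X in icont X]eq_fun do rewrite cImM.
by apply: icontD; exact: icontZ.
Qed.

Definition lip1 (p : R -> C) := forall x y, md (p x - p y) = `|x - y|.

Lemma scont_comp (f : C -> C) (p : R -> C) a b : lip1 p ->
  (forall x, a <= x <= b -> ccont f (p x)) -> scont (fun x => f (p x)) a b.
Proof.
move=> pl H.
have key (F : C -> R) : (forall z, `|F z| <= md z) -> (forall z w, F (z - w) = F z - F w) ->
   icont (fun x => F (f (p x))) a b.
  move=> F1 F2; apply: continuous_in_subspaceT => x; rewrite inE /= in_itv /= => xab.
  apply/cvgrPdist_lt => e e0; have [d d0 Hd] := H x xab e e0.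
  near=> y.
  rewrite -F2; apply: (le_lt_trans (F1 _)); rewrite mdB; apply: Hd; rewrite pl.
  rewrite distrC; near: y; exact: (@cvgr_dist_lt _ R _ (nbhs x) _ id x cvg_id).
split; apply: key.
- exact: md_Re.
- by move=> z w; rewrite cReD cReN.
- exact: md_Im.
- by move=> z w; rewrite cImD cImN.
Unshelve. all: by end_near. Qed.

End ComplexIntegral.

(** * Goursat's theorem on rectangles *)

Section Goursat.
Variable R : realType.
Local Notation C := (cplx R).
Implicit Types (f g : C -> C).

Lemma ccontD f g t : ccont f t -> ccont g t -> ccont (fun z => f z + g z) t.
Proof.
move=> /ccont_continuous h1 /ccont_continuous h2; apply/ccont_continuous.
exact: (@cvgD C C C (nbhs t) _ f g (f t) (g t) h1 h2).
Qed.
Lemma ccontM f g t : ccont f t -> ccont g t -> ccont (fun z => f z * g z) t.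
Proof.
move=> /ccont_continuous h1 /ccont_continuous h2; apply/ccont_continuous.
exact: (@cvgM C C (nbhs t) _ f g (f t) (g t) h1 h2).
Qed.
Lemma ccont_cst (c t : C) : ccont (fun=> c) t.
Proof. by apply/ccont_continuous; exact: cst_continuous. Qed.
Lemma ccont_id (t : C) : ccont id t.
Proof. by move=> e e0; exists e. Qed.
Lemma ccontV f t : f t != 0 -> ccont f t -> ccont (fun z => (f z)^-1) t.
Proof.
move=> f0 /ccont_continuous h1; apply/ccont_continuous.
exact: (@cvgV C C (nbhs t) _ f (f t) f0 h1).
Qed.
Definition contH f y a b := forall x, a <= x <= b -> ccont f (Complex x y).
Definition contV f x a b := forall y, a <= y <= b -> ccont f (Complex x y).
Definition hseg f y a b : C := cint (fun x => f (Complex x y)) a b.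
Definition vseg f x a b : C := cint (fun y => f (Complex x y)) a b.

Lemma scontH f y a b : contH f y a b -> scont (fun x => f (Complex x y)) a b.
Proof.
move=> H; apply: (@scont_comp _ f (fun x => Complex x y)) => //.
by move=> u v; rewrite md_sqrt cReD cImD cReN cImN /= subrr expr0n /= addr0 sqrtr_sqr.
Qed.
Lemma scontV f x a b : contV f x a b -> scont (fun y => f (Complex x y)) a b.
Proof.
move=> H; apply: (@scont_comp _ f (fun y => Complex x y)) => //.
by move=> u v; rewrite md_sqrt cReD cImD cReN cImN /= subrr expr0n /= add0r sqrtr_sqr.
Qed.

(** Counterclockwise boundary integral: bottom and right sides count positively, top and left
    negatively, and [dz = i dy] on vertical sides. *)
Definition gam f x0 x1 y0 y1 : C :=
  hseg f y0 x0 x1 + Complex 0 1 * vseg f x1 y0 y1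
  - hseg f y1 x0 x1 - Complex 0 1 * vseg f x0 y0 y1.

Definition bcont f x0 x1 y0 y1 :=
  [/\ contH f y0 x0 x1, contH f y1 x0 x1, contV f x0 y0 y1 & contV f x1 y0 y1].
Definition rcont f x0 x1 y0 y1 :=
  forall x y, x0 <= x <= x1 -> y0 <= y <= y1 -> ccont f (Complex x y).

Lemma rcont_bcont f x0 x1 y0 y1 : x0 <= x1 -> y0 <= y1 ->
  rcont f x0 x1 y0 y1 -> bcont f x0 x1 y0 y1.
Proof.
by move=> hx hy H; split=> u hu; apply: H => //; rewrite lexx ?hx ?hy.
Qed.

Lemma gamD f g x0 x1 y0 y1 : bcont f x0 x1 y0 y1 -> bcont g x0 x1 y0 y1 ->
  gam (fun z => f z + g z) x0 x1 y0 y1 = gam f x0 x1 y0 y1 + gam g x0 x1 y0 y1.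
Proof.
move=> [f1 f2 f3 f4] [g1 g2 g3 g4]; rewrite /gam /hseg /vseg.
rewrite !cintD; try exact: scontH; try exact: scontV.
by ring.
Qed.

Lemma gamZ c f x0 x1 y0 y1 : bcont f x0 x1 y0 y1 ->
  gam (fun z => c * f z) x0 x1 y0 y1 = c * gam f x0 x1 y0 y1.
Proof.
move=> [f1 f2 f3 f4]; rewrite /gam /hseg /vseg.
rewrite !cintZ; try exact: scontH; try exact: scontV.
by ring.
Qed.

Definition on_bdry (x0 x1 y0 y1 : R) (P : C -> Prop) :=
  (forall x, x0 <= x <= x1 -> P (Complex x y0) /\ P (Complex x y1)) /\
  (forall y, y0 <= y <= y1 -> P (Complex x0 y) /\ P (Complex x1 y)).

Lemma on_bdryW x0 x1 y0 y1 (P : C -> Prop) : x0 <= x1 -> y0 <= y1 ->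
  (forall x y, x0 <= x <= x1 -> y0 <= y <= y1 -> P (Complex x y)) -> on_bdry x0 x1 y0 y1 P.
Proof. by move=> hx hy H; split => u hu; split; apply: H => //; rewrite lexx ?hx ?hy. Qed.

Lemma gam_eq f g x0 x1 y0 y1 : on_bdry x0 x1 y0 y1 (fun z => f z = g z) ->
  gam f x0 x1 y0 y1 = gam g x0 x1 y0 y1.
Proof.
move=> [H1 H2]; rewrite /gam; congr (_ + _ * _ - _ - _ * _); apply: cint_eq => u hu;
by [case: (H1 u hu)|case: (H2 u hu)].
Qed.

Lemma md_i : md (Complex 0 1 : C) = 1.
Proof. by rewrite md_sqrt /= expr0n expr1n /= add0r sqrtr1. Qed.

Lemma gam_bound f x0 x1 y0 y1 M : x0 <= x1 -> y0 <= y1 -> bcont f x0 x1 y0 y1 ->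
  on_bdry x0 x1 y0 y1 (fun z => md (f z) <= M) ->
  md (gam f x0 x1 y0 y1) <= 4 * M * ((x1 - x0) + (y1 - y0)).
Proof.
move=> hx hy [f1 f2 f3 f4] [H1 H2].
have b1 : md (hseg f y0 x0 x1) <= 2 * M * (x1 - x0).
  by apply: cint_bound => //; [exact: scontH|move=> u /H1[]].
have b2 : md (hseg f y1 x0 x1) <= 2 * M * (x1 - x0).
  by apply: cint_bound => //; [exact: scontH|move=> u /H1[]].
have b3 : md (vseg f x0 y0 y1) <= 2 * M * (y1 - y0).
  by apply: cint_bound => //; [exact: scontV|move=> u /H2[]].
have b4 : md (vseg f x1 y0 y1) <= 2 * M * (y1 - y0).
  by apply: cint_bound => //; [exact: scontV|move=> u /H2[]].
rewrite /gam; have := md_triangle (hseg f y0 x0 x1 + Complex 0 1 * vseg f x1 y0 y1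
  - hseg f y1 x0 x1) (- (Complex 0 1 * vseg f x0 y0 y1)).
have := md_triangle (hseg f y0 x0 x1 + Complex 0 1 * vseg f x1 y0 y1) (- hseg f y1 x0 x1).
have := md_triangle (hseg f y0 x0 x1) (Complex 0 1 * vseg f x1 y0 y1).
rewrite !mdN !mdM md_i !mul1r; move: b1 b2 b3 b4; lra.
Qed.

Lemma gam_splitx f x0 m x1 y0 y1 : x0 <= m <= x1 -> y0 <= y1 ->
  contH f y0 x0 x1 -> contH f y1 x0 x1 ->
  gam f x0 x1 y0 y1 = gam f x0 m y0 y1 + gam f m x1 y0 y1.
Proof.
move=> hm hy H1 H2; rewrite /gam /hseg.
rewrite (cint_split hm (scontH H1)) (cint_split hm (scontH H2)); ring.
Qed.

Lemma gam_splity f x0 x1 y0 m y1 : x0 <= x1 -> y0 <= m <= y1 ->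
  contV f x0 y0 y1 -> contV f x1 y0 y1 ->
  gam f x0 x1 y0 y1 = gam f x0 x1 y0 m + gam f x0 x1 m y1.
Proof.
move=> hx hm H1 H2; rewrite /gam /vseg.
rewrite (cint_split hm (scontV H1)) (cint_split hm (scontV H2)); ring.
Qed.

(** Opposite sides differ by constants, which cancel around the boundary. In Goursat's argument this
    disposes of the first-order part of [f]. *)
Lemma gam_affine (a b : C) x0 x1 y0 y1 : x0 <= x1 -> y0 <= y1 ->
  gam (fun z => a + b * z) x0 x1 y0 y1 = 0.
Proof.
move=> hx hy.
have cst (c : C) u v : u <= v -> cint (fun=> c) u v = of_real (v - u) * c.
  move=> uv; apply/eqP; rewrite eq_complex cReM cImM /= !rint_cst// !mul0r subr0 addr0.
  by rewrite ![_ * (v - u)]mulrC !eqxx.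
have hs y : hseg (fun z => a + b * z) y x0 x1 =
    of_real (x1 - x0) * (a + b * Complex 0 y) + b * cint (@of_real R) x0 x1.
  rewrite /hseg -cst// -cintZ; last by apply: (@scontH id 0) => ? _; exact: ccont_id.
  rewrite -cintD; first last.
  - by apply: scontZ; apply: (@scontH id 0) => ? _; exact: ccont_id.
  - by apply: (@scontH (fun=> _) 0) => ? _; exact: ccont_cst.
  apply: cint_eq => x _; rewrite -addrA -mulrDr; congr (_ + _ * _).
  by apply/eqP; rewrite eq_complex cReD cImD /= add0r addr0 !eqxx.
have vs x : vseg (fun z => a + b * z) x y0 y1 =
    of_real (y1 - y0) * (a + b * of_real x) + b * cint (fun y => Complex 0 y) y0 y1.
  rewrite /vseg -cst// -cintZ; last by apply: (@scontV id 0) => ? _; exact: ccont_id.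
  rewrite -cintD; first last.
  - by apply: scontZ; apply: (@scontV id 0) => ? _; exact: ccont_id.
  - by apply: (@scontH (fun=> _) 0) => ? _; exact: ccont_cst.
  apply: cint_eq => x' _; rewrite -addrA -mulrDr; congr (_ + _ * _).
  by apply/eqP; rewrite eq_complex cReD cImD /= add0r addr0 !eqxx.
rewrite /gam !hs !vs.
have E y : (Complex 0 y : C) = Complex 0 1 * of_real y.
  by apply/eqP; rewrite eq_complex /=; apply/andP; split; apply/eqP; ring.
rewrite (E y0) (E y1) !of_realD !of_realN; ring.
Qed.

Definition quad := (R * R * R * R)%type.
Definition qgam f (q : quad) := let: (x0, x1, y0, y1) := q in gam f x0 x1 y0 y1.
Definition qmid (a b : R) := (a + b) / 2.
Definition quarter (i : bool * bool) (q : quad) : quad :=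
  let: (x0, x1, y0, y1) := q in
  ((if i.1 then x0 else qmid x0 x1), (if i.1 then qmid x0 x1 else x1),
   (if i.2 then y0 else qmid y0 y1), (if i.2 then qmid y0 y1 else y1)).

Lemma gam_quarters f (x0 x1 y0 y1 : R) : x0 <= x1 -> y0 <= y1 -> rcont f x0 x1 y0 y1 ->
  let q := (x0, x1, y0, y1) in
  qgam f q = qgam f (quarter (true, true) q) + qgam f (quarter (true, false) q)
           + qgam f (quarter (false, true) q) + qgam f (quarter (false, false) q).
Proof.
move=> hx hy H q; rewrite /qgam /quarter /=.
have mx : x0 <= qmid x0 x1 <= x1 by rewrite /qmid; lra.
have my : y0 <= qmid y0 y1 <= y1 by rewrite /qmid; lra.
have mx1 : x0 <= qmid x0 x1 by case/andP: mx.
have mx2 : qmid x0 x1 <= x1 by case/andP: mx.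
have ch y : y0 <= y <= y1 -> contH f y x0 x1 by move=> hy' x hx'; exact: H.
have cv x : x0 <= x <= x1 -> contV f x y0 y1 by move=> hx' y hy'; exact: H.
have [y0y y1y] : y0 <= y0 <= y1 /\ y0 <= y1 <= y1 by rewrite !lexx hy.
have [x0x x1x] : x0 <= x0 <= x1 /\ x0 <= x1 <= x1 by rewrite !lexx hx.
apply: (etrans (gam_splitx mx hy (ch _ y0y) (ch _ y1y))).
apply: (etrans (f_equal2 +%R (gam_splity mx1 my (cv _ x0x) (cv _ mx)) (gam_splity mx2 my (cv _ mx) (cv _ x1x)))).
exact: addrA.
Qed.

(** A quarter carrying at least a fourth of the modulus of the integral. The last one is the
    default: when the three others fail, the triangle inequality forces it. *)
Definition biggest_quarter f (q : quad) : quad :=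
  if md (qgam f q) <= 4 * md (qgam f (quarter (true, true) q)) then quarter (true, true) q
  else if md (qgam f q) <= 4 * md (qgam f (quarter (true, false) q)) then quarter (true, false) q
  else if md (qgam f q) <= 4 * md (qgam f (quarter (false, true) q)) then quarter (false, true) q
  else quarter (false, false) q.

Lemma biggest_quarter_ex f q : exists i, biggest_quarter f q = quarter i q.
Proof. by rewrite /biggest_quarter; do 3! [case: ifP => _; first by eexists]; eexists. Qed.

Lemma quarter_bound (s t u a b c d : R) : 4 * a < s -> 4 * b < s -> 4 * c < s ->
  u <= a + b -> t <= u + c -> s <= t + d -> s <= 4 * d.
Proof. by lra. Qed.

Lemma biggest_quarterP f x0 x1 y0 y1 : x0 <= x1 -> y0 <= y1 -> rcont f x0 x1 y0 y1 ->
  md (qgam f (x0, x1, y0, y1)) <= 4 * md (qgam f (biggest_quarter f (x0, x1, y0, y1))).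
Proof.
move=> hx hy H; rewrite /biggest_quarter.
case: ifP => // /negbT; rewrite -ltNge => h1.
case: ifP => // /negbT; rewrite -ltNge => h2.
case: ifP => // /negbT; rewrite -ltNge => h3.
set q := (x0, x1, y0, y1) in h1 h2 h3 *.
have E : qgam f q = qgam f (quarter (true, true) q) + qgam f (quarter (true, false) q)
    + qgam f (quarter (false, true) q) + qgam f (quarter (false, false) q).
  exact: gam_quarters.
rewrite E in h1 h2 h3 *; move: h1 h2 h3.
set a := qgam f _; set b := qgam f _; set c := qgam f _; set d := qgam f _.
move=> h1 h2 h3.
exact: (quarter_bound h1 h2 h3 (md_triangle a b) (md_triangle (a + b) c) (md_triangle (a + b + c) d)).
Qed.

Definition qseq f q n := iter n (biggest_quarter f) q.
Definition qx0 (q : quad) := q.1.1.1.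
Definition qx1 (q : quad) := q.1.1.2.
Definition qy0 (q : quad) := q.1.2.
Definition qy1 (q : quad) := q.2.

Lemma qseqP f q n : qx0 q <= qx1 q -> qy0 q <= qy1 q ->
  [/\ qx1 (qseq f q n) - qx0 (qseq f q n) = (qx1 q - qx0 q) / 2 ^+ n,
      qy1 (qseq f q n) - qy0 (qseq f q n) = (qy1 q - qy0 q) / 2 ^+ n &
      [/\ qx0 (qseq f q n) <= qx0 (qseq f q n.+1),
          qx1 (qseq f q n.+1) <= qx1 (qseq f q n),
          qy0 (qseq f q n) <= qy0 (qseq f q n.+1) &
          qy1 (qseq f q n.+1) <= qy1 (qseq f q n)]].
Proof.
move=> hx hy.
have step (i : bool * bool) (p : quad) :
    qx1 (quarter i p) - qx0 (quarter i p) = (qx1 p - qx0 p) / 2 /\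
    qy1 (quarter i p) - qy0 (quarter i p) = (qy1 p - qy0 p) / 2.
  by move: p i => [[[a b] c] d] [[] []]; rewrite /quarter /qx0 /qx1 /qy0 /qy1 /= /qmid; split; lra.
have step2 (i : bool * bool) (p : quad) : qx0 p <= qx1 p -> qy0 p <= qy1 p ->
    [/\ qx0 p <= qx0 (quarter i p), qx1 (quarter i p) <= qx1 p,
        qy0 p <= qy0 (quarter i p) & qy1 (quarter i p) <= qy1 p].
  by move: p i => [[[a b] c] d] [[] []]; rewrite /quarter /qx0 /qx1 /qy0 /qy1 /= /qmid; split; lra.
have sz m : qx1 (qseq f q m) - qx0 (qseq f q m) = (qx1 q - qx0 q) / 2 ^+ m /\
      qy1 (qseq f q m) - qy0 (qseq f q m) = (qy1 q - qy0 q) / 2 ^+ m.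
  elim: m => [|m [IH1 IH2]]; first by rewrite !divr1.
  have [i Hi] := biggest_quarter_ex f (qseq f q m).
  rewrite /qseq iterS -/(qseq f q m) Hi; have [-> ->] := step i (qseq f q m).
  by rewrite IH1 IH2 exprSr invfM !mulrA.
have [s1 s2] := sz n; split=> //.
have [i Hi] := biggest_quarter_ex f (qseq f q n).
rewrite /qseq iterS -/(qseq f q n) Hi; apply: step2.
  by rewrite -subr_ge0 s1 divr_ge0 ?subr_ge0// exprn_ge0.
by rewrite -subr_ge0 s2 divr_ge0 ?subr_ge0// exprn_ge0.
Qed.

Lemma nested_point (a b : nat -> R) : (forall n, a n <= a n.+1) ->
  (forall n, b n.+1 <= b n) -> (forall n, a n <= b n) ->
  exists c, forall n, a n <= c <= b n.
Proof.
move=> ha hb hab.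
have ma : {homo a : m n / (m <= n)%N >-> m <= n}.
  by apply: homo_leq => //; exact: le_trans.
have mb : {homo b : m n / (m <= n)%N >-> m >= n}.
  by apply: homo_leq => // x y z h1 h2; exact: le_trans h2 h1.
have ub n : ubound (range a) (b n).
  move=> _ [m _ <-]; apply: (le_trans (ma _ _ (leq_maxl m n))).
  by apply: (le_trans (hab _)); apply: mb; exact: leq_maxr.
exists (sup (range a)) => n; apply/andP; split.
  by apply: ub_le_sup; [exists (b 0%N); exact: ub|exists n].
by apply: ge_sup; [exists (a 0%N); exists 0%N|exact: ub].
Qed.

Lemma goursat f x0 x1 y0 y1 : x0 <= x1 -> y0 <= y1 ->
  (forall x y, x0 <= x <= x1 -> y0 <= y <= y1 -> exists l, cdiff f (Complex x y) l) ->
  gam f x0 x1 y0 y1 = 0.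
Proof.
move=> hx hy H; pose q : quad := (x0, x1, y0, y1); pose s := qseq f q.
have Hs n := @qseqP f q n hx hy.
have inx n : qx0 (s n) <= qx1 (s n).
  by have [e _ _] := Hs n; rewrite -subr_ge0 e divr_ge0 ?subr_ge0// exprn_ge0.
have iny n : qy0 (s n) <= qy1 (s n).
  by have [_ e _] := Hs n; rewrite -subr_ge0 e divr_ge0 ?subr_ge0// exprn_ge0.
have sub n : [/\ x0 <= qx0 (s n), qx1 (s n) <= x1, y0 <= qy0 (s n) & qy1 (s n) <= y1].
  elim: n => [//|n [i1 i2 i3 i4]]; have [_ _ [j1 j2 j3 j4]] := Hs n.
  by split; [exact: le_trans i1 j1|exact: le_trans j2 i2|
             exact: le_trans i3 j3|exact: le_trans j4 i4].
have rc n : rcont f (qx0 (s n)) (qx1 (s n)) (qy0 (s n)) (qy1 (s n)).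
  move=> x y /andP[a1 a2] /andP[b1 b2]; have [i1 i2 i3 i4] := sub n.
  have [||l Hl] := H x y; first by rewrite (le_trans i1)//= (le_trans a2).
    by rewrite (le_trans i3)//= (le_trans b2).
  exact: cdiff_ccont Hl.
have sE n : s n = (qx0 (s n), qx1 (s n), qy0 (s n), qy1 (s n)).
  by case: (s n) => [[[]]].
have big n : md (qgam f q) <= 4 ^+ n * md (qgam f (s n)).
  elim: n => [|n IH]; first by rewrite mul1r.
  apply: (le_trans IH); rewrite exprSr -mulrA ler_pM2l ?exprn_gt0//.
  rewrite /s /qseq iterS -/(qseq f q n) -/(s n) [in leLHS]sE [in leRHS]sE.
  by apply: biggest_quarterP.
have [X HX] : exists c, forall n, qx0 (s n) <= c <= qx1 (s n).
  by apply: nested_point => n //; have [_ _ []] := Hs n.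
have [Y HY] : exists c, forall n, qy0 (s n) <= c <= qy1 (s n).
  by apply: nested_point => n //; have [_ _ []] := Hs n.
have [||l Hl] := H X Y; [exact: HX 0%N|exact: HY 0%N|].
pose p : C := Complex X Y.
apply/eqP; rewrite -md_eq0; apply/negPn/negP => K0.
pose K := md (qgam f q); have K1 : 0 < K by rewrite lt_def K0 md_ge0.
pose D := (x1 - x0) + (y1 - y0).
have D0 : 0 <= D by rewrite addr_ge0// subr_ge0.
(* After [n] bisections both the size of the rectangle and the distance to [p] are at most
   [D / 2^n], which cancels [4^n] and leaves [K <= 4 e D^2]. This [e] contradicts it; the [+ 1]
   covers [D = 0]. *)
pose e := K / (8 * (D ^+ 2 + 1)).
have e0 : 0 < e by rewrite divr_gt0// mulr_gt0// ltr_wpDl// sqr_ge0.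
have [d d0 Hd] := Hl e e0.
have [n Hn] : exists n, D / 2 ^+ n < d.
  have Hn := archi_boundP (divr_ge0 D0 (ltW d0)).
  exists (Num.bound (D / d)); rewrite ltr_pdivrMr ?exprn_gt0// mulrC -ltr_pdivrMr//.
  by apply: (lt_trans Hn); rewrite -natrX ltr_nat ltn_expl.
have [e1 e2 _] := Hs n.
have dist (x y : R) : qx0 (s n) <= x <= qx1 (s n) -> qy0 (s n) <= y <= qy1 (s n) ->
    md (Complex x y - p) <= D / 2 ^+ n.
  move=> hx' hy'; apply: (le_trans (md_ReIm _)); rewrite cReD cReN cImD cImN /=.
  rewrite /D mulrDl; apply: lerD.
    by rewrite -[leRHS]e1 ler_norml; move: (HX n) hx'; lra.
  by rewrite -[leRHS]e2 ler_norml; move: (HY n) hy'; lra.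
(* Subtracting the affine part at [p] does not change the integral and leaves the first-order error
   only. *)
have E : qgam f (s n) = gam (fun z => (f z + (- f p)) + (- l) * (z - p))
    (qx0 (s n)) (qx1 (s n)) (qy0 (s n)) (qy1 (s n)).
  rewrite {1}sE /= (_ : (fun z => _) = (fun z => f z + ((l * p - f p) + (- l) * z))); last first.
    by apply/funext => z; ring.
  rewrite gamD ?gam_affine ?addr0//; apply: rcont_bcont => // x y _ _.
  by apply: ccontD; [exact: ccont_cst|apply: ccontM; [exact: ccont_cst|exact: ccont_id]].
have B : md (qgam f (s n)) <= 4 * (e * (D / 2 ^+ n)) * (D / 2 ^+ n).
  rewrite E; apply: le_trans.
    apply: (@gam_bound _ _ _ _ _ (e * (D / 2 ^+ n))) => //.
      apply: rcont_bcont => // x y hx' hy'; apply: ccontD; last first.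
        apply: ccontM; [exact: ccont_cst|].
        by apply: ccontD; [exact: ccont_id|exact: ccont_cst].
      by apply: ccontD; [exact: (rc n)|exact: ccont_cst].
    apply: on_bdryW => // x y hx' hy'; have dxy := dist x y hx' hy'.
    rewrite mulNr; apply: (le_trans (Hd _ (le_lt_trans dxy Hn))).
    by rewrite ler_pM2l.
  by rewrite e1 e2 -mulrDl.
have := le_trans (big n) (ler_wpM2l (exprn_ge0 n (ler0n _ 4)) B).
rewrite (_ : 4 ^+ n * _ = 4 * e * D ^+ 2); last first.
  rewrite (_ : 4 = 2 * 2 :> R); last by rewrite -natrM.
  by rewrite exprMn; field; rewrite expf_neq0.
rewrite -/K leNgt => /negP; apply.
rewrite /e (_ : 4 * _ * _ = K * (D ^+ 2 / (2 * (D ^+ 2 + 1)))); last first.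
  have : D ^+ 2 + 1 != 0 by rewrite gt_eqF// ltr_wpDl// sqr_ge0.
  by move=> ?; field.
rewrite -[ltRHS]mulr1 ltr_pM2l// ltr_pdivrMr ?mul1r; last by rewrite mulr_gt0// ltr_wpDl// sqr_ge0.
by have := sqr_ge0 D; lra.
Qed.
End Goursat.

(** * Cauchy formula *)

Section CauchyFormula.
Variable R : realType.
Local Notation C := (cplx R).
Implicit Types (f g : C -> C).

Definition inrect (x0 x1 y0 y1 : R) (z : C) :=
  x0 < complex.Re z < x1 /\ y0 < complex.Im z < y1.

Lemma ReImE (z : C) : z = Complex (complex.Re z) (complex.Im z).
Proof. by case: z. Qed.

Lemma small_eq0 (K D M d : R) : 0 < D -> 0 < M -> 0 < d ->
  (forall eta, 0 < eta -> eta < 1 -> eta * D < d -> K <= 4 * M * (eta * D)) -> K <= 0.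
Proof.
move=> D0 M0 d0 key; rewrite leNgt; apply/negP => K0.
have d1 : 0 < d / (2 * D) by rewrite divr_gt0// mulr_gt0.
have d2 : 0 < K / (8 * M * D) by rewrite divr_gt0// !mulr_gt0.
pose eta := Num.min (1 / 2) (Num.min (d / (2 * D)) (K / (8 * M * D))).
have eta0 : 0 < eta by rewrite /eta !lt_min d1 d2 !andbT divr_gt0.
have [eta1 eta2 eta3] : [/\ eta <= 1 / 2, eta <= d / (2 * D) & eta <= K / (8 * M * D)].
  by rewrite /eta !ge_min !lexx !orbT.
rewrite ler_pdivlMr ?mulr_gt0// in eta2; rewrite ler_pdivlMr ?mulr_gt0// in eta3.
have t0 : 0 < eta * D by rewrite mulr_gt0.
have t1 : 0 < M * (eta * D) by rewrite mulr_gt0.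
have h1 : eta < 1 by lra.
have h3 : eta * D < d by lra.
by have := key eta eta0 h1 h3; lra.
Qed.

(** The integral equals the one around any smaller rectangle containing [p]; there [f] stays bounded
    by continuity while the perimeter tends to 0. *)
Lemma goursat_removable f x0 x1 y0 y1 (p : C) : inrect x0 x1 y0 y1 p ->
  (forall x y, x0 <= x <= x1 -> y0 <= y <= y1 -> Complex x y != p ->
     exists l, cdiff f (Complex x y) l) ->
  ccont f p -> gam f x0 x1 y0 y1 = 0.
Proof.
case: p => px py [/= /andP[hx0 hx1] /andP[hy0 hy1]] H cp.
have hx := ltW (lt_trans hx0 hx1); have hy := ltW (lt_trans hy0 hy1).
have rc : rcont f x0 x1 y0 y1.
  move=> x y hx' hy'; have [->//|np] := eqVneq (Complex x y : C) (Complex px py).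
  by have [l] := H x y hx' hy' np; exact: cdiff_ccont.
have G a b c d : x0 <= a -> a <= b -> b <= x1 -> y0 <= c -> c <= d -> d <= y1 ->
    ~~ ((a <= px <= b) && (c <= py <= d)) -> gam f a b c d = 0.
  move=> a0 ab b1 c0 cd d1 np; apply: goursat => // x y hx' hy'.
  apply: H; [lra|lra|]; apply: contra np => /eqP[<- <-].
  by rewrite hx' hy'.
(* Cut off the four outer strips, which avoid [p] and contribute 0. *)
have small (a b c d : R) : x0 < a -> a < px -> px < b -> b < x1 -> y0 < c -> c < py ->
    py < d -> d < y1 -> gam f x0 x1 y0 y1 = gam f a b c d.
  move=> a0 ap pb b1 c0 cp' pd d1.
  have g1 : gam f x0 a y0 y1 = 0 by apply: G; try lra; apply/negP => /andP[]; lra.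
  have g2 : gam f b x1 y0 y1 = 0 by apply: G; try lra; apply/negP => /andP[]; lra.
  have g3 : gam f a b y0 c = 0 by apply: G; try lra; apply/negP => /andP[]; lra.
  have g4 : gam f a b d y1 = 0 by apply: G; try lra; apply/negP => /andP[]; lra.
  have ha : x0 <= a <= x1 by lra.
  have hb : a <= b <= x1 by lra.
  have hc : y0 <= c <= y1 by lra.
  have hd : c <= d <= y1 by lra.
  have hab : a <= b by lra.
  rewrite (gam_splitx ha hy); first last.
  - by move=> ? ?; apply: rc; lra.
  - by move=> ? ?; apply: rc; lra.
  rewrite g1 add0r (gam_splitx hb hy); first last.
  - by move=> ? ?; apply: rc; lra.
  - by move=> ? ?; apply: rc; lra.
  rewrite g2 addr0 (gam_splity hab hc); first last.
  - by move=> ? ?; apply: rc; lra.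
  - by move=> ? ?; apply: rc; lra.
  rewrite g3 add0r (gam_splity hab hd); first last.
  - by move=> ? ?; apply: rc; lra.
  - by move=> ? ?; apply: rc; lra.
  by rewrite g4 addr0.
have [d d0 Hd] := cp 1 ltr01.
pose D := (x1 - x0) + (y1 - y0); have D0 : 0 < D by rewrite /D; lra.
pose M := md (f (Complex px py)) + 1.
have M0 : 0 < M by rewrite ltr_wpDl// md_ge0.
have key eta : 0 < eta -> eta < 1 -> eta * D < d ->
    md (gam f x0 x1 y0 y1) <= 4 * M * (eta * D).
  move=> e0 e1 ed.
  (* The image of the rectangle under the homothety of centre [p] and ratio [eta]. *)
  pose a := px - eta * (px - x0); pose b := px + eta * (x1 - px).
  pose c := py - eta * (py - y0); pose dd := py + eta * (y1 - py).
  have ha : x0 < a < px by rewrite /a; apply/andP; split; nra.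
  have hb : px < b < x1 by rewrite /b; apply/andP; split; nra.
  have hc : y0 < c < py by rewrite /c; apply/andP; split; nra.
  have hd : py < dd < y1 by rewrite /dd; apply/andP; split; nra.
  have [[a1 a2] [b1 b2]] := (andP ha, andP hb); have [[c1 c2] [d1 d2]] := (andP hc, andP hd).
  rewrite (small a b c dd a1 a2 b1 b2 c1 c2 d1 d2).
  have -> : eta * D = (b - a) + (dd - c) by rewrite /a /b /c /dd /D; ring.
  apply: gam_bound; try lra.
    by apply: rcont_bcont; try lra; move=> x y ? ?; apply: rc; lra.
  apply: on_bdryW; try lra; move=> x y hx' hy'.
  have : md (f (Complex x y) - f (Complex px py)) < 1.
    apply: Hd; apply: (le_lt_trans (md_ReIm _)); rewrite cReD cReN cImD cImN /=.
    apply: le_lt_trans ed; rewrite /D.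
    have : `|x - px| <= eta * (x1 - x0) by rewrite ler_norml; move: hx'; rewrite /a /b; nra.
    have : `|y - py| <= eta * (y1 - y0) by rewrite ler_norml; move: hy'; rewrite /c /dd; nra.
    lra.
  have := md_triangle (f (Complex x y) - f (Complex px py)) (f (Complex px py)).
  by rewrite subrK /M; lra.
have := small_eq0 D0 M0 d0 key; clear => K0.
by apply/eqP; rewrite -md_eq0 eq_le K0 md_ge0.
Qed.

Lemma cdiffV f t l : f t != 0 -> cdiff f t l ->
  cdiff (fun z => (f z)^-1) t (- l / f t ^+ 2).
Proof.
move=> f0 hf; have cf := ccontV f0 (cdiff_ccont hf).
pose u := (f t)^-1; have u0 : 0 < md u by rewrite md_gt0 invr_eq0.
have [d1 d10 H1] := cf (md u) u0.
have cont2 := ccontM (@ccont_cst _ l t) cf.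
move=> e e0.
have e20 : 0 < e / (4 * (md u * md u)) by rewrite divr_gt0// !mulr_gt0.
have [d2 d20 H2] := hf _ e20.
have e30 : 0 < e / (2 * (md u)) by rewrite divr_gt0// !mulr_gt0.
have [d3 d30 H3] := cont2 _ e30.
have [d4 d40 H4] : exists2 d : R, 0 < d & forall z, md (z - t) < d -> f z != 0.
  have f0' : 0 < md (f t) by rewrite md_gt0.
  have [d d0 Hd] := cdiff_ccont hf f0'.
  by exists d => // z /Hd; apply: contraTneq => ->; rewrite sub0r mdN ltxx.
exists (Num.min (Num.min d1 d2) (Num.min d3 d4)); first by rewrite !lt_min d10 d20 d30.
move=> z; rewrite !lt_min => /andP[/andP[z1 z2] /andP[z3 z4]].
pose v := (f z)^-1.
have fz := H4 z z4.
(* The error splits into the first-order error of [f], times the bounded factor [u * v], and the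
   continuity error of [1/f], times [z - t]. *)
have -> : (f z)^-1 - (f t)^-1 - - l / f t ^+ 2 * (z - t) =
   - (u * v * (f z - f t - l * (z - t))) - u * (l * v - l * u) * (z - t).
  by rewrite /u /v; field; rewrite fz f0.
apply: (le_trans (md_triangle _ _)); rewrite !mdN !mdM.
have v2 : md v <= 2 * md u.
  have := md_triangle (v - u) u; rewrite subrK.
  by have := H1 z z1; rewrite -/u -/v; lra.
have h2 := H2 z z2; have h3 := ltW (H3 z z3); rewrite -/u -/v in h3.
have n0 := md_ge0 (z - t).
have step1 : md u * md v * md (f z - f t - l * (z - t)) <= e / 2 * md (z - t).
  apply: (@le_trans _ _ (md u * (2 * md u) * (e / (4 * (md u * md u)) * md (z - t)))).
    by apply: ler_pM => //; rewrite ?mulr_ge0 ?md_ge0// ler_wpM2l ?md_ge0.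
  by rewrite le_eqVlt; apply/orP; left; apply/eqP; field; rewrite gt_eqF.
have step2 : md u * md (l * v - l * u) * md (z - t) <= e / 2 * md (z - t).
  rewrite ler_wpM2r//; apply: (le_trans (ler_wpM2l (md_ge0 u) h3)).
  by rewrite le_eqVlt; apply/orP; left; apply/eqP; field; rewrite gt_eqF.
by lra.
Qed.

Lemma inrect_bdry x0 x1 y0 y1 (z : C) : inrect x0 x1 y0 y1 z ->
  exists2 d : R, 0 < d & on_bdry x0 x1 y0 y1 (fun w => d <= md (w - z)).
Proof.
case: z => a b [/= /andP[h1 h2] /andP[h3 h4]].
exists (Num.min (Num.min (a - x0) (x1 - a)) (Num.min (b - y0) (y1 - b))).
  by rewrite !lt_min !subr_gt0 h1 h2 h3 h4.
split=> u hu; split.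
- apply: (le_trans _ (md_Im _)); rewrite cImD cImN /= distrC.
  by rewrite (le_trans _ (ler_norm _))// !ge_min lexx ?orbT.
- apply: (le_trans _ (md_Im _)); rewrite cImD cImN /=.
  by rewrite (le_trans _ (ler_norm _))// !ge_min lexx ?orbT.
- apply: (le_trans _ (md_Re _)); rewrite cReD cReN /= distrC.
  by rewrite (le_trans _ (ler_norm _))// !ge_min lexx ?orbT.
- apply: (le_trans _ (md_Re _)); rewrite cReD cReN /=.
  by rewrite (le_trans _ (ler_norm _))// !ge_min lexx ?orbT.
Qed.

Lemma on_bdryI x0 x1 y0 y1 (P Q S : C -> Prop) : (forall z, P z -> Q z -> S z) ->
  on_bdry x0 x1 y0 y1 P -> on_bdry x0 x1 y0 y1 Q -> on_bdry x0 x1 y0 y1 S.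
Proof.
move=> H [p1 p2] [q1 q2]; split=> u hu; have := (p1 u, p2 u, q1 u, q2 u) => -[[[a b] c] d].
  by have [? ?] := a hu; have [? ?] := c hu; split; exact: H.
by have [? ?] := b hu; have [? ?] := d hu; split; exact: H.
Qed.

Lemma on_bdry_cont f x0 x1 y0 y1 : bcont f x0 x1 y0 y1 <-> on_bdry x0 x1 y0 y1 (ccont f).
Proof.
split; first by move=> [h1 h2 h3 h4]; split => u hu; split; [exact: h1|exact: h2|exact: h3|exact: h4].
by move=> [H1 H2]; split=> u hu; [have [] := H1 u hu|have [] := H1 u hu|have [] := H2 u hu|have [] := H2 u hu].
Qed.

Lemma ccont_kernel (w z : C) : w != z -> ccont (fun w => (w - z)^-1) w.
Proof.
move=> wz; apply: (@ccontV _ (fun w => w - z)); first by rewrite subr_eq0.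
by apply: ccontD; [exact: ccont_id|exact: ccont_cst].
Qed.

Lemma bdry_neq x0 x1 y0 y1 (z : C) : inrect x0 x1 y0 y1 z ->
  on_bdry x0 x1 y0 y1 (fun w => w != z).
Proof.
move=> /inrect_bdry[d d0 H]; apply: (on_bdryI _ H H) => w hw _.
by apply: contraTneq hw => ->; rewrite subrr md0 -ltNge.
Qed.

(** The difference quotient of [f] at [z], extended by the derivative, is continuous at [z], so its
    boundary integral vanishes. The winding integral is kept as a factor instead of being evaluated
    to [2 pi i]; its nonvanishing is enough. *)
Lemma cauchy_formula f x0 x1 y0 y1 (z : C) : inrect x0 x1 y0 y1 z ->
  (forall x y, x0 <= x <= x1 -> y0 <= y <= y1 -> exists l, cdiff f (Complex x y) l) ->
  gam (fun w => f w * (w - z)^-1) x0 x1 y0 y1 = f z * gam (fun w => (w - z)^-1) x0 x1 y0 y1.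
Proof.
move=> hz H; have [/andP[hx0 hx1] /andP[hy0 hy1]] := hz.
have hx := ltW (lt_trans hx0 hx1); have hy := ltW (lt_trans hy0 hy1).
have [l Hl] : exists l, cdiff f z l by rewrite (ReImE z); apply: H; rewrite !ltW.
pose g w := if w == z then l else (f w - f z) * (w - z)^-1.
have g0 : gam g x0 x1 y0 y1 = 0.
  apply: (@goursat_removable _ _ _ _ _ z) => //.
    move=> x y hx' hy'; set w : C := Complex x y => wz.
    suff [m Hm] : exists m, cdiff (fun w => (f w - f z) * (w - z)^-1) w m.
      exists m; apply: (@cdiff_near _ (fun w => (f w - f z) * (w - z)^-1) g w m (md (w - z))) => //.
        by rewrite md_gt0 subr_eq0.
      move=> u hu; rewrite /g ifN//; apply: contraTneq hu => ->.
      by rewrite mdB ltxx.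
    have [l1 h1] := H x y hx' hy'; rewrite -/w in h1.
    have w0 : w - z != 0 by rewrite subr_eq0.
    have h2 : cdiff (fun w => w - z) w (1 + 0) := cdiffD (cdiff_id w) (cdiff_cst (- z) w).
    have h3 := cdiffD h1 (cdiff_cst (- f z) w).
    have h4 := @cdiffV (fun w => w - z) w _ w0 h2.
    by eexists; exact: (@cdiffM _ (fun w => f w - f z) (fun w => (w - z)^-1) w _ _ h3 h4).
  move=> e e0; have [d d0 Hd] := Hl (e / 2) (divr_gt0 e0 (ltr0Sn _ _)).
  exists d => // w wd; rewrite /g eqxx; case: eqVneq => [_|wz]; first by rewrite subrr md0.
  have wz' : 0 < md (w - z) by rewrite md_gt0 subr_eq0.
  rewrite -(ltr_pM2r wz') -mdM mulrBl mulfVK ?subr_eq0//.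
  by apply: (le_lt_trans (Hd w wd)); rewrite ltr_pM2r// ltr_pdivrMr// mulrDr mulr1 ltrDl.
have bk : bcont (fun w : C => (w - z)^-1) x0 x1 y0 y1.
  by apply/on_bdry_cont; apply: (on_bdryI _ (bdry_neq hz) (bdry_neq hz)) => w wz _; exact: ccont_kernel.
have bf : on_bdry x0 x1 y0 y1 (ccont f).
  by apply: on_bdryW => // x y hx' hy'; have [m] := H x y hx' hy'; exact: cdiff_ccont.
apply/eqP; rewrite -subr_eq0 -mulNr -gamZ// -gamD//; last first.
- by apply/on_bdry_cont; apply: (on_bdryI _ (bdry_neq hz) bf) => w wz _; apply: ccontM; [exact: ccont_cst|exact: ccont_kernel].
- by apply/on_bdry_cont; apply: (on_bdryI _ (bdry_neq hz) bf) => w wz ?; apply: ccontM => //; exact: ccont_kernel.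
rewrite -[X in _ == X]g0; apply/eqP; apply: gam_eq.
apply: (on_bdryI _ (bdry_neq hz) bf) => w wz _; rewrite /g (negbTE wz); ring.
Qed.

(* The four sides contribute with the same sign to the imaginary part. *)
Lemma winding_neq0 x0 x1 y0 y1 (z : C) : inrect x0 x1 y0 y1 z ->
  gam (fun w => (w - z)^-1) x0 x1 y0 y1 != 0.
Proof.
move=> hz; have [/andP[hx0 hx1] /andP[hy0 hy1]] := hz.
have hx := lt_trans hx0 hx1; have hy := lt_trans hy0 hy1.
have bk : bcont (fun w : C => (w - z)^-1) x0 x1 y0 y1.
  by apply/on_bdry_cont; apply: (on_bdryI _ (bdry_neq hz) (bdry_neq hz)) => w wz _; exact: ccont_kernel.
suff : 0 < complex.Im (gam (fun w : C => (w - z)^-1) x0 x1 y0 y1).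
  by move=> h; apply/eqP => E; move: h; rewrite E ltxx.
case: bk => [/scontH[_ k1] /scontH[_ k2] /scontV[k3 _] /scontV[k4 _]].
case: z hz hx0 hx1 hy0 hy1 k1 k2 k3 k4 => a b hz /= hx0 hx1 hy0 hy1 k1 k2 k3 k4.
have reV (x y : R) : complex.Re ((Complex x y - Complex a b : C)^-1) = (x - a) / ((x - a)^+2 + (y - b)^+2).
  by [].
have imV (x y : R) : complex.Im ((Complex x y - Complex a b : C)^-1) = - ((y - b) / ((x - a)^+2 + (y - b)^+2)).
  by [].
rewrite /gam /hseg /vseg /= !mul0r !mul1r !add0r.
have p1 : 0 < rint (fun x => complex.Im ((Complex x y0 - Complex a b : C)^-1)) x0 x1.
  pose D := (x1 - x0) ^+ 2 + (b - y0) ^+ 2.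
  have D0 : 0 < D by rewrite ltr_wpDr ?sqr_ge0// exprn_gt0// subr_gt0.
  apply: (@lt_le_trans _ _ (rint (fun=> (b - y0) / D) x0 x1)).
    by rewrite rint_cst ?(ltW hx)// !mulr_gt0 ?invr_gt0 ?subr_gt0.
  apply: rint_le => //; first exact: icont_cst.
  move=> x hx'; rewrite imV -mulNr opprB ler_pM2l ?subr_gt0//.
  rewrite lef_pV2 ?posrE//; last by rewrite ltr_wpDl ?sqr_ge0// sqrrB; nra.
  rewrite /D -sqrrN opprB; rewrite lerD//; last by rewrite -sqrrN opprB.
  have : -(x1 - x0) <= x - a <= x1 - x0 by lra.
  by nra.
have p2 : 0 <= - rint (fun x => complex.Im ((Complex x y1 - Complex a b : C)^-1)) x0 x1.
  rewrite -mulN1r -rintZ//; rewrite -[leLHS](@mul0r _ (x1 - x0)) -rint_cst ?(ltW hx)//.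
  apply: rint_le; [exact: icont_cst|exact: icontZ|move=> x hx'].
  rewrite imV mulN1r opprK; apply: divr_ge0; first by rewrite subr_ge0 ltW.
  by rewrite addr_ge0 ?sqr_ge0.
have p3 : 0 <= - rint (fun y => complex.Re ((Complex x0 y - Complex a b : C)^-1)) y0 y1.
  rewrite -mulN1r -rintZ//; rewrite -[leLHS](@mul0r _ (y1 - y0)) -rint_cst ?(ltW hy)//.
  apply: rint_le; [exact: icont_cst|exact: icontZ|move=> x hx'].
  rewrite reV mulN1r -mulNr opprB; apply: divr_ge0; first by rewrite subr_ge0 ltW.
  by rewrite addr_ge0 ?sqr_ge0.
have p4 : 0 <= rint (fun y => complex.Re ((Complex x1 y - Complex a b : C)^-1)) y0 y1.
  rewrite -[leLHS](@mul0r _ (y1 - y0)) -rint_cst ?(ltW hy)//.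
  apply: rint_le => //; [exact: icont_cst|move=> x hx'].
  rewrite reV; apply: divr_ge0; first by rewrite subr_ge0 ltW.
  by rewrite addr_ge0 ?sqr_ge0.
move: p1 p2 p3 p4 => /=; lra.
Qed.

Lemma bdry_bounded f x0 x1 y0 y1 : x0 <= x1 -> y0 <= y1 -> bcont f x0 x1 y0 y1 ->
  exists2 M : R, 0 < M & on_bdry x0 x1 y0 y1 (fun w => md (f w) <= M).
Proof.
move=> hx hy [h1 h2 h3 h4].
have key (g : R -> C) a b : a <= b -> scont g a b ->
    exists M, forall x, a <= x <= b -> md (g x) <= M.
  move=> ab [g1 g2].
  have N1 : icont (fun x => `|complex.Re (g x)|) a b.
    by move=> x; apply: cvg_norm; exact: g1.
  have N2 : icont (fun x => `|complex.Im (g x)|) a b.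
    by move=> x; apply: cvg_norm; exact: g2.
  have [c _ Hc] := EVT_max ab (icontD N1 N2).
  exists (`|complex.Re (g c)| + `|complex.Im (g c)|) => x xab.
  by apply: (le_trans (md_ReIm _)); apply: Hc; rewrite in_itv.
have [M1 H1] := key _ _ _ hx (scontH h1).
have [M2 H2] := key _ _ _ hx (scontH h2).
have [M3 H3] := key _ _ _ hy (scontV h3).
have [M4 H4] := key _ _ _ hy (scontV h4).
exists (1 + `|M1| + `|M2| + `|M3| + `|M4|); first by rewrite -!addrA ltr_wpDr// !addr_ge0.
have [[n1 n2] [n3 n4]] := ((normr_ge0 M1, normr_ge0 M2), (normr_ge0 M3, normr_ge0 M4)).
have [[m1 m2] [m3 m4]] := ((ler_norm M1, ler_norm M2), (ler_norm M3, ler_norm M4)).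
split=> u hu; split.
- by have := H1 u hu; lra.
- by have := H2 u hu; lra.
- by have := H3 u hu; lra.
- by have := H4 u hu; lra.
Qed.

(** Differentiation under the integral sign: a quadratic remainder that is uniform on the boundary
    integrates to a quadratic remainder. *)
Lemma gam_cdiff (k k' : C -> C -> C) x0 x1 y0 y1 (z : C) (A d : R) :
  x0 <= x1 -> y0 <= y1 -> 0 < d -> 0 <= A ->
  (forall u, md (u - z) < d -> bcont (k u) x0 x1 y0 y1) ->
  bcont (k' z) x0 x1 y0 y1 ->
  on_bdry x0 x1 y0 y1 (fun w => forall u, md (u - z) < d ->
    md (k u w - k z w - (u - z) * k' z w) <= A * md (u - z) ^+ 2) ->
  cdiff (fun u => gam (k u) x0 x1 y0 y1) z (gam (k' z) x0 x1 y0 y1).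
Proof.
move=> hx hy d0 A0 ck ck' H e e0.
pose D := (x1 - x0) + (y1 - y0); have D0 : 0 <= D by rewrite /D addr_ge0// subr_ge0.
pose B := 4 * A * D; have B0 : 0 <= B by rewrite !mulr_ge0.
exists (Num.min d (e / (B + 1))); first by rewrite lt_min d0 divr_gt0// ltr_wpDl.
move=> u; rewrite lt_min => /andP[ud ue].
have zd : md (z - z) < d by rewrite subrr md0.
have bk := ck u ud; have bz := ck z zd.
have cc (c : C) : bcont (fun=> c) x0 x1 y0 y1.
  by apply: rcont_bcont => // ? ? _ _; exact: ccont_cst.
have cm (c : C) g : bcont g x0 x1 y0 y1 -> bcont (fun w => c * g w) x0 x1 y0 y1.
  by move=> [h1 h2 h3 h4]; split=> v hv; apply: ccontM; [exact: ccont_cst|exact: h1|exact: ccont_cst|exact: h2|exact: ccont_cst|exact: h3|exact: ccont_cst|exact: h4].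
have ca g h : bcont g x0 x1 y0 y1 -> bcont h x0 x1 y0 y1 -> bcont (fun w => g w + h w) x0 x1 y0 y1.
  by move=> [h1 h2 h3 h4] [i1 i2 i3 i4]; split=> v hv; apply: ccontD; [exact: h1|exact: i1|exact: h2|exact: i2|exact: h3|exact: i3|exact: h4|exact: i4].
have E : gam (k u) x0 x1 y0 y1 - gam (k z) x0 x1 y0 y1 - gam (k' z) x0 x1 y0 y1 * (u - z) =
   gam (fun w => (k u w + (-1) * k z w) + (- (u - z)) * k' z w) x0 x1 y0 y1.
  rewrite gamD ?gamD ?gamZ//; [by ring|exact: cm|exact/ca/cm|exact: cm].
rewrite E; apply: (@le_trans _ _ (4 * (A * md (u - z) ^+ 2) * D)).
  apply: gam_bound => //; first by apply: (ca); [apply: ca => //; exact: cm|exact: cm].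
  apply: (on_bdryI _ H H) => w /(_ u ud) h _.
  by rewrite mulN1r mulNr.
rewrite (_ : 4 * _ * D = B * md (u - z) * md (u - z)); last by rewrite /B expr2; ring.
rewrite ler_wpM2r ?md_ge0//.
have : (B + 1) * md (u - z) <= e by rewrite mulrC -ler_pdivlMr ?ltr_wpDl// ltW.
have := md_ge0 (u - z); lra.
Qed.

(** Two derivatives of the Cauchy integral: the first gives a formula for [derive1 f], the second
    shows that this formula is differentiable. *)
Lemma cauchy_kernel_cdiff h x0 x1 y0 y1 (z : C) : inrect x0 x1 y0 y1 z ->
  bcont h x0 x1 y0 y1 ->
  cdiff (fun u => gam (fun w => h w * (w - u)^-1) x0 x1 y0 y1) z
        (gam (fun w => h w * (w - z)^-1 ^+ 2) x0 x1 y0 y1) /\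
  cdiff (fun u => gam (fun w => h w * (w - u)^-1 ^+ 2) x0 x1 y0 y1) z
        (gam (fun w => h w * (2 * (w - z)^-1 ^+ 3)) x0 x1 y0 y1).
Proof.
move=> hz bh; have [/andP[hx0 hx1] /andP[hy0 hy1]] := hz.
have hx := ltW (lt_trans hx0 hx1); have hy := ltW (lt_trans hy0 hy1).
have [d d0 Hd] := inrect_bdry hz.
have [M M0 HM] := bdry_bounded hx hy bh.
have d20 : 0 < d / 2 by rewrite divr_gt0.
have far u w : md (u - z) < d / 2 -> d <= md (w - z) -> d / 2 <= md (w - u).
  move=> h1 h2; have := md_triangle (w - u) (u - z).
  by rewrite addrA subrK; lra.
have bku n u : md (u - z) < d / 2 -> bcont (fun w => h w * (w - u)^-1 ^+ n) x0 x1 y0 y1.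
  move=> ud; apply/on_bdry_cont; have /on_bdry_cont bh' := bh.
  apply: (on_bdryI _ Hd bh') => w hw ch; apply: ccontM => //.
  have wu : w != u.
    by apply: contraTneq (far u w ud hw) => ->; rewrite subrr md0 -ltNge.
  elim: n => [|n IH].
    by under [X in ccont X]eq_fun do rewrite expr0; exact: ccont_cst.
  under [X in ccont X]eq_fun do rewrite exprS.
  by apply: ccontM => //; exact: ccont_kernel.
have zz : md (z - z) < d / 2 by rewrite subrr md0.
(* with [a = (w - z)^-1] and [b = (w - u)^-1] one has [b - a = (u - z) a b] *)
have alg w u : md (u - z) < d / 2 -> d <= md (w - z) ->
    let a := (w - z)^-1 in let b := (w - u)^-1 in
    [/\ b - a - (u - z) * a ^+ 2 = (u - z) ^+ 2 * (a ^+ 2 * b),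
        b ^+ 2 - a ^+ 2 - (u - z) * (2 * a ^+ 3) = (u - z) ^+ 2 * (a ^+ 2 * b * (b + 2 * a)),
        md a <= d^-1 & md b <= 2 / d].
  move=> ud wd a b.
  have w1 : w - z != 0 by rewrite -md_eq0 gt_eqF// (lt_le_trans d0).
  have w2 : w - u != 0 by rewrite -md_eq0 gt_eqF// (lt_le_trans d20)// far.
  split.
  - by rewrite /a /b; field; rewrite w1 w2.
  - by rewrite /a /b; field; rewrite w1 w2.
  - by rewrite /a mdV lef_pV2 ?posrE// md_gt0.
  - by rewrite /b mdV -[2 / d]invf_div lef_pV2 ?posrE ?md_gt0//; exact: far.
split.
- apply: (@gam_cdiff (fun u w => h w * (w - u)^-1) (fun z w => h w * (w - z)^-1 ^+ 2) _ _ _ _ _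
    (M * (d^-1 ^+ 2 * (2 / d))) (d / 2)) => //.
  + by rewrite !mulr_ge0 ?exprn_ge0 ?invr_ge0// ltW.
  + by move=> u /(bku 1%N); under [X in bcont X]eq_fun do rewrite expr1.
  + exact: bku.
  apply: (on_bdryI _ Hd HM) => w wd hM u ud.
  have [e1 _ ha hb] := alg w u ud wd.
  rewrite (_ : _ - _ - _ = h w * ((w - u)^-1 - (w - z)^-1 - (u - z) * (w - z)^-1 ^+ 2)); last by ring.
  rewrite e1 !(mdX, mdM) mulrCA [leRHS]mulrC ler_wpM2l ?exprn_ge0 ?md_ge0//.
  by rewrite !ler_pM ?mulr_ge0 ?exprn_ge0 ?md_ge0// lerXn2r ?nnegrE ?md_ge0 ?invr_ge0 ?ltW.
- apply: (@gam_cdiff (fun u w => h w * (w - u)^-1 ^+ 2) (fun z w => h w * (2 * (w - z)^-1 ^+ 3)) _ _ _ _ _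
    (M * (d^-1 ^+ 2 * (2 / d) * (2 / d + 2 * d^-1))) (d / 2)) => //.
  + by rewrite !mulr_ge0 ?exprn_ge0 ?addr_ge0 ?mulr_ge0 ?invr_ge0// ltW.
  + by move=> u /(bku 2%N).
  + apply/on_bdry_cont; have /on_bdry_cont b3 := bku 3%N z zz.
    apply: (on_bdryI _ b3 b3) => w c3 _.
    under [X in ccont X]eq_fun do rewrite mulrCA.
    by apply: ccontM => //; exact: ccont_cst.
  apply: (on_bdryI _ Hd HM) => w wd hM u ud.
  have [_ e1 ha hb] := alg w u ud wd.
  rewrite (_ : _ - _ - _ = h w * ((w - u)^-1 ^+ 2 - (w - z)^-1 ^+ 2 - (u - z) * (2 * (w - z)^-1 ^+ 3))); last by ring.
  rewrite e1 !(mdX, mdM) mulrCA [leRHS]mulrC ler_wpM2l ?exprn_ge0 ?md_ge0//.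
  rewrite !ler_pM ?mulr_ge0 ?exprn_ge0 ?md_ge0//.
  apply: (le_trans (md_triangle _ _)); rewrite mdM lerD// ler_pM ?md_ge0//.
  by rewrite -[2]/(1 + 1 : C); apply: (le_trans (md_triangle _ _)); rewrite md1.
Qed.

(** On a small square [f] is the quotient of its Cauchy integral by that of the constant 1, and both
    can be differentiated twice. *)
Lemma holomorphic_derive f (U : set C) : open U -> holomorphic_on U f ->
  holomorphic_on U (derive1 f).
Proof.
move=> oU hU t Ut.
have [r r0 Hr] : exists2 r : R, 0 < r & forall z, md (z - t) < r -> U z.
  by apply/(@nbhs_md _ t); exact: open_nbhs_nbhs.
(* The closed square of half-side [r / 4] lies in the disc of radius [r], as [|x| + |y| <= r / 2] on
   it. *)
pose s := r / 4; have s0 : 0 < s by rewrite divr_gt0.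
pose a := complex.Re t; pose b := complex.Im t.
pose x0 := a - s; pose x1 := a + s; pose y0 := b - s; pose y1 := b + s.
have hx : x0 <= x1 by rewrite /x0 /x1; lra.
have hy : y0 <= y1 by rewrite /y0 /y1; lra.
have H x y : x0 <= x <= x1 -> y0 <= y <= y1 -> exists l, cdiff f (Complex x y) l.
  move=> hx' hy'; apply/derivable_cdiff; apply: hU; apply: Hr.
  apply: (le_lt_trans (md_ReIm _)); rewrite cReD cReN cImD cImN /=.
  have : `|x - complex.Re t| <= s by rewrite ler_norml; move: hx'; rewrite /x0 /x1 /a; lra.
  have : `|y - complex.Im t| <= s by rewrite ler_norml; move: hy'; rewrite /y0 /y1 /b; lra.
  rewrite /s; lra.
have bf : bcont f x0 x1 y0 y1.
  by apply: rcont_bcont => // x y hx' hy'; have [l] := H x y hx' hy'; exact: cdiff_ccont.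
have b1 : bcont (fun=> 1 : C) x0 x1 y0 y1.
  by apply: rcont_bcont => // x y _ _; exact: ccont_cst.
pose K1 h z := gam (fun w => h w * (w - z)^-1) x0 x1 y0 y1.
pose K2 h z := gam (fun w => h w * (w - z)^-1 ^+ 2) x0 x1 y0 y1.
have ins z : md (z - t) < s -> inrect x0 x1 y0 y1 z.
  move=> zs; have := le_lt_trans (md_Re _) zs; have := le_lt_trans (md_Im _) zs.
  rewrite cReD cReN cImD cImN !ltr_norml /inrect /x0 /x1 /y0 /y1 /a /b; lra.
have I0 z : md (z - t) < s -> K1 (fun=> 1) z != 0.
  move=> /ins hz; rewrite /K1; under [X in gam X]eq_fun do rewrite mul1r.
  exact: winding_neq0.
have fE z : md (z - t) < s -> K1 f z * (K1 (fun=> 1) z)^-1 = f z.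
  move=> zs; rewrite {1}/K1 (cauchy_formula (ins z zs) H).
  have := I0 z zs; rewrite /K1; under [X in gam X]eq_fun do rewrite mul1r.
  by move=> i0; rewrite mulfK.
pose F z := K2 f z * (K1 (fun=> 1) z)^-1 +
            K1 f z * (- K2 (fun=> 1) z * ((K1 (fun=> 1) z)^-1 * (K1 (fun=> 1) z)^-1)).
have dF z : md (z - t) < s -> derive1 f z = F z.
  move=> zs; apply: derive1_cdiff.
  have [c1 _] := cauchy_kernel_cdiff (ins z zs) bf.
  have [c2 _] := cauchy_kernel_cdiff (ins z zs) b1.
  have := @cdiffM _ (K1 f) (fun z => (K1 (fun=> 1) z)^-1) z _ _ c1 (@cdiffV (K1 (fun=> 1)) z _ (I0 z zs) c2).
  rewrite -exprVn expr2 -/(K1 f z) -/(K2 f z) -/(K2 _ z) -/(F z).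
  apply: (@cdiff_near _ _ _ _ _ (s - md (z - t))); first by rewrite subr_gt0.
  move=> u us; apply: fE; have := md_triangle (u - z) (z - t); rewrite addrA subrK; lra.
have t0 : md (t - t) < s by rewrite subrr md0.
have [c1 c2] := cauchy_kernel_cdiff (ins t t0) bf.
have [c3 c4] := cauchy_kernel_cdiff (ins t t0) b1.
have ci := @cdiffV (K1 (fun=> 1)) t _ (I0 t t0) c3.
apply/derivable_cdiff.
suff [l Hl] : exists l, cdiff F t l.
  by exists l; apply: (@cdiff_near _ F _ _ _ s) => // z zs; rewrite dF.
have q1 := @cdiffM _ (K2 f) (fun z => (K1 (fun=> 1) z)^-1) t _ _ c2 ci.
have q2 := @cdiffM _ (fun z => (K1 (fun=> 1) z)^-1) (fun z => (K1 (fun=> 1) z)^-1) t _ _ ci ci.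
have q3 := @cdiffM _ (fun=> -1) (K2 (fun=> 1)) t _ _ (cdiff_cst (-1) t) c4.
have q4 := @cdiffM _ (fun z => -1 * K2 (fun=> 1) z) _ t _ _ q3 q2.
have q5 := @cdiffM _ (K1 f) _ t _ _ c1 q4.
have q6 := @cdiffD _ _ _ t _ _ q1 q5.
eexists; apply: (@cdiff_near _ _ F t _ s s0 _ q6) => z _.
by rewrite /F mulN1r.
Qed.
End CauchyFormula.

(** * Formal Laurent series *)

Section FiniteSums.
Implicit Types (I J : choiceType).

(** Such a sum takes the value 0 when the support is infinite; algebraic rules therefore carry a
    hypothesis [fsupp]. *)
Definition fsum I (M : nmodType) (F : I -> M) : M := \sum_(i \in [set: I]) F i.

Definition fsupp I (M : nmodType) (F : I -> M) := exists r : seq I, forall i, F i <> 0 -> i \in r.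

Lemma fsum_seq I (M : nmodType) (r : seq I) (F : I -> M) : uniq r ->
  (forall i, F i <> 0 -> i \in r) -> fsum F = \sum_(i <- r) F i.
Proof.
move=> ur H; rewrite /fsum (_ : [set: I] = [set` (predT : {pred I})]); last by apply/seteqP; split.
rewrite -(bigfs _ ur) // => i _ /negP; apply: contra_notP => h; exact: H.
Qed.

Lemma fsuppP I (M : nmodType) (F : I -> M) : fsupp F ->
  exists r : seq I, uniq r /\ forall i, F i <> 0 -> i \in r.
Proof. by move=> [r Hr]; exists (undup r); rewrite undup_uniq; split=> // i /Hr; rewrite mem_undup. Qed.

Lemma fsupp_sub I (M N : nmodType) (F : I -> M) (G : I -> N) :
  (forall i, F i = 0 -> G i = 0) -> fsupp F -> fsupp G.
Proof. by move=> H [r Hr]; exists r => i Gi; apply: Hr => /H. Qed.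

Lemma fsum_ext I (M : nmodType) (F G : I -> M) : (forall i, F i = G i) -> fsum F = fsum G.
Proof. by move=> h; congr fsum; apply/funext. Qed.

Lemma fsum0 I (M : nmodType) (F : I -> M) : (forall i, F i = 0) -> fsum F = 0.
Proof. by move=> h; rewrite (@fsum_seq _ _ [::]) ?big_nil// => i; rewrite h. Qed.

Lemma fsumD I (M : nmodType) (F G : I -> M) : fsupp F -> fsupp G ->
  fsum (fun i => F i + G i) = fsum F + fsum G.
Proof.
move=> [r Hr] [s Hs]; have u := undup_uniq (r ++ s).
have hF i : F i <> 0 -> i \in undup (r ++ s) by move=> /Hr; rewrite mem_undup mem_cat => ->.
have hG i : G i <> 0 -> i \in undup (r ++ s) by move=> /Hs; rewrite mem_undup mem_cat => ->; rewrite orbT.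
rewrite (fsum_seq u hF) (fsum_seq u hG) (@fsum_seq _ _ _ _ u) ?big_split// => i h.
apply: contra_notT h => /negP h.
have -> : F i = 0 by apply: contra_notP h => /hF.
have -> : G i = 0 by apply: contra_notP h => /hG.
by rewrite addr0.
Qed.

Lemma fsum_add I (M N : nmodType) (f : M -> N) (F : I -> M) : f 0 = 0 ->
  (forall x y, f (x + y) = f x + f y) -> fsupp F -> f (fsum F) = fsum (fun i => f (F i)).
Proof.
move=> f0 fD /fsuppP[r [u Hr]]; rewrite (fsum_seq u Hr) (@fsum_seq _ _ r)//; last first.
  by move=> i h; apply: Hr => h'; apply: h; rewrite h'.
by elim: r {u Hr} => [|i r IH]; rewrite ?big_nil ?big_cons// fD IH.
Qed.

Lemma fsumM I (K : pzSemiRingType) (c : K) (F : I -> K) : fsupp F -> c * fsum F = fsum (fun i => c * F i).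
Proof. by apply: (@fsum_add _ _ _ ( *%R c)); [exact: mulr0|move=> x y; exact: mulrDr]. Qed.
Lemma fsumMr I (K : pzSemiRingType) (c : K) (F : I -> K) : fsupp F -> fsum F * c = fsum (fun i => F i * c).
Proof. by apply: (@fsum_add _ _ _ ( *%R^~ c)); [exact: mul0r|move=> x y; exact: mulrDl]. Qed.
Lemma fsumZ I (K : pzRingType) (M : lmodType K) (c : K) (F : I -> M) :
  fsupp F -> c *: fsum F = fsum (fun i => c *: F i).
Proof. by apply: (@fsum_add _ _ _ ( *:%R c)); [exact: scaler0|move=> x y; exact: scalerDr]. Qed.
Lemma fsumN I (M : zmodType) (F : I -> M) : fsupp F -> - fsum F = fsum (fun i => - F i).
Proof. by apply: (@fsum_add _ _ _ (-%R)); [exact: oppr0|move=> x y; exact: opprD]. Qed.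

Lemma fsum_exchange I J (M : nmodType) (F : I -> J -> M) :
  (exists (r : seq I) (s : seq J), forall i j, F i j <> 0 -> i \in r /\ j \in s) ->
  fsum (fun i => fsum (fun j => F i j)) = fsum (fun j => fsum (fun i => F i j)).
Proof.
move=> [r [s H]].
have ur := undup_uniq r; have us := undup_uniq s.
have E1 i : fsum (fun j => F i j) = \sum_(j <- undup s) F i j.
  by rewrite (@fsum_seq _ _ (undup s))// => j /H[_]; rewrite mem_undup.
have E2 j : fsum (fun i => F i j) = \sum_(i <- undup r) F i j.
  by rewrite (@fsum_seq _ _ (undup r))// => i /H[]; rewrite mem_undup.
rewrite (fsum_ext E1) (fsum_ext E2).
rewrite (@fsum_seq _ _ (undup r))//; last first.
  move=> i h; apply: contra_notT h => hi; apply: big1 => j _.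
  by apply: contrapT => /H[]; rewrite -mem_undup (negbTE hi).
rewrite (@fsum_seq _ _ (undup s))//; last first.
  move=> j h; apply: contra_notT h => hj; apply: big1 => i _.
  by apply: contrapT => /H[_]; rewrite -mem_undup (negbTE hj).
exact: exchange_big.
Qed.

Lemma fsum_reindex I J (M : nmodType) (h : I -> J) (F : J -> M) : bijective h ->
  fsum F = fsum (fun i => F (h i)).
Proof. exact: reindex_fsbigT. Qed.

Lemma fsum_delta I (M : nmodType) (F : I -> M) i0 : (forall i, i != i0 -> F i = 0) -> fsum F = F i0.
Proof.
move=> H; rewrite (@fsum_seq _ _ [:: i0])//; first by rewrite big_seq1.
by move=> i; rewrite inE; apply: contra_notT => /H.
Qed.

Lemma int_seq (a b : int) : exists r : seq int, forall i, a <= i -> i <= b -> i \in r.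
Proof.
exists [seq a + k%:Z | k <- iota 0 (`|b - a|%N.+1)] => i ai ib.
by apply/mapP; exists `|i - a|%N; [rewrite mem_iota; lia|lia].
Qed.

Lemma fsupp_int (M : nmodType) (F : int -> M) (a b : int) :
  (forall i, F i <> 0 -> a <= i /\ i <= b) -> fsupp F.
Proof. by move=> H; have [r Hr] := int_seq a b; exists r => i /H[]; exact: Hr. Qed.

Lemma fsum_nat (M : nmodType) (F : nat -> M) (N : nat) :
  (forall i, (N <= i)%N -> F i = 0) -> fsum F = \sum_(i < N) F i.
Proof.
move=> H; rewrite (@fsum_seq _ _ (iota 0 N)) ?iota_uniq//; last first.
  by move=> i; rewrite mem_iota /= add0n ltnNge; apply: contra_notN; exact: H.
by rewrite -(big_mkord xpredT F) /index_iota subn0.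
Qed.
End FiniteSums.

(** * The differential ring of formal Laurent series *)

Section LaurentSeries.
Variable K : numFieldType.

Record laurent := Laurent {
  lcoef :> int -> K;
  lcoef_bound : exists N : int, forall n, n < N -> lcoef n = 0
}.

Lemma laurentP (f g : laurent) : (forall n, f n = g n) -> f = g.
Proof.
case: f g => [f hf] [g hg] /= /funext fg; case: _ / fg in hg *.
by congr Laurent; exact: Prop_irrelevance.
Qed.

HB.instance Definition _ := gen_eqMixin laurent.
HB.instance Definition _ := gen_choiceMixin laurent.

Lemma lzero_bound : exists N : int, forall n, n < N -> (0 : K) = 0.
Proof. by exists 0. Qed.
Definition lzero := @Laurent (fun=> 0) lzero_bound.
Lemma ladd_bound (f g : laurent) : exists N : int, forall n, n < N -> f n + g n = 0.
Proof.
case: (lcoef_bound f) (lcoef_bound g) => [a Ha] [b Hb]; exists (Num.min a b) => n.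
by rewrite lt_min => /andP[/Ha -> /Hb ->]; rewrite addr0.
Qed.
Definition ladd f g := Laurent (ladd_bound f g).
Lemma lopp_bound (f : laurent) : exists N : int, forall n, n < N -> - f n = 0.
Proof. by case: (lcoef_bound f) => [a Ha]; exists a => n /Ha ->; rewrite oppr0. Qed.
Definition lopp f := Laurent (lopp_bound f).

Lemma laddA : associative ladd. Proof. by move=> f g h; apply: laurentP => n /=; rewrite addrA. Qed.
Lemma laddC : commutative ladd. Proof. by move=> f g; apply: laurentP => n /=; rewrite addrC. Qed.
Lemma ladd0 : left_id lzero ladd. Proof. by move=> f; apply: laurentP => n /=; rewrite add0r. Qed.
Lemma laddN : left_inverse lzero lopp ladd.
Proof. by move=> f; apply: laurentP => n /=; rewrite addNr. Qed.
HB.instance Definition _ := GRing.isZmodule.Build laurent laddA laddC ladd0 laddN.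

Lemma conv_supp (f g : laurent) n : fsupp (fun i : int => f i * g (n - i)).
Proof.
case: (lcoef_bound f) (lcoef_bound g) => [a Ha] [b Hb].
apply: (@fsupp_int _ _ a (n - b)) => i h; split.
  by rewrite leNgt; apply/negP => /Ha e; apply: h; rewrite e mul0r.
by rewrite leNgt; apply/negP => e; apply: h; rewrite (Hb (n - i)) ?mulr0//; lia.
Qed.

Lemma lmul_bound (f g : laurent) :
  exists N : int, forall n, n < N -> fsum (fun i : int => f i * g (n - i)) = 0.
Proof.
case: (lcoef_bound f) (lcoef_bound g) => [a Ha] [b Hb].
exists (a + b) => n nab; apply: fsum0 => i; have [/Ha ->|ai] := ltP i a; first by rewrite mul0r.
by rewrite (Hb (n - i)) ?mulr0//; lia.
Qed.
Definition lmul f g := Laurent (lmul_bound f g).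

Lemma lone_bound : exists N : int, forall n, n < N -> ((n == 0)%:R : K) = 0.
Proof. by exists 0 => n n0; rewrite lt_eqF. Qed.
Definition lone := Laurent lone_bound.

Lemma bij_refl (n : int) : bijective (fun i => n - i).
Proof. by exists (fun i => n - i) => i; rewrite subKr. Qed.
Lemma bij_shift (n : int) : bijective (fun i => i - n).
Proof. by exists (fun i => i + n) => i; rewrite ?subrK ?addrK. Qed.

Lemma lmulC : commutative lmul.
Proof.
move=> f g; apply: laurentP => n /=; rewrite (fsum_reindex _ (bij_refl n)).
by apply: fsum_ext => i; rewrite subKr mulrC.
Qed.

Lemma lmulA : associative lmul.
Proof.
move=> f g h; apply: laurentP => n /=.
rewrite (fsum_ext (G := fun i => fsum (fun j => f i * (g (j - i) * h (n - j))))); last first.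
  move=> i; rewrite (fsumM _ (conv_supp g h _)) [LHS](fsum_reindex _ (bij_shift i)).
  by apply: fsum_ext => j; have -> : n - i - (j - i) = n - j by lia.
rewrite fsum_exchange.
  apply: fsum_ext => j; rewrite (fsumMr _ (conv_supp f g j)).
  by apply: fsum_ext => i; rewrite mulrA.
case: (lcoef_bound f) (lcoef_bound g) (lcoef_bound h) => [a Ha] [b Hb] [c Hc].
have [r Hr] := int_seq a (n - b - c); have [s Hs] := int_seq (a + b) (n - c).
exists r, s => i j H.
have h1 : a <= i by rewrite leNgt; apply/negP => /Ha e; apply: H; rewrite e mul0r.
have h2 : b <= j - i by rewrite leNgt; apply/negP => /Hb e; apply: H; rewrite e mul0r mulr0.
have h3 : c <= n - j by rewrite leNgt; apply/negP => /Hc e; apply: H; rewrite e !mulr0.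
by split; [apply: Hr|apply: Hs]; lia.
Qed.

Lemma lmul1 : left_id lone lmul.
Proof.
move=> f; apply: laurentP => n; rewrite [LHS](@fsum_delta _ _ _ 0) /= ?mul1r ?subr0//.
by move=> i i0; rewrite /= (negbTE i0) mul0r.
Qed.

Lemma lmulDl : left_distributive lmul +%R.
Proof.
move=> f g h; apply: laurentP => n /=; rewrite -fsumD; try exact: conv_supp.
by apply: fsum_ext => i; rewrite mulrDl.
Qed.

Lemma lone_neq0 : lone != 0 :> laurent.
Proof. by apply/eqP => /(congr1 (fun f : laurent => f 0)) /= /eqP; rewrite oner_eq0. Qed.

HB.instance Definition _ := GRing.Zmodule_isComNzRing.Build laurent lmulA lmulC lmul1 lmulDl lone_neq0.

(** Units are the series that have an inverse, chosen classically; those that occur later are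
    exhibited one at a time. *)
Definition lunit : pred laurent := fun f => `[< exists g : laurent, g * f = 1 >].
Definition linv (f : laurent) : laurent :=
  if pselect (exists g : laurent, g * f = 1) is left h then projT1 (cid h) else f.
Lemma lmulV : {in lunit, left_inverse 1 linv *%R}.
Proof.
move=> f; rewrite unfold_in /lunit /linv => /asboolP h; case: pselect => // h'.
by case: cid.
Qed.
Lemma lunitP : forall f g : laurent, g * f = 1 -> lunit f.
Proof. by move=> f g h; apply/asboolP; exists g. Qed.
Lemma linv_out : {in [predC lunit], linv =1 id}.
Proof.
move=> f; rewrite inE /= => h; rewrite /linv; case: pselect => // h'.
by exfalso; move/negP: h; apply; apply/asboolP.
Qed.
HB.instance Definition _ := GRing.ComNzRing_hasMulInverse.Build laurent lmulV lunitP linv_out.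

Lemma lcoefD (f g : laurent) n : (f + g) n = f n + g n. Proof. by []. Qed.
Lemma lcoefN (f : laurent) n : (- f) n = - f n. Proof. by []. Qed.
Lemma lcoefB (f g : laurent) n : (f - g) n = f n - g n. Proof. by []. Qed.
Lemma lcoef1 n : (1 : laurent) n = (n == 0)%:R. Proof. by []. Qed.
Lemma lcoefM (f g : laurent) n : (f * g) n = fsum (fun i : int => f i * g (n - i)). Proof. by []. Qed.
Lemma lcoef_sum (I : Type) (s : seq I) (P : pred I) (F : I -> laurent) n :
  (\sum_(i <- s | P i) F i) n = \sum_(i <- s | P i) F i n.
Proof. by elim/big_ind2 : _ => // f a g b <- <-. Qed.

Lemma lmono_bound (c : K) (k : int) : exists N : int, forall n, n < N -> c * (n == k)%:R = 0.
Proof. by exists k => n /lt_eqF ->; rewrite mulr0. Qed.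
Definition lmono c k := Laurent (lmono_bound c k).
Definition lC c := lmono c 0.
Definition lX k := lmono 1 k.

Lemma lmonoM c k (f : laurent) n : (lmono c k * f) n = c * f (n - k).
Proof.
rewrite lcoefM (@fsum_delta _ _ _ k) /= ?eqxx ?mulr1// => i /negbTE ->.
by rewrite mulr0 mul0r.
Qed.
Lemma lcoefC c n : lC c n = c * (n == 0)%:R. Proof. by []. Qed.
Lemma lCM c (f : laurent) n : (lC c * f) n = c * f n. Proof. by rewrite lmonoM subr0. Qed.
Lemma lXM k (f : laurent) n : (lX k * f) n = f (n - k). Proof. by rewrite lmonoM mul1r. Qed.

Lemma lC_is_mult : {morph lC : x y / x * y}.
Proof. by move=> x y; apply: laurentP => n; rewrite lCM /= mulrA. Qed.
Lemma lC0 : lC 0 = 0. Proof. by apply: laurentP => n /=; rewrite mul0r. Qed.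
Lemma lC1 : lC 1 = 1. Proof. by apply: laurentP => n /=; rewrite mul1r. Qed.
Lemma lC_zmod : zmod_morphism lC.
Proof. by move=> x y; apply: laurentP => n /=; rewrite mulrBl. Qed.
Lemma lC_monoid : monoid_morphism lC. Proof. by split; [exact: lC1|exact: lC_is_mult]. Qed.
HB.instance Definition _ := GRing.isZmodMorphism.Build K laurent lC lC_zmod.
HB.instance Definition _ := GRing.isMonoidMorphism.Build K laurent lC lC_monoid.

Lemma lX0 : lX 0 = 1. Proof. exact: lC1. Qed.
Lemma lXD j k : lX (j + k) = lX j * lX k.
Proof. by apply: laurentP => n; rewrite lXM /= !mul1r; congr (nat_of_bool _)%:R; lia. Qed.
Lemma lX_unit k : lX k \is a GRing.unit.
Proof. by apply/unitrPr; exists (lX (- k)); rewrite -lXD subrr lX0. Qed.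

Lemma lD_bound (f : laurent) : exists N : int, forall n, n < N -> (n + 1)%:~R * f (n + 1) = 0.
Proof. by case: (lcoef_bound f) => [a Ha]; exists (a - 1) => n na; rewrite Ha ?mulr0//; lia. Qed.
Definition lD f := Laurent (lD_bound f).
Lemma lcoef_lD f n : lD f n = (n + 1)%:~R * f (n + 1). Proof. by []. Qed.
Lemma lDD f g : lD (f + g) = lD f + lD g.
Proof. by apply: laurentP => n /=; rewrite mulrDr. Qed.
Lemma lD_zmod : zmod_morphism lD.
Proof. by move=> f g; apply: laurentP => n /=; rewrite mulrBr. Qed.
HB.instance Definition _ := GRing.isZmodMorphism.Build laurent laurent lD lD_zmod.
Lemma lDM f g : lD (f * g) = lD f * g + f * lD g.
Proof.
apply: laurentP => n; rewrite lcoefD lcoef_lD !lcoefM (fsumM _ (conv_supp f g _)).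
rewrite [X in _ = X + _](fsum_reindex _ (bij_shift 1)) -fsumD.
- apply: fsum_ext => i /=; rewrite subrK.
  have -> : n - (i - 1) = n + 1 - i by lia.
  have -> : n - i + 1 = n + 1 - i by lia.
  have -> : (n + 1)%:~R = i%:~R + (n + 1 - i)%:~R :> K by rewrite -intrD; congr (_%:~R); lia.
  ring.
- case: (conv_supp (lD f) g n) => r Hr; exists [seq i + 1 | i <- r] => i h.
  by apply/mapP; exists (i - 1); [exact: Hr|rewrite subrK].
- exact: conv_supp.
Qed.
Lemma lD_C c : lD (lC c) = 0.
Proof.
apply: laurentP => n /=; have [->|n0] := eqVneq (n + 1) 0; first by rewrite mul0r.
by rewrite mulr0 mulr0.
Qed.
Lemma lD1 : lD 1 = 0. Proof. by rewrite -lC1 lD_C. Qed.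
Lemma lDZ c f : lD (lC c * f) = lC c * lD f.
Proof. by rewrite lDM lD_C mul0r add0r. Qed.
Lemma lD_X k : lD (lX k) = lC k%:~R * lX (k - 1).
Proof.
apply: laurentP => n; rewrite lCM lcoef_lD /= !mul1r.
have -> : (n + 1 == k) = (n == k - 1) by lia.
by case: eqP => [->|]; rewrite ?subrK// !mulr0.
Qed.
Lemma lD_eq0 f : lD f = 0 -> f = lC (f 0).
Proof.
move=> h; apply: laurentP => n; rewrite lcoefC; have [->|n0] := eqVneq n 0; first by rewrite mulr1.
have := congr1 (fun f : laurent => f (n - 1)) h; rewrite /= subrK => /eqP.
by rewrite mulf_eq0 intr_eq0 (negbTE n0) /= mulr0 => /eqP.
Qed.
Lemma lDXn f n : lD (f ^+ n.+1) = (f ^+ n * lD f) *+ n.+1.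
Proof.
elim: n => [|n IH]; first by rewrite expr0 mul1r.
rewrite exprS lDM IH mulrnAr mulrA -exprS [lD f * _]mulrC -mulrS //.
Qed.
Lemma lDXn_nat f n : lD (f ^+ n.+1) = lC n.+1%:R * (f ^+ n * lD f).
Proof. by rewrite lDXn -mulr_natl rmorph_nat. Qed.

Definition lres (f : laurent) : K := f (-1).
Lemma lres_lD f : lres (lD f) = 0. Proof. by rewrite /lres /= addNr mul0r. Qed.
Lemma lresD f g : lres (f + g) = lres f + lres g. Proof. by []. Qed.
Lemma lresC c f : lres (lC c * f) = c * lres f. Proof. exact: lCM. Qed.

(** The order of [f] at 0 is at least [k]; it need not be equal to [k]. *)
Definition lord (f : laurent) (k : int) := forall n, n < k -> f n = 0.
Lemma lordM f g j k : lord f j -> lord g k -> lord (f * g) (j + k).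
Proof.
move=> hf hg n h; rewrite lcoefM; apply: fsum0 => i.
by have [/hf ->|ij] := ltP i j; [rewrite mul0r|rewrite (hg (n - i)) ?mulr0//; lia].
Qed.
Lemma lordD f g k : lord f k -> lord g k -> lord (f + g) k.
Proof. by move=> hf hg n h; rewrite lcoefD hf// hg// addr0. Qed.
Lemma lordN f k : lord f k -> lord (- f) k.
Proof. by move=> hf n h; rewrite lcoefN hf// oppr0. Qed.
Lemma lord_le f j k : j <= k -> lord f k -> lord f j.
Proof. by move=> jk hf n h; apply: hf; exact: lt_le_trans jk. Qed.
Lemma lordC c : lord (lC c) 0.
Proof. by move=> n n0; rewrite lcoefC lt_eqF// mulr0. Qed.
Lemma lord_mono c k : lord (lmono c k) k.
Proof. by move=> n n0 /=; rewrite lt_eqF// mulr0. Qed.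
Lemma lord_lD f k : lord f k -> lord (lD f) (k - 1).
Proof. by move=> h n hn; rewrite lcoef_lD h ?mulr0//; lia. Qed.
Lemma lord_res f : lord f 0 -> lres f = 0. Proof. by apply. Qed.
End LaurentSeries.

(** * Power series and exponentials as Laurent series *)

Section PowerSeries.
Variable K : numFieldType.
Local Notation L := (laurent K).
Implicit Types f g : nat -> K.

Lemma lfps_bound f : exists N : int, forall n, n < N -> (if n is Posz k then f k else 0) = 0.
Proof. by exists 0 => -[]. Qed.
Definition lfps f : L := Laurent (lfps_bound f).

Lemma lord_lfps f : lord (lfps f) 0. Proof. by case. Qed.

Lemma lfps_mul f g : lfps (fps_mul f g) = lfps f * lfps g.
Proof.
apply: laurentP => n; rewrite lcoefM; case: n => n; last first.
  rewrite fsum0 // => -[i|i] /=; last by rewrite mul0r.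
  by rewrite (_ : Negz n - i%:Z = Negz (n + i)) ?mulr0//; lia.
rewrite (@fsum_seq _ _ [seq k%:Z | k <- iota 0 n.+1]).
- rewrite big_map [LHS]/= /fps_mul -(big_mkord xpredT (fun i => f i * g (n - i)%N)) /index_iota subn0.
  rewrite big_seq [RHS]big_seq; apply: eq_bigr => i; rewrite mem_iota add0n ltnS /= => hi.
  by rewrite subzn.
- by rewrite map_inj_uniq ?iota_uniq// => ? ? [].
- move=> -[i|i] h; last by rewrite /= mul0r in h.
  apply/mapP; exists i => //; rewrite mem_iota add0n leq0n andTb ltnS leqNgt; apply/negP => hi.
  by apply: h; rewrite (_ : n%:Z - i%:Z = Negz (i - n).-1) /= ?mulr0//; lia.
Qed.

Lemma lfps_one : lfps (fps_one K) = 1.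
Proof. by apply: laurentP => -[]. Qed.

Lemma lfps_iter f n : lfps (iter n (fps_mul f) (fps_one K)) = lfps f ^+ n.
Proof. by elim: n => [|n IH]; rewrite ?lfps_one// iterS lfps_mul IH exprS. Qed.

Lemma lordX (F : L) k n : lord F k -> lord (F ^+ n) (k * n%:Z).
Proof.
move=> h; elim: n => [|n IH]; first by rewrite expr0 mulr0 -lC1; exact: lordC.
by rewrite exprS (_ : k * n.+1%:Z = k + k * n%:Z); [exact: lordM|lia].
Qed.

(** Write [f = f_0 (1 - G)] with [G] of order at least 1. Up to degree [n] the series [fps_inv f] is
    [f_0^-1] times the geometric sum of the [G^k], [k <= n], whose product with [1 - G] is
    [1 - G^(n+1)]. *)
Lemma lfps_inv f : f 0%N != 0 -> lfps (fps_inv f) * lfps f = 1.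
Proof.
move=> f0; pose G : L := lfps (fun j => fps_one K j - f j / f 0%N).
have oG : lord G 1.
  move=> [[|n]|n] //= _; by rewrite /fps_one eqxx divff// subrr.
have fG : lfps f = lC (f 0%N) * (1 - G).
  apply: laurentP => n; rewrite lCM lcoefB lcoef1; case: n => n //=; last by rewrite !subr0 mulr0.
  by rewrite /fps_one opprB addrCA subrr addr0 mulrC divfK.
apply: laurentP => -[n|n]; last by rewrite (lordM (lord_lfps _) (lord_lfps _)).
pose S := \sum_(k < n.+1) G ^+ k.
have key : lord (lfps (fps_inv f) - lC (f 0%N)^-1 * S) n.+1%:Z.
  move=> [i|i] hi; rewrite lcoefB lCM; last first.
    by rewrite lcoef_sum big1 ?mulr0 ?subr0//= => k _; apply: (lordX oG); lia.
  apply/eqP; rewrite subr_eq0; apply/eqP; rewrite /= /fps_inv; congr (_ * _).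
  rewrite lcoef_sum (big_ord_widen n.+1 (fun k => iter k (fps_mul (fun j => fps_one K j - f j / f 0%N)) (fps_one K) i)); last lia.
  rewrite [RHS](bigID (fun k : 'I_n.+1 => (k < i.+1)%N)) /= [X in _ = _ + X]big1 ?addr0.
    by apply: eq_bigr => k _; rewrite -lfps_iter.
  by move=> k; rewrite -leqNgt => hk; apply: (lordX oG); lia.
have := lordM key (lord_lfps f) => /(_ n%:Z); rewrite addr0 => /(_ (ltac:(lia))).
rewrite mulrBl lcoefB => /eqP; rewrite subr_eq0 => /eqP ->.
rewrite fG mulrACA -rmorphM mulVf// rmorph1 mul1r.
have -> : S * (1 - G) = 1 - G ^+ n.+1.
  by rewrite mulrC -[1 in RHS](expr1n _ n.+1) subrXX; congr (_ * _); apply: eq_bigr => k _; rewrite expr1n mul1r.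
by rewrite lcoefB (lordX oG) ?subr0//; lia.
Qed.

Lemma lfps_unit f : f 0%N != 0 -> lfps f \is a GRing.unit.
Proof. by move=> /lfps_inv h; apply/unitrPr; exists (lfps (fps_inv f)); rewrite mulrC. Qed.

Lemma lfps_invE f : f 0%N != 0 -> lfps (fps_inv f) = (lfps f)^-1.
Proof.
by move=> f0; apply: (mulIr (lfps_unit f0)); rewrite lfps_inv// mulVr// lfps_unit.
Qed.

Lemma lfps_expz f p : f 0%N != 0 -> lfps (fps_expz f p) = lfps f ^ p.
Proof.
move=> f0; case: p => n; rewrite /fps_expz; first by rewrite lfps_iter.
by rewrite lfps_iter lfps_invE// exprVn.
Qed.

Definition lexp a : L := lfps (fps_expc a).

Lemma lexpD a b : lexp (a + b) = lexp a * lexp b.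
Proof.
rewrite /lexp -lfps_mul; congr lfps; apply/funext => n; rewrite /fps_mul /fps_expc.
rewrite addrC exprDn mulr_suml; apply: eq_bigr => i _.
rewrite -mulr_natr -(@bin_fact n i); last by rewrite -ltnS.
rewrite !natrM; field.
by rewrite !pnatr_eq0 -!lt0n !fact_gt0 bin_gt0 -ltnS ltn_ord.
Qed.

Lemma lexp0 : lexp 0 = 1.
Proof.
rewrite /lexp -lfps_one; congr lfps; apply/funext => -[|n]; rewrite /fps_expc /fps_one /=.
  by rewrite expr0 divr1.
by rewrite expr0n mul0r.
Qed.

Lemma lexp_unit a : lexp a \is a GRing.unit.
Proof. by apply/unitrPr; exists (lexp (- a)); rewrite -lexpD subrr lexp0. Qed.

Lemma lD_lexp a : lD (lexp a) = lC a * lexp a.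
Proof.
apply: laurentP => n; rewrite lCM lcoef_lD; case: n => [n|[|n]] //=; last 2 first.
  by rewrite mul0r mulr0.
  by rewrite !mulr0.
rewrite -PoszD addn1 /= /fps_expc exprS factS natrM; field.
by rewrite pnatr_eq0 -lt0n fact_gt0 nat1r pnatr_eq0.
Qed.

Lemma lexpMn a n : lexp (a * n%:R) = lexp a ^+ n.
Proof.
elim: n => [|n IH]; first by rewrite mulr0 lexp0.
by rewrite -natr1 mulrDr mulr1 lexpD IH exprSr.
Qed.

Lemma lDXz (F : L) p : F \is a GRing.unit -> lD (F ^ p) = lC p%:~R * F ^ (p - 1) * lD F.
Proof.
move=> uF.
(* Multiplied by [F], the formula has the single exponent [p] and admits induction in both
   directions. *)
suff H : lD (F ^ p) * F = lC p%:~R * F ^ p * lD F.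
  have e : F ^ p = F ^ (p - 1) * F.
    by rewrite -[X in _ = _ * X]expr1z -exprzDr// subrK.
  by apply: (mulIr uF); rewrite H {1}e; ring.
elim/int_ind: p => [|n IH|n IH].
- by rewrite expr0z lD1 mul0r mulr0z lC0 !mul0r.
- rewrite exprSz; rewrite (_ : n.+1%:~R = 1 + n%:~R :> K); last by rewrite -[1]/(1%:~R) -intrD; congr (_%:~R); lia.
  rewrite rmorphD rmorph1 lDM mulrDl [F * lD _]mulrC IH; ring.
- have e : F ^ (- n%:Z) = F * F ^ (- n.+1%:Z).
    by rewrite -[X in X * _]expr1z -exprzDr//; congr (_ ^ _); lia.
  move: IH; rewrite e lDM.
  rewrite (_ : (- n.+1%:Z)%:~R = (- n%:Z)%:~R - 1 :> K); last first.
    by rewrite -[1]/(1%:~R) -intrB; congr (_%:~R); lia.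
  rewrite rmorphB rmorph1 => IH; apply: (mulIr uF).
  have -> : lD (F ^ (- n.+1%:Z)) * F * F = (lD F * F ^ (- n.+1%:Z) + F * lD (F ^ (- n.+1%:Z))) * F - lD F * F ^ (- n.+1%:Z) * F by ring.
  by rewrite IH; ring.
Qed.
End PowerSeries.

(** * The coordinate [exp(2 pi i z) - 1] *)

Section Coordinate.
Variable R : realType.
Local Notation C := (cplx R).
Local Notation L := (laurent C).
Local Notation tau := (two_pi_i R).

Lemma two_pi_i_neq0 : tau != 0 :> C.
Proof. by rewrite /two_pi_i eq_complex /= negb_and mulf_neq0 ?orbT// gt_eqF// pi_gt0. Qed.
Hint Resolve two_pi_i_neq0 : core.

Lemma fact_neq0 n : (n`!)%:R != 0 :> C.
Proof. by rewrite pnatr_eq0 -lt0n fact_gt0. Qed.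

(** [cw] is [w = exp(2 pi i z)] and [cx] is [x = w - 1], factored as [z] times the invertible power
    series [cc] so that its integer powers make sense. *)
Definition cw : L := lexp tau.
Definition cc : L := lfps (fps_coord R).
Definition cx : L := lX C 1 * cc.

Lemma fps_coord0 : fps_coord R 0 = tau. Proof. by rewrite /fps_coord expr1 divr1. Qed.
Lemma fps_coord0_neq0 : fps_coord R 0 != 0. Proof. by rewrite fps_coord0. Qed.
Hint Resolve fps_coord0_neq0 : core.

Lemma cxE : cx = cw - 1.
Proof.
apply: laurentP => n; rewrite lXM lcoefB lcoef1; case: n => [[|n]|n] /=.
- by rewrite /fps_expc expr0 divr1 subrr.
- by rewrite subn1 subr0.
- by rewrite subr0.
Qed.

Lemma cc_unit : cc \is a GRing.unit. Proof. exact: lfps_unit. Qed.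
Lemma cx_unit : cx \is a GRing.unit. Proof. by rewrite unitrM lX_unit cc_unit. Qed.
Lemma cw_unit : cw \is a GRing.unit. Proof. exact: lexp_unit. Qed.
Hint Resolve cc_unit cx_unit cw_unit : core.

Lemma lDcx : lD cx = lC tau * cw.
Proof. by rewrite cxE raddfB /= lD1 subr0 lD_lexp. Qed.

Lemma lC_unit (c : C) : c != 0 -> lC c \is a GRing.unit.
Proof. by move=> c0; apply/unitrPr; exists (lC c^-1); rewrite -rmorphM divff// rmorph1. Qed.

Lemma lDcx_unit : lD cx \is a GRing.unit.
Proof. by rewrite lDcx unitrM cw_unit andbT; apply: lC_unit. Qed.
Hint Resolve lDcx_unit : core.

Lemma ccz p : cc ^ p = lfps (fps_expz (fps_coord R) p). Proof. by rewrite lfps_expz. Qed.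
Lemma lXz p : lX C 1 ^ p = lX C p.
Proof.
elim/int_ind: p => [|n IH|n IH]; first by rewrite expr0z lX0.
  by rewrite exprSz IH -lXD; congr lX; lia.
apply: (mulrI (lX_unit C 1)); rewrite -lXD -[X in X * _]expr1z -exprzDr ?lX_unit//.
by rewrite (_ : 1 - n.+1%:Z = - n%:Z) ?IH; [congr lX; lia|lia].
Qed.
Lemma cxz p : cx ^ p = lX C p * lfps (fps_expz (fps_coord R) p).
Proof. by rewrite -ccz -lXz /cx exprMz_comm ?lX_unit//; exact: mulrC. Qed.

Lemma lord_cxz p : lord (cx ^ p) p.
Proof. by move=> n np; rewrite cxz lXM lord_lfps//; lia. Qed.

Lemma lcoef0M (f g : L) : lord f 0 -> lord g 0 -> (f * g) 0 = f 0 * g 0.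
Proof.
move=> hf hg; rewrite lcoefM (@fsum_delta _ _ _ 0) ?subr0// => i i0.
have [/hf ->|ip] := ltP i 0; first by rewrite mul0r.
by rewrite (hg (0 - i)) ?mulr0//; lia.
Qed.

Lemma cxz_lead p : (cx ^ p) p != 0.
Proof.
have E q : (cx ^ q) q = lfps (fps_expz (fps_coord R) q) 0 by rewrite cxz lXM subrr.
apply/eqP => h; have : (cc ^ p * cc ^ (- p)) 0 = 1.
  by rewrite -exprzDr// subrr expr0z.
rewrite !ccz lcoef0M; try exact: lord_lfps.
by rewrite -E h mul0r => /esym/eqP; rewrite oner_eq0.
Qed.

Lemma lDcx0 : lD cx 0 = tau.
Proof. by rewrite lDcx lCM /= /fps_expc expr0 divr1 mulr1. Qed.
Lemma lord_lDcx : lord (lD cx) 0.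
Proof. by rewrite lDcx -[0]addr0; apply: lordM; [exact: lordC|exact: lord_lfps]. Qed.
Lemma lord_lDcxV : lord (lD cx)^-1 0.
Proof.
have -> : (lD cx)^-1 = lC tau^-1 * lexp (- tau).
  apply: (mulIr lDcx_unit); rewrite mulVr// lDcx mulrACA -rmorphM mulVf// rmorph1 mul1r.
  by rewrite -lexpD addNr lexp0.
by rewrite -[0]addr0; apply: lordM; [exact: lordC|exact: lord_lfps].
Qed.

(** The residue does not depend on the coordinate: for [p != -1] the series is a multiple of a
    derivative, and for [p = -1] it is the logarithmic derivative of [z * cc], that is [1/z] plus a
    power series. *)
Lemma res_cxz p : lres (cx ^ p * lD cx) = (p == -1)%:R.
Proof.
have [->|p1] := eqVneq p (-1).
  rewrite /cx lDM lD_X mulr1z subrr lX0 lC1 !mul1r.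
  have -> : (lX C 1 * cc) ^ (-1) = lX C (-1) * cc^-1.
    by rewrite exprMz_comm ?lX_unit ?lXz//; exact: mulrC.
  rewrite mulrDr -mulrA mulVr// mulr1 lresD.
  have -> : lX C (-1) * cc^-1 * (lX C 1 * lD cc) = cc^-1 * lD cc.
    by rewrite mulrACA -lXD subrr? lX0 ?mul1r.
  rewrite [X in _ + X]lord_res ?addr0; first by rewrite /lres /= mulr1.
  rewrite -lfps_invE// -[0]addr0; apply: lordM; first exact: lord_lfps.
  move=> n n0; rewrite lcoef_lD; have [->|n1] := eqVneq n (-1); first by rewrite addNr mul0r.
  by rewrite lord_lfps ?mulr0//; lia.
have p10 : (p + 1)%:~R != 0 :> C by rewrite intr_eq0; apply: contra p1 => /eqP ?; apply/eqP; lia.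
apply: (mulfI p10); rewrite mulr0 -lresC mulrA.
by rewrite -{2}(addrK 1 p) -lDXz// lres_lD.
Qed.

(** As [H dz = (H / x') dx], this is the coefficient of [x^m] in the expansion of [H / x'] in powers
    of [x]. *)
Definition rc (H : L) (m : int) : C := lres (H * cx ^ (- m - 1)).

Lemma rcD H K m : rc (H + K) m = rc H m + rc K m. Proof. by rewrite /rc mulrDl. Qed.
Lemma rcC c H m : rc (lC c * H) m = c * rc H m. Proof. by rewrite /rc -mulrA lresC. Qed.
Lemma rc_ord H a m : lord H a -> m < a -> rc H m = 0.
Proof. by move=> h ma; rewrite /rc /lres (lordM h (lord_cxz (p := - m - 1)))//; lia. Qed.
Lemma rc_cx p m : rc (lD cx * cx ^ p) m = (m == p)%:R.
Proof.
rewrite /rc -mulrA -exprzDr// mulrC res_cxz; congr (nat_of_bool _)%:R; lia.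
Qed.

Lemma rc_lD H m : rc (lD (H * (lD cx)^-1)) m = (m + 1)%:~R * rc H (m + 1).
Proof.
pose F := H * (lD cx)^-1; have HF : H = F * lD cx by rewrite /F mulrVK.
have : lres (lD (F * cx ^ (- m - 1))) = 0 by exact: lres_lD.
rewrite lDM lresD -/(rc _ m) => /eqP; rewrite addr_eq0 => /eqP ->.
rewrite lDXz// mulrCA -mulrA lresC -mulNr -intrN (_ : - (- m - 1) = m + 1); last by lia.
rewrite /rc HF; congr (_ * lres _); rewrite -[RHS]mulrA [lD cx * _]mulrC.
by rewrite (_ : - m - 1 - 1 = - (m + 1) - 1) 1?mulrCA//; lia.
Qed.

(** If [H / x' = h(x)] then [dx i H / x'] is the [i]-th derivative of [h] with respect to [x]. *)
Fixpoint dx (i : nat) (H : L) : L := if i is j.+1 then lD (dx j H * (lD cx)^-1) else H.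

Lemma rc_dx i H m : rc (dx i H) m = (i`!)%:R * binz C (m + i%:Z) i * rc H (m + i%:Z).
Proof.
elim: i m => [|i IH] m; first by rewrite /binz big_ord0 divr1 mulr1 mul1r addr0.
rewrite /= rc_lD IH mulrA (_ : m + 1 + i%:Z = m + i.+1%:Z); last by lia.
congr (_ * _); rewrite /binz big_ord_recr /= !mulrA ![_ * \prod_(_ < _) _]mulrC.
rewrite (_ : (m + i.+1%:Z)%:~R - i%:R = (m + 1)%:~R :> C); last first.
  by rewrite -[i%:R]/((Posz i)%:~R) -intrB; congr (_%:~R); lia.
set P := \prod_(_ < _) _; have f0 := fact_neq0 i; have f1 := fact_neq0 i.+1.
by field; rewrite f0 f1.
Qed.

(** [x' x^k] has order exactly [k], so the leading terms of [H] can be removed one after the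
    other. *)
Lemma cx_expansion H a N : lord H a ->
  exists c : nat -> C, lord (H - \sum_(k < N) lC (c k) * (lD cx * cx ^ (a + k%:Z))) (a + N%:Z).
Proof.
move=> hH; elim: N => [|N [c IH]].
  by exists (fun=> 0); rewrite big_ord0 subr0 addr0.
set H' := H - _ in IH; pose M := lD cx * cx ^ (a + N%:Z).
have M0 : M (a + N%:Z) != 0.
  have -> : M (a + N%:Z) = tau * (cx ^ (a + N%:Z)) (a + N%:Z).
    rewrite /M lcoefM (@fsum_delta _ _ _ 0) ?subr0 ?lDcx0// => i i0.
    have [/lord_lDcx ->|ip] := ltP i 0; first by rewrite mul0r.
    by rewrite (lord_cxz (n := _)) ?mulr0//; lia.
  by rewrite mulf_neq0// cxz_lead.
have lM : lord M (a + N%:Z).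
  by rewrite -[a + N%:Z]add0r; apply: lordM; [exact: lord_lDcx|exact: lord_cxz].
pose d := H' (a + N%:Z) / M (a + N%:Z).
exists (fun k => if (k < N)%N then c k else d).
have -> : H - \sum_(k < N.+1) lC (if (k < N)%N then c k else d) * (lD cx * cx ^ (a + k%:Z)) = H' - lC d * M.
  rewrite big_ord_recr /= ltnn opprD addrA; congr (_ - _ - _).
  by apply: eq_bigr => k _; rewrite ltn_ord.
move=> n hn; rewrite lcoefB lCM; have [->|ne] := eqVneq n (a + N%:Z).
  by rewrite /d divfK// subrr.
by rewrite IH ?lM ?mulr0 ?subr0//; lia.
Qed.

Lemma rc_conv_supp H K N : fsupp (fun l : int => rc H l * rc K (N - l)).
Proof.
case: (lcoef_bound H) (lcoef_bound K) => [a Ha] [b Hb].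
apply: (@fsupp_int _ _ a (N - b)) => l h; split.
  by rewrite leNgt; apply/negP => e; apply: h; rewrite (rc_ord Ha e) mul0r.
by rewrite leNgt; apply/negP => e; apply: h; rewrite (@rc_ord K b) ?mulr0//; lia.
Qed.

(** Multiplication of expansions in [x]. The difference [B] of the two sides is bilinear and
    symmetric, vanishes on the pairs [x' x^p], [x' x^r], and vanishes when the orders of the
    arguments add up to more than [N]; finite expansions of [H] and [K] then suffice. *)
Lemma rc_conv H K N : fsum (fun l : int => rc H l * rc K (N - l)) = rc (H * K * (lD cx)^-1) N.
Proof.
pose B (H K : L) := fsum (fun l : int => rc H l * rc K (N - l)) - rc (H * K * (lD cx)^-1) N.
have BD H1 H2 K1 : B (H1 + H2) K1 = B H1 K1 + B H2 K1.
  rewrite /B !mulrDl rcD -[X in X - _ = _](_ : fsum (fun l => rc H1 l * rc K1 (N - l)) + fsum (fun l => rc H2 l * rc K1 (N - l)) = _); first by ring.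
  rewrite -fsumD; try exact: rc_conv_supp.
  by apply: fsum_ext => l; rewrite rcD mulrDl.
have BC H1 K1 : B H1 K1 = B K1 H1.
  rewrite /B (mulrC K1 H1); apply: (congr1 (fun x : C => x - _)); rewrite (fsum_reindex _ (bij_refl N)).
  by apply: fsum_ext => l; rewrite subKr mulrC.
have BZ c H1 K1 : B (lC c * H1) K1 = c * B H1 K1.
  rewrite /B mulrBr (fsumM _ (rc_conv_supp _ _ _)) -!mulrA rcC !mulrA; congr (_ - _).
  by apply: fsum_ext => l; rewrite rcC mulrA.
have Bsum (m : nat) (F : nat -> L) K1 : B (\sum_(k < m) F k) K1 = \sum_(k < m) B (F k) K1.
  elim: m => [|m IH]; last by rewrite !big_ord_recr BD IH.
  by rewrite !big_ord0 -lC0 -[lC 0]mulr1 BZ mul0r.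
have B0 H1 K1 a b : lord H1 a -> lord K1 b -> N < a + b -> B H1 K1 = 0.
  move=> h1 h2 ab; rewrite /B fsum0 ?sub0r; last first.
    move=> l; have [e|e] := ltP l a; first by rewrite (rc_ord h1 e) mul0r.
    by rewrite (@rc_ord K1 b) ?mulr0//; lia.
  apply/eqP; rewrite oppr_eq0; apply/eqP; apply: (@rc_ord _ (a + b)) => //.
  by rewrite -[a + b]addr0; apply: lordM; [exact: lordM|exact: lord_lDcxV].
have Bx p r : B (lD cx * cx ^ p) (lD cx * cx ^ r) = 0.
  rewrite /B (@fsum_delta _ _ _ p); last by move=> l lp; rewrite rc_cx (negbTE lp) mul0r.
  have -> : lD cx * cx ^ p * (lD cx * cx ^ r) / lD cx = lD cx * cx ^ (p + r).
    by rewrite exprzDr// mulrACA [X in X / _]mulrAC mulrK.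
  rewrite !rc_cx eqxx mul1r; apply/eqP; rewrite subr_eq0; apply/eqP; congr (nat_of_bool _)%:R; lia.
suff : B H K = 0 by rewrite /B => /eqP; rewrite subr_eq0 => /eqP.
case: (lcoef_bound H) (lcoef_bound K) => [a Ha] [b Hb].
(* With [e] terms on each side the remainders are of too high an order to contribute to degree
   [N]. *)
have [e he] : exists e : nat, N < a + b + e%:Z.
  have [h|h] := ltP N (a + b); first by exists 0%N; lia.
  pose M : int := N - a - b; exists `|M|%N.+1; lia.
have [c Hc] := cx_expansion e Ha; have [d Hd] := cx_expansion e Hb.
set S := \sum_(k < _) _ in Hc; set T := \sum_(k < _) _ in Hd.
have -> : H = S + (H - S) by rewrite addrC subrK.
rewrite BD [X in _ + X](B0 _ _ _ _ Hc Hb) ?addr0; last by lia.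
rewrite /S (Bsum e (fun k => lC (c k) * (lD cx * cx ^ (a + k%:Z)))) big1// => k _; rewrite BZ (_ : K = T + (K - T)); last by rewrite addrC subrK.
rewrite BC BD BC [X in _ + X]BC [X in _ + X](@B0 _ _ a (b + e%:Z))//; last 2 first.
- apply: (@lord_le _ _ _ (0 + (a + k%:Z))); first by lia.
  by apply: lordM; [exact: lord_lDcx|exact: lord_cxz].
- by lia.
rewrite addr0 BC /T (Bsum e (fun k => lC (d k) * (lD cx * cx ^ (b + k%:Z)))) big1 ?mulr0// => j _.
by rewrite BZ Bx mulr0.
Qed.

Lemma rc_comm i H K N :
  fsum (fun l : int => binz C l i * rc H l * rc K (N + i%:Z - l)) =
  rc (lC (i`!)%:R^-1 * dx i H * K * (lD cx)^-1) N.
Proof.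
rewrite -!mulrA rcC [dx i H * _]mulrA -rc_conv (fsumM _ (rc_conv_supp _ _ _)).
rewrite [LHS](fsum_reindex _ (bij_shift (- i%:Z))).
apply: fsum_ext => l; rewrite opprK rc_dx !mulrA mulVf ?fact_neq0// mul1r.
by congr (_ * rc _ _); lia.
Qed.

Lemma square_coefE h m j :
  square_coef R h m j = lres (lX C (m - j%:Z) * cx ^ (- m - 1) * lexp (tau * h%:R)).
Proof.
rewrite cxz mulrA -lXD -mulrA -lfps_mul /lres lXM /square_coef.
by rewrite (_ : -1 - (m - j%:Z + (- m - 1)) = j)//; lia.
Qed.
End Coordinate.

(** * Modes of a module against Laurent series *)

Section LinearMaps.
Variables (K : pzRingType) (M N : lmodType K).
Variable f : M -> N.
Hypothesis lf : linear f.
Lemma lin0 : f 0 = 0.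
Proof. by have := lf (-1) 0 0; rewrite scaler0 addr0 scaleN1r addNr. Qed.
Lemma linD u v : f (u + v) = f u + f v.
Proof. by have := lf 1 u v; rewrite !scale1r. Qed.
Lemma linZ c u : f (c *: u) = c *: f u.
Proof. by have := lf c u 0; rewrite !addr0 lin0 addr0. Qed.
Lemma linN u : f (- u) = - f u.
Proof. by rewrite -scaleN1r linZ scaleN1r. Qed.
Lemma linB u v : f (u - v) = f u - f v.
Proof. by rewrite linD linN. Qed.
Lemma lin_fsum (I : choiceType) (F : I -> M) : fsupp F -> f (fsum F) = fsum (fun i => f (F i)).
Proof. by apply: fsum_add; [exact: lin0|exact: linD]. Qed.
Lemma lin_sum (I : Type) (s : seq I) (P : pred I) (F : I -> M) :
  f (\sum_(i <- s | P i) F i) = \sum_(i <- s | P i) f (F i).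
Proof. by elim/big_ind2 : _ => [|a b c d <- <-|//]; [exact: lin0|rewrite linD]. Qed.
End LinearMaps.

Section Binomials.
Variable F : numFieldType.
Lemma binz_0 j : binz F 0 j = (j == 0%N)%:R.
Proof.
case: j => [|j]; first by rewrite /binz big_ord0 divr1.
by rewrite /binz big_ord_recl /= subrr mul0r mul0r.
Qed.
Lemma binz_r0 m : binz F m 0 = 1.
Proof. by rewrite /binz big_ord0 divr1. Qed.
Lemma binz_m2 j : (-1) ^+ j * binz F (-2) j = j.+1%:R.
Proof.
rewrite /binz; have -> : \prod_(i < j) ((-2)%:~R - i%:R : F) = (-1) ^+ j * (j.+1`!)%:R.
  elim: j => [|j IH]; first by rewrite big_ord0 expr0 mulr1.
  rewrite big_ord_recr /= IH exprS [(j.+2)`!]factS natrM.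
  have -> : (-2)%:~R - j%:R = - (j.+2%:R) :> F by rewrite intrN -opprD -natrD.
  ring.
by rewrite mulrA mulrA -exprMn mulrNN mulr1 expr1n mul1r factS natrM mulfK// pnatr_eq0 -lt0n fact_gt0.
Qed.
End Binomials.

Lemma fsum_int_nat (M : nmodType) (F : int -> M) (n : int) :
  (forall m, m < n -> F m = 0) -> fsupp F -> fsum F = fsum (fun j : nat => F (n + j%:Z)).
Proof.
move=> H [r Hr].
have [N HN] : exists N : nat, forall m, m \in r -> m - n < N%:Z.
  elim: r {Hr} => [|i r [N IH]]; first by exists 0%N.
  exists (maxn N `|i - n|%N.+1) => m; rewrite inE => /orP[/eqP ->|/IH]; lia.
have fN i : (N <= i)%N -> F (n + i%:Z) = 0.
  by move=> Ni; apply: contrapT => /Hr /HN; lia.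
rewrite (fsum_nat fN) (@fsum_seq _ _ [seq n + k%:Z | k <- iota 0 N]).
- by rewrite big_map -(big_mkord xpredT (fun i => F (n + i%:Z))) /index_iota subn0.
- by rewrite map_inj_uniq ?iota_uniq// => i j /addrI [].
move=> m Fm; have nm : n <= m by rewrite leNgt; apply/negP => /H.
have := HN m (Hr m Fm) => mN; apply/mapP; exists `|m - n|%N; last by lia.
by rewrite mem_iota; lia.
Qed.

Section TwoIndexSums.
Variable M : nmodType.
Definition fsupp2 (F : int -> int -> M) :=
  exists (r s : seq int), forall i j, F i j <> 0 -> i \in r /\ j \in s.
Definition fsum2 (F : int -> int -> M) := fsum (fun i => fsum (fun j => F i j)).

Lemma fsupp2_r F i : fsupp2 F -> fsupp (F i).
Proof. by move=> [r [s H]]; exists s => j /H[]. Qed.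
Lemma fsupp2_l F : fsupp2 F -> fsupp (fun i => fsum (F i)).
Proof.
move=> [r [s H]]; exists r => i; apply: contra_notT => ir; apply: fsum0 => j.
by apply: contrapT => /H[]; rewrite (negbTE ir).
Qed.
Lemma fsum2D F G : fsupp2 F -> fsupp2 G -> fsum2 (fun i j => F i j + G i j) = fsum2 F + fsum2 G.
Proof.
move=> hF hG; rewrite /fsum2 -fsumD; try exact: fsupp2_l.
by apply: fsum_ext => i; rewrite fsumD//; exact: fsupp2_r.
Qed.
Lemma fsupp2_0 : fsupp2 (fun _ _ => 0).
Proof. by exists [::], [::]. Qed.
Lemma fsupp2D F G : fsupp2 F -> fsupp2 G -> fsupp2 (fun i j => F i j + G i j).
Proof.
move=> [r [s H]] [r' [s' H']]; exists (r ++ r'), (s ++ s') => i j h; rewrite !mem_cat.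
have [e|/H[-> ->]//] := pselect (F i j = 0).
have [e'|/H'[-> ->]//] := pselect (G i j = 0); last by rewrite !orbT.
by case: h; rewrite e e' addr0.
Qed.
Lemma fsum2_sum (n : nat) (F : nat -> int -> int -> M) : (forall k, fsupp2 (F k)) ->
  fsum2 (fun i j => \sum_(k < n) F k i j) = \sum_(k < n) fsum2 (F k) /\
  fsupp2 (fun i j => \sum_(k < n) F k i j).
Proof.
move=> h; elim: n => [|n [IH1 IH2]].
  split; last by under eq_fun => i do under eq_fun => j do rewrite big_ord0; exact: fsupp2_0.
  by rewrite big_ord0; apply: fsum0 => i; apply: fsum0 => j; rewrite big_ord0.
have E : (fun i j => \sum_(k < n.+1) F k i j) = (fun i j => \sum_(k < n) F k i j + F n i j).
  by apply/funext => i; apply/funext => j; rewrite big_ord_recr.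
by rewrite E big_ord_recr -IH1 fsum2D//; split => //; exact: fsupp2D.
Qed.
End TwoIndexSums.

Section ModeOperators.
Variables (R : realType) (V : voa R) (W : admissible_module V).
Local Notation C := (cplx R).
Local Notation L := (laurent C).
Local Notation tau := (two_pi_i R).
Local Notation om := (conformal_vector V).
Implicit Types (a b : V) (H K : L) (u v : W).
Let wax := am_axioms W.
Let vax := voa_axioms V.

Lemma am_linl n (u : W) : linear (fun a => am_mode a n u). Proof. exact: wm_linear_l wax _ _. Qed.
Lemma am_linr a n : linear (@am_mode R V W a n). Proof. exact: wm_linear_r wax _ _. Qed.
Lemma vm_linr a n : linear (@voa_mode R V a n). Proof. exact: wm_linear_r vax _ _. Qed.
Lemma am_trunc a (u : W) : exists N : int, forall n, N <= n -> am_mode a n u = 0.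
Proof. exact: wm_truncation wax _ _. Qed.

(** The Jacobi identity at [l = 0], where [binz 0 j] leaves only the term [j = 0] on the right. *)
Lemma am_commutator a b (u : W) (m n : int) :
  am_mode a m (am_mode b n u) - am_mode b n (am_mode a m u) =
  fsum (fun i : nat => binz C m i *: am_mode (voa_mode a i%:Z b) (m + n - i%:Z) u).
Proof.
have := wm_jacobi wax a b u 0 m n.
rewrite -!/(fsum _) [RHS](@fsum_delta _ _ _ 0%N); last first.
  by move=> j j0; rewrite binz_0 (negbTE j0) mulr0 scale0r.
rewrite binz_r0 expr0 mulr1 scale1r expr0z scale1r.
have z0 (k : int) : k + 0 - 0%N%:Z = k by lia.
have z1 (k : int) : k + 0%N%:Z = k by lia.
rewrite !z0 !z1 => <-.
by apply: fsum_ext => i; rewrite add0r.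
Qed.

(* [L(-1) b = b_(-2) 1], and the Jacobi identity with [l = -2], [m = 0] computes
   the modes of the latter. *)
Lemma am_translation b n (u : W) :
  am_mode (voa_mode om 0 b) n u = - n%:~R *: am_mode b (n - 1) u.
Proof.
have -> : voa_mode om 0 b = voa_mode b (-2) (vacuum V).
  have := voa_creation (voa_mode om 0 b) (isT : -1 <= (-1 : int)); rewrite eqxx => <-.
  by rewrite voa_derivative rmorphN1 opprK scale1r.
have := wm_jacobi wax b (vacuum V) u (-2) 0 n.
rewrite -!/(fsum _) [LHS](@fsum_delta _ _ _ 0%N); last first.
  by move=> j j0; rewrite binz_0 (negbTE j0) scale0r.
rewrite binz_r0 scale1r addr0 add0r subr0 => ->.
have vacE k (v : W) : am_mode (vacuum V) k v = if k == -1 then v else 0 by exact: wm_vacuum wax _ _.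
have m2 : (-1) ^ (-2) = 1 :> C by rewrite -exprnN sqrrN expr1n invr1.
under fsum_ext => j do rewrite binz_m2 !vacE m2 scale1r.
have y0 k : am_mode b k (0 : W) = 0 by exact: lin0 (am_linr b k).
have [n0|n0] := ltP n 0.
  rewrite (@fsum_delta _ _ _ (`|n|.-1)%N); last first.
    move=> j hj; rewrite (_ : n + j%:Z == -1 = false); last by lia.
    by rewrite (_ : n + (-2) - j%:Z == -1 = false) ?y0 ?subrr ?scaler0//; lia.
  rewrite (_ : n + (`|n|.-1)%N%:Z == -1); last by lia.
  rewrite (_ : n + (-2) - (`|n|.-1)%N%:Z == -1 = false); last by lia.
  rewrite subr0; congr (_ *: am_mode b _ u); last by lia.
  rewrite -[_%:R]/((Posz _)%:~R) -intrN; congr (_%:~R); lia.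
have [->|n1] := eqVneq n 0.
  rewrite oppr0 scale0r; apply: fsum0 => j.
  rewrite (_ : 0 + j%:Z == -1 = false); last by lia.
  by rewrite (_ : 0 + (-2) - j%:Z == -1 = false) ?y0 ?subrr ?scaler0//; lia.
rewrite (@fsum_delta _ _ _ (`|n|.-1)%N); last first.
  move=> j hj; rewrite (_ : n + j%:Z == -1 = false); last by lia.
  by rewrite (_ : n + (-2) - j%:Z == -1 = false) ?y0 ?subrr ?scaler0//; lia.
rewrite (_ : n + (`|n|.-1)%N%:Z == -1 = false); last by lia.
rewrite (_ : n + (-2) - (`|n|.-1)%N%:Z == -1); last by lia.
rewrite y0 sub0r scalerN -scaleNr; congr (_ *: am_mode b _ u); last by lia.
rewrite -[_%:R]/((Posz _)%:~R); congr (- _%:~R); lia.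
Qed.

(** The [b{g}] of the overview is [act b (g * w^h)] for [b] of weight [h]; leaving out [w^h] makes
    the definition linear in [b] without reference to weights. *)
Definition act (b : V) (H : L) (v : W) : W := fsum (fun m : int => rc H m *: am_mode b m v).

Lemma act_supp b H v : fsupp (fun m : int => rc H m *: am_mode b m v).
Proof.
case: (lcoef_bound H) (am_trunc b v) => [a Ha] [N HN].
apply: (@fsupp_int _ _ a N) => m h; split.
  by rewrite leNgt; apply/negP => e; apply: h; rewrite (rc_ord Ha e) scale0r.
by rewrite leNgt; apply/negP => e; apply: h; rewrite (HN m (ltW e)) scaler0.
Qed.

Lemma act_linv b H : linear (act b H).
Proof.
move=> c u v; rewrite /act (fsumZ _ (act_supp _ _ _)) -fsumD; last 2 first.
- by apply: fsupp_sub (act_supp b H u) => i ->; rewrite scaler0.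
- exact: act_supp.
by apply: fsum_ext => m; rewrite am_linr scalerDr !scalerA mulrC.
Qed.

Lemma act_linb H v : linear (fun b => act b H v).
Proof.
move=> c a b; rewrite /act (fsumZ _ (act_supp _ _ _)) -fsumD; last 2 first.
- by apply: fsupp_sub (act_supp a H v) => i ->; rewrite scaler0.
- exact: act_supp.
by apply: fsum_ext => m; rewrite am_linl scalerDr !scalerA mulrC.
Qed.

Lemma actD b H K v : act b (H + K) v = act b H v + act b K v.
Proof.
by rewrite /act -fsumD; try exact: act_supp; apply: fsum_ext => m; rewrite rcD scalerDl.
Qed.
Lemma actC b c H v : act b (lC c * H) v = c *: act b H v.
Proof.
by rewrite /act (fsumZ _ (act_supp _ _ _)); apply: fsum_ext => m; rewrite rcC scalerA.
Qed.
Lemma actN b H v : act b (- H) v = - act b H v.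
Proof. by rewrite -mulN1r -lC1 -rmorphN actC scaleN1r. Qed.
Lemma act0 b v : act b 0 v = 0.
Proof. by rewrite -[0](mul0r 0) -lC0 actC scale0r. Qed.
(** For fixed [b] and [v] only finitely many nonnegative powers of [z] are felt, with a bound
    independent of the series; this replaces [P] by a polynomial truncation later. *)
Lemma act_trunc b v : exists M : int, forall H, lord H M -> act b H v = 0.
Proof.
have [N HN] := am_trunc b v; exists N => H hH; apply: fsum0 => m.
by have [mN|Nm] := ltP m N; [rewrite (rc_ord hH mN) scale0r|rewrite HN// scaler0].
Qed.

(** Integration by parts: the modes of [L(-1) b] are those of the derivative of the field of [b]. *)
Lemma act_translation b H v :
  act (voa_mode om 0 b) H v = - act b (lD (H * (lD (cx R))^-1)) v.
Proof.
rewrite /act (fsumN (act_supp _ _ _)) [LHS](fsum_reindex _ (bij_shift (-1))).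
apply: fsum_ext => m; rewrite opprK am_translation rc_lD addrK scalerA.
by rewrite mulrN scaleNr mulrC.
Qed.

Lemma act_vacuum H v : act (vacuum V) H v = lres H *: v.
Proof.
have vacE k : am_mode (vacuum V) k v = if k == -1 then v else 0 by exact: wm_vacuum wax _ _.
rewrite /act (@fsum_delta _ _ _ (-1)).
  by rewrite vacE eqxx /rc opprK subrr expr0z mulr1.
by move=> m /negbTE h; rewrite vacE h scaler0.
Qed.

(** The finiteness of the double support is recorded together with the formula, since the commutator
    requires exchanging the two sums. *)
Lemma act_act a b H K v : act a H (act b K v) =
    fsum2 (fun l m => (rc H l * rc K m) *: am_mode a l (am_mode b m v)) /\
  fsupp2 (fun l m => (rc H l * rc K m) *: am_mode a l (am_mode b m v)).
Proof.
have [s Hs] := act_supp b K v.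
have [N HN] : exists N : int, forall m, m \in s -> forall l, N <= l -> am_mode a l (am_mode b m v) = 0.
  elim: s {Hs} => [|m s [N IH]]; first by exists 0.
  have [N' HN'] := am_trunc a (am_mode b m v); exists (Num.max N N') => k.
  by rewrite inE => /orP[/eqP ->|/IH h] l; rewrite ge_max => /andP[h1 h2]; [exact: HN'|exact: h].
case: (lcoef_bound H) => [c Hc]; have [r Hr] := int_seq c N.
have F2 : fsupp2 (fun l m => (rc H l * rc K m) *: am_mode a l (am_mode b m v)).
  exists r, s => l m h.
  have ms : m \in s.
    apply: Hs => e; apply: h; rewrite -scalerA -(linZ (am_linr a l)) e.
    by rewrite (lin0 (am_linr a l)) scaler0.
  split => //; apply: Hr.
    by rewrite leNgt; apply/negP => e; apply: h; rewrite (rc_ord Hc e) mul0r scale0r.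
  by rewrite leNgt; apply/negP => e; apply: h; rewrite (HN m ms l (ltW e)) scaler0.
split => //; rewrite {1}/act /fsum2; apply: fsum_ext => l.
rewrite /act (lin_fsum (am_linr a l)); last exact: act_supp.
rewrite fsumZ; last first.
  by apply: fsupp_sub (act_supp b K v) => m ->; rewrite (lin0 (am_linr a l)).
by apply: fsum_ext => m; rewrite (linZ (am_linr a l)) scalerA.
Qed.

(** Generating form of the commutator formula: the binomial coefficients of [am_commutator] become
    derivatives of [H / x'] with respect to [x], divided by [i!]. *)
Lemma act_commutator a b H K v :
  act a H (act b K v) - act b K (act a H v) =
  fsum (fun i : nat => act (voa_mode a i%:Z b) (lC (i`!)%:R^-1 * dx i H * K * (lD (cx R))^-1) v).
Proof.
have [E1 S1] := act_act a b H K v; have [E2 S2] := act_act b a K H v.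
have [N0 HN0] := wm_truncation vax a b.
pose N := `|N0|%N.
have vN (i : nat) : (N <= i)%N -> voa_mode a i%:Z b = 0 by move=> Ni; apply: HN0; rewrite /N in Ni; lia.
have az m (u : W) : am_mode 0 m u = 0 by exact: lin0 (am_linl m u).
rewrite [RHS](@fsum_nat _ _ N); last first.
  by move=> i /vN ->; rewrite /act fsum0// => m; rewrite az scaler0.
have S2' : fsupp2 (fun l m => (rc K m * rc H l) *: am_mode b m (am_mode a l v)).
  by case: S2 => r [s h]; exists s, r => i j /h[].
have E2' : act b K (act a H v) = fsum2 (fun l m => (rc K m * rc H l) *: am_mode b m (am_mode a l v)).
  by rewrite E2 /fsum2 fsum_exchange.
have S2'' : fsupp2 (fun l m => - ((rc K m * rc H l) *: am_mode b m (am_mode a l v))).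
  by case: S2' => r [s h]; exists r, s => i j hij; apply: h => e; apply: hij; rewrite e oppr0.
have -> : - act b K (act a H v) = fsum2 (fun l m => - ((rc K m * rc H l) *: am_mode b m (am_mode a l v))).
  rewrite E2' /fsum2 fsumN; last exact: fsupp2_l.
  by apply: fsum_ext => l; rewrite fsumN//; exact: (fsupp2_r l S2').
rewrite E1 -fsum2D//.
pose G (i : nat) l m := (binz C l i * rc H l * rc K m) *: am_mode (voa_mode a i%:Z b) (l + m - i%:Z) v.
have GS i : fsupp2 (G i).
  case: (lcoef_bound H) (lcoef_bound K) (am_trunc (voa_mode a i%:Z b) v) => [c Hc] [d Hd] [e He].
  have [r Hr] := int_seq c (e + i%:Z - d); have [s Hs] := int_seq d (e + i%:Z - c).
  exists r, s => l m h.
  have h1 : c <= l.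
    by rewrite leNgt; apply/negP => g; apply: h; rewrite /G (rc_ord Hc g) mulr0 mul0r scale0r.
  have h2 : d <= m.
    by rewrite leNgt; apply/negP => g; apply: h; rewrite /G (rc_ord Hd g) mulr0 scale0r.
  have h3 : l + m - i%:Z < e.
    by rewrite ltNge; apply/negP => g; apply: h; rewrite /G He// scaler0.
  by split; [apply: Hr|apply: Hs]; lia.
transitivity (fsum2 (fun l m => \sum_(i < N) G i l m)).
  apply: fsum_ext => l; apply: fsum_ext => m.
  rewrite [rc K m * _]mulrC -scalerBr am_commutator (@fsum_nat _ _ N); last first.
    by move=> i /vN ->; rewrite az scaler0.
  rewrite scaler_sumr; apply: eq_bigr => i _.
  by rewrite scalerA /G; congr (_ *: _); ring.
have [-> _] := fsum2_sum N GS.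
apply: eq_bigr => i _; rewrite /act /fsum2.
transitivity (fsum (fun l : int => fsum (fun n : int =>
    (binz C l i * rc H l * rc K (n + i%:Z - l)) *: am_mode (voa_mode a i%:Z b) n v))).
  (* Take the mode index [n = l + m - i] as the summation variable in place of [m]. *)
  apply: fsum_ext => l; rewrite (fsum_reindex _ (bij_shift (l - i%:Z))).
  apply: fsum_ext => n; rewrite /G.
  have e1 : l + (n - (l - i%:Z)) - i%:Z = n by lia.
  have e2 : n - (l - i%:Z) = n + i%:Z - l by lia.
  by rewrite e1 e2.
rewrite fsum_exchange; last first.
  case: (lcoef_bound H) (lcoef_bound K) (am_trunc (voa_mode a i%:Z b) v) => [c Hc] [d Hd] [e He].
  have [r Hr] := int_seq c (e + i%:Z - d); have [s Hs] := int_seq (c + d - i%:Z) e.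
  exists r, s => l m h.
  have h1 : c <= l.
    by rewrite leNgt; apply/negP => g; apply: h; rewrite (rc_ord Hc g) mulr0 mul0r scale0r.
  have h2 : d <= m + i%:Z - l.
    by rewrite leNgt; apply/negP => g; apply: h; rewrite (rc_ord Hd g) mulr0 scale0r.
  have h3 : m < e.
    by rewrite ltNge; apply/negP => g; apply: h; rewrite He// scaler0.
  by split; [apply: Hr|apply: Hs]; lia.
apply: fsum_ext => n; rewrite -rc_comm.
rewrite (@fsum_add _ _ _ (fun c : C => c *: am_mode (voa_mode a i%:Z b) n v)) ?scale0r//.
  by move=> x y; rewrite scalerDl.
case: (lcoef_bound H) (lcoef_bound K) => [c Hc] [d Hd].
apply: (@fsupp_int _ _ c (n + i%:Z - d)) => l h; split.
  by rewrite leNgt; apply/negP => g; apply: h; rewrite (rc_ord Hc g) mulr0 mul0r.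
by rewrite leNgt; apply/negP => g; apply: h; rewrite (@rc_ord _ K d) ?mulr0//; lia.
Qed.
End ModeOperators.

(** * Conformal weights of the modes of the conformal vector *)

Section Weights.
Variables (R : realType) (V : voa R).
Local Notation C := (cplx R).
Local Notation om := (conformal_vector V).
Local Notation comp := (component (voa_grading V)).
Implicit Types (a b : V).

Lemma compP i j b : comp i (comp j b) = if i == j then comp j b else 0.
Proof. exact: component_proj. Qed.

Lemma comp_lin j : linear (comp j). Proof. exact: component_linear. Qed.

Lemma comp_bound a : exists N : nat, a = \sum_(n < N) comp n a /\ forall h, (N <= h)%N -> comp h a = 0.
Proof.
have [N HN] := component_sum (voa_grading V) a; exists N; split => // h Nh.
rewrite HN (lin_sum (comp_lin h)) big1// => n _; rewrite compP.
by rewrite gtn_eqF// (leq_trans (ltn_ord n)).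
Qed.

Lemma comp_L0 j b : comp j (voa_mode om 1 b) = j%:R *: comp j b.
Proof.
have [N [HN _]] := comp_bound b.
rewrite {1}HN (lin_sum (vm_linr om 1)) (lin_sum (comp_lin j)) {2}HN (lin_sum (comp_lin j)).
rewrite scaler_sumr; apply: eq_bigr => n _.
rewrite (@voa_L0 _ V n); last by rewrite /piece /= compP eqxx.
by rewrite (linZ (comp_lin j)) compP; case: eqP => [->//|_]; rewrite !scaler0.
Qed.

Lemma comp_eigen j b (c : C) : voa_mode om 1 b = c *: b -> j%:R != c -> comp j b = 0.
Proof.
move=> e jc; have := comp_L0 j b; rewrite e (linZ (comp_lin j)) => /eqP.
by rewrite eq_sym -subr_eq0 -scalerBl scaler_eq0 subr_eq0 (negbTE jc) => /eqP.
Qed.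

(** The Virasoro relation for [L(0)] and [L(i - 1)]; its central term carries the factor
    [0^3 - 0]. *)
Lemma omega_weight h b (i : nat) : piece (voa_grading V) h b ->
  voa_mode om 1 (voa_mode om i%:Z b) = (h%:R + 1 - i%:R) *: voa_mode om i%:Z b.
Proof.
move=> hb; have := @voa_virasoro _ V 0 (i%:Z - 1) b => /=.
rewrite add0r sub0r !add0r subrK.
rewrite (_ : (0 ^+ 3 - 0)%:~R / 12 * central_charge V = 0); last by rewrite subr0 expr0n /= mulr0z !mul0r.
rewrite scale0r if_same addr0 (voa_L0 hb) (linZ (vm_linr om _)) => /eqP.
rewrite subr_eq -scalerDl => /eqP ->; congr (_ *: _).
by rewrite intrN intrB; ring.
Qed.

(** A graded component survives only if its degree is the [L(0)]-eigenvalue [h + 1 - i]; when this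
    is negative there is none. *)
Lemma omega_piece h b (i : nat) : piece (voa_grading V) h b ->
  if (i <= h.+1)%N then piece (voa_grading V) (h.+1 - i) (voa_mode om i%:Z b)
  else voa_mode om i%:Z b = 0.
Proof.
move=> hb; set u := voa_mode om i%:Z b.
have E : voa_mode om 1 u = (h%:R + 1 - i%:R) *: u by exact: omega_weight.
have [N [HN _]] := comp_bound u.
case: leqP => ih.
  have Z j : j != (h.+1 - i)%N -> comp j u = 0.
    move=> jn; apply: comp_eigen E _; apply: contra jn => /eqP e; apply/eqP.
    apply/eqP; rewrite -(@eqr_nat C) e natrB// -natr1; apply/eqP; ring.
  rewrite /piece /= {1}HN (lin_sum (comp_lin _)) [RHS]HN; apply: eq_bigr => j _.
  by rewrite compP; case: eqP => // /eqP; rewrite eq_sym => /Z ->.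
rewrite HN big1// => j _; apply: comp_eigen E _; apply/eqP => e.
have : (j + i)%:R = h.+1%:R :> C by rewrite natrD e -natr1; ring.
by move=> /eqP; rewrite eqr_nat => /eqP; lia.
Qed.
End Weights.

(** * Square-bracket modes and the series killed by a functional *)

Section SquareModes.
Variables (R : realType) (V : voa R) (W : admissible_module V).
Local Notation C := (cplx R).
Local Notation L := (laurent C).
Local Notation tau := (two_pi_i R).
Local Notation om := (conformal_vector V).
Local Notation comp := (component (voa_grading V)).
Implicit Types (a b : V) (f g H K : L) (u v : W).

Definition wt (h : nat) : L := lexp (tau * h%:R).
Lemma wtS h : wt h.+1 = wt h * cw R.
Proof. by rewrite /wt -natr1 mulrDr mulr1 lexpD. Qed.
Lemma wt0 : wt 0 = 1. Proof. by rewrite /wt mulr0 lexp0. Qed.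
Lemma lD_wt h : lD (wt h) = lC (tau * h%:R) * wt h. Proof. exact: lD_lexp. Qed.
Lemma lord_wt h : lord (wt h) 0. Proof. exact: lord_lfps. Qed.

(** This is [a{f}] for arbitrary [a], each homogeneous component receiving the factor [w^h] of its
    own weight. *)
Definition sact a f v : W := fsum (fun h : nat => act (comp h a) (f * wt h) v).

Lemma actz H v : act 0 H v = 0 :> W.
Proof. exact: lin0 (act_linb H v). Qed.

Lemma sactE a : exists N, forall f v, sact a f v = \sum_(h < N) act (comp h a) (f * wt h) v.
Proof.
have [N [_ HN]] := comp_bound a; exists N => f v; apply: fsum_nat => h /HN ->.
exact: actz.
Qed.

Lemma sact_piece h b f v : piece (voa_grading V) h b -> sact b f v = act b (f * wt h) v.
Proof.
move=> hb; rewrite /sact (@fsum_delta _ _ _ h); first by rewrite hb.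
by move=> j jh; rewrite -hb compP (negbTE jh) actz.
Qed.

Lemma sactD a f g v : sact a (f + g) v = sact a f v + sact a g v.
Proof.
have [N HN] := sactE a; rewrite !HN -big_split; apply: eq_bigr => h _.
by rewrite mulrDl actD.
Qed.
Lemma sactC a c f v : sact a (lC c * f) v = c *: sact a f v.
Proof.
have [N HN] := sactE a; rewrite !HN scaler_sumr; apply: eq_bigr => h _.
by rewrite -mulrA actC.
Qed.
Lemma sact_linv a f : linear (sact a f).
Proof.
have [N HN] := sactE a; move=> c u v; rewrite !HN scaler_sumr -big_split.
by apply: eq_bigr => h _; rewrite act_linv.
Qed.
Lemma sact_lina f v : linear (fun a => sact a f v).
Proof.
move=> c a b.
have [N [_ HN]] := comp_bound a; have [N' [_ HN']] := comp_bound b.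
have e x : (forall h, (maxn N N' <= h)%N -> comp h x = 0) ->
    sact x f v = \sum_(h < maxn N N') act (comp h x) (f * wt h) v.
  by move=> hx; apply: fsum_nat => h /hx ->; exact: actz.
have Ha h : (maxn N N' <= h)%N -> comp h a = 0 by rewrite geq_max => /andP[/HN].
have Hb h : (maxn N N' <= h)%N -> comp h b = 0 by rewrite geq_max => /andP[_ /HN'].
rewrite !e//; last by move=> h hh; rewrite comp_lin Ha// Hb// scaler0 addr0.
rewrite scaler_sumr -big_split; apply: eq_bigr => h _.
by rewrite comp_lin act_linb.
Qed.

Lemma sact_trunc a v : exists M : int, forall f, lord f M -> sact a f v = 0.
Proof.
have [N HN] := sactE a.
have [M HM] : exists M : int, forall f, lord f M -> \sum_(h < N) act (comp h a) (f * wt h) v = 0.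
  elim: N {HN} => [|N [M IH]]; first by exists 0 => f _; rewrite big_ord0.
  have [M' HM'] := act_trunc (comp N a) v; exists (Num.max M M') => f hf.
  rewrite big_ord_recr /= IH ?HM' ?addr0//.
    by rewrite -[M']addr0; apply: lordM (lord_wt _); apply: lord_le hf; rewrite le_max lexx orbT.
  by apply: lord_le hf; rewrite le_max lexx.
by exists M => f /HM; rewrite HN.
Qed.

(** [a[n]] is [a{z^n}]: a coefficient of a series in [z] is the residue of its product with a power
    of [z]. *)
Lemma square_modeE a n v : square_mode a n v = sact a (lX C n) v.
Proof.
rewrite /square_mode -/(fsum _); apply: fsum_ext => h; rewrite -/(fsum _) /act.
rewrite (@fsum_int_nat _ _ n); last exact: act_supp.
  apply: fsum_ext => j; congr (_ *: _); rewrite square_coefE /rc; congr lres.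
  by rewrite addrK mulrAC.
move=> m mn; rewrite (@rc_ord _ _ n) ?scale0r//.
by have := lordM (@lord_mono _ 1 n) (lord_wt h); rewrite addr0.
Qed.

(* [(d/dx)^i] applied to [f w^2 / x'], with [x = w - 1], written in the coordinate [z]. *)
Fixpoint dxw (i : nat) f : L :=
  if i is j.+1 then lC tau^-1 * lD (dxw j f) + lC (1 - j%:R) * dxw j f else f.

Let tau0 := two_pi_i_neq0 R.

Lemma lDcxV : (lD (cx R))^-1 = lC tau^-1 * (cw R)^-1.
Proof.
have u1 := lDcx_unit R; have u2 := cw_unit R.
apply: (mulIr u1); rewrite mulVr// lDcx mulrACA -rmorphM mulVf// rmorph1 mul1r.
by rewrite mulVr.
Qed.

Lemma lD_cw : lD (cw R) = lC tau * cw R. Proof. exact: lD_lexp. Qed.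

(** As [x' = 2 pi i w], each [d/dx] lowers the exponent of [w] by one, and the coefficient [1 - j]
    comes from differentiating [w^(1 - j)]. *)
Lemma dx_dxw i f : dx i (f * cw R ^+ 2) = dxw i f * cw R ^ (2 - i%:Z).
Proof.
have u2 := cw_unit R.
elim: i => [|i IH]; first by rewrite /= subr0.
rewrite /= IH lDcxV.
have e : cw R ^ (2 - i%:Z) = cw R ^ (1 - i%:Z) * cw R.
  by rewrite -[X in _ * X]expr1z -exprzDr//; congr (_ ^ _); lia.
have e3 : cw R ^ (1 - i%:Z) * cw R * (lC tau^-1 * (cw R)^-1) = lC tau^-1 * cw R ^ (1 - i%:Z).
  by rewrite mulrACA mulrV// mulr1 mulrC.
rewrite e -mulrA e3 mulrCA lDZ lDM.
rewrite lDXz// lD_cw.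
have e2 : cw R ^ (1 - i%:Z - 1) * cw R = cw R ^ (1 - i%:Z).
  by rewrite -[X in _ * X]expr1z -exprzDr// subrK.
have -> : lC (1 - i%:Z)%:~R * cw R ^ (1 - i%:Z - 1) * (lC tau * cw R) = lC ((1 - i%:Z)%:~R * tau) * cw R ^ (1 - i%:Z).
  by rewrite -e2 rmorphM; ring.
rewrite (_ : 2 - i.+1%:Z = 1 - i%:Z); last by lia.
rewrite (_ : (1 - i%:Z)%:~R = 1 - i%:R :> C); last by rewrite intrB.
have tt : lC tau^-1 * lC tau = 1 by rewrite -rmorphM mulVf// rmorph1.
transitivity (lC tau^-1 * lD (dxw i f) * cw R ^ (1 - i%:Z) +
  (lC tau^-1 * lC tau) * (lC (1 - i%:R) * dxw i f * cw R ^ (1 - i%:Z))).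
  by rewrite rmorphM; ring.
by rewrite tt mul1r -mulrDl.
Qed.

Section Killed.
Variable phi : W -> C.
Hypothesis phil : linear (phi : W -> C^o).

(** Quantified over all [b] and [v], so that it is a property of the series [g] alone, stable under
    d/dz. *)
Definition killed (g : L) :=
  forall h b v, piece (voa_grading V) h b -> phi (act b (g * wt h) v) = 0.

Lemma phiD u v : phi (u + v) = phi u + phi v. Proof. exact: (linD phil). Qed.
Lemma phiZ c u : phi (c *: u) = c * phi u. Proof. exact: (linZ phil). Qed.
Lemma phi0 : phi 0 = 0. Proof. exact: (lin0 phil). Qed.
Lemma phiN u : phi (- u) = - phi u. Proof. exact: (linN phil). Qed.
Lemma phiB u v : phi (u - v) = phi u - phi v. Proof. exact: (linB phil). Qed.

Lemma killed_sact g : killed g <-> forall a v, phi (sact a g v) = 0.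
Proof.
split; last by move=> H h b v hb; rewrite -(sact_piece _ _ hb).
move=> H a v; have [N HN] := sactE a; rewrite HN (lin_sum phil) big1// => h _.
by apply: H; rewrite /piece /= compP eqxx.
Qed.

Lemma killedD f g : killed f -> killed g -> killed (f + g).
Proof. by move=> hf hg h b v hb; rewrite mulrDl actD phiD hf// hg// addr0. Qed.
Lemma killedC c f : killed f -> killed (lC c * f).
Proof. by move=> hf h b v hb; rewrite -mulrA actC phiZ hf// mulr0. Qed.

(* [b{g'} = -(2 pi i) ((L(-1) b){g} + h b{g})] *)
Lemma killed_lD g : killed g -> killed (lD g).
Proof.
move=> hg h b v hb.
have := act_translation b (lC tau * (g * wt h.+1)) v.
have -> : lD (lC tau * (g * wt h.+1) * (lD (cx R))^-1) = lD g * wt h + lC (tau * h%:R) * (g * wt h).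
  rewrite lDcxV wtS (_ : _ * _ = g * wt h); last first.
    rewrite mulrACA -rmorphM mulfV// rmorph1 mul1r mulrA mulrK//; exact: cw_unit.
  by rewrite lDM lD_wt mulrCA.
rewrite actC actD actC => /(congr1 phi); rewrite phiZ phiN phiD phiZ.
have := @omega_piece _ V h b 0 hb; rewrite /= subn0 => hb0.
have k1 := hg _ _ v hb0; have k2 := hg _ _ v hb.
have lin0 (c d x y z : C) : c * x = - (z + d * y) -> x = 0 -> y = 0 -> z = 0.
  by move=> e x0 y0; move/esym/eqP: e; rewrite x0 y0 !mulr0 addr0 oppr_eq0 => /eqP.
by move=> e; exact: (lin0 _ _ _ _ _ e k1 k2).
Qed.

(** The coefficient [1 - j] of [dxw] vanishes at [j = 1]; hence [dxw 2 f], and every later term, is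
    a combination of derivatives of [f] of order at least 1. *)
Lemma killed_dxw i f g : (forall j, killed (iter j.+1 (@lD _) f * g)) ->
  killed (dxw i.+2 f * g).
Proof.
move=> H.
pose P F := forall k, killed (iter k (@lD C) F * g).
have PD F G : P F -> P G -> P (F + G).
  move=> hF hG k; rewrite (_ : iter k _ _ = iter k (@lD _) F + iter k (@lD _) G).
    by rewrite mulrDl; apply: killedD.
  by elim: k => //= k ->; rewrite lDD.
have PC c F : P F -> P (lC c * F).
  move=> hF k; rewrite (_ : iter k _ _ = lC c * iter k (@lD _) F).
    by rewrite -mulrA; apply: killedC.
  by elim: k => //= k ->; rewrite lDZ.
have PL F : P F -> P (lD F) by move=> hF k; rewrite -iterSr; exact: hF.
have Pf : P (lD f) by move=> k; rewrite -iterSr; exact: H.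
suff : P (dxw i.+2 f) by move=> /(_ 0%N).
elim: i => [|i IH]; last exact: (PD _ _ (PC _ _ (PL _ IH)) (PC _ _ IH)).
have -> : dxw 2 f = lC tau^-1 * lD (lC tau^-1 * lD f) + lC tau^-1 * lD f.
  by rewrite /= subrr lC0 mul0r addr0 subr0 lC1 mul1r lDD mulrDr.
exact: (PD _ _ (PC _ _ (PL _ (PC _ _ Pf))) (PC _ _ Pf)).
Qed.

(** Terms with [i >= 2] are killed. For [i = 0], translation gives the derivative of [f g w^h]; for
    [i = 1], [L(0)] gives [h]. The contributions of [h f g] cancel, [f' g] is killed, and [f g']
    remains. *)
Lemma omega_commutator h b f g v : piece (voa_grading V) h b ->
  (forall j, killed (iter j.+1 (@lD _) f * g)) ->
  phi (act om (f * cw R ^+ 2) (act b (g * wt h) v) - act b (g * wt h) (act om (f * cw R ^+ 2) v)) =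
  - tau^-1 ^+ 2 * phi (act b (f * lD g * wt h) v).
Proof.
move=> hb H; rewrite act_commutator.
have u2 := cw_unit R.
pose F (i : nat) := act (voa_mode om i%:Z b) (lC (i`!)%:R^-1 * dx i (f * cw R ^+ 2) * (g * wt h) * (lD (cx R))^-1) v.
have FE i : (i <= h.+1)%N -> F i = (i`!%:R^-1 * tau^-1) *: act (voa_mode om i%:Z b) (dxw i f * g * wt (h.+1 - i)) v.
  move=> ih; rewrite /F -actC; congr (act _ _ v).
  rewrite dx_dxw lDcxV rmorphM.
  have e : cw R ^ (2 - i%:Z) * wt h * (cw R)^-1 = wt (h.+1 - i).
    rewrite (_ : wt h = cw R ^ h%:Z); last by rewrite /wt lexpMn.
    rewrite (_ : wt (h.+1 - i) = cw R ^ (h.+1 - i)%N%:Z); last by rewrite /wt lexpMn.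
    rewrite -[(cw R)^-1]/(cw R ^ (-1)) -!exprzDr//.
    by rewrite (_ : 2 - i%:Z + h%:Z + (-1) = (h.+1 - i)%N%:Z)//; lia.
  rewrite -e; ring.
have F0 i : (h.+1 < i)%N -> F i = 0.
  by move=> ih; have := @omega_piece _ V h b i hb; rewrite leqNgt ih /= /F => ->; exact: actz.
have Fk i : phi (F i.+2) = 0.
  have [ih|ih] := leqP i.+2 h.+1; last by rewrite F0// phi0.
  rewrite FE// phiZ (@killed_dxw i f g H (h.+1 - i.+2)%N) ?mulr0//.
  by have := @omega_piece _ V h b i.+2 hb; rewrite ih.
rewrite -/(fsum F) (@fsum_nat _ F h.+2); last by move=> i /F0.
rewrite (lin_sum phil) -(big_mkord xpredT (fun i => phi (F i))) big_nat_recl// big_nat_recl// big1 ?addr0; last by move=> i _; exact: Fk.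
have E0 := FE 0%N isT; have E1 := FE 1%N isT.
rewrite fact0 invr1 mul1r subn0 in E0; rewrite (_ : 1`! = 1%N)// invr1 mul1r (_ : h.+1 - 1 = h)%N ?subn1// in E1.
have k0 : phi (act b (lD f * g * wt h) v) = 0 := H 0%N h b v hb.
have e0 : lD (f * g * wt h.+1 * (lC tau^-1 * (cw R)^-1)) =
    lC tau^-1 * (lD f * g * wt h + f * lD g * wt h + lC (tau * h%:R) * (f * g * wt h)).
  rewrite wtS (_ : _ * _ * _ = lC tau^-1 * (f * g * wt h)); last first.
    by rewrite [f * g * (_ * _)]mulrA mulrACA mulrV// mulr1 mulrC.
  by rewrite lDZ lDM lDM lD_wt; congr (_ * _); ring.
have e1 : dxw 1 f * g * wt h = lC tau^-1 * (lD f * g * wt h) + f * g * wt h.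
  by rewrite /= subr0 lC1 mul1r; ring.
rewrite act_translation lDcxV e0 actC actD actD actC in E0.
rewrite (voa_L0 hb) (linZ (act_linb _ _)) e1 actD actC in E1.
apply: (etrans (f_equal2 (fun x y => phi x + phi y) E0 E1)).
move: (act b (lD f * g * wt h) v) (act b (f * lD g * wt h) v) (act b (f * g * wt h) v) k0.
move=> A0 A1 A2 k0; rewrite phiZ phiN phiZ !phiD !phiZ !phiD !phiZ k0.
by field; exact: tau0.
Qed.
End Killed.
End SquareModes.

(** * The algebra generated by the Weierstrass function *)

Section EllipticAlgebra.
Variable K : numFieldType.
Local Notation L := (laurent K).

(* [z^-1 - sum_(k >= 1) G_k z^(2k-1)] *)
Definition eis_coef (G : nat -> K) (n : int) : K :=
  match n with
  | Posz j => if odd j then - G (j.+1)./2 else 0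
  | Negz j => (j == 0%N)%:R
  end.
Lemma eisL_bound G : exists N : int, forall n, n < N -> eis_coef G n = 0.
Proof. by exists (-1) => -[//|[//|n]]. Qed.
Definition eisL G : L := Laurent (eisL_bound G).
(** The same series without its pole: the pole [z^-1] of [P] is constant in [tau], so [xi P] has
    this shape. *)
Definition eis_dcoef (G : nat -> K) (n : int) : K :=
  if n is Posz j then (if odd j then - G (j.+1)./2 else 0) else 0.
Lemma eisdL_bound G : exists N : int, forall n, n < N -> eis_dcoef G n = 0.
Proof. by exists 0 => -[]. Qed.
Definition eisdL G : L := Laurent (eisdL_bound G).

Variables (P X : L) (alpha beta t2 : K).
Let p := - lD P.
(** The term [alpha * p] appears because [p] is the Weierstrass function plus the constant [G_2]. In
    the next hypothesis [X] stands for [xi P] and [t2] for [(2 pi i)^2]. *)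
Hypothesis weierstrass : p * p = lC 6^-1 * lD (lD p) + lC alpha * p + lC beta.
Hypothesis heat : lC t2 * X = P * lD P + lC 2^-1 * lD (lD P).

Inductive ell : L -> Prop :=
| ell_C c : ell (lC c)
| ell_p : ell p
| ell_p' : ell (lD p)
| ell_D f g : ell f -> ell g -> ell (f + g)
| ell_M f g : ell f -> ell g -> ell (f * g).

Lemma ell_1 : ell 1. Proof. by rewrite -lC1; exact: ell_C. Qed.
Lemma ell_N f : ell f -> ell (- f).
Proof. by move=> h; rewrite -mulN1r -lC1 -rmorphN; apply: ell_M => //; exact: ell_C. Qed.
Lemma ell_B f g : ell f -> ell g -> ell (f - g).
Proof. by move=> h1 h2; apply: ell_D => //; exact: ell_N. Qed.

Lemma natrn0 n : (n.+1)%:R != 0 :> K. Proof. by rewrite pnatr_eq0. Qed.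

Lemma lD_p' : lD (lD p) = lC 6 * (p * p - lC alpha * p - lC beta).
Proof.
rewrite weierstrass [X in X - _ - _](_ : _ = lC 6^-1 * lD (lD p) + (lC alpha * p + lC beta)); last by rewrite addrA.
rewrite (_ : _ - _ - _ = lC 6^-1 * lD (lD p)); last by ring.
by rewrite mulrA -rmorphM divff ?natrn0// rmorph1 mul1r.
Qed.

Lemma ell_lD f : ell f -> ell (lD f).
Proof.
elim=> {f} [c|||f g _ h1 _ h2|f g hf h1 hg h2].
- by rewrite lD_C -lC0; exact: ell_C.
- exact: ell_p'.
- rewrite lD_p'; apply: ell_M; first exact: ell_C.
  apply: ell_B; last exact: ell_C; apply: ell_B; first by apply: ell_M; exact: ell_p.
  by apply: ell_M; [exact: ell_C|exact: ell_p].
- by rewrite lDD; exact: ell_D.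
- by rewrite lDM; apply: ell_D; exact: ell_M.
Qed.

Lemma ell_iter n f : ell f -> ell (iter n (@lD K) f).
Proof. by move=> h; elim: n => //= n; exact: ell_lD. Qed.

(** First integral of the second-order equation: the difference of the two sides has derivative 0,
    and [gamma] is the resulting constant. *)
Lemma p'_sqr : exists gamma : K,
  lD p * lD p = lC 4 * p ^+ 3 - lC (6 * alpha) * p ^+ 2 - lC (12 * beta) * p + lC gamma.
Proof.
pose D := lD p * lD p - (lC 4 * p ^+ 3 - lC (6 * alpha) * p ^+ 2 - lC (12 * beta) * p).
have : lD D = 0.
  have -> : lD D = lD (lD p) * lD p + lD p * lD (lD p) -
      (lC 4 * (lC 3 * (p ^+ 2 * lD p)) - lC (6 * alpha) * (lC 2 * (p ^+ 1 * lD p)) - lC (12 * beta) * lD p).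
    rewrite -(lDXn_nat p 2) -(lDXn_nat p 1) -!lDZ -lDM /D.
    by rewrite (raddfB (@lD K)) (raddfB (@lD K)) (raddfB (@lD K)).
  rewrite lD_p' !rmorphM /=.
  have -> : (lC 12 : L) = lC 6 * lC 2 by rewrite -rmorphM -natrM.
  have -> : (lC 4 : L) = lC 2 * lC 2 by rewrite -rmorphM -natrM.
  have -> : (lC 6 : L) = lC 2 * lC 3 by rewrite -rmorphM -natrM.
  rewrite expr1; ring.
move=> /lD_eq0 e; exists (D 0); rewrite -e /D; ring.
Qed.

Section Closed.
(** [N] will be the set of series killed by a block; only linearity and stability under d/dz are
    available, not products. *)
Variable N : L -> Prop.
Hypotheses (ND : forall f g, N f -> N g -> N (f + g)) (NC : forall c f, N f -> N (lC c * f))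
  (NL : forall f, N f -> N (lD f)) (N1 : N 1) (Np : N p).

Lemma N_opp f : N f -> N (- f).
Proof. by move=> h; rewrite -mulN1r -lC1 -rmorphN; exact: NC. Qed.
Lemma N_sub f g : N f -> N g -> N (f - g).
Proof. by move=> h1 h2; apply: ND => //; exact: N_opp. Qed.

(* [p^n p' = (p^(n+1))' / (n+1)] *)
Lemma N_pow_p' n : N (p ^+ n.+1) -> N (p ^+ n * lD p).
Proof.
move=> /NL h; have := NC (n.+1%:R^-1) h.
by rewrite lDXn_nat mulrA -rmorphM mulVf ?natrn0// rmorph1 mul1r.
Qed.

(* The derivative of [p^n p'] is [(4 n + 6) p^(n+2)] up to lower powers of [p]. *)
Lemma N_pow n : N (p ^+ n).
Proof.
have [gamma pp] := p'_sqr.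
elim/ltn_ind: n => -[|[|n]] IH; [by []|by []|].
have h := NL (N_pow_p' (IH n.+1 (ltnSn _))).
pose m : K := (4 * n + 6)%:R.
have m0 : m != 0 by rewrite /m addnC natrn0.
have -> : p ^+ n.+2 = lC m^-1 * (lD (p ^+ n * lD p) +
    (lC (n%:R * 6 * alpha) * p ^+ n.+1 + lC (n%:R * 12 * beta) * p ^+ n -
     lC (n%:R * gamma) * p ^+ n.-1) + lC (6 * alpha) * p ^+ n.+1 + lC (6 * beta) * p ^+ n).
  have um : lC m \is a GRing.unit.
    by apply/unitrPr; exists (lC m^-1); rewrite -rmorphM divff// rmorph1.
  apply: (mulrI um).
  have mm : lC m * lC m^-1 = 1 by rewrite -rmorphM divff// rmorph1.
  rewrite [RHS]mulrA mm mul1r lDM lD_p'.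
  case: n {IH h um mm} @m m0 => [|n] m m0.
    rewrite lD1 mul0r !mul0r !lC0 /m muln0 add0n expr0 expr1; rewrite !rmorphM /=; ring.
  rewrite lDXn_nat [_ * lD p](_ : _ = lC n.+1%:R * (p ^+ n * (lD p * lD p))); last by ring.
  rewrite pp /m natrD natrM !rmorphD !rmorphM /= !exprS /=; ring.
apply: NC; apply: ND; last by apply: NC; apply: IH; lia.
apply: ND; last by apply: NC; apply: IH; lia.
apply: ND => //; apply: N_sub; last by apply: NC; apply: IH; lia.
by apply: ND; apply: NC; apply: IH; lia.
Qed.

(** By [p'_sqr] the square of [p'] is a polynomial in [p], so [C[p, p'] = C[p] + C[p] p'];
    membership in [N] then reduces to [N_pow] and [N_pow_p']. *)
Lemma ell_normal f : ell f ->
  exists a b : {poly K}, f = (map_poly (@lC K) a).[p] + (map_poly (@lC K) b).[p] * lD p.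
Proof.
have [c1 [c2 [c3 [c4 pp]]]] : exists c1 c2 c3 c4,
    lD p * lD p = lC c1 * (p * (p * p)) - lC c2 * (p * p) - lC c3 * p + lC c4.
  have [gamma pp] := p'_sqr; exists 4, (6 * alpha), (12 * beta), gamma.
  by rewrite pp !exprS expr0 !mulr1.
elim=> {f} [c|||f g _ [a [b e]] _ [a' [b' e']]|f g _ [a [b e]] _ [a' [b' e']]].
- by exists c%:P, 0; rewrite map_polyC hornerC rmorph0 horner0 mul0r addr0.
- by exists 'X, 0; rewrite map_polyX hornerX rmorph0 horner0 mul0r addr0.
- by exists 0, 1; rewrite rmorph1 hornerC rmorph0 horner0 mul1r add0r.
- by exists (a + a'), (b + b'); rewrite !rmorphD !hornerD e e'; ring.
- exists (a * a' + b * b' * (c1%:P * ('X * ('X * 'X)) - c2%:P * ('X * 'X) - c3%:P * 'X + c4%:P)),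
    (a * b' + a' * b).
  rewrite !(rmorphD, rmorphN, rmorphM) /= !map_polyX !map_polyC.
  rewrite !(hornerD, hornerN, hornerM, hornerC, hornerX) /= -pp e e'.
  ring.
Qed.

Lemma N_ell f : ell f -> N f.
Proof.
have N0 : N 0 by rewrite -(mul0r 1) -lC0; exact: NC.
have Nsum (n : nat) (F : nat -> L) : (forall i, N (F i)) -> N (\sum_(i < n) F i).
  by move=> h; elim: n => [|n IH]; rewrite ?big_ord0// big_ord_recr; exact: ND.
move=> /ell_normal[a [b ->]]; rewrite !horner_coef; apply: ND.
  by apply: (Nsum _ (fun i => (map_poly (@lC K) a)`_i * p ^+ i)) => i; rewrite coef_map; apply: NC; exact: N_pow.
rewrite mulr_suml; apply: (Nsum _ (fun i => (map_poly (@lC K) b)`_i * p ^+ i * lD p)) => i.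
by rewrite coef_map -mulrA; apply: NC; apply: N_pow_p'; exact: N_pow.
Qed.
End Closed.

Lemma ell_lDP n : ell (iter n.+1 (@lD K) P).
Proof.
rewrite iterSr (_ : lD P = - p); last by rewrite /p opprK.
by apply: ell_iter; apply: ell_N; exact: ell_p.
Qed.

(** By the Leibniz rule the correction involves only derivatives of [P], which are elliptic although
    [P] is not. *)
Lemma ell_iter_mul n f : ell f ->
  ell (iter n (@lD K) (P * f) - P * iter n (@lD K) f).
Proof.
move=> hf; elim: n => [|n IH]; first by rewrite /= subrr -lC0; exact: ell_C.
have := ell_D (ell_lD IH) (ell_M (ell_lDP 0) (ell_iter n hf)).
by rewrite /= raddfB /= lDM; congr ell; ring.
Qed.

(** Differentiate the heat equation [n + 1] times; every term except [P] times a derivative of [p]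
    is elliptic. *)
Lemma ell_heat n : t2 != 0 ->
  ell (- iter n.+1 (@lD K) X - lC t2^-1 * (P * lD (iter n (@lD K) p))).
Proof.
move=> t20.
have iZ c m f : iter m (@lD K) (lC c * f) = lC c * iter m (@lD K) f.
  by elim: m => //= m ->; rewrite lDZ.
have iD m f g : iter m (@lD K) (f + g) = iter m (@lD K) f + iter m (@lD K) g.
  by elim: m => //= m ->; rewrite lDD.
have iN m f : iter m (@lD K) (- f) = - iter m (@lD K) f.
  by elim: m => //= m ->; rewrite raddfN.
have e := congr1 (iter n.+1 (@lD K)) heat.
rewrite iZ iD iZ in e.
have h1 := ell_iter_mul n.+1 (ell_lDP 0).
have h2 := ell_M (ell_C 2^-1) (ell_lDP n.+2).
have h := ell_N (ell_M (ell_C t2^-1) (ell_D h1 h2)).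
have eX : iter n.+1 (@lD K) X = lC t2^-1 * (iter n.+1 (@lD K) (P * lD P) + lC 2^-1 * iter n.+1 (@lD K) (lD (lD P))).
  by rewrite -e mulrA -rmorphM mulVf// rmorph1 mul1r.
have e2 : iter n.+1 (@lD K) (lD (lD P)) = iter n.+3 (@lD K) P by rewrite -!iterSr.
have e3 : lD (iter n (@lD K) p) = - iter n.+1 (@lD K) (lD P) by rewrite /p iN raddfN.
rewrite eX e2 e3; move: h; congr ell; rewrite [iter 1 _ P]/=; ring.
Qed.
End EllipticAlgebra.

(** * Finite Lambert sums *)

Section TriangularSums.
Variable M : zmodType.
Implicit Type f : nat -> nat -> M.

Lemma sum_triangle N f :
  \sum_(1 <= a < N.+1) \sum_(1 <= b < N.+1 - a) f a b =
  \sum_(1 <= l < N.+1) \sum_(1 <= a < l) f a (l - a)%N.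
Proof.
elim: N => [|N IH]; first by rewrite !big_geq.
rewrite big_nat_recr// [RHS]big_nat_recr// -IH /= [X in _ + X]big_geq ?addr0; last by lia.
rewrite -big_split; apply: eq_big_nat => a /andP[a1 aN].
rewrite (_ : N.+2 - a = (N.+1 - a).+1)%N; last by lia.
by rewrite big_nat_recr//=; lia.
Qed.

(** Grouping by [l = a + b]. The pairs with [a + b > N] are set apart: for Lambert sums they are of
    size [|q|^N] up to a polynomial in [N] and form the truncation error. *)
Lemma sum_antidiagonals N f :
  \sum_(1 <= a < N.+1) \sum_(1 <= b < N.+1) f a b =
  \sum_(1 <= l < N.+1) \sum_(1 <= a < l) f a (l - a)%N +
  \sum_(1 <= a < N.+1) \sum_(N.+1 - a <= b < N.+1) f a b.
Proof.
rewrite -sum_triangle -big_split; apply: eq_big_nat => a /andP[a1 aN].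
by rewrite -big_cat_nat//=; lia.
Qed.

(** Grouping by the difference [l] of the indices; here no pair is left over. *)
Lemma sum_diagonals N f :
  \sum_(1 <= a < N.+1) \sum_(1 <= b < N.+1) f a b =
  \sum_(1 <= a < N.+1) f a a +
  \sum_(1 <= l < N.+1) \sum_(1 <= b < N.+1 - l) (f (b + l)%N b + f b (b + l)%N).
Proof.
elim: N => [|N IH]; first by rewrite !big_geq// addr0.
rewrite big_nat_recr//= [X in _ + X]big_nat_recr//=.
rewrite [X in X + _](_ : _ = \sum_(1 <= a < N.+1) \sum_(1 <= b < N.+1) f a b + \sum_(1 <= a < N.+1) f a N.+1); last first.
  by rewrite -big_split; apply: eq_big_nat => a _; rewrite big_nat_recr.
rewrite IH [X in _ = X + _]big_nat_recr//= [X in _ = _ + X]big_nat_recr//= [X in _ = _ + (_ + X)]big_geq ?addr0; last by lia.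
rewrite [X in _ = _ + X](_ : _ = \sum_(1 <= l < N.+1) \sum_(1 <= b < N.+1 - l) (f (b + l)%N b + f b (b + l)%N)
   + \sum_(1 <= l < N.+1) (f N.+1 l + f l N.+1)).
  by rewrite big_split /= -!addrA; congr (_ + _); rewrite [RHS]addrC -!addrA; congr (_ + _); exact: addrCA.
rewrite [X in _ = _ + X]big_nat_rev /= -big_split; apply: eq_big_nat => l /andP[l1 lN].
rewrite (_ : N.+2 - l = (N.+1 - l).+1)%N; last by lia.
rewrite big_nat_recr//=; last by lia.
have e1 : (N.+1 - l + l = N.+1)%N by lia.
have e2 : (1 + N.+1 - l.+1 = N.+1 - l)%N by lia.
by rewrite e1 e2.
Qed.

Lemma sum_exchange_triangle N f :
  \sum_(1 <= d < N.+1) \sum_(1 <= j < d) f d j =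
  \sum_(1 <= l < N.+1) \sum_(l.+1 <= d < N.+1) f d l.
Proof.
elim: N => [|N IH]; first by rewrite !big_geq.
rewrite big_nat_recr//= IH [RHS]big_nat_recr//= [X in _ = _ + X]big_geq// addr0 -big_split.
by apply: eq_big_nat => l /andP[l1 lN] /=; rewrite [RHS]big_nat_recr.
Qed.
End TriangularSums.

(* [A] is a differential ring containing the scalars [K]; [ex d] plays the part of
   [w^d] with [w = exp (t z)], and [U] that of [(w + 1) / (2 (w - 1))]. *)
Section LambertAlgebra.
Variables (K : numFieldType) (A : comUnitRingType) (k : {rmorphism K -> A}).
Variables (ex exN : nat -> A) (U : A) (D : {additive A -> A}) (t : K).
Hypothesis exD : forall a b, ex (a + b) = ex a * ex b.
Hypothesis exND : forall a b, exN (a + b) = exN a * exN b.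
Hypothesis exK : forall a, ex a * exN a = 1.
Hypothesis ex0 : ex 0 = 1.
Hypothesis exN0 : exN 0 = 1.
Hypothesis ucx : ex 1 - 1 \is a GRing.unit.
Hypothesis U_cx : k 2 * U * (ex 1 - 1) = ex 1 + 1.
Hypothesis DM : forall f g, D (f * g) = D f * g + f * D g.
Hypothesis Dk : forall c, D (k c) = 0.
Hypothesis D_ex : forall d, D (ex d) = k (t * d%:R) * ex d.
Hypothesis D_exN : forall d, D (exN d) = - (k (t * d%:R) * exN d).

Local Notation w := (ex 1).
Definition ls d := ex d - exN d.
Definition lc d := ex d + exN d.

Lemma k_unit (c : K) : c != 0 -> k c \is a GRing.unit.
Proof. by move=> c0; apply/unitrPr; exists (k c^-1); rewrite -rmorphM divff// rmorph1. Qed.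
Lemma kn (n : nat) : k n%:R = n%:R.
Proof. exact: rmorph_nat. Qed.
Lemma DZ c f : D (k c * f) = k c * D f.
Proof. by rewrite DM Dk mul0r add0r. Qed.

Lemma lc0 : lc 0 = 2. Proof. by rewrite /lc ex0 exN0. Qed.
Lemma ls0 : ls 0 = 0. Proof. by rewrite /ls ex0 exN0 subrr. Qed.
Lemma D_lc d : D (lc d) = k (t * d%:R) * ls d.
Proof. by rewrite /lc raddfD /= D_ex D_exN -mulrBr. Qed.
Lemma D_ls d : D (ls d) = k (t * d%:R) * lc d.
Proof. by rewrite /ls raddfB /= D_ex D_exN opprK -mulrDr. Qed.

Lemma lsM_shift b l : ls (b + l) * ls b = lc (b + l + b) - lc l.
Proof.
rewrite /ls /lc !exD !exND.
transitivity (ex b * ex l * ex b + exN b * exN l * exN b - (ex b * exN b) * (ex l + exN l)).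
  by ring.
by rewrite exK mul1r.
Qed.
Lemma lcM_shift b l : lc (b + l) * lc b = lc (b + l + b) + lc l.
Proof.
rewrite /lc !exD !exND.
transitivity (ex b * ex l * ex b + exN b * exN l * exN b + (ex b * exN b) * (ex l + exN l)).
  by ring.
by rewrite exK mul1r.
Qed.

Lemma w_exN d : w * exN d.+1 = exN d.
Proof. by rewrite -[d.+1]addn1 exND mulrCA exK mulr1. Qed.
Lemma w_ex d : w * ex d = ex d.+1.
Proof. by rewrite -[d.+1]addn1 exD mulrC. Qed.

(** [w^d - w^(-d)] is divisible by [w - 1], so the pole of [U] cancels and the quotient is a
    telescoping sum. *)
Lemma U_ls d : k 2 * U * ls d = \sum_(0 <= i < d) (lc i.+1 + lc i).
Proof.
elim: d => [|d IH]; first by rewrite big_geq// ls0 mulr0.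
rewrite big_nat_recr//= -IH.
have -> : ls d.+1 = ls d + (w - 1) * (ex d + exN d.+1).
  by rewrite mulrBl !mul1r mulrDr w_exN w_ex /ls; ring.
by rewrite mulrDr; congr (_ + _); rewrite mulrA U_cx mulrDl mul1r mulrDr w_exN w_ex /lc; ring.
Qed.

(** The Riccati equation of the cotangent, from the derivative of [U_cx] after clearing
    denominators. *)
Lemma D_U : D U = k t * (k 4^-1 - U ^+ 2).
Proof.
apply: (mulIr ucx); apply: (mulIr ucx).
have u2 : k 2 \is a GRing.unit by apply: k_unit; rewrite pnatr_eq0.
apply: (mulrI u2); apply: (mulrI u2).
have Dw : D w = k t * w by rewrite D_ex mulr1.
have D1 : D 1 = 0 by rewrite -(rmorph1 k) Dk.
have Dw1 : D (w + 1) = k t * w by rewrite raddfD /= D1 addr0 Dw.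
have Dw2 : D (w - 1) = k t * w by rewrite raddfB /= D1 subr0 Dw.
have := congr1 D U_cx; rewrite DM DZ Dw1 Dw2 => e.
have e' : k 2 * D U * (w - 1) = k t * w - k 2 * U * (k t * w).
  by apply: (addIr (k 2 * U * (k t * w))); rewrite e subrK.
have -> : k 2 * (k 2 * (D U * (w - 1) * (w - 1))) = k 2 * (k 2 * D U * (w - 1)) * (w - 1) by ring.
rewrite e'.
have -> : k 2 * (k t * w - k 2 * U * (k t * w)) * (w - 1) =
   k 2 * k t * w * (w - 1) - k 2 * k t * w * (k 2 * U * (w - 1)) by ring.
have -> : k 2 * (k 2 * (k t * (k 4^-1 - U ^+ 2) * (w - 1) * (w - 1))) =
  k t * ((k 2 * k 2 * k 4^-1) * (w - 1) * (w - 1) - (k 2 * U * (w - 1)) * (k 2 * U * (w - 1))) by ring.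
have -> : k 2 * k 2 * k 4^-1 = 1.
  by rewrite !kn -natrM -(kn 4) -rmorphM divff ?rmorph1// pnatr_eq0.
by rewrite U_cx kn; ring.
Qed.

(** Equal to [w / (w - 1)^2], the trigonometric part of [wp], which is what remains of it at
    [q = 0]. *)
Definition wp0 : A := U ^+ 2 - k 4^-1.

Lemma D_wp0 : D wp0 = - (k (2 * t) * U * wp0).
Proof. by rewrite /wp0 raddfB /= Dk subr0 expr2 DM D_U rmorphM kn; ring. Qed.
Lemma D2_wp0 : D (D wp0) = k (t ^+ 2) * (k 6 * wp0 ^+ 2 + wp0).
Proof.
have -> : D (D wp0) = - (k (2 * t) * (D U * wp0 + U * D wp0)).
  by rewrite {1}D_wp0 raddfN /= -mulrA DZ DM.
rewrite D_wp0 D_U.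
have e : U ^+ 2 = wp0 + k 4^-1 by rewrite /wp0 subrK.
have e4 : 4 * k 4^-1 = 1 by rewrite -(kn 4) -rmorphM divff ?rmorph1// pnatr_eq0.
rewrite -[k 4^-1 - _]opprB -/wp0 expr2 !rmorphM !kn.
transitivity (k t * k t * (2 * wp0 ^+ 2 + 4 * (U ^+ 2) * wp0)); first by ring.
rewrite e; transitivity (k t * k t * (2 * wp0 ^+ 2 + (4 * wp0 + 4 * k 4^-1) * wp0)); first by ring.
by rewrite e4; ring.
Qed.

Lemma wp0_second : wp0 * (w - 2 + exN 1) = 1.
Proof.
have key : wp0 * (w - 1) ^+ 2 = w.
  have u2 : k 4 \is a GRing.unit by apply: k_unit; rewrite pnatr_eq0.
  apply: (mulrI u2).
  have e4 : k 4 * k 4^-1 = 1 by rewrite -rmorphM divff ?rmorph1// pnatr_eq0.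
  transitivity (k 4 * U ^+ 2 * (w - 1) ^+ 2 - (k 4 * k 4^-1) * (w - 1) ^+ 2).
    by rewrite /wp0; ring.
  rewrite e4 mul1r; transitivity ((k 2 * U * (w - 1)) ^+ 2 - (w - 1) ^+ 2).
    by rewrite !kn; ring.
  by rewrite U_cx kn; ring.
have e := exK 1.
have -> : w - 2 + exN 1 = (w - 1) ^+ 2 * exN 1.
  transitivity (w * (w * exN 1) - 2 * (w * exN 1) + exN 1); last by ring.
  by rewrite e !mulr1.
by rewrite mulrA key.
Qed.

(* [wp0 (c_d - 2)] is a Laurent polynomial in [w], with second difference [c_d]. *)
Lemma wp0_lc d : wp0 * lc d = 2 * wp0 + d%:R + \sum_(1 <= j < d) (d - j)%:R * lc j.
Proof.
have rec m : wp0 * lc m.+2 = 2 * (wp0 * lc m.+1) - wp0 * lc m + lc m.+1.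
  have -> : lc m.+2 = lc m.+1 * (w - 2 + exN 1) + 2 * lc m.+1 - lc m.
    have e1 : ex m.+2 = ex m.+1 * w by rewrite -exD addn1.
    have e2 : ex m.+1 * exN 1 = ex m by rewrite -[m.+1]addn1 exD -mulrA exK mulr1.
    have e3 : exN m.+1 * w = exN m by rewrite mulrC w_exN.
    have e4 : exN m.+2 = exN m.+1 * exN 1 by rewrite -exND addn1.
    transitivity (ex m.+1 * w + ex m.+1 * exN 1 + exN m.+1 * w + exN m.+1 * exN 1 - lc m); last first.
      by rewrite /lc; ring.
    by rewrite e2 e3 -e1 -e4 /lc; ring.
  transitivity (lc m.+1 * (wp0 * (w - 2 + exN 1)) + 2 * (wp0 * lc m.+1) - wp0 * lc m); first by ring.
  by rewrite wp0_second; ring.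
suff : forall d, wp0 * lc d = 2 * wp0 + d%:R + \sum_(1 <= j < d) (d - j)%:R * lc j /\
    wp0 * lc d.+1 = 2 * wp0 + d.+1%:R + \sum_(1 <= j < d.+1) (d.+1 - j)%:R * lc j.
  by move=> H; case: (H d).
elim=> [|m [IH1 IH2]].
  split; first by rewrite lc0 big_geq// !addr0 mulrC.
  rewrite big_geq// addr0.
  have -> : lc 1 = (w - 2 + exN 1) + 2 by rewrite /lc; ring.
  by rewrite mulrDr wp0_second; ring.
split => //; rewrite rec IH2 IH1.
have -> : \sum_(1 <= j < m.+2) (m.+2 - j)%:R * lc j =
   2 * (\sum_(1 <= j < m.+1) (m.+1 - j)%:R * lc j) - \sum_(1 <= j < m) (m - j)%:R * lc j + lc m.+1.
  rewrite big_nat_recr//= subSnn mul1r; congr (_ + _).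
  case: m {IH1 IH2} => [|m]; first by rewrite !big_geq// mulr0 subr0.
  rewrite [X in _ = _ - X](_ : _ = \sum_(1 <= j < m.+2) (m.+1 - j)%:R * lc j); last first.
    by rewrite [RHS]big_nat_recr//= subnn mul0r addr0.
  rewrite mulr_sumr -sumrB; apply: eq_big_nat => j /andP[j1 jm].
  rewrite (_ : m.+3 - j = (m.+1 - j).+2)%N; last by lia.
  rewrite (_ : m.+2 - j = (m.+1 - j).+1)%N; last by lia.
  by rewrite -!natr1; ring.
rewrite -!natr1; ring.
Qed.

(* The values [q^d / (1 - q^d)] satisfy this relation. *)
Variables (x : nat -> K) (N : nat).
Hypothesis xM : forall a b, (0 < a)%N -> (0 < b)%N ->
  x a * x b = x (a + b)%N * (1 + x a + x b).

Lemma xM_shift b l : (0 < b)%N -> (0 < l)%N ->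
  x (b + l)%N * x b = x l * (x b - x (b + l)%N) - x (b + l)%N.
Proof. by move=> b0 l0; have := xM b0 l0 => e; rewrite mulrBr [x l * x b]mulrC e; ring. Qed.

Definition lambert_sum (F : nat -> A) := \sum_(1 <= d < N.+1) k (x d) * F d.
Local Notation XX := (\sum_(1 <= d < N.+1) x d).

Definition corner (Y : nat -> nat -> A) :=
  \sum_(1 <= a < N.+1) \sum_(N.+1 - a <= b < N.+1) k (x a * x b) * Y a b.

Lemma kM a b : k (a * b) = k a * k b. Proof. exact: rmorphM. Qed.

(** Common to [ls] (with [eps = -1]) and [lc] (with [eps = 1]): the product formula gives
    [s_a s_b = c_(a+b) + eps c_|a-b|], and the first part is grouped by sums, the second by
    differences. *)
Lemma lambert_sqr (c s : nat -> A) (m : nat -> K) (eps : A) :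
  (forall a, s a * s a = c (a + a)%N + eps * c 0%N) ->
  (forall b l, s (b + l)%N * s b = c (b + l + b)%N + eps * c l) ->
  (\sum_(1 <= d < N.+1) k (m d * x d) * s d) ^+ 2 =
  eps * c 0%N * k (\sum_(1 <= a < N.+1) (m a * x a) ^+ 2) +
  \sum_(1 <= l < N.+1) (k (\sum_(1 <= a < l) m a * m (l - a)%N * (x a * x (l - a)%N)) +
    eps * k (2 * \sum_(1 <= b < N.+1 - l) m b * m (b + l)%N * (x (b + l)%N * x b))) * c l +
  corner (fun a b => k (m a * m b) * c (a + b)%N).
Proof.
move=> h1 h2.
have E : (\sum_(1 <= d < N.+1) k (m d * x d) * s d) ^+ 2 =
   \sum_(1 <= a < N.+1) \sum_(1 <= b < N.+1) k (m a * x a * (m b * x b)) * (s a * s b).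
  rewrite expr2 mulr_suml; apply: eq_bigr => a _; rewrite mulr_sumr; apply: eq_bigr => b _.
  by rewrite kM; ring.
pose f a b := k (m a * x a * (m b * x b)) * c (a + b)%N.
pose g (a b : nat) := k (m a * x a * (m b * x b)) * c (maxn a b - minn a b)%N.
have sE a b : s a * s b = c (a + b)%N + eps * c (maxn a b - minn a b)%N.
  have [ab|ba|->] := ltngtP a b; last by rewrite h1 subnn.
    have := h2 a (b - a)%N; rewrite subnKC 1?ltnW// (addnC b a) => <-.
    by rewrite mulrC.
  by have := h2 b (a - b)%N; rewrite subnKC 1?ltnW.
have -> : (\sum_(1 <= d < N.+1) k (m d * x d) * s d) ^+ 2 =
  \sum_(1 <= a < N.+1) \sum_(1 <= b < N.+1) f a b + eps * \sum_(1 <= a < N.+1) \sum_(1 <= b < N.+1) g a b.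
  rewrite E mulr_sumr -big_split; apply: eq_bigr => a _; rewrite mulr_sumr -big_split.
  by apply: eq_bigr => b _; rewrite sE /f /g /=; ring.
rewrite sum_antidiagonals sum_diagonals mulrDr.
have -> : \sum_(1 <= a < N.+1) g a a = c 0%N * k (\sum_(1 <= a < N.+1) (m a * x a) ^+ 2).
  rewrite rmorph_sum mulr_sumr; apply: eq_bigr => a _.
  by rewrite /g maxnn minnn subnn expr2 mulrC.
have -> : \sum_(1 <= a < N.+1) \sum_(N.+1 - a <= b < N.+1) f a b = corner (fun a b => k (m a * m b) * c (a + b)%N).
  by apply: eq_bigr => a _; apply: eq_bigr => b _; rewrite /f !kM; ring.
have -> : \sum_(1 <= l < N.+1) \sum_(1 <= a < l) f a (l - a)%N =
   \sum_(1 <= l < N.+1) k (\sum_(1 <= a < l) m a * m (l - a)%N * (x a * x (l - a)%N)) * c l.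
  apply: eq_bigr => l _; rewrite rmorph_sum mulr_suml; apply: eq_big_nat => a /andP[a1 al].
  by rewrite /f subnKC 1?ltnW// !kM; ring.
have -> : \sum_(1 <= l < N.+1) \sum_(1 <= b < N.+1 - l) (g (b + l)%N b + g b (b + l)%N) =
   \sum_(1 <= l < N.+1) k (2 * \sum_(1 <= b < N.+1 - l) m b * m (b + l)%N * (x (b + l)%N * x b)) * c l.
  apply: eq_bigr => l _; rewrite mulr_sumr rmorph_sum mulr_suml.
  apply: eq_bigr => b _.
  rewrite /g (_ : maxn (b + l) b - minn (b + l) b = l)%N; last by lia.
  rewrite (_ : maxn b (b + l) - minn b (b + l) = l)%N; last by lia.
  by rewrite !kM kn; ring.
set S1 := \sum_(1 <= l < N.+1) _ * c l; set S4 := \sum_(1 <= l < N.+1) _ * c l.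
rewrite [X in _ = _ + X + _](_ : _ = S1 + eps * S4); last first.
  by rewrite /S1 /S4 mulr_sumr -big_split; apply: eq_bigr => l _ /=; ring.
ring.
Qed.

Lemma sum_x_split l : (1 <= l <= N)%N -> forall F : nat -> K,
  \sum_(1 <= d < N.+1) F d = \sum_(1 <= d < l) F d + F l + \sum_(l.+1 <= d < N.+1) F d /\
  \sum_(1 <= d < N.+1) F d = \sum_(1 <= d < N.+1 - l) F d + \sum_(N.+1 - l <= d < N.+1) F d.
Proof.
move=> /andP[l1 lN] F; split; last by rewrite -big_cat_nat//=; lia.
rewrite (@big_cat_nat _ _ _ l)//=; last by lia.
by rewrite [X in _ + X]big_ltn 1?addrA//; lia.
Qed.

Lemma sum_rev l (F : nat -> K) : \sum_(1 <= a < l) F (l - a)%N = \sum_(1 <= a < l) F a.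
Proof.
rewrite [RHS]big_nat_rev; apply: eq_big_nat => a /andP[a1 al] /=; congr F; lia.
Qed.

Lemma sum_shift l (F : nat -> K) : (l <= N)%N ->
  \sum_(1 <= b < N.+1 - l) F (b + l)%N = \sum_(l.+1 <= d < N.+1) F d.
Proof.
move=> lN; rewrite -[l.+1]add1n big_addn; apply: eq_big_nat => b _; by rewrite addnC.
Qed.

(** What the condition [b + l <= N] removes from the full sum of the [x b]. It always occurs
    multiplied by [x l], hence is again a sum over pairs with [b + l > N]. *)
Definition Lhat (l : nat) := \sum_(N.+1 - l <= b < N.+1) x b.

(* The square of the logarithmic derivative of the theta function. *)
Lemma theta_square : exists c0 : K,
  (U - lambert_sum ls) ^+ 2 = U ^+ 2 + k c0 +
    \sum_(1 <= l < N.+1) k ((l%:R - 2) * x l - 2 * x l ^+ 2) * lc l +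
    (corner (fun a b => lc (a + b)) +
     \sum_(1 <= l < N.+1) k (2 * x l * Lhat l) * lc l).
Proof.
have h1 a : ls a * ls a = lc (a + a) + (-1) * lc 0.
  by have := lsM_shift a 0; rewrite addn0 mulN1r.
have h2 b l : ls (b + l) * ls b = lc (b + l + b) + (-1) * lc l.
  by rewrite lsM_shift mulN1r.
have := lambert_sqr (fun=> 1) h1 h2.
have -> : \sum_(1 <= d < N.+1) k (1 * x d) * ls d = lambert_sum ls.
  by apply: eq_bigr => d _; rewrite mul1r.
have -> : corner (fun a b => k (1 * 1) * lc (a + b)) = corner (fun a b => lc (a + b)).
  by apply: eq_bigr => a _; apply: eq_bigr => b _; rewrite mulr1 rmorph1 mul1r.
set X2 := \sum_(1 <= a < N.+1) (1 * x a) ^+ 2; move=> eV.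
have eU : k 2 * U * lambert_sum ls = k (2 * XX) + \sum_(1 <= l < N.+1) k (x l + 2 * \sum_(l.+1 <= d < N.+1) x d) * lc l.
  rewrite /lambert_sum mulr_sumr.
  have -> : \sum_(1 <= d < N.+1) k 2 * U * (k (x d) * ls d) =
     \sum_(1 <= d < N.+1) (k (2 * x d) + k (x d) * lc d + \sum_(1 <= j < d) k (2 * x d) * lc j).
    apply: eq_big_nat => d /andP[d1 _].
    have -> : k 2 * U * (k (x d) * ls d) = k (x d) * (k 2 * U * ls d) by ring.
    rewrite U_ls big_split /= -mulr_sumr kM kn.
    have -> : \sum_(0 <= i < d) lc i.+1 = \sum_(1 <= i < d) lc i + lc d.
      by rewrite -(big_add1 _ _ 0 d.+1 xpredT) big_nat_recr.
    have -> : \sum_(0 <= i < d) lc i = 2 + \sum_(1 <= i < d) lc i.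
      by rewrite big_ltn// lc0.
    ring.
  rewrite big_split big_split /= sum_exchange_triangle mulr_sumr rmorph_sum -addrA; congr (_ + _).
  rewrite -big_split; apply: eq_bigr => l _ /=.
  rewrite rmorphD kM rmorph_sum mulrDl; congr (_ + _).
  by rewrite -mulr_suml kn mulr_sumr; congr (_ * _); apply: eq_bigr => d _; rewrite kM kn.
exists (- (2 * X2) - 2 * XX).
have -> : (U - lambert_sum ls) ^+ 2 = U ^+ 2 - k 2 * U * lambert_sum ls + lambert_sum ls ^+ 2.
  by rewrite kn; ring.
rewrite eV eU lc0.
(* [xM] linearises [x_a x_(l-a)] and [x_(b+l) x_b]. The partial sums of [x] multiplying [x_l] then
   cancel, up to [x_l] itself and [Lhat l]; the isolated sum over [d > l] is the one produced by
   [U]. *)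
have key l : (1 <= l < N.+1)%N ->
  k (\sum_(1 <= a < l) 1 * 1 * (x a * x (l - a)%N)) +
    -1 * k (2 * \sum_(1 <= b < N.+1 - l) 1 * 1 * (x (b + l)%N * x b)) =
  k (x l + 2 * \sum_(l.+1 <= d < N.+1) x d) + k ((l%:R - 2) * x l - 2 * x l ^+ 2)
    + k (2 * x l * Lhat l).
  move=> /andP[l1 lN].
  have -> : \sum_(1 <= a < l) 1 * 1 * (x a * x (l - a)%N) = x l * ((l%:R - 1) + 2 * \sum_(1 <= a < l) x a).
    transitivity (\sum_(1 <= a < l) (x l + x l * x a + x l * x (l - a)%N)).
      apply: eq_big_nat => a /andP[a1 al]; rewrite !mul1r xM ?subn_gt0// subnKC 1?ltnW//; ring.
    rewrite !big_split /= -!mulr_sumr (sum_rev l x) sumr_const_nat -[x l *+ _]mulr_natr natrB//; ring.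
  have -> : \sum_(1 <= b < N.+1 - l) 1 * 1 * (x (b + l)%N * x b) =
     x l * (\sum_(1 <= b < N.+1 - l) x b - \sum_(l.+1 <= d < N.+1) x d) - \sum_(l.+1 <= d < N.+1) x d.
    rewrite -(sum_shift x); last by [].
    rewrite -sumrB mulr_sumr -sumrB; apply: eq_big_nat => b /andP[b1 _].
    by rewrite !mul1r xM_shift.
  have hl : (1 <= l <= N)%N by rewrite l1 -ltnS.
  have [e1 e2] := sum_x_split hl x.
  rewrite mulN1r -rmorphB -!rmorphD; congr (k _).
  rewrite e1 in e2; rewrite /Lhat.
  have -> : \sum_(1 <= b < N.+1 - l) x b = \sum_(1 <= d < l) x d + x l + \sum_(l.+1 <= d < N.+1) x d - \sum_(N.+1 - l <= d < N.+1) x d.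
    by rewrite e2 addrK.
  ring.
rewrite [\sum_(1 <= l < N.+1) (_ + -1 * _) * _](_ : _ =
  \sum_(1 <= l < N.+1) k (x l + 2 * \sum_(l.+1 <= d < N.+1) x d) * lc l +
  \sum_(1 <= l < N.+1) k ((l%:R - 2) * x l - 2 * x l ^+ 2) * lc l +
  \sum_(1 <= l < N.+1) k (2 * x l * Lhat l) * lc l); last first.
  rewrite -!big_split; apply: eq_big_nat => l hl /=.
  by rewrite key// !mulrDl.
rewrite rmorphB rmorphN !kM kn; ring.
Qed.

Lemma sum_nat_mul l : (0 < l)%N ->
  6 * \sum_(1 <= a < l) (a%:R * (l%:R - a%:R)) = l%:R ^+ 3 - l%:R :> K.
Proof.
move=> l0.
have h1 n : (0 < n)%N -> 2 * \sum_(1 <= a < n) a%:R = n%:R ^+ 2 - n%:R :> K.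
  elim: n => [//|[|n] IH _]; first by rewrite big_geq// mulr0 expr1n subrr.
  by rewrite big_nat_recr//= mulrDr IH// -!natr1; ring.
have h2 n : (0 < n)%N -> 6 * \sum_(1 <= a < n) a%:R ^+ 2 = (n%:R - 1) * n%:R * (2 * n%:R - 1) :> K.
  elim: n => [//|[|n] IH _]; first by rewrite big_geq// mulr0 subrr !mul0r.
  by rewrite big_nat_recr//= mulrDr IH// -!natr1; ring.
have -> : \sum_(1 <= a < l) (a%:R * (l%:R - a%:R)) = l%:R * \sum_(1 <= a < l) a%:R - \sum_(1 <= a < l) a%:R ^+ 2 :> K.
  by rewrite mulr_sumr -sumrB; apply: eq_bigr => a _; ring.
have -> : 6 * (l%:R * \sum_(1 <= a < l) a%:R - \sum_(1 <= a < l) a%:R ^+ 2) =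
   3 * l%:R * (2 * \sum_(1 <= a < l) a%:R) - 6 * \sum_(1 <= a < l) a%:R ^+ 2 :> K by ring.
by rewrite h1// h2//; ring.
Qed.

Definition wp := wp0 + \sum_(1 <= d < N.+1) k (d%:R * x d) * lc d.
Local Notation S1 := (\sum_(1 <= d < N.+1) d%:R * x d).
Definition Ehat (l : nat) := \sum_(N.+1 - l <= b < N.+1) b%:R * (b%:R + l%:R) * x b.

(** Same method as for the square of the theta logarithmic derivative, with weights [a b]: the sum
    of [a (l - a)] over [a < l] is [(l^3 - l) / 6], whose cubic part is the second derivative of
    [lc l]. The coefficient of [wp], times [t^2], is the truncation of [2 G_2]. *)
Lemma wp_square : t != 0 -> exists c0 : K,
  wp ^+ 2 = k (6 * t ^+ 2)^-1 * D (D wp) + k (- 6^-1 + 4 * S1) * wp + k c0 +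
    (corner (fun a b => k (a%:R * b%:R) * lc (a + b)) -
     \sum_(1 <= l < N.+1) k (2 * x l * Ehat l) * lc l).
Proof.
move=> t0; have n6 : 6 != 0 :> K by rewrite pnatr_eq0.
have h1 a : lc a * lc a = lc (a + a) + 1 * lc 0.
  by have := lcM_shift a 0; rewrite addn0 mul1r.
have h2 b l : lc (b + l) * lc b = lc (b + l + b) + 1 * lc l.
  by rewrite lcM_shift mul1r.
have := lambert_sqr (fun a => a%:R) h1 h2.
set Q := \sum_(1 <= d < N.+1) k (d%:R * x d) * lc d.
set X2 := \sum_(1 <= a < N.+1) (_ * x a) ^+ 2; move=> eQ.
pose Z l := \sum_(l.+1 <= d < N.+1) (d - l)%:R * (d%:R * x d).
have eW : 2 * (wp0 * Q) = k (4 * S1) * wp0 + k (2 * \sum_(1 <= d < N.+1) d%:R ^+ 2 * x d) +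
    \sum_(1 <= l < N.+1) k (2 * Z l) * lc l.
  rewrite /Q !mulr_sumr.
  have -> : \sum_(1 <= d < N.+1) 2 * (wp0 * (k (d%:R * x d) * lc d)) =
     \sum_(1 <= d < N.+1) (k (4 * (d%:R * x d)) * wp0 + k (2 * (d%:R ^+ 2 * x d))
        + \sum_(1 <= j < d) k (2 * ((d - j)%:R * (d%:R * x d))) * lc j).
    apply: eq_bigr => d _.
    have -> : 2 * (wp0 * (k (d%:R * x d) * lc d)) = 2 * k (d%:R * x d) * (wp0 * lc d) by ring.
    rewrite wp0_lc mulrDr mulr_sumr; congr (_ + _).
      by rewrite expr2 !kM !kn; ring.
    by apply: eq_bigr => j _; rewrite !kM !kn; ring.
  rewrite !big_split /= sum_exchange_triangle !rmorph_sum /= mulr_suml; congr (_ + _ + _).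
  apply: eq_bigr => l _; rewrite -mulr_suml /Z mulr_sumr rmorph_sum //.
have eD : k (6 * t ^+ 2)^-1 * D (D wp) = wp0 ^+ 2 + k 6^-1 * wp0 +
    \sum_(1 <= l < N.+1) k (6^-1 * l%:R ^+ 3 * x l) * lc l.
  rewrite /wp raddfD raddfD /= D2_wp0 mulrDr; congr (_ + _).
    rewrite mulrA -rmorphM.
    have -> : (6 * t ^+ 2)^-1 * t ^+ 2 = 6^-1 by field; rewrite t0.
    rewrite mulrDr mulrA -rmorphM mulVf// rmorph1 mul1r //.
  rewrite /Q !raddf_sum mulr_sumr; apply: eq_bigr => l _.
  rewrite DZ D_lc DZ DZ D_ls !mulrA -!rmorphM; congr (k _ * _).
  by field; rewrite t0.
exists (2 * X2 + 2 * \sum_(1 <= d < N.+1) d%:R ^+ 2 * x d).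
have -> : wp ^+ 2 = wp0 ^+ 2 + 2 * (wp0 * Q) + Q ^+ 2 by rewrite /wp -/Q; ring.
rewrite eQ eW eD lc0.
have key l : (1 <= l < N.+1)%N ->
  k (\sum_(1 <= a < l) a%:R * (l - a)%:R * (x a * x (l - a)%N)) +
    1 * k (2 * \sum_(1 <= b < N.+1 - l) b%:R * (b + l)%:R * (x (b + l)%N * x b)) =
  k (6^-1 * l%:R ^+ 3 * x l) + k ((- 6^-1 + 4 * S1) * (l%:R * x l)) - k (2 * Z l) - k (2 * x l * Ehat l).
  move=> /andP[l1 lN].
  have -> : \sum_(1 <= a < l) a%:R * (l - a)%:R * (x a * x (l - a)%N) =
      x l * (\sum_(1 <= a < l) a%:R * (l%:R - a%:R) + 2 * \sum_(1 <= a < l) a%:R * (l%:R - a%:R) * x a).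
    pose F a : K := a%:R * (l%:R - a%:R) * x a.
    transitivity (\sum_(1 <= a < l) (x l * (a%:R * (l%:R - a%:R)) + x l * F a + x l * F (l - a)%N)).
      apply: eq_big_nat => a /andP[a1 al]; rewrite xM ?subn_gt0// subnKC 1?ltnW//.
      by rewrite /F natrB 1?ltnW//; ring.
    rewrite !big_split /= -!mulr_sumr (sum_rev l F); ring.
  have -> : \sum_(1 <= b < N.+1 - l) b%:R * (b + l)%:R * (x (b + l)%N * x b) =
     x l * (\sum_(1 <= b < N.+1 - l) b%:R * (b%:R + l%:R) * x b - Z l) - Z l.
    rewrite /Z -(sum_shift (fun d => (d - l)%:R * (d%:R * x d))); last by [].
    rewrite -sumrB mulr_sumr -sumrB; apply: eq_big_nat => b /andP[b1 _].
    by rewrite xM_shift// addnK natrD; ring.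
  have hl : (1 <= l <= N)%N by rewrite l1 -ltnS.
  have [_ e2] := sum_x_split hl (fun b => b%:R * (b%:R + l%:R) * x b).
  have [e3 _] := sum_x_split hl (fun b => b%:R * (b%:R - l%:R) * x b).
  rewrite subrr mulr0 mul0r addr0 in e3.
  have e4 : \sum_(1 <= d < N.+1) d%:R * (d%:R + l%:R) * x d =
     \sum_(1 <= d < N.+1) d%:R * (d%:R - l%:R) * x d + 2 * l%:R * S1.
    by rewrite mulr_sumr -big_split; apply: eq_bigr => d _ /=; ring.
  have e5 : \sum_(1 <= d < l) d%:R * (d%:R - l%:R) * x d = - \sum_(1 <= d < l) d%:R * (l%:R - d%:R) * x d.
    by rewrite -sumrN; apply: eq_bigr => d _; ring.
  have e6 : \sum_(l.+1 <= d < N.+1) d%:R * (d%:R - l%:R) * x d = Z l.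
    by apply: eq_big_nat => d /andP[d1 _]; rewrite natrB 1?ltnW//; ring.
  rewrite e5 e6 in e3; rewrite -/(Ehat l) e4 e3 in e2.
  have -> : \sum_(1 <= b < N.+1 - l) b%:R * (b%:R + l%:R) * x b =
    - (\sum_(1 <= d < l) d%:R * (l%:R - d%:R) * x d) + Z l + 2 * l%:R * S1 - Ehat l.
    by rewrite e2 addrK.
  have e7 : \sum_(1 <= a < l) a%:R * (l%:R - a%:R) = 6^-1 * (l%:R ^+ 3 - l%:R) :> K.
    by rewrite -(sum_nat_mul l1) mulKf.
  rewrite e7 mul1r -!rmorphN -!rmorphD; congr (k _).
  ring.
rewrite [\sum_(1 <= l < N.+1) (_ + 1 * _) * _](_ : _ =
  \sum_(1 <= l < N.+1) k (6^-1 * l%:R ^+ 3 * x l) * lc l +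
  k (- 6^-1 + 4 * S1) * Q - \sum_(1 <= l < N.+1) k (2 * Z l) * lc l
  - \sum_(1 <= l < N.+1) k (2 * x l * Ehat l) * lc l); last first.
  rewrite /Q mulr_sumr -!sumrN -!big_split; apply: eq_big_nat => l hl /=.
  rewrite key// [k ((_ + _) * _)]kM; ring.
rewrite /wp -/Q !rmorphD !rmorphN !kM !kn; ring.
Qed.

Definition lambert_P := k t * (U - lambert_sum ls).
(** This is [q d/dq] of [lambert_P]: for [x_l = q^l / (1 - q^l)] that operator sends [x_l] to
    [l x_l (1 + x_l)]. *)
Definition lambert_X := - (k t * \sum_(1 <= l < N.+1) k (l%:R * (x l * (1 + x l))) * ls l).
Definition theta_error :=
  corner (fun a b => lc (a + b)) + \sum_(1 <= l < N.+1) k (2 * x l * Lhat l) * lc l.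
Definition wp_error :=
  corner (fun a b => k (a%:R * b%:R) * lc (a + b)) - \sum_(1 <= l < N.+1) k (2 * x l * Ehat l) * lc l.

Lemma D_lambert_P : D lambert_P = - (k (t ^+ 2) * wp).
Proof.
rewrite /lambert_P DZ raddfB /= D_U /lambert_sum raddf_sum.
have -> : \sum_(1 <= d < N.+1) D (k (x d) * ls d) = k t * \sum_(1 <= d < N.+1) k (d%:R * x d) * lc d.
  by rewrite mulr_sumr; apply: eq_bigr => d _; rewrite DZ D_ls !kM; ring.
by rewrite /wp /wp0 expr2 kM; ring.
Qed.

(** If [P] is the logarithmic derivative of theta, [P^2 + P'] is [theta'' / theta], which the heat
    equation of theta turns into a logarithmic derivative in [q]. Half the derivative of this
    identity is the claim, and the constant [c0] of [theta_square] disappears. *)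
Lemma theta_heat : lambert_P * D lambert_P + k 2^-1 * D (D lambert_P) =
  k (t ^+ 2) * lambert_X + k (t ^+ 2 / 2) * D theta_error.
Proof.
have [c0 e0] := theta_square.
have e : lambert_P * lambert_P + D lambert_P = k (t ^+ 2 * (4^-1 + c0)) +
   k (t ^+ 2) * (\sum_(1 <= l < N.+1) k (- (2 * (x l * (1 + x l)))) * lc l + theta_error).
  rewrite D_lambert_P /lambert_P; set V := lambert_sum ls in e0 *.
  have -> : k t * (U - V) * (k t * (U - V)) = k (t ^+ 2) * (U - V) ^+ 2 by rewrite !expr2 kM; ring.
  rewrite e0 -/theta_error /wp /wp0.
  have -> : \sum_(1 <= l < N.+1) k ((l%:R - 2) * x l - 2 * x l ^+ 2) * lc l =
     \sum_(1 <= l < N.+1) k (- (2 * (x l * (1 + x l)))) * lc l + \sum_(1 <= l < N.+1) k (l%:R * x l) * lc l.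
    rewrite -big_split; apply: eq_bigr => l _ /=; rewrite -mulrDl -rmorphD; congr (k _ * _); ring.
  by rewrite kM rmorphD; ring.
move: theta_error e => err e.
have h2 : k 2^-1 * 2 = 1 by rewrite -(kn 2) -kM mulVf ?rmorph1// pnatr_eq0.
have := congr1 (fun f => k 2^-1 * D f) e.
rewrite !raddfD /= Dk DM DZ add0r raddfD /= mulrDr => e2.
transitivity (k 2^-1 * (D lambert_P * lambert_P + lambert_P * D lambert_P) + k 2^-1 * D (D lambert_P)).
  congr (_ + _); transitivity (k 2^-1 * 2 * (lambert_P * D lambert_P)); first by rewrite h2 mul1r.
  by ring.
rewrite e2 !kM raddf_sum /lambert_X.
have -> : \sum_(1 <= l < N.+1) D (k (- (2 * (x l * (1 + x l)))) * lc l) =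
   - 2 * (k t * \sum_(1 <= l < N.+1) k (l%:R * (x l * (1 + x l))) * ls l).
  rewrite !mulr_sumr; apply: eq_bigr => l _; rewrite DZ D_lc rmorphN !kM !kn; ring.
set S := \sum_(1 <= l < N.+1) _.
transitivity (- (k 2^-1 * 2) * (k t * k t * (k t * S)) + k t * k t * k 2^-1 * D err).
  by ring.
by rewrite h2; ring.
Qed.

(** Stated after one differentiation because the constant [c0] of [wp_square] depends on [N]; only
    the coefficient of [p] then has to converge. *)
Lemma lambert_weierstrass : t != 0 -> let p := - D lambert_P in
  D (p * p - k 6^-1 * D (D p) - k (t ^+ 2 * (- 6^-1 + 4 * S1)) * p - k (t ^+ 4) * wp_error) = 0.
Proof.
move=> t0 /=; rewrite D_lambert_P opprK.
have [c0 e0] := wp_square t0; rewrite -/wp_error in e0.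
have -> : k (t ^+ 2) * wp * (k (t ^+ 2) * wp) = k (t ^+ 4) * wp ^+ 2.
  by rewrite (_ : t ^+ 4 = t ^+ 2 * t ^+ 2) ?kM; [ring|rewrite -exprD].
rewrite e0 !DZ.
have e6 : k (t ^+ 4) * (k (6 * t ^+ 2)^-1 * D (D wp)) = k 6^-1 * (k (t ^+ 2) * D (D wp)).
  rewrite !mulrA -!kM; congr (k _ * _).
  have -> : t ^+ 4 = t ^+ 2 * t ^+ 2 by rewrite -exprD.
  by rewrite -[6 * t * t](mulrA 6 t t) invfM mulrCA (mulfK (x := t ^+ 2)) ?expf_neq0.
have e4 : k (t ^+ 4) * (k (- 6^-1 + 4 * S1) * wp) = k (t ^+ 2 * (- 6^-1 + 4 * S1)) * (k (t ^+ 2) * wp).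
  by rewrite !mulrA -!kM; congr (k _ * _); ring.
rewrite (_ : _ - _ - _ - _ = k (t ^+ 4 * c0)) ?Dk// [k (t ^+ 4 * c0)]kM.
rewrite -e6 -e4; move: (k (t ^+ 4)) (k (6 * _)^-1 * _) (k (- 6^-1 + _) * _) (k c0) wp_error.
by move=> a b c d f; ring.
Qed.
End LambertAlgebra.

(** * Geometrically decaying sequences *)

Section Sequences.
Variable R : realType.
Local Notation C := (cplx R).
Implicit Types (u v : nat -> C).

Definition clim u (l : C) := forall e : R, 0 < e ->
  exists N : nat, forall n, (N <= n)%N -> md (u n - l) < e.

Lemma climP u l : clim u l <-> u @ \oo --> l.
Proof.
split => [H|H].
  apply/(@cvgrPdist_lt C C nat) => e e0.
  have e1 : e = of_real (md e) by rewrite -normE ger0_norm// ltW.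
  have [|N HN] := H (md e); first by rewrite md_gt0 gt_eqF.
  by exists N => // n /= Nn; rewrite e1 normE of_real_lt mdB; exact: HN.
move=> e e0; move/(@cvgrPdist_lt C C nat): H => /(_ (of_real e)).
rewrite (_ : 0 = of_real 0 :> C)// of_real_lt => /(_ e0)[N _ HN].
by exists N => n Nn; have := HN n Nn; rewrite /= normE of_real_lt mdB.
Qed.

Lemma clim_lim u l : clim u l -> limn u = l.
Proof. by move=> /climP; apply: (@cvg_lim C); exact: norm_hausdorff. Qed.

Lemma clim_unique u l m : clim u l -> clim u m -> l = m.
Proof. by move=> /clim_lim <- /clim_lim <-. Qed.

Lemma climD u v l m : clim u l -> clim v m -> clim (fun n => u n + v n) (l + m).
Proof.
by move=> /climP H1 /climP H2; apply/climP; exact: (@cvgD C C nat \oo _ u v l m H1 H2).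
Qed.
Lemma climM u v l m : clim u l -> clim v m -> clim (fun n => u n * v n) (l * m).
Proof.
by move=> /climP H1 /climP H2; apply/climP; exact: (@cvgM C nat \oo _ u v l m H1 H2).
Qed.
Lemma clim_cst l : clim (fun=> l) l.
Proof. by move=> e e0; exists 0%N => n _; rewrite subrr md0. Qed.
Lemma climZ c u l : clim u l -> clim (fun n => c * u n) (c * l).
Proof. exact/climM/clim_cst. Qed.
Lemma climN u l : clim u l -> clim (fun n => - u n) (- l).
Proof.
by move=> H e /H[N HN]; exists N => n Nn; rewrite -opprD mdN; exact: HN.
Qed.
Lemma climB u v l m : clim u l -> clim v m -> clim (fun n => u n - v n) (l - m).
Proof. by move=> H1 H2; apply: climD => //; exact: climN. Qed.
Lemma clim_sum (I : Type) (s : seq I) (F : nat -> I -> C) (l : I -> C) :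
  (forall i, clim (F^~ i) (l i)) -> clim (fun n => \sum_(i <- s) F n i) (\sum_(i <- s) l i).
Proof.
move=> H; elim: s => [|i s IH].
  rewrite big_nil (_ : (fun n : nat => _) = fun=> 0); first exact: clim_cst.
  by apply/funext => n; rewrite big_nil.
rewrite big_cons (_ : (fun n : nat => _) = fun n => F n i + \sum_(i <- s) F n i); first exact: climD.
by apply/funext => n; rewrite big_cons.
Qed.
Lemma clim_ext u v l : (forall n, u n = v n) -> clim u l -> clim v l.
Proof. by move=> /funext->. Qed.

Lemma clim_le u l B : clim u l -> (forall n, md (u n) <= B) -> md l <= B.
Proof.
move=> H HB; rewrite leNgt; apply/negP => lt.
have [|N HN] := H (md l - B); first by rewrite subr_gt0.
have := HN N (leqnn _); rewrite mdB => h.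
have := md_triangle (l - u N) (u N); rewrite subrK => h2.
by have := HB N; lra.
Qed.

Lemma clim_of_real (f : nat -> R) l : f @ \oo --> l -> clim (fun n => of_real (f n)) (of_real l).
Proof.
move=> /cvgrPdist_lt H e e0; have [N _ HN] := H e e0.
exists N => n Nn; rewrite -of_realN -of_realD md_of_real distrC; exact: HN.
Qed.

Lemma geometric_sum (s : R) n : (\sum_(i < n) s ^+ i) * (1 - s) = 1 - s ^+ n.
Proof. by rewrite -[RHS]opprB subrX1 -mulNr opprB mulrC. Qed.

Definition geo (f : nat -> R) := exists K s : R, [/\ 0 <= K, 0 < s, s < 1 & forall n, f n <= K * s ^+ n].

Lemma geo_pow (K s : R) : 0 <= s -> s < 1 -> geo (fun n => K * s ^+ n).
Proof.
move=> s0 s1; exists `|K|, ((s + 1) / 2); split; [by []|lra|lra|] => n.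
apply: (le_trans (ler_norm _)); rewrite normrM ler_wpM2l// normrX ger0_norm//.
by rewrite lerXn2r ?nnegrE//; lra.
Qed.

Lemma geo_le (B : R) f g : 0 <= B -> (forall n, f n <= B * g n) -> geo g -> geo f.
Proof.
move=> B0 H [K [s [K0 s0 s1 Hs]]]; exists (B * K), s; split => //; first exact: mulr_ge0.
by move=> n; apply: (le_trans (H n)); rewrite -mulrA ler_wpM2l.
Qed.

Lemma geo_dom f g : (forall n, f n <= g n) -> geo g -> geo f.
Proof. by move=> H; apply: (@geo_le 1) => // n; rewrite mul1r. Qed.

(** Replace the ratio [s] by some [r] between [s] and 1: with [th = s / r], the product
    [(n + 1) th^n] is at most the geometric sum of the [th^i], [i <= n], hence bounded. *)
Lemma geo_natM f : geo f -> geo (fun n => n.+1%:R * f n).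
Proof.
move=> [K [s [K0 s0 s1 Hs]]].
pose r := (s + 1) / 2; have r0 : 0 < r by rewrite /r; lra.
have sr : s < r by rewrite /r; lra.
pose th := s / r; have th0 : 0 <= th by rewrite divr_ge0// ltW.
have th1 : th < 1 by rewrite ltr_pdivrMr// mul1r.
have key n : n.+1%:R * th ^+ n <= (1 - th)^-1.
  rewrite -[leRHS]mul1r ler_pdivlMr ?subr_gt0//.
  apply: (@le_trans _ _ ((\sum_(i < n.+1) th ^+ i) * (1 - th))).
    apply: ler_wpM2r; first by rewrite subr_ge0 ltW.
    rewrite mulr_natl -[X in _ *+ X]card_ord -sumr_const.
    apply: ler_sum => i _; apply: ler_wiXn2l => //; first exact: ltW.
    by rewrite -ltnS.
  by rewrite geometric_sum lerBlDr lerDl exprn_ge0.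
exists (K * (1 - th)^-1), r; split => //.
- by rewrite mulr_ge0// invr_ge0 subr_ge0 ltW.
- by rewrite /r; lra.
move=> n; apply: (@le_trans _ _ (K * (n.+1%:R * th ^+ n) * r ^+ n)); last first.
  apply: ler_wpM2r; [by rewrite exprn_ge0// ltW|exact: ler_wpM2l].
rewrite (_ : K * (n.+1%:R * th ^+ n) * r ^+ n = n.+1%:R * (K * s ^+ n)) ?ler_wpM2l//.
have -> : s ^+ n = th ^+ n * r ^+ n by rewrite -exprMn /th divfK// gt_eqF.
by rewrite !mulrA [n.+1%:R * K]mulrC.
Qed.

Lemma geo_natX k f : geo f -> geo (fun n => n.+1%:R ^+ k * f n).
Proof.
elim: k => [|k IH] H; first by apply: geo_dom H => n; rewrite mul1r.
by apply: geo_dom (geo_natM (IH H)) => n; rewrite exprS mulrA.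
Qed.

Lemma geo_clim0 u : geo (fun n => md (u n)) -> clim u 0.
Proof.
move=> [K [s [K0 s0 s1 Hs]]] e e0.
have : `|s| < 1 by rewrite gtr0_norm.
move=> /(@cvg_geometric R K); rewrite /geometric /= => /cvgr0Pnorm_lt /(_ e e0)[N _ HN].
exists N => n Nn; rewrite subr0; apply: (le_lt_trans (Hs n)).
by apply: le_lt_trans (HN n Nn); rewrite ler_norm.
Qed.

Lemma geo_psum f : geo f -> exists B : R, forall n, \sum_(i < n) f i <= B.
Proof.
move=> [K [s [K0 s0 s1 Hs]]]; exists (K * (1 - s)^-1) => n.
apply: (@le_trans _ _ (\sum_(i < n) K * s ^+ i)); first exact: ler_sum.
rewrite -mulr_sumr ler_wpM2l// -[leRHS]mul1r ler_pdivlMr ?subr_gt0//.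
by rewrite geometric_sum lerBlDr lerDl exprn_ge0// ltW.
Qed.

Lemma psum_clim u : geo (fun n => md (u n)) -> exists l, clim (series u) l.
Proof.
move=> H; have [B HB] := geo_psum H.
have cv (f : nat -> R) : (forall n, `|f n| <= md (u n)) -> cvgn (series f).
  move=> hf; apply: (@normed_cvg R R).
  apply: nondecreasing_is_cvgn.
    by apply: nondecreasing_series => n _ _ /=.
  exists B => _ [n _ <-]; rewrite /normed_series_of /series /= big_mkord.
  apply: le_trans (HB n); exact: ler_sum.
have h1 := cv (fun n => complex.Re (u n)) (fun n => md_Re (u n)).
have h2 := cv (fun n => complex.Im (u n)) (fun n => md_Im (u n)).
exists (Complex (limn (series (fun n => complex.Re (u n)))) (limn (series (fun n => complex.Im (u n))))).
move=> e e0; have e20 : 0 < e / 2 by lra.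
move/cvgrPdist_lt: h1 => /(_ _ e20)[N1 _ H1].
move/cvgrPdist_lt: h2 => /(_ _ e20)[N2 _ H2].
exists (maxn N1 N2) => n; rewrite geq_max => /andP[n1 n2].
apply: (le_lt_trans (md_ReIm _)); rewrite cReD cReN cImD cImN /=.
have eR : complex.Re (series u n) = series (fun n => complex.Re (u n)) n.
  rewrite /series /=; elim: n {n1 n2} => [|n IH]; first by rewrite !big_geq.
  by rewrite !big_nat_recr//= cReD IH.
have eI : complex.Im (series u n) = series (fun n => complex.Im (u n)) n.
  rewrite /series /=; elim: n {n1 n2 eR} => [|n IH]; first by rewrite !big_geq.
  by rewrite !big_nat_recr//= cImD IH.
rewrite eR eI; have := H1 n n1; have := H2 n n2; rewrite /= distrC (distrC (limn _)); lra.
Qed.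
End Sequences.

(** * Divisor sums *)

Section DivisorSums.
Variable M : nmodType.

Lemma sum_divisors_exchange (F : nat -> nat -> M) N :
  \sum_(1 <= n < N.+1) \sum_(d <- divisors n) F d n =
  \sum_(1 <= d < N.+1) \sum_(1 <= e < (N %/ d).+1) F d (d * e)%N.
Proof.
transitivity (\sum_(1 <= n < N.+1) \sum_(1 <= d < N.+1 | (d %| n)%N) F d n).
  apply: eq_big_nat => n /andP[n1 nN]; rewrite -[RHS]big_filter; apply: perm_big.
  apply: uniq_perm; [exact: divisors_uniq|by rewrite filter_uniq// iota_uniq|] => d.
  rewrite -dvdn_divisors// mem_filter mem_index_iota.
  have [dn|//] := boolP (d %| n)%N; rewrite (dvdn_gt0 _ dn)//=.
  by rewrite (leq_ltn_trans _ nN)// dvdn_leq.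
rewrite (exchange_big_dep_nat predT)//=; apply: eq_big_nat => d /andP[d1 dN].
rewrite -[LHS]big_filter -[RHS](big_map (muln d) xpredT (F d)); apply: perm_big.
apply: uniq_perm; first by rewrite filter_uniq// iota_uniq.
  by rewrite map_inj_uniq ?iota_uniq// => i j /eqP; rewrite eqn_pmul2l// => /eqP.
move=> n; rewrite mem_filter mem_index_iota; apply/idP/idP.
  move=> /andP[/dvdnP[e ->] /andP[e1 eN]]; rewrite mulnC; apply: map_f.
  rewrite mem_index_iota ltnS leq_divRL//.
  by move: e1 eN; rewrite muln_gt0 ltnS => /andP[-> _] ->.
move=> /mapP[e]; rewrite mem_index_iota ltnS leq_divRL// => /andP[e1 eN] ->.
by rewrite dvdn_mulr// muln_gt0 d1 e1/= ltnS mulnC.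
Qed.
End DivisorSums.

Lemma series1 (V : zmodType) (f : nat -> V) N : series (fun n => f n.+1) N = \sum_(1 <= n < N.+1) f n.
Proof. by rewrite /series /= big_add1. Qed.

(** * Convergence of Lambert series *)

Section LambertSeries.
Variable R : realType.
Local Notation C := (cplx R).
Lemma md_nat (n : nat) : md (n%:R : C) = n%:R.
Proof.
rewrite (_ : n%:R = of_real n%:R :> C) ?md_of_real ?ger0_norm//.
by elim: n => [//|m IH]; rewrite -!natr1 of_realD IH.
Qed.

Lemma md_natX_le (d N k : nat) : (d <= N)%N -> md (d%:R ^+ k : C) <= N.+1%:R ^+ k.
Proof. by move=> dN; rewrite mdX md_nat lerXn2r ?nnegrE// ler_nat ltnW. Qed.

Lemma md_sum_le (a b N : nat) (F : nat -> C) (B : R) : 0 <= B -> (b <= a + N)%N ->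
  (forall d, (a <= d < b)%N -> md (F d) <= B) -> md (\sum_(a <= d < b) F d) <= N%:R * B.
Proof.
move=> B0 bN H; rewrite big_nat; apply: (le_trans (md_sum _ _ _)); rewrite -big_nat.
apply: (@le_trans _ _ (\sum_(a <= d < b) B)); first exact: ler_sum_nat.
rewrite sumr_const_nat -[leLHS]mulr_natl; apply: ler_wpM2r => //.
by rewrite ler_nat leq_subLR.
Qed.

Variable q : C.
Hypothesis q1 : md q < 1.
Local Notation rho := (md q).

Definition lambert_x (d : nat) : C := q ^+ d / (1 - q ^+ d).
Local Notation x := lambert_x.

Lemma md_pow_le d : (0 < d)%N -> rho ^+ d <= rho.
Proof. by case: d => // d _; rewrite exprS ler_piMr ?md_ge0// exprn_ile1 ?md_ge0// ltW. Qed.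

Lemma md_one_sub d : (0 < d)%N -> 1 - rho <= md (1 - q ^+ d).
Proof.
move=> d0; have := md_triangle (1 - q ^+ d) (q ^+ d); rewrite subrK md1 mdX.
have := md_pow_le d0; lra.
Qed.

Lemma one_sub_neq0 d : (0 < d)%N -> 1 - q ^+ d != 0.
Proof. by move=> d0; rewrite -md_gt0 (lt_le_trans _ (md_one_sub d0))// subr_gt0. Qed.

Lemma one_sub_inv d : (0 < d)%N -> md (1 - q ^+ d)^-1 <= (1 - rho)^-1.
Proof.
move=> d0; rewrite mdV lef_pV2 ?posrE; first exact: md_one_sub.
- by rewrite md_gt0 one_sub_neq0.
- by rewrite subr_gt0.
Qed.

Lemma lambert_xM a b : (0 < a)%N -> (0 < b)%N -> x a * x b = x (a + b)%N * (1 + x a + x b).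
Proof.
move=> a0 b0; have := one_sub_neq0 a0; have := one_sub_neq0 b0.
have := @one_sub_neq0 (a + b) (ltn_addr _ a0).
rewrite /x exprD; set u := q ^+ a; set v := q ^+ b => h1 h2 h3.
by field; rewrite h1 h2 h3.
Qed.

Lemma md_lambert_x d : (0 < d)%N -> md (x d) <= (1 - rho)^-1 * rho ^+ d.
Proof.
move=> d0; rewrite /x mdM mdX mulrC; apply: ler_wpM2r; first by rewrite exprn_ge0// md_ge0.
exact: one_sub_inv.
Qed.

Lemma tail_clim0 (e : nat -> nat -> C) (B : R) k : 0 <= B ->
  (forall N d, (0 < d <= N)%N -> md (e N d) <= B * (N.+1%:R ^+ k * rho ^+ N)) ->
  clim (fun N => \sum_(1 <= d < N.+1) e N d) 0.
Proof.
move=> B0 H; apply: geo_clim0.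
have g : geo (fun n => 1 * rho ^+ n) by apply: geo_pow => //; exact: md_ge0.
apply: (@geo_le _ B _ _ B0 _ (geo_natX k.+1 g)) => N.
 have P0 : 0 <= B * (N.+1%:R ^+ k * rho ^+ N).
  by rewrite mulr_ge0// mulr_ge0 ?exprn_ge0 ?md_ge0.
apply: (le_trans (@md_sum_le 1 N.+1 N.+1 (e N) _ P0 _ (H N))); first by rewrite add1n.
by rewrite exprS mul1r mulrCA -[in leRHS]mulrA.
Qed.

(** In the corner [a + b > N], so [x a * x b] is bounded by a multiple of [|q|^N], against at most
    about [N^2] terms of polynomial growth. *)
Lemma corner_clim0 (c : nat -> nat -> C) (B : R) k : 0 <= B ->
  (forall N a b, (a <= N)%N -> (b <= N)%N -> md (c a b) <= B * N.+1%:R ^+ k) ->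
  clim (fun N => \sum_(1 <= a < N.+1) \sum_(N.+1 - a <= b < N.+1) x a * x b * c a b) 0.
Proof.
move=> B0 H; have r0 : 0 <= (1 - rho)^-1 by rewrite invr_ge0 subr_ge0 ltW.
apply: (@tail_clim0 _ ((1 - rho)^-1 ^+ 2 * B) k.+1); first by rewrite mulr_ge0// exprn_ge0.
move=> N a /andP[a1 aN].
have P0 : 0 <= (1 - rho)^-1 ^+ 2 * B * (N.+1%:R ^+ k * rho ^+ N).
  by rewrite !mulr_ge0// exprn_ge0// md_ge0.
have -> : (1 - rho)^-1 ^+ 2 * B * (N.+1%:R ^+ k.+1 * rho ^+ N) =
    N.+1%:R * ((1 - rho)^-1 ^+ 2 * B * (N.+1%:R ^+ k * rho ^+ N)).
  by rewrite [N.+1%:R ^+ k.+1]exprS; move: (N.+1%:R ^+ k) ((1 - rho)^-1) => P Q; ring.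
apply: md_sum_le => //; first by lia.
move=> b /andP[b1 bN]; have b0 : (0 < b)%N by lia.
rewrite !mdM.
have hx : md (x a) * md (x b) <= (1 - rho)^-1 ^+ 2 * rho ^+ N.
  apply: (@le_trans _ _ ((1 - rho)^-1 * rho ^+ a * ((1 - rho)^-1 * rho ^+ b))).
    by apply: ler_pM; rewrite ?md_ge0// md_lambert_x.
  rewrite (_ : _ * _ * (_ * _) = (1 - rho)^-1 ^+ 2 * rho ^+ (a + b)); last by rewrite exprD; ring.
  apply: ler_wpM2l; first exact: exprn_ge0.
  by apply: ler_wiXn2l; rewrite ?md_ge0 ?ltW//; lia.
have := @H N a b aN; rewrite -ltnS => /(_ bN) hc.
apply: (@le_trans _ _ ((1 - rho)^-1 ^+ 2 * rho ^+ N * (B * N.+1%:R ^+ k))).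
  rewrite -!mdM in hx *; rewrite mdM.
  by apply: ler_pM => //; exact: md_ge0.
by rewrite le_eqVlt; apply/orP; left; apply/eqP; ring.
Qed.

Lemma geometric1 (y : C) M : 1 - y != 0 ->
  \sum_(1 <= e < M.+1) y ^+ e = y / (1 - y) - y ^+ M.+1 / (1 - y).
Proof.
move=> y1; elim: M => [|M IH]; first by rewrite big_geq// expr1 subrr.
by rewrite big_nat_recr//= IH [y ^+ M.+2]exprS; field.
Qed.

Lemma geometric2 (y : C) M : 1 - y != 0 ->
  \sum_(1 <= e < M.+1) e%:R * y ^+ e =
  y / (1 - y) * (1 + y / (1 - y)) - y ^+ M.+1 * (M.+1%:R - M%:R * y) / (1 - y) ^+ 2.
Proof.
move=> y1; elim: M => [|M IH]; first by rewrite big_geq// expr1; field.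
by rewrite big_nat_recr//= IH [y ^+ M.+2]exprS -!natr1; field.
Qed.

Lemma sigmaE (r n : nat) : (sigma r n)%:R = \sum_(d <- divisors n) d%:R ^+ r :> C.
Proof. by rewrite /sigma natr_sum; apply: eq_bigr => d _; rewrite natrX. Qed.

Lemma pow_tail N d : (0 < d <= N)%N -> md ((q ^+ d) ^+ (N %/ d).+1) <= rho ^+ N.
Proof.
move=> /andP[d0 dN]; rewrite -exprM mdX; apply: ler_wiXn2l; rewrite ?md_ge0 ?ltW//.
by rewrite mulnC ltnW// ltn_ceil.
Qed.

(** Writing [n = d e], the divisor sum truncates the geometric series of [x d] at [e <= N / d]; the
    remainder starts at an exponent [d e > N]. *)
Lemma lambert_sigma_diff r : clim (fun N => \sum_(1 <= d < N.+1) d%:R ^+ r * x d -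
  series (fun n => (sigma r n.+1)%:R * q ^+ n.+1) N) 0.
Proof.
have r0 : 0 <= (1 - rho)^-1 by rewrite invr_ge0 subr_ge0 ltW.
apply: clim_ext (@tail_clim0 (fun N d => d%:R ^+ r * ((q ^+ d) ^+ (N %/ d).+1 / (1 - q ^+ d))) _ r r0 _); last first.
  move=> N d /[dup] dN /andP[d0 d1]; rewrite !mdM.
  rewrite [leRHS]mulrCA; apply: ler_pM; rewrite ?mulr_ge0 ?md_ge0//.
    by apply: md_natX_le.
  by rewrite mulrC; apply: ler_pM; rewrite ?md_ge0 ?one_sub_inv ?pow_tail.
move=> N; rewrite (series1 (fun n => (sigma r n)%:R * q ^+ n)).
have -> : \sum_(1 <= n < N.+1) (sigma r n)%:R * q ^+ n =
  \sum_(1 <= n < N.+1) \sum_(d <- divisors n) d%:R ^+ r * q ^+ n.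
  by apply: eq_bigr => n _; rewrite sigmaE mulr_suml.
rewrite (sum_divisors_exchange (fun d n => d%:R ^+ r * q ^+ n)) -sumrB.
apply: eq_big_nat => d /andP[d0 dN].
have -> : \sum_(1 <= e < (N %/ d).+1) d%:R ^+ r * q ^+ (d * e) =
  d%:R ^+ r * \sum_(1 <= e < (N %/ d).+1) (q ^+ d) ^+ e.
  by rewrite mulr_sumr; apply: eq_bigr => e _; rewrite exprM.
by rewrite geometric1 ?one_sub_neq0// -mulrBr subKr.
Qed.

Lemma lambert_sigma_deriv_diff r : clim (fun N => \sum_(1 <= d < N.+1) d%:R ^+ r.+1 * (x d * (1 + x d)) -
  series (fun n => n.+1%:R * (sigma r n.+1)%:R * q ^+ n.+1) N) 0.
Proof.
have r0 : 0 <= (1 - rho)^-1 by rewrite invr_ge0 subr_ge0 ltW.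
apply: clim_ext (@tail_clim0 (fun N d => d%:R ^+ r.+1 * ((q ^+ d) ^+ (N %/ d).+1 * ((N %/ d).+1%:R - (N %/ d)%:R * q ^+ d) / (1 - q ^+ d) ^+ 2)) (2 * (1 - rho)^-1 ^+ 2) r.+2 _ _); last first.
- move=> N d /[dup] dN /andP[d0 d1]; rewrite !mdM mdV [md ((_ - _) ^+ 2)]mdX -exprVn -mdV.
  have h1 : md ((N %/ d).+1%:R - (N %/ d)%:R * q ^+ d) <= 2 * N.+1%:R.
    apply: (le_trans (md_triangle _ _)); rewrite mdN mdM.
    have hd : (N %/ d <= N)%N by exact: leq_div.
    have e1 : md ((N %/ d).+1%:R : C) <= N.+1%:R.
      by rewrite md_nat ler_nat.
    have e2 : md ((N %/ d)%:R : C) * md (q ^+ d) <= N.+1%:R.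
      rewrite -[leRHS]mulr1; apply: ler_pM; rewrite ?md_ge0//.
        by have := @md_natX_le (N %/ d) N 1 hd; rewrite !expr1.
      by rewrite mdX exprn_ile1// ?md_ge0// ltW.
    lra.
  have h2 := one_sub_inv d0; have h3 := pow_tail dN.
  have h4 : md (d%:R ^+ r.+1 : C) <= N.+1%:R ^+ r.+1 by apply: md_natX_le.
  have -> : 2 * (1 - rho)^-1 ^+ 2 * (N.+1%:R ^+ r.+2 * rho ^+ N) =
    N.+1%:R ^+ r.+1 * (rho ^+ N * (2 * N.+1%:R) * (1 - rho)^-1 ^+ 2).
    by rewrite [N.+1%:R ^+ r.+2]exprS; move: (N.+1%:R ^+ r.+1) ((1 - rho)^-1) => P Q; ring.
  apply: ler_pM; rewrite ?mulr_ge0 ?md_ge0 ?exprn_ge0 ?md_ge0//.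
  apply: ler_pM; rewrite ?mulr_ge0 ?md_ge0 ?exprn_ge0 ?md_ge0//.
    by apply: ler_pM; rewrite ?md_ge0.
  by rewrite lerXn2r ?nnegrE ?md_ge0.
- by rewrite mulr_ge0// exprn_ge0.
move=> N; rewrite (series1 (fun n => n%:R * (sigma r n)%:R * q ^+ n)).
have -> : \sum_(1 <= n < N.+1) n%:R * (sigma r n)%:R * q ^+ n =
  \sum_(1 <= n < N.+1) \sum_(d <- divisors n) n%:R * q ^+ n * d%:R ^+ r.
  by apply: eq_bigr => n _; rewrite sigmaE mulrAC mulr_sumr.
rewrite (sum_divisors_exchange (fun d n => n%:R * q ^+ n * d%:R ^+ r)) -sumrB.
apply: eq_big_nat => d /andP[d0 dN].
transitivity (d%:R ^+ r.+1 * (x d * (1 + x d)) - d%:R ^+ r.+1 * \sum_(1 <= e < (N %/ d).+1) e%:R * (q ^+ d) ^+ e).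
  by rewrite geometric2 ?one_sub_neq0// -mulrBr subKr.
congr (_ - _); rewrite mulr_sumr; apply: eq_bigr => e _.
by rewrite exprM natrM exprS; ring.
Qed.

Lemma sigma_le r n : (sigma r n.+1 <= n.+1 ^ r.+1)%N.
Proof.
rewrite /sigma; apply: (@leq_trans (\sum_(d <- divisors n.+1) n.+1 ^ r)).
  rewrite big_seq [X in (_ <= X)%N]big_seq; apply: leq_sum => d; rewrite -dvdn_divisors// => dn.
  have dl : (d <= n.+1)%N by rewrite dvdn_leq.
  by elim: (r) => [//|k IH]; rewrite !expnS leq_mul.
rewrite big_const_seq iter_addn_0 count_predT mulnC expnS leq_mul2r; apply/orP; right.
have : {subset divisors n.+1 <= index_iota 1 n.+2}.
  by move=> d; rewrite -dvdn_divisors// mem_index_iota => dn; rewrite (dvdn_gt0 _ dn)//= ltnS dvdn_leq.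
by move=> /(uniq_leq_size (divisors_uniq _)); rewrite size_iota subn1.
Qed.

Lemma sigma_geo r (s : R) k : 0 <= s -> s < 1 ->
  geo (fun n => n.+1%:R ^+ k * (sigma r n.+1)%:R * s ^+ n).
Proof.
move=> s0 s1; have g : geo (fun n => 1 * s ^+ n) by exact: geo_pow.
apply: geo_dom (geo_natX (k + r.+1) g) => n.
rewrite mul1r exprD; apply: ler_wpM2r; first exact: exprn_ge0.
by apply: ler_wpM2l; rewrite ?exprn_ge0// -natrX ler_nat sigma_le.
Qed.

Lemma sigma_clim r k : exists l, clim (series (fun n => n.+1%:R ^+ k * (sigma r n.+1)%:R * q ^+ n.+1)) l.
Proof.
apply: psum_clim; apply: (@geo_le _ rho) (@sigma_geo r rho k (md_ge0 q) q1); first exact: md_ge0.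
move=> n; rewrite !(mdX, mdM) !md_nat exprS; nra.
Qed.

Lemma lambert_sigma r : clim (fun N => \sum_(1 <= d < N.+1) d%:R ^+ r * x d)
  (limn (series (fun n => (sigma r n.+1)%:R * q ^+ n.+1))).
Proof.
have [l hl] := sigma_clim r 0.
have hl' : clim (series (fun n => (sigma r n.+1)%:R * q ^+ n.+1)) l.
  by apply: clim_ext hl => N; rewrite /series /=; apply: eq_bigr => n _; rewrite mul1r.
rewrite (clim_lim hl') -[l]add0r.
by apply: clim_ext (climD (lambert_sigma_diff r) hl') => N; rewrite subrK.
Qed.

Lemma lambert_sigma_deriv r : clim (fun N => \sum_(1 <= d < N.+1) d%:R ^+ r.+1 * (x d * (1 + x d)))
  (limn (series (fun n => n.+1%:R * (sigma r n.+1)%:R * q ^+ n.+1))).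
Proof.
have [l hl'] := sigma_clim r 1.
rewrite (clim_lim hl') -[l]add0r.
by apply: clim_ext (climD (lambert_sigma_deriv_diff r) hl') => N; rewrite subrK.
Qed.
End LambertSeries.

(** * Laurent expansions of Eisenstein series *)

Section LaurentLimits.
Variable R : realType.
Local Notation C := (cplx R).
Local Notation L := (laurent C).
Implicit Types (F G : nat -> L) (f g : L).

(** Coefficientwise convergence with a uniform bound on the pole order; thanks to the bound each
    coefficient of a product is one fixed finite sum, so limits commute with products. *)
Definition lconv F f :=
  (exists m : int, (forall N, lord (F N) m) /\ lord f m) /\
  forall j, clim (fun N => F N j) (f j).

Lemma lconvD F G f g : lconv F f -> lconv G g -> lconv (fun N => F N + G N) (f + g).
Proof.
move=> [[m [Fm fm]] cF] [[n [Gn gn]] cG]; split; last by move=> j; apply: climD.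
exists (Num.min m n); split => [N|].
  by apply: lordD; [apply: lord_le (Fm N)|apply: lord_le (Gn N)]; rewrite ge_min lexx ?orbT.
by apply: lordD; [apply: lord_le fm|apply: lord_le gn]; rewrite ge_min lexx ?orbT.
Qed.

Lemma lconvN F f : lconv F f -> lconv (fun N => - F N) (- f).
Proof.
move=> [[m [Fm fm]] cF]; split; last by move=> j; apply: climN.
by exists m; split=> [N|]; apply: lordN.
Qed.
Lemma lconvB F G f g : lconv F f -> lconv G g -> lconv (fun N => F N - G N) (f - g).
Proof. by move=> H1 H2; apply: lconvD => //; apply: lconvN. Qed.

Lemma lconv_ext F G f : (forall N, F N = G N) -> lconv F f -> lconv G f.
Proof. by move=> /funext ->. Qed.

Lemma lconv_lC (c : nat -> C) l : clim c l -> lconv (fun N => lC (c N)) (lC l).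
Proof.
move=> H; split; first by exists 0; split=> [N|]; apply: lordC.
by move=> j; apply: climM => //; exact: clim_cst.
Qed.
Lemma lconv_cst f : lconv (fun=> f) f.
Proof.
split; last by move=> j; apply: clim_cst.
by have [m Hm] := lcoef_bound f; exists m.
Qed.

Lemma lconv_lD F f : lconv F f -> lconv (fun N => lD (F N)) (lD f).
Proof.
move=> [[m [Fm fm]] cF]; split; last by move=> j; apply: climZ; exact: cF.
by exists (m - 1); split=> [N|]; apply: lord_lD.
Qed.

Lemma lconvM F G f g : lconv F f -> lconv G g -> lconv (fun N => F N * G N) (f * g).
Proof.
move=> [[m [Fm fm]] cF] [[n [Gn gn]] cG]; split.
  by exists (m + n); split=> [N|]; apply: lordM.
move=> j; have [r Hr] := int_seq m (j - n).
have E (a b : L) : lord a m -> lord b n -> (a * b) j = \sum_(i <- undup r) a i * b (j - i).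
  move=> am bn; rewrite lcoefM (fsum_seq (undup_uniq r))// => i h; rewrite mem_undup; apply: Hr.
    by rewrite leNgt; apply/negP => /am e; apply: h; rewrite e mul0r.
  rewrite lerBrDr -lerBrDl leNgt; apply/negP => /bn e; apply: h; rewrite e mulr0//.
rewrite E//; apply: clim_ext (@clim_sum _ _ _ (fun N i => F N i * G N (j - i)) _ _).
  by move=> N; rewrite E.
by move=> i; apply: climM.
Qed.

Lemma lconv_unique F f g : lconv F f -> lconv F g -> f = g.
Proof. by move=> [_ H1] [_ H2]; apply: laurentP => n; exact: clim_unique (H1 n) (H2 n). Qed.
End LaurentLimits.

(** * Heat and Weierstrass equations in the limit *)

Section EisensteinLaurent.
Variable R : realType.
Local Notation C := (cplx R).
Local Notation L := (laurent C).
Local Notation tau := (two_pi_i R).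

(** [2 pi i] times this series is [pi cot(pi z)]. *)
Definition cot_laurent : L := lC 2^-1 * (cw R + 1) * (cx R)^-1.
Local Notation U := cot_laurent.
Definition wpow (d : nat) : L := lexp (tau * d%:R).
Definition wpowN (d : nat) : L := lexp (- (tau * d%:R)).

Lemma wpowD a b : wpow (a + b) = wpow a * wpow b.
Proof. by rewrite /wpow natrD mulrDr lexpD. Qed.
Lemma wpowND a b : wpowN (a + b) = wpowN a * wpowN b.
Proof. by rewrite /wpowN natrD mulrDr opprD lexpD. Qed.
Lemma wpowK a : wpow a * wpowN a = 1.
Proof. by rewrite /wpow /wpowN -lexpD subrr lexp0. Qed.
Lemma wpow0 : wpow 0 = 1. Proof. by rewrite /wpow mulr0 lexp0. Qed.
Lemma wpowN0 : wpowN 0 = 1. Proof. by rewrite /wpowN mulr0 oppr0 lexp0. Qed.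
Lemma wpow1 : wpow 1 = cw R. Proof. by rewrite /wpow mulr1. Qed.
Lemma wpow_unit : wpow 1 - 1 \is a GRing.unit.
Proof. by rewrite wpow1 -cxE cx_unit. Qed.
Lemma U_wpow : lC 2 * U * (wpow 1 - 1) = wpow 1 + 1.
Proof.
rewrite wpow1 -cxE /U mulrA -mulrA mulVr ?cx_unit// mulr1 mulrA -rmorphM divff ?pnatr_eq0//.
by rewrite rmorph1 mul1r.
Qed.
Lemma lD_wpow d : lD (wpow d) = lC (tau * d%:R) * wpow d. Proof. exact: lD_lexp. Qed.
Lemma lD_wpowN d : lD (wpowN d) = - (lC (tau * d%:R) * wpowN d).
Proof. by rewrite /wpowN lD_lexp rmorphN mulNr. Qed.

Local Notation ls := (ls wpow wpowN).
Local Notation lc := (lc wpow wpowN).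

Definition lc_coef (n : nat) : C := (tau ^+ n + (- tau) ^+ n) / (n`!)%:R.
Definition ls_coef (n : nat) : C := (tau ^+ n - (- tau) ^+ n) / (n`!)%:R.

Lemma lcE d (n : nat) : lc d n%:Z = d%:R ^+ n * lc_coef n.
Proof.
rewrite /lc lcoefD /wpow /wpowN /= /fps_expc -mulNr !exprMn /lc_coef.
by ring.
Qed.
Lemma lsE d (n : nat) : ls d n%:Z = d%:R ^+ n * ls_coef n.
Proof.
rewrite /ls lcoefB /wpow /wpowN /= /fps_expc -[- (tau * _)]mulNr !exprMn /ls_coef.
by ring.
Qed.
Lemma lc_neg d j : lc d (Negz j) = 0. Proof. by rewrite /lc lcoefD /= addr0. Qed.
Lemma ls_neg d j : ls d (Negz j) = 0. Proof. by rewrite /ls lcoefB /= subr0. Qed.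
Lemma ls_coef_even n : ~~ odd n -> ls_coef n = 0.
Proof. by move=> on; rewrite /ls_coef exprNn -signr_odd (negbTE on) mul1r subrr mul0r. Qed.
Lemma ls_coef_odd n : odd n -> ls_coef n = 2 * tau ^+ n / (n`!)%:R.
Proof. by move=> on; rewrite /ls_coef exprNn -signr_odd on mulN1r opprK -mulr2n mulr_natl. Qed.

Lemma odd_index n : odd n -> (2 * n.+1./2 - 1 = n)%N /\ (2 * n.+1./2 = n.+1)%N.
Proof. by move=> on; have := odd_double_half n.+1; rewrite /= on /=; lia. Qed.

Lemma eisL_m1 (G : nat -> C) : lord (eisL G) (-1).
Proof. by case=> [//|[//|n]]. Qed.

Variable q : C.
Hypothesis q1 : md q < 1.
Local Notation x := (lambert_x q).

Lemma lord_sum_lc N (m : nat -> C) : lord (\sum_(1 <= d < N.+1) lC (m d) * lc d) 0.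
Proof.
case=> [//|j] _; rewrite lcoef_sum big1// => d _; by rewrite lCM lc_neg mulr0.
Qed.
Lemma lord_sum_ls N (m : nat -> C) : lord (\sum_(1 <= d < N.+1) lC (m d) * ls d) 0.
Proof.
case=> [//|j] _; rewrite lcoef_sum big1// => d _; by rewrite lCM ls_neg mulr0.
Qed.
Lemma sum_lsE N (m : nat -> C) (n : nat) :
  (\sum_(1 <= d < N.+1) lC (m d) * ls d) n%:Z = ls_coef n * \sum_(1 <= d < N.+1) d%:R ^+ n * m d.
Proof.
rewrite lcoef_sum mulr_sumr; apply: eq_bigr => d _; rewrite lCM lsE; ring.
Qed.

Lemma lconv0 (F : nat -> L) : (forall N, lord (F N) 0) ->
  (forall n : nat, clim (fun N => F N n%:Z) 0) -> lconv F 0.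
Proof.
move=> F0 H; split; first by exists 0.
by case=> [n|n]; [exact: H|apply: clim_ext (clim_cst 0) => N; rewrite F0].
Qed.

Local Notation corner := (corner (@lC C) x).

Lemma cornerE N (Y : nat -> nat -> L) n :
  corner N Y n = \sum_(1 <= a < N.+1) \sum_(N.+1 - a <= b < N.+1) x a * x b * Y a b n.
Proof.
rewrite /corner lcoef_sum; apply: eq_bigr => a _; rewrite lcoef_sum.
by apply: eq_bigr => b _; rewrite lCM.
Qed.

Lemma md_natD_le a b N k : (a <= N)%N -> (b <= N)%N ->
  md ((a + b)%:R ^+ k : C) <= 2 ^+ k * N.+1%:R ^+ k.
Proof.
move=> aN bN; rewrite -exprMn mdX md_nat; apply: lerXn2r; rewrite ?nnegrE// ?mulr_ge0//.
by rewrite -natrM ler_nat; lia.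
Qed.

(** The tails [Lhat l] range over [b > N - l], so both parts of the error are corner sums with
    weights polynomial in the indices. *)
Lemma theta_error_conv : lconv (fun N => theta_error (@lC C) wpow wpowN x N) 0.
Proof.
apply: lconv0 => [N|n].
  apply: lordD; last exact: lord_sum_lc.
  case=> [//|j] _; rewrite cornerE big1// => a _; rewrite big1// => b _.
  by rewrite lc_neg mulr0.
rewrite -[0]addr0; apply: clim_ext (climD (@corner_clim0 _ q q1
    (fun a b => (a + b)%:R ^+ n * lc_coef n) (2 ^+ n * md (lc_coef n)) n _ _)
  (@corner_clim0 _ q q1 (fun a b => 2 * (a%:R ^+ n * lc_coef n)) (2 * md (lc_coef n)) n _ _)).
- move=> N; rewrite /theta_error lcoefD cornerE; congr (_ + _).
    by apply: eq_bigr => a _; apply: eq_bigr => b _; rewrite lcE.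
  rewrite lcoef_sum; apply: eq_bigr => a _; rewrite lCM /Lhat lcE mulr_sumr mulr_suml.
  by apply: eq_bigr => b _; ring.
- by rewrite mulr_ge0 ?md_ge0// exprn_ge0.
- move=> N a b aN bN; rewrite mdM mulrAC; apply: ler_wpM2r; first exact: md_ge0.
  exact: md_natD_le.
- by rewrite mulr_ge0 ?md_ge0.
- move=> N a b aN bN; move: (lc_coef n) => kap; rewrite !mdM md_nat -mulrA; apply: ler_wpM2l => //; rewrite mulrC.
  by apply: ler_wpM2l; rewrite ?md_ge0// md_natX_le.
Qed.

Lemma wp_error_conv : lconv (fun N => wp_error (@lC C) wpow wpowN x N) 0.
Proof.
apply: lconv0 => [N|n].
  apply: lordD; last by apply: lordN; exact: lord_sum_lc.
  case=> [//|j] _; rewrite cornerE big1// => a _; rewrite big1// => b _.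
  by rewrite lCM lc_neg !mulr0.
rewrite -[0]subr0; apply: clim_ext (climB (@corner_clim0 _ q q1
    (fun a b => a%:R * b%:R * ((a + b)%:R ^+ n * lc_coef n)) (2 ^+ n * md (lc_coef n)) n.+2 _ _)
  (@corner_clim0 _ q q1 (fun a b => 2 * (b%:R * (b + a)%:R) * (a%:R ^+ n * lc_coef n)) (4 * md (lc_coef n)) n.+2 _ _)).
- move=> N; rewrite /wp_error lcoefB cornerE; congr (_ - _).
    by apply: eq_bigr => a _; apply: eq_bigr => b _; rewrite lCM lcE.
  rewrite lcoef_sum; apply: eq_bigr => a _; rewrite lCM /Ehat lcE mulr_sumr mulr_suml.
  by apply: eq_bigr => b _; rewrite natrD; ring.
- by rewrite mulr_ge0 ?md_ge0// exprn_ge0.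
- move=> N a b aN bN; move: (lc_coef n) => kap; rewrite !mdM !md_nat.
  have h := @md_natD_le a b N n aN bN.
  have ha : a%:R <= N.+1%:R :> R by rewrite ler_nat; lia.
  have hb : b%:R <= N.+1%:R :> R by rewrite ler_nat; lia.
  rewrite -[n.+2]addn2 exprD [leRHS](_ : _ = N.+1%:R * N.+1%:R * ((2 ^+ n * N.+1%:R ^+ n) * md kap)).
    apply: ler_pM; rewrite ?mulr_ge0 ?md_ge0//; first by apply: ler_pM.
    by apply: ler_wpM2r; rewrite ?md_ge0.
  by rewrite expr2; move: (N.+1%:R ^+ n) => P; ring.
- by rewrite mulr_ge0 ?md_ge0.
- move=> N a b aN bN; move: (lc_coef n) => kap; rewrite !mdM !md_nat.
  have h := @md_natX_le R a N n aN.
  have hb : b%:R <= N.+1%:R :> R by rewrite ler_nat; lia.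
  have hc : (b + a)%:R <= 2 * N.+1%:R :> R by rewrite -natrM ler_nat; lia.
  rewrite -[n.+2]addn2 exprD [leRHS](_ : _ = 2 * (N.+1%:R * (2 * N.+1%:R)) * (N.+1%:R ^+ n * md kap)).
    apply: ler_pM; rewrite ?mulr_ge0 ?md_ge0//.
      by apply: ler_wpM2l => //; apply: ler_pM.
    by apply: ler_wpM2r; rewrite ?md_ge0.
  by rewrite expr2; move: (N.+1%:R ^+ n) => P; ring.
Qed.

(** [z k] stands for [2 zeta(2k)], and [Uz] for the expansion of the cotangent, supplied later by
    [cot_zeta]. With these values [eis_value k] is [G_2k] and [eis_deriv k] is [xi G_2k]. *)
Variable z : nat -> C.
Hypothesis Uz : lC tau * U = eisL z.
Definition sigma_sum (r : nat) : C := limn (series (fun n => (sigma r n.+1)%:R * q ^+ n.+1)).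
Definition sigma_dsum (r : nat) : C := limn (series (fun n => n.+1%:R * (sigma r n.+1)%:R * q ^+ n.+1)).
Definition eis_value (k : nat) : C :=
  z k + 2 * tau ^+ (2 * k) / ((2 * k - 1)`!)%:R * sigma_sum (2 * k - 1).
Definition eis_deriv (k : nat) : C :=
  2 * tau ^+ (2 * k) / ((2 * k - 1)`!)%:R * sigma_dsum (2 * k - 1).

Local Notation P_ := (lambert_P (@lC C) wpow wpowN U tau x).
Local Notation X_ := (lambert_X (@lC C) wpow wpowN tau x).

Lemma lambert_P_conv : lconv P_ (eisL eis_value).
Proof.
split.
  exists (-1); split; last exact: eisL_m1.
  move=> N; rewrite /lambert_P mulrBr Uz; apply: lordD; first exact: eisL_m1.
  apply: lordN; rewrite -[-1]add0r; apply: lordM; first exact: lordC.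
  by apply: lord_le (lord_sum_ls _ _).
have E N j : P_ N j = eisL z j - tau * lambert_sum (@lC C) x N ls j.
  by rewrite /lambert_P mulrBr Uz lcoefB lCM.
case=> [n|n]; last first.
  apply: clim_ext (clim_cst _) => N; rewrite E lord_sum_ls// mulr0 subr0.
  by [].
have -> : eisL eis_value n%:Z = eisL z n%:Z - tau * (ls_coef n * sigma_sum n).
  rewrite /= ; case: ifPn => on; last by rewrite ls_coef_even// mul0r mulr0 subrr.
  have [e1 e2] := odd_index on.
  rewrite ls_coef_odd// /eis_value e1 e2 exprS; ring.
apply: clim_ext (climB (clim_cst _) (climZ tau (climZ (ls_coef n) (lambert_sigma q1 n)))) => N.
by rewrite E /lambert_sum sum_lsE.
Qed.

Lemma lambert_X_conv : lconv X_ (eisdL eis_deriv).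
Proof.
split.
  exists 0; split; last by case.
  move=> N n n0; rewrite /lambert_X lcoefN lCM (@lord_sum_ls N (fun l => l%:R * (x l * (1 + x l))))//.
  by rewrite mulr0 oppr0.
case=> [n|n]; last first.
  apply: clim_ext (clim_cst _) => N; rewrite /lambert_X lcoefN lCM lord_sum_ls// mulr0 oppr0.
  by [].
have -> : eisdL eis_deriv n%:Z = - (tau * (ls_coef n * sigma_dsum n)).
  rewrite /= ; case: ifPn => on; last by rewrite ls_coef_even// mul0r mulr0 oppr0.
  have [e1 e2] := odd_index on.
  rewrite ls_coef_odd// /eis_deriv e1 e2 exprS; ring.
apply: clim_ext (climN (climZ tau (climZ (ls_coef n) (lambert_sigma_deriv q1 n)))) => N.
rewrite /lambert_X lcoefN lCM sum_lsE; congr (- (_ * (_ * _))); apply: eq_bigr => d _.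
by rewrite exprSr -mulrA.
Qed.

Lemma eis_heat : lC (tau ^+ 2) * eisdL eis_deriv =
  eisL eis_value * lD (eisL eis_value) + lC 2^-1 * lD (lD (eisL eis_value)).
Proof.
have cP := lambert_P_conv; have cX := lambert_X_conv; have cE := theta_error_conv.
have c1 := lconvD (lconvM cP (lconv_lD cP)) (lconvM (lconv_cst (lC 2^-1)) (lconv_lD (lconv_lD cP))).
have c2 := lconvD (lconvM (lconv_cst (lC (tau ^+ 2))) cX) (lconvM (lconv_cst (lC (tau ^+ 2 / 2))) (lconv_lD cE)).
rewrite raddf0 mulr0 addr0 in c2; apply: (lconv_unique c2); apply: lconv_ext c1 => N.
exact: (@theta_heat _ _ (@lC C) wpow wpowN U (@lD C) tau wpowD wpowND wpowK wpow0 wpowN0 wpow_unit U_wpow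
  (@lDM _) (@lD_C _) lD_wpow lD_wpowN x N (lambert_xM q1)).
Qed.

(** The differentiated identities pass to the limit; [beta] is then the constant of integration. *)
Lemma eis_weierstrass : exists alpha beta : C, let p := - lD (eisL eis_value) in
  p * p = lC 6^-1 * lD (lD p) + lC alpha * p + lC beta.
Proof.
have cP := lambert_P_conv; have cE := wp_error_conv.
have cp := lconvN (lconv_lD cP).
have cS : clim (fun N => tau ^+ 2 * (- 6^-1 + 4 * \sum_(1 <= d < N.+1) d%:R * x d))
   (tau ^+ 2 * (- 6^-1 + 4 * sigma_sum 1)).
  by apply: climZ; apply: climD; [exact: clim_cst|apply: climZ; exact: (lambert_sigma q1 1)].
have c := lconv_lD (lconvB (lconvB (lconvB (lconvM cp cp) (lconvM (lconv_cst (lC 6^-1)) (lconv_lD (lconv_lD cp))))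
  (lconvM (lconv_lC cS) cp)) (lconvM (lconv_cst (lC (tau ^+ 4))) cE)).
have c0 : lconv (fun=> 0 : L) 0 by exact: lconv_cst.
have := lconv_unique c0 (lconv_ext _ c) => /(_ _)/esym.
rewrite mulr0 subr0 => H.
have /lD_eq0 := H (fun N => @lambert_weierstrass _ _ (@lC C) wpow wpowN U (@lD C) tau wpowD wpowND wpowK
  wpow0 wpowN0 wpow_unit U_wpow (@lDM _) (@lD_C _) lD_wpow lD_wpowN x N (lambert_xM q1) (two_pi_i_neq0 R)).
set b := _ 0 => e; exists (tau ^+ 2 * (- 6^-1 + 4 * sigma_sum 1)), b => /=.
by rewrite -e; ring.
Qed.
End EisensteinLaurent.

(** * Zeta values *)

Section BaselProblem.
Variable R : realType.
Implicit Types x y : R.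

Lemma sin_bounds y : 0 < y -> y < pi / 2 -> [/\ 0 < sin y, sin y <= y & y * cos y <= sin y].
Proof.
move=> y0 y1; have ppi := pi_gt0 R.
have [|c /itvP c0y] := @MVT R sin cos 0 y y0.
  by apply: continuous_subspaceT; exact: continuous_sin.
rewrite sin0 !subr0 => e; split.
- by apply: sin_gt0_pihalf; rewrite y0.
- by rewrite e ler_piMl ?cos_le1// ltW.
rewrite e mulrC; apply: ler_wpM2r; first exact: ltW.
have [c0 cy] : 0 < c /\ c < y by rewrite !c0y.
by rewrite ltW// ltr_cos// in_itv /=; lra.
Qed.

(** The upper bound is the square of [y cos y <= sin y], divided by [(y sin y)^2]. *)
Lemma inv_sin_sqr y : 0 < y -> y < pi / 2 ->
  (y ^+ 2)^-1 <= (sin y ^+ 2)^-1 /\ (sin y ^+ 2)^-1 <= 1 + (y ^+ 2)^-1.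
Proof.
move=> y0 y1; have [s0 s1 s2] := sin_bounds y0 y1; split.
  by rewrite lef_pV2 ?posrE ?exprn_gt0// lerXn2r// nnegrE ltW.
rewrite -[X in X <= _]mul1r ler_pdivrMr ?exprn_gt0// mulrDl mul1r.
have : 1 - sin y ^+ 2 <= (y ^+ 2)^-1 * sin y ^+ 2; last by lra.
rewrite mulrC ler_pdivlMr ?exprn_gt0// -cos2sin2 mulrC -exprMn.
have c0 : 0 < cos y by apply: cos_gt0_pihalf; have := pi_gt0 R; lra.
by rewrite lerXn2r// nnegrE ?mulr_ge0 // ltW.
Qed.

Lemma cosec_double y : sin y != 0 ->
  (sin y ^+ 2)^-1 = 4^-1 * ((sin (y / 2) ^+ 2)^-1 + (sin (y / 2 + pi / 2) ^+ 2)^-1).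
Proof.
move=> sy; rewrite sinDpihalf.
have e : sin y = 2 * (cos (y / 2) * sin (y / 2)).
  by rewrite mulr_natl -sin_mulr2n; congr sin; rewrite mulr2n; lra.
move: sy; rewrite e !mulf_eq0 !negb_or => /andP[_ /andP[c0 s0]].
have := cos2Dsin2 (y / 2); move: c0 s0; move: (cos _) (sin _) => c s c0 s0 h.
have -> : (s ^+ 2)^-1 + (c ^+ 2)^-1 = ((c * s) ^+ 2)^-1.
  rewrite -[RHS]mul1r -h; field; rewrite c0 s0//.
by field; rewrite c0 s0.
Qed.

(** Iterate [cosec_double]: the shift by [pi / 2] after halving supplies the second half of the
    indices [k]. *)
Lemma cosec_sum n x : 0 < x -> x < pi ->
  \sum_(k < 2 ^ n) (sin ((x + k%:R * pi) / 2 ^+ n) ^+ 2)^-1 = 4 ^+ n / sin x ^+ 2.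
Proof.
move=> x0 x1; elim: n => [|n IH].
  by rewrite expn0 big_ord1 mul0r addr0 expr0 divr1 mul1r.
rewrite expnS mul2n -addnn big_split_ord /= -big_split /=.
rewrite [4 ^+ n.+1]exprS -mulrA -IH mulr_sumr; apply: eq_bigr => k _.
have p2 : 0 < 2 ^+ n :> R by rewrite exprn_gt0.
have sn : sin ((x + k%:R * pi) / 2 ^+ n) != 0.
  have ppi := pi_gt0 R.
  have k0 : 0 <= k%:R :> R by [].
  have k1 : k%:R + 1 <= 2 ^+ n :> R by rewrite natr1 -natrX ler_nat.
  rewrite gt_eqF// sin_gt0_pi//; apply/andP; split.
    by apply: divr_gt0 => //; nra.
  by rewrite ltr_pdivrMr//; nra.
rewrite (cosec_double sn) mulrA divff ?pnatr_eq0// mul1r.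
have -> : (x + k%:R * pi) / 2 ^+ n / 2 = (x + k%:R * pi) / 2 ^+ n.+1.
  by rewrite exprSr invfM mulrA.
congr (_ + (sin _ ^+ 2)^-1).
rewrite natrD natrX exprS; field; rewrite gt_eqF//.
Qed.

Definition odd_squares (n : nat) : R := \sum_(k < n) ((2 * k%:R + 1) ^+ 2)^-1.

(** [cosec_sum] at [x = pi / 2] evaluates a sum of inverse squared sines at odd multiples of
    [pi / 2^(m+2)]; comparing each with the inverse square of its argument costs at most 1 per
    term. *)
Lemma odd_squares_bounds m :
  pi ^+ 2 / 8 - pi ^+ 2 / 16 * (2 ^+ m)^-1 <= odd_squares (2 ^ m) /\
  odd_squares (2 ^ m) <= pi ^+ 2 / 8.
Proof.
have ppi := pi_gt0 R.
pose y (k : nat) : R := (2 * k%:R + 1) * pi / 2 ^+ m.+2.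
have p2 : 0 < 2 ^+ m :> R by rewrite exprn_gt0.
have := @cosec_sum m.+1 (pi / 2); rewrite sin_pihalf expr1n divr1 => /(_ _ _).
have h1 : 0 < pi / 2 :> R by lra.
have h2 : pi / 2 < pi :> R by lra.
move=> /(_ h1 h2).
have yE k : (pi / 2 + k%:R * pi) / 2 ^+ m.+1 = y k.
  by rewrite /y !exprS; field; rewrite gt_eqF.
rewrite expnS mul2n -addnn big_split_ord /=.
(* Read backwards, the second half of the points is [pi - y j], with the same sines as the first
   half. *)
rewrite [X in _ + X](reindex_inj rev_ord_inj) /=.
have -> : \sum_(j < 2 ^ m) (sin ((pi / 2 + (2 ^ m + (2 ^ m - j.+1))%N%:R * pi) / 2 ^+ m.+1) ^+ 2)^-1 =
   \sum_(j < 2 ^ m) (sin (y j) ^+ 2)^-1.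
  apply: eq_bigr => j _.
  have -> : (pi / 2 + (2 ^ m + (2 ^ m - j.+1))%N%:R * pi) / 2 ^+ m.+1 = pi - y j.
    rewrite natrD natrB// natrX -natr1 /y !exprS; field; rewrite gt_eqF//.
  by rewrite sinB sinpi cospi mul0r sub0r mulN1r opprK.
under [X in X + _ = _ -> _]eq_bigr => k _ do rewrite yE.
set S := \sum_(k < 2 ^ m) _ => eS.
have yk (k : 'I_(2 ^ m)) : 0 < y k /\ y k < pi / 2.
  have k1 : k%:R + 1 <= 2 ^+ m :> R by rewrite natr1 -natrX ler_nat.
  have k0 : 0 <= k%:R :> R by [].
  rewrite /y; split; first by apply: divr_gt0; [apply: mulr_gt0 => //; lra|exact: exprn_gt0].
  rewrite ltr_pdivrMr ?exprn_gt0// !exprS; nra.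
have sE : \sum_(k < 2 ^ m) (y k ^+ 2)^-1 = 16 * (2 ^+ m) ^+ 2 / pi ^+ 2 * odd_squares (2 ^ m).
  rewrite /odd_squares mulr_sumr; apply: eq_bigr => k _; rewrite /y !exprS.
  have k0 : 0 <= k%:R :> R by [].
  by field; rewrite !gt_eqF//; lra.
have lo : \sum_(k < 2 ^ m) (y k ^+ 2)^-1 <= S.
  by apply: ler_sum => k _; have [a b] := yk k; have [] := inv_sin_sqr a b.
have hi : S <= 2 ^+ m + \sum_(k < 2 ^ m) (y k ^+ 2)^-1.
  apply: (@le_trans _ _ (\sum_(k < 2 ^ m) (1 + (y k ^+ 2)^-1))).
    by apply: ler_sum => k _; have [a b] := yk k; have [] := inv_sin_sqr a b.
  by rewrite big_split /= sumr_const card_ord natrX.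
have SE : S = 2 * (2 ^+ m) ^+ 2.
  have e4 : 4 ^+ m = (2 ^+ m) ^+ 2 :> R by rewrite -exprM mulnC exprM; congr (_ ^+ _); ring.
  by move: eS; rewrite exprS e4; lra.
rewrite sE SE in lo hi; move: (odd_squares _) lo hi => O lo hi.
have pp : 0 < pi ^+ 2 :> R by rewrite exprn_gt0.
move: (2 ^+ m : R) p2 lo hi => t t0 lo hi.
have eO : 16 * t ^+ 2 / pi ^+ 2 * O = t ^+ 2 * (16 * O / pi ^+ 2) by ring.
rewrite eO in lo hi.
have t2 : 0 < t ^+ 2 by rewrite exprn_gt0.
have lo' : 16 * O / pi ^+ 2 <= 2 by rewrite -(ler_pM2l t2) [leRHS]mulrC.
have hi' : 2 - t^-1 <= 16 * O / pi ^+ 2.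
  rewrite -(ler_pM2l t2); have -> : t ^+ 2 * (2 - t^-1) = 2 * t ^+ 2 - t by field; rewrite gt_eqF.
  by lra.
rewrite ler_pdivrMr// in lo'; rewrite ler_pdivlMr// in hi'.
by split; nra.
Qed.
End BaselProblem.

(** * Truncated partial fractions of the cotangent *)

Section PartialFractions.
Variables (K : numFieldType) (A : comUnitRingType) (k : {rmorphism K -> A}).
Variables (D : {additive A -> A}) (z : A) (g : nat -> A).
Hypothesis DM : forall f g, D (f * g) = D f * g + f * D g.
Hypothesis Dk : forall c, D (k c) = 0.
Hypothesis uz : z \is a GRing.unit.
Hypothesis Dz : D z = 1.
Hypothesis gE : forall a, (0 < a)%N -> g a * (z ^+ 2 - k (a%:R ^+ 2)) = 1.

Definition harmonic_window (N a : nat) : K := \sum_(N.+1 - a <= j < (N + a).+1) j%:R^-1.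

(** With [0^-1 = 0] the singular term at [b = a] is dropped. The rest is a difference of harmonic
    numbers, and [1/a] is the only index missing from the window. *)
Lemma harmonic_window_sum m a : (0 < a)%N ->
  \sum_(1 <= b < (a + m).+1) ((a%:R - b%:R)^-1 + (a%:R + b%:R)^-1) =
  harmonic_window (a + m) a - a%:R^-1 :> K.
Proof.
move=> a0; rewrite /harmonic_window; elim: m => [|m IH].
  rewrite addn0 subSnn big_split /=.
  rewrite [X in X + _](_ : _ = \sum_(1 <= j < a) j%:R^-1); last first.
    rewrite big_nat_recr//= subrr invr0 addr0 [LHS]big_nat_rev /=.
    by apply: eq_big_nat => j /andP[j1 ja]; congr (_^-1); rewrite add1n subSS natrB ?subKr// ltnW.
  rewrite [X in _ + X](_ : _ = \sum_(a.+1 <= j < (a + a).+1) j%:R^-1); last first.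
    rewrite -[a.+1 in RHS]add1n big_addn (_ : (a + a).+1 - a = a.+1)%N; last by lia.
    by apply: eq_bigr => j _; rewrite natrD addrC.
  rewrite [in RHS](@big_cat_nat _ _ _ a)//=; last by lia.
  by rewrite [X in _ = _ + X - _]big_ltn; [ring|lia].
rewrite addnS big_nat_recr//= IH.
have e1 : ((a + m).+1 - a = m.+1)%N by lia.
have e2 : ((a + m).+2 - a = m.+2)%N by lia.
rewrite e1 e2 [X in X - _ + _]big_ltn; last by lia.
rewrite [X in _ = X - _]big_nat_recr /=; last by lia.
have -> : a%:R - (a + m).+1%:R = - m.+1%:R :> K.
  by rewrite -addnS natrD opprD addrA subrr sub0r.
have -> : a%:R + (a + m).+1%:R = ((a + m).+1 + a)%:R :> K by rewrite natrD addrC.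
rewrite invrN addSn; ring.
Qed.

Lemma sum_inv_sqr_sub N a : (0 < a <= N)%N ->
  \sum_(1 <= b < N.+1) (a%:R ^+ 2 - b%:R ^+ 2)^-1 =
  harmonic_window N a / (2 * a%:R) - 3 / (4 * a%:R ^+ 2) :> K.
Proof.
move=> /andP[a0 aN]; have e := harmonic_window_sum (N - a) a0; rewrite subnKC// in e.
have an : a%:R != 0 :> K by rewrite pnatr_eq0 -lt0n.
transitivity ((2 * a%:R)^-1 * \sum_(1 <= b < N.+1) ((a%:R - b%:R)^-1 + (a%:R + b%:R)^-1) -
   (4 * a%:R ^+ 2)^-1 :> K); last first.
  by rewrite e; field.
have E b : (1 <= b)%N -> (a%:R ^+ 2 - b%:R ^+ 2)^-1 = (2 * a%:R)^-1 * ((a%:R - b%:R)^-1 + (a%:R + b%:R)^-1) -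
    (if b == a then (4 * a%:R ^+ 2)^-1 else 0) :> K.
  move=> b0; have bn : a%:R + b%:R != 0 :> K by rewrite -natrD pnatr_eq0 addn_eq0 negb_and -!lt0n a0.
  case: eqP => [->|/eqP ba]; first by rewrite !subrr invr0 add0r -mulr2n -mulr_natl; field.
  have dn : a%:R - b%:R != 0 :> K by rewrite subr_eq0 eqr_nat eq_sym.
  have d2 : a%:R ^+ 2 - b%:R ^+ 2 != 0 :> K by rewrite subr_sqr mulf_neq0.
  by rewrite subr0 subr_sqr; field; rewrite an bn dn.
rewrite (eq_big_nat _ _ (F2 := fun b => (2 * a%:R)^-1 * ((a%:R - b%:R)^-1 + (a%:R + b%:R)^-1) -
    (if b == a then (4 * a%:R ^+ 2)^-1 else 0))); last by move=> b /andP[b0 _]; exact: E.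
rewrite sumrB -mulr_sumr; congr (_ - _).
rewrite (bigD1_seq a) ?mem_index_iota ?iota_uniq//=; last by rewrite a0 ltnS.
by rewrite eqxx big1 ?addr0// => b /negbTE ->.
Qed.

Definition pole_pair (a : nat) : A := k 2 * z * g a.
Local Notation f := pole_pair.
Definition cot_approx N := z^-1 + \sum_(1 <= a < N.+1) f a.

Lemma D_g a : (0 < a)%N -> D (g a) = - (k 2 * z * g a ^+ 2).
Proof.
move=> a0; have e := gE a0.
have u : z ^+ 2 - k (a%:R ^+ 2) \is a GRing.unit by apply/unitrPr; exists (g a); rewrite mulrC.
have D1 : D 1 = 0 by rewrite -(rmorph1 k) Dk.
have := congr1 D e; rewrite DM raddfB /= Dk subr0 expr2 DM Dz D1 => e2.
apply: (mulIr u).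
have -> : - (k 2 * z * g a ^+ 2) * (z ^+ 2 - k (a%:R ^+ 2)) =
   - (k 2 * z * g a * (g a * (z ^+ 2 - k (a%:R ^+ 2)))) by ring.
rewrite e mulr1 rmorph_nat; apply/eqP; rewrite -addr_eq0 expr2 -e2.
by apply/eqP; ring.
Qed.

Lemma D_inv : D z^-1 = - z^-1 ^+ 2.
Proof.
have D1 : D 1 = 0 by rewrite -(rmorph1 k) Dk.
have := congr1 D (mulVr uz); rewrite DM Dz mulr1 D1 => /eqP; rewrite addr_eq0 => /eqP e.
by apply: (mulIr uz); rewrite e expr2 mulNr -mulrA mulVr// mulr1.
Qed.

(** The cross terms split by [(a^2 - b^2) g_a g_b = g_a - g_b], so everything becomes a combination
    of the [g a]. Its coefficients sum the inverses of [a^2 - b^2] over [b], which [sum_inv_sqr_sub]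
    evaluates; the squares [f a ^ 2] combine with [D (f a)]. *)
Lemma cot_riccati N : D (cot_approx N) + cot_approx N ^+ 2 =
  k 4 * \sum_(1 <= a < N.+1) k (a%:R * harmonic_window N a) * g a.
Proof.
have zg a : (0 < a)%N -> z ^+ 2 * g a = 1 + k (a%:R ^+ 2) * g a.
  by move=> a0; rewrite -(gE a0); ring.
have ff a b : (0 < a)%N -> (0 < b)%N -> f a * f b =
   k 4 * (k (a%:R ^+ 2) * g a - k (b%:R ^+ 2) * g b) * k (a%:R ^+ 2 - b%:R ^+ 2)^-1 +
   (if b == a then f a ^+ 2 else 0).
  move=> a0 b0; case: eqP => [->|/eqP ba]; first by rewrite !subrr mulr0 mul0r add0r expr2.
  rewrite addr0 /f.
  have d2 : a%:R ^+ 2 - b%:R ^+ 2 != 0 :> K.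
    rewrite subr_sqr mulf_neq0//; first by rewrite subr_eq0 eqr_nat eq_sym.
    by rewrite -natrD pnatr_eq0 addn_eq0 negb_and -!lt0n a0.
  have u : k (a%:R ^+ 2 - b%:R ^+ 2) \is a GRing.unit.
    by apply/unitrPr; exists (k (a%:R ^+ 2 - b%:R ^+ 2)^-1); rewrite -rmorphM divff// rmorph1.
  have gg : k (a%:R ^+ 2 - b%:R ^+ 2) * (g a * g b) = g a - g b.
    rewrite rmorphB; transitivity (g a * (g b * (z ^+ 2 - k (b%:R ^+ 2))) - g b * (g a * (z ^+ 2 - k (a%:R ^+ 2)))).
      by ring.
    by rewrite !gE// !mulr1.
  apply: (mulIr u); rewrite -[RHS]mulrA -rmorphM mulVf// rmorph1 mulr1.
  transitivity (k 4 * z ^+ 2 * (k (a%:R ^+ 2 - b%:R ^+ 2) * (g a * g b))).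
    by rewrite !rmorph_nat; ring.
  by rewrite gg -mulrA mulrBr !zg//; ring.
have Df a : (0 < a)%N -> D (f a) + f a ^+ 2 = k 2 * g a.
  move=> a0; rewrite /f !DM Dk D_g// Dz !rmorph_nat; ring.
have zf a : z^-1 * f a = k 2 * g a.
  by rewrite /f mulrA mulrCA mulVr// mulr1.
pose s := \sum_(1 <= a < N.+1) f a; pose G := \sum_(1 <= a < N.+1) k 2 * g a.
have zs : z^-1 * s = G by rewrite /s mulr_sumr; apply: eq_bigr => a _; exact: zf.
pose r a b := k 4 * (k (a%:R ^+ 2) * g a - k (b%:R ^+ 2) * g b) * k (a%:R ^+ 2 - b%:R ^+ 2)^-1 : A.
have s2 : s ^+ 2 = \sum_(1 <= a < N.+1) f a ^+ 2 + \sum_(1 <= a < N.+1) \sum_(1 <= b < N.+1) r a b.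
  rewrite expr2 mulr_suml -big_split; apply: eq_big_nat => a /andP[a0 aN] /=.
  rewrite mulr_sumr (eq_big_nat _ _ (F2 := fun b => (if b == a then f a ^+ 2 else 0) + r a b)); last first.
    by move=> b /andP[b0 bN]; rewrite ff// addrC.
  rewrite big_split /=; congr (_ + _).
  rewrite (bigD1_seq a) ?mem_index_iota ?iota_uniq ?a0//= eqxx big1 ?addr0// => b /negbTE->//.
pose R1 a : A := \sum_(1 <= b < N.+1) k (a%:R ^+ 2) * g a * k (a%:R ^+ 2 - b%:R ^+ 2)^-1.
have rr : \sum_(1 <= a < N.+1) \sum_(1 <= b < N.+1) r a b = k 8 * \sum_(1 <= a < N.+1) R1 a.
  transitivity (\sum_(1 <= a < N.+1) \sum_(1 <= b < N.+1)
      (k 4 * (k (a%:R ^+ 2) * g a * k (a%:R ^+ 2 - b%:R ^+ 2)^-1)) +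
     \sum_(1 <= a < N.+1) \sum_(1 <= b < N.+1)
      (k 4 * (k (b%:R ^+ 2) * g b * k (b%:R ^+ 2 - a%:R ^+ 2)^-1))).
    rewrite -big_split; apply: eq_bigr => a _; rewrite -big_split; apply: eq_bigr => b _ /=.
    rewrite /r -[(b%:R ^+ 2 - _)]opprB invrN [k (- _)]rmorphN; ring.
  rewrite [X in _ + X]exchange_big /= -mulr2n.
  have -> : \sum_(1 <= a < N.+1) \sum_(1 <= b < N.+1) (k 4 * (k (a%:R ^+ 2) * g a * k (a%:R ^+ 2 - b%:R ^+ 2)^-1)) =
      k 4 * \sum_(1 <= a < N.+1) R1 a.
    by rewrite mulr_sumr; apply: eq_bigr => a _; rewrite mulr_sumr.
  by rewrite !rmorph_nat; ring.
have Ds : D s + \sum_(1 <= a < N.+1) f a ^+ 2 = G.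
  by rewrite raddf_sum -big_split; apply: eq_big_nat => a /andP[a0 _]; exact: Df.
have -> : D (cot_approx N) + cot_approx N ^+ 2 = 3 * G + k 8 * \sum_(1 <= a < N.+1) R1 a.
  rewrite /cot_approx -/s raddfD /= D_inv sqrrD s2 rr zs.
  by move: Ds; set S := \sum_(1 <= a < N.+1) f a ^+ 2 => <-; rewrite mulr2n; ring.
rewrite /G !mulr_sumr -big_split; apply: eq_big_nat => a /andP[a0 aN] /=.
have an : a%:R != 0 :> K by rewrite pnatr_eq0 -lt0n.
rewrite /R1 -mulr_sumr -rmorph_sum sum_inv_sqr_sub ?a0//.
transitivity (k (6 + 8 * (a%:R ^+ 2 * (harmonic_window N a / (2 * a%:R) - 3 / (4 * a%:R ^+ 2)))) * g a).
  by rewrite rmorphD !rmorphM !rmorph_nat /=; ring.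
by rewrite [RHS]mulrA -rmorphM; congr (k _ * _); field.
Qed.
End PartialFractions.

(** * Uniqueness for the Riccati equation *)

Section RiccatiUniqueness.
Variable K : numFieldType.
Local Notation L := (laurent K).

(** The difference satisfies [E' = - (Y + Z) E] with [Y + Z = 2/z + ...]; if [E] has order at least
    [m], comparing coefficients gives [(m + 2) E_m = 0]. *)
Lemma riccati_unique (Y Z : L) (c : K) : lord Y (-1) -> lord Z (-1) ->
  Y (-1) = 1 -> Z (-1) = 1 -> lD Y = lC c - Y * Y -> lD Z = lC c - Z * Z -> Y = Z.
Proof.
move=> Yo Zo Y1 Z1 dY dZ; apply/eqP; rewrite -subr_eq0; apply/eqP.
set E := Y - Z; set S := Y + Z.
have So : lord S (-1) by apply: lordD.
have S1 : S (-1) = 2 by rewrite lcoefD Y1 Z1.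
have dE : lD E = - (S * E) by rewrite raddfB /= dY dZ /S /E; ring.
suff H (m : nat) : lord E m%:Z.
  by apply: laurentP => -[n|n]; [apply: (H n.+1); rewrite ltz_nat|exact: (H 0%N)].
elim: m => [|m IH].
  move=> n n0.
  have [n1|n1] := ltP n (-1); first by rewrite lcoefB Yo// Zo// subr0.
  have -> : n = -1 by lia.
  by rewrite lcoefB Y1 Z1 subrr.
move=> n nm; have [/IH//|mn] := ltP n m%:Z.
have {mn nm} -> : n = m%:Z by lia.
have := congr1 (fun f : L => f (m%:Z - 1)) dE.
rewrite lcoef_lD subrK lcoefN lcoefM (@fsum_delta _ _ _ (-1)); last first.
  move=> i i1; have [/So ->|Hi] := ltP i (-1); first by rewrite mul0r.
  by rewrite (IH (m%:Z - 1 - i)) ?mulr0//; lia.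
rewrite S1 opprK subrK => /eqP; rewrite -addr_eq0 -mulrDl mulf_eq0.
rewrite (_ : m%:~R + 2 = m.+2%:R :> K); last by rewrite -!natr1; ring.
by rewrite pnatr_eq0 => /eqP.
Qed.
End RiccatiUniqueness.

(** * The Laurent expansion of the cotangent *)

Section Zeta.
Variable R : realType.
Local Notation C := (cplx R).
Local Notation L := (laurent C).
Local Notation tau := (two_pi_i R).

Lemma zeta_cvg s : (2 <= s)%N -> cvgn (series (fun n : nat => (n.+1%:R ^+ s)^-1 : R)).
Proof.
move=> s2; apply: nondecreasing_is_cvgn.
  by apply: nondecreasing_series => n _ _ /=; rewrite invr_ge0 exprn_ge0.
exists 2 => _ [n _ <-].
suff H (m : nat) : series (fun n : nat => (n.+1%:R ^+ s)^-1 : R) m.+1 <= 2 - m.+1%:R^-1.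
  case: n => [|n]; first by rewrite /series /= big_geq.
  by apply: (le_trans (H n)); rewrite lerBlDr lerDl invr_ge0.
elim: m => [|m IH]; first by rewrite /series /= big_nat1 expr1n !invr1; lra.
rewrite seriesS; apply: (@le_trans _ _ ((m.+2%:R ^+ 2)^-1 + (2 - m.+1%:R^-1))).
  apply: lerD => //; rewrite lef_pV2 ?posrE ?exprn_gt0//; apply: ler_weXn2l => //.
  by rewrite ler1n.
have m1 : 0 < m.+1%:R :> R by [].
rewrite -[m.+2%:R]natr1; move: (m.+1%:R : R) m1 => x x0.
have -> : ((x + 1) ^+ 2)^-1 + (2 - x^-1) = 2 - (x + 1)^-1 - (x * (x + 1) ^+ 2)^-1.
  by field; rewrite !gt_eqF//; lra.
rewrite lerBlDr lerDl invr_ge0 mulr_ge0 ?exprn_ge0//; lra.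
Qed.

Lemma of_real_nat (n : nat) : of_real n%:R = n%:R :> C.
Proof. by elim: n => [//|n IH]; rewrite -!natr1 of_realD IH. Qed.
Lemma of_realV (x : R) : of_real x^-1 = (of_real x)^-1 :> C.
Proof.
have [->|x0] := eqVneq x 0; first by rewrite !invr0.
have cx : of_real x != 0 :> C by apply/eqP => -[] /eqP; rewrite (negbTE x0).
by apply: (mulfI cx); rewrite -of_realM !divff.
Qed.
Lemma of_realX (x : R) n : of_real (x ^+ n) = of_real x ^+ n :> C.
Proof. by elim: n => [//|n IH]; rewrite !exprS of_realM IH. Qed.
Lemma of_real_sum (I : Type) (s : seq I) (F : I -> R) :
  of_real (\sum_(i <- s) F i) = \sum_(i <- s) of_real (F i) :> C.
Proof. by elim: s => [|i s IH]; rewrite ?big_nil// !big_cons of_realD IH. Qed.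

Lemma zeta_clim s : (2 <= s)%N ->
  clim (fun N => \sum_(1 <= a < N.+1) (a%:R ^+ s)^-1) (of_real (zeta R s) : C).
Proof.
move=> s2; have := zeta_cvg s2 => /clim_of_real; apply: clim_ext => N.
rewrite (series1 (fun n : nat => (n%:R ^+ s)^-1 : R)) of_real_sum.
by apply: eq_bigr => a _; rewrite of_realV of_realX of_real_nat.
Qed.

Lemma clim_subseq (u : nat -> C) (l : C) (s : nat -> nat) : (forall n, (n <= s n)%N) ->
  clim u l -> clim (fun n => u (s n)) l.
Proof.
by move=> ss H e /H[N HN]; exists N => n Nn; apply: HN; apply: leq_trans (ss n).
Qed.

(** Odd and even terms give [zeta(2) = pi^2/8 + zeta(2)/4]. The limits are taken along [2^m], where
    [odd_squares] is controlled. *)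
Lemma zeta2 : zeta R 2 = pi ^+ 2 / 6.
Proof.
pose u : nat -> R := fun n => (n.+1%:R ^+ 2)^-1.
have split M : series u (M + M)%N = odd_squares R M + 4^-1 * series u M.
  rewrite /series /odd_squares /= !big_mkord.
  elim: M => [|M IH]; first by rewrite !big_ord0 mulr0 addr0.
  rewrite addnS addSn !big_ord_recr /= IH /u.
  have -> : (M + M).+1%:R = 2 * M%:R + 1 :> R by rewrite -natr1 natrD; ring.
  have -> : (M + M).+2%:R = 2 * M.+1%:R :> R by rewrite -!natr1 natrD; ring.
  have -> : ((2 * M.+1%:R) ^+ 2)^-1 = 4^-1 * (M.+1%:R ^+ 2)^-1 :> R.
    have m0 : M.+1%:R != 0 :> R by rewrite pnatr_eq0.
    by move: (M.+1%:R : R) m0 => x x0; field.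
  ring.
have cu : clim (fun n => of_real (series u n)) (of_real (zeta R 2) : C).
  by apply: clim_of_real; exact: zeta_cvg.
have n2 n : (n <= 2 ^ n)%N by exact/ltnW/ltn_expl.
have c1 : clim (fun m => of_real (series u (2 ^ m + 2 ^ m)%N)) (of_real (zeta R 2) : C).
  by apply: (@clim_subseq _ _ (fun m => 2 ^ m + 2 ^ m)%N) cu => n; apply: leq_trans (n2 n) (leq_addr _ _).
have c2 : clim (fun m => of_real (series u (2 ^ m)%N)) (of_real (zeta R 2) : C).
  exact: (@clim_subseq _ _ (fun m => 2 ^ m)%N) cu.
have c3 : clim (fun m => of_real (odd_squares R (2 ^ m))) (of_real (pi ^+ 2 / 8) : C).
  move=> e e0; have p16 : 0 <= pi ^+ 2 / 16 :> R by rewrite divr_ge0// exprn_ge0// pi_ge0.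
  have : geo (fun m => pi ^+ 2 / 16 * 2^-1 ^+ m : R) by apply: geo_pow; lra.
  move=> g; have : clim (fun m => of_real (pi ^+ 2 / 16 * 2^-1 ^+ m) : C) 0.
    apply: geo_clim0; apply: geo_dom g => n; rewrite md_of_real ger0_norm//.
    by rewrite mulr_ge0// exprn_ge0.
  move=> /(_ e e0)[N HN]; exists N => n Nn; apply: le_lt_trans (HN n Nn).
  rewrite subr0 -of_realN -of_realD !md_of_real.
  have [lo hi] := odd_squares_bounds R n; rewrite ler_norml.
  have P0 : 0 <= pi ^+ 2 / 16 * (2 ^+ n)^-1 :> R by rewrite mulr_ge0// invr_ge0 exprn_ge0.
  by rewrite exprVn ger0_norm//; apply/andP; split; lra.
have := clim_unique c1 (clim_ext _ (climD c3 (climZ (of_real 4^-1) c2))) => /(_ _)H.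
have /of_real_inj : of_real (zeta R 2) = of_real (pi ^+ 2 / 8 + 4^-1 * zeta R 2) :> C.
  by rewrite of_realD [of_real (4^-1 * _)]of_realM; apply: H => m; rewrite split of_realD of_realM.
by lra.
Qed.

(** The expansion of [1 / (z^2 - a^2)] at 0. *)
Definition inv_sqr_sub (a : nat) : L := lfps (fun n => if odd n then 0 else - (a%:R ^+ (n + 2))^-1).

Lemma inv_sqr_subE a (n : nat) : inv_sqr_sub a n%:Z = if odd n then 0 else - (a%:R ^+ (n + 2))^-1.
Proof. by []. Qed.

Lemma inv_sqr_subM a : (0 < a)%N -> inv_sqr_sub a * (lX C 1 ^+ 2 - lC (a%:R ^+ 2)) = 1.
Proof.
move=> a0; have an : a%:R != 0 :> C by rewrite pnatr_eq0 -lt0n.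
rewrite mulrC mulrBl expr2 -lXD; apply: laurentP => n.
rewrite lcoefB lXM lCM lcoef1; case: n => [[|[|n]]|n].
- by rewrite inv_sqr_subE /= sub0r mulrN opprK divff// expf_neq0.
- by rewrite inv_sqr_subE /= mulr0 subr0.
- rewrite (_ : n.+2%:Z - (1 + 1) = n%:Z); last by lia.
  rewrite !inv_sqr_subE /= negbK; case: (odd n); first by rewrite mulr0 subr0.
  rewrite mulrN opprK -[n.+2]addn2 [_ ^+ (n + 2 + 2)]exprD invfM mulrCA divff ?mulr1 ?addNr//.
  by rewrite expf_neq0.
- by rewrite /= mulr0 subr0; case: n => [|n].
Qed.

Lemma lD_lX1 : lD (lX C 1) = 1.
Proof. by rewrite lD_X mulr1z lC1 mul1r subrr lX0. Qed.

Definition zeta_coef (k : nat) : C := 2 * of_real (zeta R (2 * k)).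
Local Notation Z_ := (cot_approx (@lC C) (lX C 1) inv_sqr_sub).

Lemma lX1V : (lX C 1)^-1 = lX C (-1).
Proof.
by apply: (mulIr (lX_unit C 1)); rewrite mulVr ?lX_unit// -lXD addNr lX0.
Qed.

Lemma cot_approxE N (n : int) : Z_ N n = (n == -1)%:R +
  2 * \sum_(1 <= a < N.+1) inv_sqr_sub a (n - 1).
Proof.
rewrite /cot_approx lX1V lcoefD /= mul1r; congr (_ + _).
rewrite lcoef_sum mulr_sumr; apply: eq_bigr => a _.
by rewrite /pole_pair -mulrA lCM lXM.
Qed.

Lemma cot_approx_conv : lconv Z_ (eisL zeta_coef).
Proof.
split.
  exists (-1); split; last exact: eisL_m1.
  move=> N n n1; rewrite cot_approxE lt_eqF// add0r big1 ?mulr0// => a _.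
  by apply: lord_lfps; lia.
case=> [n|n]; last first.
  apply: clim_ext (clim_cst _) => N; rewrite cot_approxE.
  by rewrite big1 ?mulr0 ?addr0; [case: n|move=> a _; apply: lord_lfps; lia].
have -> : eisL zeta_coef n%:Z = if odd n then - zeta_coef n.+1./2 else 0 by [].
case: ifPn => on.
  have [e1 e2] := odd_index on.
  rewrite /zeta_coef e2 -mulrN; apply: clim_ext (climZ 2 (climN (@zeta_clim n.+1 _))).
    move=> N; rewrite cot_approxE add0r -sumrN; congr (_ * _); apply: eq_bigr => a _.
    case: n on e1 e2 => [//|n] on _ _.
    rewrite (_ : n.+1%:Z - 1 = n%:Z); last by lia.
    by rewrite inv_sqr_subE; move: on => /= /negbTE ->; rewrite addn2.
  by case: n on e1 e2.
apply: clim_ext (clim_cst _) => N; rewrite cot_approxE add0r big1 ?mulr0// => a _.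
case: n on => [|n] on; first by apply: lord_lfps; lia.
rewrite (_ : n.+1%:Z - 1 = n%:Z); last by lia.
by rewrite inv_sqr_subE; move: on => /=; rewrite negbK => ->.
Qed.

Lemma harmonic_window_le N a : (0 < a <= N)%N ->
  md (harmonic_window C N a) <= 2 * a%:R * (N.+1 - a)%:R^-1.
Proof.
move=> /andP[a0 aN]; have n0 : (0 < N.+1 - a)%N by lia.
have -> : 2 * a%:R * (N.+1 - a)%:R^-1 = (a + a)%:R * (N.+1 - a)%:R^-1 :> R by rewrite natrD mulrDl mul1r.
apply: md_sum_le; [by rewrite invr_ge0|by lia|].
move=> j /andP[j0 j1]; rewrite mdV md_nat lef_pV2 ?posrE ?ltr0n//; last by lia.
by rewrite ler_nat.
Qed.

Lemma sum_inv_rev N : \sum_(1 <= a < N.+1) (N.+1 - a)%:R^-1 = \sum_(1 <= a < N.+1) a%:R^-1 :> R.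
Proof. by rewrite [RHS]big_nat_rev; apply: eq_big_nat => a /andP[a1 aN]; rewrite add1n subSS. Qed.

(** For [m >= 1] the term is at most [2 / (a (N + 1 - a))], that is [2 / (N + 1)] times
    [1/a + 1/(N + 1 - a)], and the sum is of the order of [log N / N]. The coefficient [m = 0] is
    excluded: it tends to a nonzero constant. *)
Lemma cot_error_clim m : (0 < m)%N ->
  clim (fun N => \sum_(1 <= a < N.+1) a%:R * harmonic_window C N a * (a%:R ^+ (m + 2))^-1) 0.
Proof.
move=> m0 e e0.
have e40 : 0 < e / 4 by lra.
(* Harmonic numbers divided by their index tend to 0, as Cesaro means of [1/n]. *)
have := cesaro (@cvg_harmonic R) => /cvgr0Pnorm_lt /(_ _ e40)[M _ HM].
exists M => N MN; rewrite subr0; have := HM N MN; rewrite /arithmetic_mean /=.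
set H := series _ _ => hH.
have H0 : 0 <= H by rewrite /H /series /=; apply: sumr_ge0 => i _; rewrite /harmonic/= invr_ge0.
rewrite ger0_norm ?mulr_ge0 ?invr_ge0// in hH.
have Hs : \sum_(1 <= a < N.+1) a%:R^-1 <= H.
  rewrite /H (series1 (fun n : nat => n%:R^-1 : R)) [leRHS]big_nat_recr//=.
  by rewrite lerDl invr_ge0.
apply: (@le_lt_trans _ _ (\sum_(1 <= a < N.+1) 2 * (N.+1%:R^-1 * (a%:R^-1 + (N.+1 - a)%:R^-1)))).
  rewrite big_nat; apply: (le_trans (md_sum _ _ _)); rewrite -big_nat.
  apply: ler_sum_nat => a /andP[a0 aN].
  have an : a%:R != 0 :> R by rewrite pnatr_eq0 -lt0n.
  have bn : (N.+1 - a)%:R != 0 :> R by rewrite pnatr_eq0; lia.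
  have Nn : N.+1%:R != 0 :> R by rewrite pnatr_eq0.
  have -> : 2 * (N.+1%:R^-1 * (a%:R^-1 + (N.+1 - a)%:R^-1)) = 2 * a%:R * (N.+1 - a)%:R^-1 * (a%:R ^+ 2)^-1 :> R.
    have : a%:R + (N.+1 - a)%:R = N.+1%:R :> R by rewrite -natrD subnKC// ltnW.
    move: Nn an bn; move: (a%:R) ((N.+1 - a)%:R) (N.+1%:R : R) => x y s s0 x0 y0 e1.
    by rewrite -e1; field; rewrite x0 y0 e1 s0.
  rewrite !mdM mdV mdX !md_nat mulrAC.
  have h := @harmonic_window_le N a; rewrite a0 -ltnS aN in h; have {}h := h isT.
  rewrite mulrC; apply: ler_pM => //; rewrite ?md_ge0 ?mulr_ge0 ?invr_ge0 ?exprn_ge0//.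
  rewrite (_ : m + 2 = m.-1 + 2 + 1)%N; last by lia.
  rewrite exprD expr1 invfM mulrCA divff// mulr1 lef_pV2 ?posrE ?exprn_gt0 ?ltr0n//.
  by apply: ler_weXn2l; [rewrite ler1n|lia].
rewrite -mulr_sumr -mulr_sumr big_split /= sum_inv_rev.
apply: (@le_lt_trans _ _ (4 * (N.+1%:R^-1 * H))); last first.
  by move: hH; move: (_ * H) => p; lra.
have Ni : 0 <= N.+1%:R^-1 :> R by rewrite invr_ge0.
have := ler_wpM2l Ni Hs; rewrite mulrDr; move: (_ * \sum_(_ <= _ < _) _) (_ * H) => p1 p2; lra.
Qed.

Definition cot_error N : L := lC 4 * \sum_(1 <= a < N.+1) lC (a%:R * harmonic_window C N a) * inv_sqr_sub a.

(** The derivative is taken because the constant coefficient of [cot_error] does not tend to 0. *)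
Lemma cot_error_conv : lconv (fun N => lD (cot_error N)) 0.
Proof.
have E N n : cot_error N n = 4 * \sum_(1 <= a < N.+1) a%:R * harmonic_window C N a * inv_sqr_sub a n.
  rewrite /cot_error lCM lcoef_sum; congr (_ * _); apply: eq_bigr => a _; by rewrite lCM.
apply: lconv0 => [N n n0|n].
  rewrite lcoef_lD E; have [n1|n1] := ltP n (-1).
    rewrite big1 ?mulr0// => a _; rewrite lord_lfps ?mulr0//; lia.
  by rewrite (_ : n = -1) ?addNr ?mul0r//; lia.
have -> : (0 : C) = (n%:Z + 1)%:~R * (4 * - 0) by rewrite oppr0 !mulr0.
have [on|on] := boolP (odd n.+1).
  rewrite oppr0 !mulr0; apply: clim_ext (clim_cst 0) => N; rewrite lcoef_lD E big1 ?mulr0// => a _.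
  by rewrite (_ : n%:Z + 1 = n.+1%:Z) ?inv_sqr_subE ?on ?mulr0//; lia.
apply: clim_ext (climZ _ (climZ 4 (climN (@cot_error_clim n.+1 isT)))) => N.
rewrite lcoef_lD E; congr (_ * (_ * _)); rewrite -sumrN; apply: eq_bigr => a _.
by rewrite (_ : n%:Z + 1 = n.+1%:Z) ?inv_sqr_subE ?(negbTE on) ?mulrN//; lia.
Qed.

Lemma two_pi_i_sqr : tau ^+ 2 = - of_real (4 * pi ^+ 2) :> C.
Proof.
apply/eqP; rewrite expr2 eq_complex cReM cImM /=; apply/andP; split; apply/eqP; ring.
Qed.

(** In the limit [Z' + Z^2] is constant. *)
Lemma zeta_riccati : lD (eisL zeta_coef) = lC (tau ^+ 2 / 4) - eisL zeta_coef * eisL zeta_coef.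
Proof.
set Z := eisL zeta_coef; have cZ : lconv Z_ Z := cot_approx_conv.
have c1 := lconv_lD (lconvD (lconv_lD cZ) (lconvM cZ cZ)).
have /lD_eq0 e : lD (lD Z + Z * Z) = 0.
  apply: (lconv_unique c1); apply: lconv_ext cot_error_conv => N; congr lD.
  rewrite /cot_error -(@cot_riccati _ _ (@lC C) (@lD C) (lX C 1) inv_sqr_sub (@lDM _) (@lD_C _)
    (lX_unit C 1) lD_lX1 inv_sqr_subM N).
  by rewrite expr2.
(* The constant is [- 6 zeta(2)]: the coefficient of [z] contributes once through the derivative and
   twice through its product with the pole. *)
have -> : tau ^+ 2 / 4 = (lD Z + Z * Z) 0.
  rewrite lcoefD lcoef_lD lcoefM (@fsum_seq _ _ [:: -1; 0; 1])//; last first.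
    move=> i h; have [i1|i1] := ltP i (-1).
      by exfalso; apply: h; rewrite (@eisL_m1 _ zeta_coef)// mul0r.
    have [i2|i2] := ltP 1 i; last by rewrite !inE; lia.
    by exfalso; apply: h; rewrite (@eisL_m1 _ zeta_coef (0 - i)) ?mulr0//; lia.
  rewrite !big_cons big_nil /= /zeta_coef muln1 zeta2 two_pi_i_sqr.
  have -> : pi ^+ 2 / 6 = 4 * pi ^+ 2 / 24 :> R by field.
  rewrite [of_real (4 * _ / 24)]of_realM of_realV of_real_nat; move: (of_real (4 * _)) => x.
  by rewrite !mulr0 !add0r addr0; field.
by rewrite -e addrK.
Qed.

(** Both series have the polar part [1/z] and satisfy the Riccati equation with constant
    [tau^2 / 4], by [D_U] and [zeta_riccati]. *)
Lemma cot_zeta : lC tau * cot_laurent R = eisL zeta_coef.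
Proof.
have t0 := two_pi_i_neq0 R.
have UE : lC tau * cot_laurent R = lX C (-1) * (lC (tau / 2) * (cw R + 1) * (cc R)^-1).
  rewrite /cot_laurent /cx invrM ?lX_unit ?cc_unit// lX1V rmorphM; ring.
have cco : lord (cc R)^-1 0.
  by rewrite /cc -lfps_invE ?fps_coord0_neq0//; exact: lord_lfps.
have co : lord (lC (tau / 2) * (cw R + 1)) 0.
  apply: (@lordM _ _ _ 0 0); first exact: lordC.
  by apply: lordD; [exact: lord_lfps|rewrite -lC1; exact: lordC].
have V0 : (lC (tau / 2) * (cw R + 1) * (cc R)^-1) 0 = 1.
  rewrite lcoef0M// lCM lcoefD lcoef1 /cc -lfps_invE ?fps_coord0_neq0//=.
  rewrite /fps_inv /fps_expc big_ord1 /= /fps_one eqxx fps_coord0 expr0 fact0 !divr1 mulr1.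
  by field.
apply: (@riccati_unique _ _ _ (tau ^+ 2 / 4)).
- by rewrite UE -[-1]addr0; apply: lordM; [exact: (@lord_mono _ 1 (-1))|rewrite -[0]addr0; apply: (@lordM _ _ _ 0 0)].
- exact: eisL_m1.
- by rewrite UE lXM subrr V0.
- by [].
- rewrite lDZ (@D_U _ _ (@lC C) (@wpow R) (cot_laurent R) (@lD C) tau (wpow_unit R) (U_wpow R) (@lDM _)
    (@lD_C _) (@lD_wpow R)).
  by rewrite rmorphM rmorphXn /=; ring.
- exact: zeta_riccati.
Qed.
End Zeta.

(** * Derivatives of Eisenstein series *)

Section ComplexExponential.
Variable R : realType.
Local Notation C := (cplx R).
Local Notation tau := (two_pi_i R).

Lemma cdiff_comp (f g : C -> C) (t l m : C) : cdiff f (g t) m -> cdiff g t l ->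
  cdiff (fun z => f (g z)) t (m * l).
Proof.
move=> Hf Hg e e0; have [M M0 HM] : exists2 M : R, 0 < M & md l + 1 <= M.
  by exists (md l + 1); rewrite ?ltr_wpDl ?md_ge0.
pose e1 := e / 2 / M; have e10 : 0 < e1 by rewrite !divr_gt0.
have M1 : 0 < md m + 1 by rewrite ltr_wpDl ?md_ge0.
pose e2 := Num.min 1 (e / 2 / (md m + 1)).
have e20 : 0 < e2 by rewrite lt_min ltr01 !divr_gt0.
have [d1 d10 H1] := Hf e1 e10; have [d2 d20 H2] := Hg e2 e20.
have lip z : md (z - t) < d2 -> md (g z - g t) <= M * md (z - t).
  move=> /H2 h; have e21 : e2 <= 1 by rewrite ge_min lexx.
  have := md_triangle (g z - g t - l * (z - t)) (l * (z - t)); rewrite subrK mdM => h3.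
  have := md_ge0 (z - t); move: (md (z - t)) h h3 => w h h3 w0; nra.
exists (Num.min d2 (d1 / M)); first by rewrite lt_min d20 divr_gt0.
move=> z; rewrite lt_min => /andP[z2 z1].
have := lip z z2 => hl.
have hg : md (g z - g t) < d1.
  by apply: (le_lt_trans hl); rewrite mulrC -ltr_pdivlMr.
have := H1 _ hg; have := H2 _ z2 => h2 h1.
have -> : f (g z) - f (g t) - m * l * (z - t) =
   (f (g z) - f (g t) - m * (g z - g t)) + m * (g z - g t - l * (z - t)) by ring.
apply: (le_trans (md_triangle _ _)); rewrite mdM.
have w0 := md_ge0 (z - t).
have a1 : md (f (g z) - f (g t) - m * (g z - g t)) <= e / 2 * md (z - t).
  apply: (le_trans h1); apply: (@le_trans _ _ (e1 * (M * md (z - t)))).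
    by apply: ler_wpM2l => //; exact: ltW.
  by rewrite /e1 mulrA divfK// gt_eqF.
have a2 : md m * md (g z - g t - l * (z - t)) <= e / 2 * md (z - t).
  apply: (@le_trans _ _ ((md m + 1) * (e2 * md (z - t)))).
    by apply: ler_pM; rewrite ?md_ge0// lerDl.
  rewrite mulrA; apply: ler_wpM2r => //.
  apply: (@le_trans _ _ ((md m + 1) * (e / 2 / (md m + 1)))).
    by apply: ler_wpM2l; [exact: ltW|rewrite ge_min lexx orbT].
  by rewrite mulrC divfK// gt_eqF.
by rewrite [e in leRHS]splitr mulrDl; exact: lerD.
Qed.

Lemma cexpD (a b : C) : cexp (a + b) = cexp a * cexp b.
Proof.
apply/eqP; rewrite eq_complex cReM cImM /cexp /= cReD cImD expRD cosD sinD.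
by apply/andP; split; apply/eqP; ring.
Qed.

Lemma md_cexp (a : C) : md (cexp a) = expR (complex.Re a).
Proof.
rewrite md_sqrt /cexp /= !exprMn -mulrDr cos2Dsin2 mulr1 sqrtr_sqr ger0_norm// expR_ge0.
Qed.

Lemma expR_near0 (x : R) : `|x| <= 2^-1 -> `|expR x - 1 - x| <= 2 * x ^+ 2.
Proof.
rewrite ler_norml => /andP[x1 x2].
have h1 := expR_ge1Dx x; have h2 := expR_ge1Dx (- x).
rewrite ger0_norm; last by lra.
rewrite expRN in h2; have e0 := expR_gt0 x; set E := expR x in h1 h2 e0 *.
have : E * (1 - x) <= 1 by rewrite -[leRHS](@mulfV _ E) ?gt_eqF//; apply: ler_wpM2l => //; exact: ltW.
by nra.
Qed.

Lemma sin_le_norm (y : R) : `|y| <= 2^-1 -> `|sin y| <= `|y| /\ `|sin y - y| <= `|y| * (1 - cos y).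
Proof.
have pos (x : R) : 0 < x -> x <= 2^-1 -> `|sin x| <= `|x| /\ `|sin x - x| <= `|x| * (1 - cos x).
  move=> x0 x1; have [s0 s1 s2] : [/\ 0 < sin x, sin x <= x & x * cos x <= sin x].
    by apply: sin_bounds => //; have := @pi_ge2 R; have := pi_gt0 R; lra.
  rewrite (gtr0_norm s0) (gtr0_norm x0) distrC ger0_norm; last by lra.
  by split => //; lra.
move=> y1; have [y0|y0|<-] := ltgtP 0 y.
- by apply: pos => //; move: y1; rewrite gtr0_norm.
- have := pos (- y); rewrite sinN cosN -opprD !normrN; apply; first by lra.
  by move: y1; rewrite ltr0_norm.
- by rewrite sin0 cos0 !subrr normr0 mul0r.
Qed.

Lemma cos_near0 (y : R) : `|y| <= 2^-1 -> 1 - cos y <= y ^+ 2 / 2 /\ 0 <= 1 - cos y.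
Proof.
move=> y1; split; last by rewrite subr_ge0 cos_le1.
have e : cos y = 1 - 2 * sin (y / 2) ^+ 2.
  have -> : cos y = cos ((y / 2) *+ 2) by congr cos; rewrite mulr2n; lra.
  by rewrite cos_mulr2n cos2sin2 mulr2n; ring.
have [|h _] := @sin_le_norm (y / 2); first by rewrite normrM [`|2^-1|]ger0_norm//; lra.
have : sin (y / 2) ^+ 2 <= (y / 2) ^+ 2.
  by rewrite -[sin _ ^+ 2]real_normK ?num_real// -[leRHS]real_normK ?num_real// lerXn2r// nnegrE.
rewrite e; nra.
Qed.

Lemma cexp_near0 (w : C) : md w <= 2^-1 -> md (cexp w - 1 - w) <= 6 * md w ^+ 2.
Proof.
move=> w1; apply: (le_trans (md_ReIm _)); rewrite !cReD !cImD !cReN !cImN /=.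
have := md_Re w; have := md_Im w; have := md_ge0 w.
move: (complex.Re w) (complex.Im w) (md w) w1 => x y m m1 m0 ym xm.
have hE := @expR_near0 x (le_trans xm m1).
have y1 : `|y| <= 2^-1 by lra.
have [s1 s2] := sin_le_norm y1; have [c1 c0] := cos_near0 y1.
have x2 : x ^+ 2 <= m ^+ 2 by rewrite -real_normK ?num_real// lerXn2r// nnegrE.
have y2 : y ^+ 2 <= m ^+ 2 by rewrite -real_normK ?num_real// lerXn2r// nnegrE.
have Ep := expR_gt0 x; set E := expR x in hE Ep *.
have E1 : `|E - 1| <= 2 * m.
  have -> : E - 1 = (E - 1 - x) + x by ring.
  apply: (le_trans (ler_normD _ _)); nra.
have E2 : E <= 2 by move: E1; rewrite ler_norml => /andP[_]; lra.
have a1 : `|E * cos y - 1 - x| <= 3 * m ^+ 2.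
  have -> : E * cos y - 1 - x = (E - 1 - x) - E * (1 - cos y) by ring.
  apply: (le_trans (ler_normB _ _)).
  rewrite [`|E * _|]ger0_norm; last by rewrite mulr_ge0// ltW.
  nra.
have a2 : `|E * sin y - 0 - y| <= 3 * m ^+ 2.
  have -> : E * sin y - 0 - y = (E - 1) * sin y + (sin y - y) by ring.
  apply: (le_trans (ler_normD _ _)); rewrite normrM.
  have b1 : `|E - 1| * `|sin y| <= 2 * m * m.
    by apply: ler_pM => //; apply: le_trans s1 ym.
  have b2 : `|y| * (1 - cos y) <= m ^+ 2.
    have yn := normr_ge0 y; nra.
  rewrite expr2 in b2 *; lra.
lra.
Qed.

Lemma cexp_cdiff (t : C) : cdiff (@cexp R) t (cexp t).
Proof.
move=> e e0; pose M := md (cexp t); have M0 : 0 <= M := md_ge0 _.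
exists (Num.min 2^-1 (e / (6 * M + 1))).
  by rewrite lt_min invr_gt0 ltr0n divr_gt0//; lra.
move=> z; rewrite lt_min => /andP[z1 z2].
have -> : cexp z - cexp t - cexp t * (z - t) = cexp t * (cexp (z - t) - 1 - (z - t)).
  by rewrite (_ : cexp z = cexp t * cexp (z - t)); [ring|rewrite -cexpD addrC subrK].
rewrite mdM -/M; have := cexp_near0 (ltW z1); have := md_ge0 (z - t).
rewrite ltr_pdivlMr in z2; last by lra.
move: (md (z - t)) z1 z2 => w z1 z2 w0 h; nra.
Qed.

Lemma nome_cdiff (t : C) : cdiff (@nome R) t (tau * nome t).
Proof.
have h1 := @cdiff_comp (@cexp R) (fun z => tau * z) t tau _ (cexp_cdiff _).
rewrite mulrC; apply: h1.
by have := cdiffM (cdiff_cst tau t) (cdiff_id t); rewrite mul0r add0r mulr1.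
Qed.

Lemma md_nome (t : C) : upper_half_plane t -> md (nome t) < 1.
Proof.
move=> t0; rewrite /nome md_cexp cReM /= mul0r sub0r -[ltRHS]expR0 ltr_expR oppr_lt0.
by rewrite mulr_gt0// mulr_gt0// pi_gt0.
Qed.
End ComplexExponential.

(** * Termwise differentiation of power series *)

Section PowerSeries.
Variable R : realType.
Local Notation C := (cplx R).

(** Second-order Taylor remainder of [q^(n+1)]; the factor [s] on the left avoids the exponent
    [n - 1] on the right. *)
Lemma pow_second_order (q h : C) (s : R) n : 0 <= s -> md q <= s -> md (q + h) <= s ->
  s * md ((q + h) ^+ n.+1 - q ^+ n.+1 - n.+1%:R * q ^+ n * h) <= n.+1%:R ^+ 2 * md h ^+ 2 * s ^+ n.
Proof.
move=> s0 qs hs; elim: n => [|n IH].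
  rewrite !expr1 expr0 !mul1r mulr1 (_ : q + h - q - h = 0); last by ring.
  by rewrite md0 mulr0 mulr_ge0// exprn_ge0// md_ge0.
set E := (q + h) ^+ n.+1 - _ - _ in IH.
have -> : (q + h) ^+ n.+2 - q ^+ n.+2 - n.+2%:R * q ^+ n.+1 * h =
   (q + h) * E + n.+1%:R * h ^+ 2 * q ^+ n.
  rewrite /E -[n.+2%:R]natr1 ![_ ^+ n.+2]exprS [q ^+ n.+1]exprS; ring.
apply: (@le_trans _ _ (s * (s * md E + n.+1%:R * md h ^+ 2 * s ^+ n))).
  apply: ler_wpM2l => //; apply: (le_trans (md_triangle _ _)); apply: lerD.
    by rewrite mdM; apply: ler_wpM2r; rewrite ?md_ge0.
  rewrite [md (_ * q ^+ n)]mdM [md (_ * h ^+ 2)]mdM md_nat !mdX; apply: ler_wpM2l; first by rewrite mulr_ge0// exprn_ge0// md_ge0.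
  by rewrite lerXn2r// nnegrE md_ge0.
apply: (@le_trans _ _ (s * (n.+1%:R ^+ 2 * md h ^+ 2 * s ^+ n + n.+1%:R * md h ^+ 2 * s ^+ n))).
  by apply: ler_wpM2l => //; apply: lerD.
rewrite [s ^+ n.+1]exprS -[n.+2%:R]natr1.
have n0 : 0 <= n.+1%:R :> R by [].
have h0 : 0 <= md h ^+ 2 by rewrite exprn_ge0// md_ge0.
have sn : 0 <= s * s ^+ n by rewrite mulr_ge0// exprn_ge0.
move: (n.+1%:R : R) n0 (md h ^+ 2) h0 (s ^+ n) sn => N N0 H H0 P P0.
rewrite -subr_ge0 (_ : _ - _ = (s * P) * (H * (N + 1))); last by ring.
by rewrite mulr_ge0// mulr_ge0// addr_ge0.
Qed.

(** With [s] halfway between [|q|] and 1, the remainders of the partial sums are bounded by a fixed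
    multiple of [|z - q|^2], a bound that survives the limit. *)
Lemma power_series_cdiff (a : nat -> C) (q : C) :
  (forall s : R, 0 <= s -> s < 1 -> geo (fun n => n.+1%:R ^+ 2 * md (a n) * s ^+ n)) ->
  md q < 1 ->
  cdiff (fun z => limn (series (fun n => a n * z ^+ n.+1))) q
    (limn (series (fun n => n.+1%:R * a n * q ^+ n))).
Proof.
move=> ga q1; have q0 := md_ge0 q.
pose s := (1 + md q) / 2; have s0 : 0 < s by rewrite /s; lra.
have s1 : s < 1 by rewrite /s; lra.
have qs : md q < s by rewrite /s; lra.
have gs := ga s (ltW s0) s1; have [B HB] := geo_psum gs.
have B0 : 0 <= B by have := HB 0%N; rewrite big_ord0.
have n1 n : 1 <= n.+1%:R :> R by rewrite ler1n.
have cz z : md z <= s -> exists l, clim (series (fun n => a n * z ^+ n.+1)) l.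
  move=> zs; apply: psum_clim; apply: geo_dom gs => n; rewrite mdM mdX exprS.
  have h : md z * md z ^+ n <= s ^+ n.
    rewrite -[leRHS]mul1r; apply: ler_pM; rewrite ?exprn_ge0 ?md_ge0//; first by lra.
    by rewrite lerXn2r ?nnegrE ?md_ge0// ltW.
  apply: ler_pM; rewrite ?mulr_ge0 ?exprn_ge0 ?md_ge0//.
  by rewrite ler_peMl ?md_ge0// exprn_ege1.
have [l hl] : exists l, clim (series (fun n => n.+1%:R * a n * q ^+ n)) l.
  apply: psum_clim; apply: geo_dom gs => n; rewrite !mdM md_nat mdX.
  apply: ler_pM; rewrite ?mulr_ge0 ?exprn_ge0 ?md_ge0//.
    by apply: ler_wpM2r; rewrite ?md_ge0// expr2 ler_peMl.
  by rewrite lerXn2r ?nnegrE ?md_ge0// ltW.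
have [fq hq] := cz q (ltW qs).
rewrite (clim_lim hl) => e e0.
exists (Num.min (s - md q) (e * s / (B + 1))).
  by rewrite lt_min subr_gt0 qs/= divr_gt0 ?mulr_gt0//; lra.
move=> z; rewrite lt_min => /andP[z1 z2].
have zs : md z <= s.
  by have := md_triangle (z - q) q; rewrite subrK; lra.
have [fz hz] := cz z zs.
have := clim_lim hz; have := clim_lim hq; move: (limn _) (limn _) => f1 f2 -> ->.
have hc := climB (climB hz hq) (climM hl (clim_cst (z - q))).
apply: (@le_trans _ _ (s^-1 * (B * md (z - q) ^+ 2))).
  apply: clim_le hc _ => N; rewrite /series /= !big_mkord mulr_suml -!sumrB.
  apply: (le_trans (md_sum _ _ _)).
  apply: (@le_trans _ _ (\sum_(n < N) s^-1 * (n.+1%:R ^+ 2 * md (a n) * s ^+ n * md (z - q) ^+ 2))).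
    apply: ler_sum => n _.
    have -> : a n * z ^+ n.+1 - a n * q ^+ n.+1 - n.+1%:R * a n * q ^+ n * (z - q) =
      a n * (z ^+ n.+1 - q ^+ n.+1 - n.+1%:R * q ^+ n * (z - q)) by ring.
    rewrite mdM ler_pdivlMl//.
    have := @pow_second_order q (z - q) s n (ltW s0) (ltW qs); rewrite addrC subrK => /(_ zs) h.
    rewrite mulrCA (_ : _ ^+ 2 * md (a n) * _ * _ = md (a n) * (n.+1%:R ^+ 2 * md (z - q) ^+ 2 * s ^+ n)).
      by apply: ler_wpM2l; rewrite ?md_ge0.
    by move: (n.+1%:R ^+ 2) => P; ring.
  rewrite -mulr_sumr -mulr_suml; apply: ler_wpM2l; first by rewrite invr_ge0 ltW.
  by apply: ler_wpM2r; rewrite ?exprn_ge0 ?md_ge0.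
rewrite ler_pdivrMl// ltr_pdivlMr in z2 *; last by lra.
have := md_ge0 (z - q); move: (md (z - q)) z1 z2 => w z1 z2 w0; nra.
Qed.
End PowerSeries.

(** * The derivative of an Eisenstein series *)

Section EisensteinDerivative.
Variable R : realType.
Local Notation C := (cplx R).
Local Notation tau := (two_pi_i R).

Lemma power_series_deriv_clim (q : C) r : md q < 1 ->
  exists l, clim (series (fun n => n.+1%:R * (sigma r n.+1)%:R * q ^+ n)) l.
Proof.
move=> q1; apply: psum_clim; apply: geo_dom (sigma_geo r 1 (md_ge0 q) q1) => n.
by rewrite !mdM !md_nat mdX expr1.
Qed.

Lemma eisenstein_cdiff k (t : C) : upper_half_plane t ->
  cdiff (@eisenstein R k) t (tau * eis_deriv (nome t) k).
Proof.
move=> t0; have q1 := md_nome t0; pose r := (2 * k - 1)%N.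
have h := @power_series_cdiff R (fun n => (sigma r n.+1)%:R) (nome t) _ q1.
have {}h := h _; have := @cdiff_comp R _ (@nome R) t _ _ (h _) (nome_cdiff t) => /(_ _)hc.
have {}hc := hc _.
pose c : C := 2 * tau ^+ (2 * k) / (r`!)%:R.
have := cdiffD (cdiff_cst (2 * of_real (zeta R (2 * k))) t) (cdiffM (cdiff_cst c t) (hc _)).
have -> : tau * eis_deriv (nome t) k = 0 + (0 * limn (series (fun n => (sigma r n.+1)%:R * nome t ^+ n.+1)) +
   c * (limn (series (fun n => n.+1%:R * (sigma r n.+1)%:R * nome t ^+ n)) * (tau * nome t))).
  have [l hl] := @sigma_clim R (nome t) q1 r 1.
  have -> : limn (series (fun n => n.+1%:R * (sigma r n.+1)%:R * nome t ^+ n)) * (tau * nome t) = tau * l.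
    have [l' hl'] := power_series_deriv_clim r q1.
    rewrite (clim_lim hl') mulrCA; congr (_ * _).
    apply: clim_unique hl; apply: clim_ext (climM hl' (clim_cst (nome t))) => N.
    by rewrite /series /= mulr_suml; apply: eq_bigr => n _; rewrite expr1 exprSr mulrA.
  rewrite mul0r !add0r /eis_deriv -/r /sigma_dsum (clim_lim hl) /c; ring.
by apply => s s0 s1; apply: geo_dom (sigma_geo r 2 s0 s1) => n; rewrite md_nat.
Qed.
End EisensteinDerivative.

(** * Conformal blocks *)

Section IteratedDerivatives.
Variable K : numFieldType.
Local Notation L := (laurent K).

Lemma iter_lDD n (f g : L) : iter n (@lD K) (f + g) = iter n (@lD K) f + iter n (@lD K) g.
Proof. by elim: n => //= n ->; rewrite lDD. Qed.
Lemma iter_lDZ n c (f : L) : iter n (@lD K) (lC c * f) = lC c * iter n (@lD K) f.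
Proof. by elim: n => //= n ->; rewrite lDZ. Qed.
Lemma iter_lDN n (f : L) : iter n (@lD K) (- f) = - iter n (@lD K) f.
Proof. by elim: n => //= n ->; rewrite raddfN. Qed.
Lemma lord_iter_lD n (f : L) k : lord f k -> lord (iter n (@lD K) f) (k - n%:Z).
Proof.
elim: n => [|n IH] h; first by rewrite subr0.
by move=> j hj; apply: (lord_lD (IH h)); lia.
Qed.

Lemma iter_lD_Xnat (n j : nat) : iter j (@lD K) (lX K n%:Z) = lC (n ^_ j)%:R * lX K (n%:Z - j%:Z).
Proof.
elim: j => [|j IH]; first by rewrite ffactn0 subr0 lC1 mul1r.
rewrite iterS IH lDZ lD_X mulrA -rmorphM ffactnSr natrM (_ : n%:Z - j%:Z - 1 = n%:Z - j.+1%:Z); last by lia.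
congr (lC _ * _); have [jn|jn] := leqP j n; last by rewrite ffact_small// !mul0r.
by congr (_ * _); rewrite subzn.
Qed.

Lemma iter_lD_Xinv j : iter j (@lD K) (lX K (-1)) = lC ((-1) ^+ j * (j`!)%:R) * lX K (-1 - j%:Z).
Proof.
elim: j => [|j IH]; first by rewrite subr0 expr0 mul1r fact0 lC1 mul1r.
rewrite iterS IH lDZ lD_X mulrA -rmorphM (_ : -1 - j%:Z - 1 = -1 - j.+1%:Z); last by lia.
congr (lC _ * _); rewrite exprS factS natrM (_ : -1 - j%:Z = - j.+1%:Z); last by lia.
by rewrite mulrNz; ring.
Qed.

(** Normalised so that [z^-1] becomes [z^(-n-1)] and the powers [z^(2k-1)] acquire the binomial
    coefficients of the block relations. *)
Definition eis_der n (f : L) : L := lC ((-1) ^+ n / (n`!)%:R) * iter n (@lD K) f.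

Lemma nfact n : (n`!)%:R != 0 :> K. Proof. by rewrite pnatr_eq0 -lt0n fact_gt0. Qed.

Lemma eis_derD n f g : eis_der n (f + g) = eis_der n f + eis_der n g.
Proof. by rewrite /eis_der iter_lDD mulrDr. Qed.
Lemma eis_derZ n c f : eis_der n (lC c * f) = lC c * eis_der n f.
Proof. by rewrite /eis_der iter_lDZ mulrCA. Qed.
Lemma eis_der_sum n (I : Type) (s : seq I) (F : I -> L) :
  eis_der n (\sum_(i <- s) F i) = \sum_(i <- s) eis_der n (F i).
Proof.
elim: s => [|i s IH]; last by rewrite !big_cons eis_derD IH.
by rewrite !big_nil -(mul0r (0 : L)) -lC0 eis_derZ lC0 !mul0r.
Qed.

Lemma eis_der_inv n : eis_der n (lX K (-1)) = lX K (- n.+1%:Z).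
Proof.
rewrite /eis_der iter_lD_Xinv mulrA -rmorphM (_ : -1 - n%:Z = - n.+1%:Z); last by lia.
have -> : (-1) ^+ n / (n`!)%:R * ((-1) ^+ n * (n`!)%:R) = 1 :> K; last by rewrite rmorph1 mul1r.
by rewrite mulrACA -exprD addnn -mul2n exprM sqrrN !expr1n mul1r mulVf// nfact.
Qed.

Lemma eis_der_pos n k : (0 < k)%N ->
  eis_der n (lX K ((2 * k)%:Z - 1)) = lC ((-1) ^+ n * 'C(2 * k - 1, n)%:R) * lX K ((2 * k)%:Z - n.+1%:Z).
Proof.
move=> k0; rewrite (_ : (2 * k)%:Z - 1 = (2 * k - 1)%N%:Z); last by lia.
rewrite /eis_der iter_lD_Xnat mulrA -rmorphM (_ : (2 * k - 1)%N%:Z - n%:Z = (2 * k)%:Z - n.+1%:Z); last by lia.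
congr (lC _ * _); rewrite -bin_ffact natrM -!mulrA; congr (_ * _).
by rewrite mulrCA mulVf ?mulr1// nfact.
Qed.

Lemma eisL_split (G : nat -> K) : eisL G = lX K (-1) + eisdL G.
Proof.
apply: laurentP => -[n|n]; rewrite lcoefD /= mul1r ?add0r ?addr0//.
Qed.

Lemma eisdL_trunc (G : nat -> K) N :
  lord (eisdL G + \sum_(1 <= k < N.+1) lC (G k) * lX K ((2 * k)%:Z - 1)) ((2 * N)%:Z + 1).
Proof.
move=> n nN; rewrite lcoefD lcoef_sum.
have E k : (lC (G k) * lX K ((2 * k)%:Z - 1)) n = if n == (2 * k)%:Z - 1 then G k else 0.
  by rewrite lCM /= mul1r; case: eqP => _; rewrite ?mulr1 ?mulr0.
case: n nN E => [n|n] nN E; last first.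
  rewrite (_ : eisdL G _ = 0)// add0r big_nat big1// => k /andP[k0 kN]; rewrite E; case: eqP => //; lia.
rewrite (_ : eisdL G _ = if odd n then - G n.+1./2 else 0)//; case: ifPn => on.
  have [e1 e2] := odd_index on.
  have h0 : n.+1./2 \in index_iota 1 N.+1 by rewrite mem_index_iota; lia.
  rewrite (bigD1_seq n.+1./2) ?iota_uniq// E big1 ?addr0; last first.
    by move=> k kn; rewrite E; case: eqP => // h; exfalso; move/eqP: kn; apply; lia.
  rewrite e2 (_ : (n%:Z == n.+1%:Z - 1) = true); last by apply/eqP; lia.
  by rewrite [X in _ + X]addr0 addNr.
rewrite add0r big1// => k _; rewrite E; case: eqP => // h; exfalso.
have k0 : (0 < k)%N by lia.
have e : n = (k.*2).-1 by lia.
by move: on; rewrite e -(prednK k0) doubleS /= odd_double.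
Qed.
End IteratedDerivatives.

(** * Block relations and the operator T in terms of P *)

Section BlockExpansion.
Variables (R : realType) (V : voa R) (W : admissible_module V).
Local Notation C := (cplx R).
Local Notation L := (laurent C).
Local Notation tau := (two_pi_i R).
Local Notation om := (conformal_vector V).

Lemma fsum_ge1 (M : nmodType) (F : nat -> M) N : (forall k, (N < k)%N -> F k = 0) ->
  \sum_(k \in [set k : nat | (1 <= k)%N]) F k = \sum_(1 <= k < N.+1) F k.
Proof.
move=> H; rewrite fsbig_mkcond -/(fsum _) (@fsum_nat _ _ N.+1); last first.
  by move=> k kN; rewrite /patch; case: ifP => // _; exact: H.
rewrite -(big_mkord xpredT) big_ltn// {1}/patch memNset ?add0r//.
by apply: eq_big_nat => k /andP[k1 _]; rewrite /patch mem_set.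
Qed.

Lemma sact_lin_sum a v (I : Type) (s : seq I) (F : I -> L) :
  sact a (\sum_(i <- s) F i) v = \sum_(i <- s) sact a (F i) v :> W.
Proof.
elim: s => [|i s IH]; last by rewrite !big_cons sactD IH.
by rewrite !big_nil -(mul0r (0 : L)) -lC0 sactC scale0r.
Qed.

(** [N] depends on [a] and [v] but not on the coefficients [G]: the same finite sum is valid for all
    [tau], hence can be differentiated. *)
Lemma eisdL_expand n a (v : W) : exists N : nat,
  (forall k, (N < k)%N -> sact a (lX C ((2 * k)%:Z - n.+1%:Z)) v = 0) /\
  forall G : nat -> C, sact a (eis_der n (eisdL G)) v =
    (-1) ^+ n.+1 *: \sum_(1 <= k < N.+1) ('C(2 * k - 1, n)%:R * G k) *: sact a (lX C ((2 * k)%:Z - n.+1%:Z)) v.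
Proof.
have [M HM] := sact_trunc a v; exists (`|M| + n)%N; set N := (`|M| + n)%N.
split=> [k kN|G].
  by apply: HM => j hj; apply: (@lord_mono _ 1 ((2 * k)%:Z - n.+1%:Z)); rewrite /N in kN *; lia.
set S := \sum_(1 <= k < N.+1) lC (G k) * lX C ((2 * k)%:Z - 1).
have h0 : sact a (eis_der n (eisdL G + S)) v = 0 :> W.
  apply: HM => j hj; rewrite /eis_der lCM (@lord_iter_lD _ n _ _ (@eisdL_trunc _ G N)) ?mulr0//.
  by rewrite /N; lia.
have : sact a (eis_der n (eisdL G)) v = - sact a (eis_der n S) v :> W.
  by apply/eqP; rewrite -addr_eq0 -sactD -eis_derD h0.
move=> ->; rewrite /S eis_der_sum sact_lin_sum scaler_sumr -sumrN; apply: eq_big_nat => k /andP[k0 _].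
rewrite eis_derZ eis_der_pos// mulrA -rmorphM sactC scalerA -scaleNr; congr (_ *: _).
by rewrite exprS; ring.
Qed.

Lemma eisL_expand n a (v : W) : exists N : nat,
  (forall k, (N < k)%N -> sact a (lX C ((2 * k)%:Z - n.+1%:Z)) v = 0) /\
  forall G : nat -> C, sact a (eis_der n (eisL G)) v = sact a (lX C (- n.+1%:Z)) v +
    (-1) ^+ n.+1 *: \sum_(1 <= k < N.+1) ('C(2 * k - 1, n)%:R * G k) *: sact a (lX C ((2 * k)%:Z - n.+1%:Z)) v.
Proof.
have [N [H1 H2]] := eisdL_expand n a v; exists N; split=> // G.
by rewrite eisL_split eis_derD sactD eis_der_inv H2.
Qed.

Definition eisP (t : C) : L := eisL (fun k => eisenstein k t).

Lemma block_relationE t n a (v : W) :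
  square_mode a (- n.+1%:Z) v + (-1) ^+ n.+1 *:
    \sum_(k \in [set k : nat | (1 <= k)%N])
      ('C(2 * k - 1, n.+1 - 1)%:R * eisenstein k t) *: square_mode a ((2 * k)%:Z - n.+1%:Z) v =
  sact a (eis_der n (eisP t)) v.
Proof.
have [N [H1 H2]] := eisL_expand n a v; rewrite /eisP H2 square_modeE; congr (_ + _ *: _).
rewrite (@fsum_ge1 _ _ N).
  by apply: eq_bigr => k _; rewrite square_modeE (_ : n.+1 - 1 = n)%N//; lia.
by move=> k kN; rewrite square_modeE H1// scaler0.
Qed.

(** The relation of index [m >= 2] corresponds to the derivative of [P] of order [m - 1 >= 1]; [P]
    itself is not among the killed series but enters through [T]. *)
Lemma conformal_blockE (t : C) (phi : W -> C) : conformal_block t phi <->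
  [/\ scalar phi, forall a v, phi (sact a 1 v) = 0 &
      forall n a v, phi (sact a (eis_der n.+1 (eisP t)) v) = 0].
Proof.
split=> -[h1 h2 h3]; split=> //.
- by move=> a v; rewrite -lX0 -square_modeE.
- by move=> n a v; rewrite -block_relationE; exact: h3.
- by move=> a v; rewrite square_modeE lX0.
- by move=> a v [//|[//|n]] _; rewrite block_relationE.
Qed.

Lemma T_operatorE t (v : W) : T_operator t v = sact (square_conformal_vector V) (eisP t) v.
Proof.
have eis0 f : eis_der 0 f = f :> L by rewrite /eis_der fact0 divr1 lC1 mul1r.
have [N [H1 H2]] := eisL_expand 0 (square_conformal_vector V) v.
have := H2 (fun k => eisenstein k t); rewrite eis0 -/(eisP t) => ->.
rewrite /T_operator expr1 scaleN1r /square_L square_modeE; congr (_ - _).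
rewrite (@fsum_ge1 _ _ N).
  apply: eq_bigr => k _; rewrite square_modeE bin0 mul1r.
  by rewrite (_ : (2 * k)%:Z - 2 + 1 = (2 * k)%:Z - 1%N%:Z)//; lia.
move=> k kN; rewrite square_modeE (_ : (2 * k)%:Z - 2 + 1 = (2 * k)%:Z - 1%N%:Z); last by lia.
by rewrite H1// scaler0.
Qed.

(** The vacuum part of the shifted conformal vector contributes the residue of [P], which is 1. *)
Lemma T_operator_act t (v : W) : T_operator t v =
  tau ^+ 2 *: (act om (eisP t * cw R ^+ 2) v - (central_charge V / 24) *: v).
Proof.
rewrite T_operatorE /square_conformal_vector; set f := eisP t.
rewrite (linZ (sact_lina f v)) (linB (sact_lina f v)) (linZ (sact_lina f v)).
rewrite (sact_piece _ _ (voa_conformal_weight V)) (sact_piece _ _ (voa_vacuum_weight V)).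
rewrite wt0 mulr1 act_vacuum /wt lexpMn -/(cw R) (_ : lres f = 1) ?scale1r//.
Qed.
End BlockExpansion.

(** * Preservation of conformal blocks *)

Section BlockConnection.
Variables (R : realType) (V : voa R) (W : admissible_module V).
Local Notation C := (cplx R).
Local Notation L := (laurent C).
Local Notation tau := (two_pi_i R).
Local Notation om := (conformal_vector V).
Local Notation field := (C -> W -> C).

Lemma open_disc (U : set C) t : open U -> U t -> exists2 r : R, 0 < r & forall z, md (z - t) < r -> U z.
Proof. by move=> oU Ut; apply/nbhs_md; apply: open_nbhs_nbhs. Qed.

Lemma holomorphic_cdiff (U : set C) (f : C -> C) t : holomorphic_on U f -> U t -> cdiff f t (derive1 f t).
Proof. by move=> h /h/derivable_cdiff[l hl]; rewrite (derive1_cdiff hl). Qed.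

Lemma cdiff_sum (I : Type) (s : seq I) (F : I -> C -> C) (l : I -> C) t :
  (forall i, cdiff (F i) t (l i)) -> cdiff (fun z => \sum_(i <- s) F i z) t (\sum_(i <- s) l i).
Proof.
move=> H; elim: s => [|i s IH].
  rewrite big_nil (_ : (fun z : C => _) = fun=> 0); first exact: cdiff_cst.
  by apply/funext => z; rewrite big_nil.
rewrite big_cons (_ : (fun z : C => _) = fun z => F i z + \sum_(i <- s) F i z); first exact: cdiffD.
by apply/funext => z; rewrite big_cons.
Qed.

Lemma cdiffZ (c : C) (f : C -> C) t l : cdiff f t l -> cdiff (fun z => c * f z) t (c * l).
Proof. by move=> h; have := cdiffM (cdiff_cst c t) h; rewrite mul0r add0r. Qed.
Lemma cdiffB (f g : C -> C) t l m : cdiff f t l -> cdiff g t m -> cdiff (fun z => f z - g z) t (l - m).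
Proof.
move=> h1 h2; have := cdiffD h1 (cdiffZ (-1) h2); rewrite mulN1r.
by rewrite (_ : (fun z => f z + -1 * g z) = fun z => f z - g z)//; apply/funext => z; rewrite mulN1r.
Qed.

Definition eisX (t : C) : L := eisdL (fun k => eis_deriv (nome t) k).

Lemma eisP_heat t : upper_half_plane t ->
  lC (tau ^+ 2) * eisX t = eisP t * lD (eisP t) + lC 2^-1 * lD (lD (eisP t)).
Proof. by move=> /md_nome q1; exact: (eis_heat q1 (cot_zeta R)). Qed.

Lemma eisP_weierstrass t : upper_half_plane t -> exists alpha beta : C, let p := - lD (eisP t) in
  p * p = lC 6^-1 * lD (lD p) + lC alpha * p + lC beta.
Proof. by move=> /md_nome q1; exact: (eis_weierstrass q1 (cot_zeta R)). Qed.

Lemma T_linear t : linear (@T_operator R V W t).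
Proof. by move=> c u v; rewrite !T_operatorE; exact: sact_linv. Qed.

Section SectionOver.
Variables (U : set C) (phi : field).
Hypotheses (oU : open U) (UH : U `<=` @upper_half_plane R) (sphi : @block_section R V W U phi).

Lemma phi_linear t : U t -> linear (phi t : W -> C^o).
Proof. by move=> Ut; have [] := sphi.1 t Ut. Qed.

Definition dphi (t : C) (v : W) : C := derive1 (fun s => phi s v) t.

Lemma phi_cdiff t v : U t -> cdiff (fun s => phi s v) t (dphi t v).
Proof. by apply: holomorphic_cdiff; exact: sphi.2. Qed.

Lemma dphi_linear t : U t -> linear (dphi t : W -> C^o).
Proof.
move=> Ut c u v; have [r r0 Hr] := open_disc oU Ut.
apply: derive1_cdiff; apply: cdiff_near r0 _ (cdiffD (cdiffZ c (phi_cdiff u Ut)) (phi_cdiff v Ut)) => z zt.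
by rewrite (phi_linear (Hr z zt)).
Qed.

(** Product rule for the dependence on [s] through [phi] and through [P], applied to a finite
    expansion. The factor [tau] appears because [d/ds] is [2 pi i] times [xi]. *)
Lemma phi_expand_cdiff n a v t : U t ->
  cdiff (fun s => phi s (sact a (eis_der n (eisP s)) v)) t
    (dphi t (sact a (eis_der n (eisP t)) v) + tau * phi t (sact a (eis_der n (eisX t)) v)).
Proof.
move=> Ut; have [N [_ HN]] := eisdL_expand n a v; have [r r0 Hr] := open_disc oU Ut.
pose u0 : W := sact a (lX C (- n.+1%:Z)) v.
pose u (k : nat) : W := sact a (lX C ((2 * k)%:Z - n.+1%:Z)) v.
have E (f : W -> C) s : linear (f : W -> C^o) -> f (sact a (eis_der n (eisP s)) v) =
  f u0 + \sum_(1 <= k < N.+1) ((-1) ^+ n.+1 * 'C(2 * k - 1, n)%:R * eisenstein k s) * f (u k).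
  move=> fl; rewrite /eisP eisL_split eis_derD sactD eis_der_inv HN (linD fl) (linZ fl) (@lin_sum _ _ _ _ fl _ (index_iota 1 N.+1)).
  congr (_ + _); rewrite -[LHS]/(_ * _) mulr_sumr; apply: eq_bigr => k _.
  by rewrite (linZ fl) -[_ *: f _]/(_ * f _) !mulrA.
have EX : phi t (sact a (eis_der n (eisX t)) v) =
  \sum_(1 <= k < N.+1) ((-1) ^+ n.+1 * 'C(2 * k - 1, n)%:R * eis_deriv (nome t) k) * phi t (u k).
  have fl := phi_linear Ut; rewrite /eisX HN (linZ fl) (@lin_sum _ _ _ _ fl _ (index_iota 1 N.+1)).
  rewrite -[LHS]/(_ * _) mulr_sumr; apply: eq_bigr => k _.
  by rewrite (linZ fl) -[_ *: phi _ _]/(_ * phi _ _) !mulrA.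
have H := cdiffD (phi_cdiff u0 Ut) (@cdiff_sum _ (index_iota 1 N.+1)
  (fun k s => ((-1) ^+ n.+1 * 'C(2 * k - 1, n)%:R) * (eisenstein k s * phi s (u k))) _ t
  (fun k => cdiffZ _ (cdiffM (eisenstein_cdiff k (UH Ut)) (phi_cdiff (u k) Ut)))).
rewrite (E _ t (dphi_linear Ut)) EX -addrA mulr_sumr -big_split /=.
move: H; rewrite (_ : \sum_(i <- index_iota 1 N.+1) _ = \sum_(1 <= k < N.+1)
   ((-1) ^+ n.+1 * 'C(2 * k - 1, n)%:R * eisenstein k t * dphi t (u k) +
    tau * ((-1) ^+ n.+1 * 'C(2 * k - 1, n)%:R * eis_deriv (nome t) k * phi t (u k)))); last first.
  by apply: eq_bigr => k _; ring.
apply: cdiff_near r0 _ => z zt; rewrite (E _ z (phi_linear (Hr z zt))).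
by congr (_ + _); apply: eq_bigr => k _; rewrite !mulrA.
Qed.

Lemma cdiff0_near (f : C -> C) t l : U t -> (forall s, U s -> f s = 0) -> cdiff f t l -> l = 0.
Proof.
move=> Ut f0 hf; have [r r0 Hr] := open_disc oU Ut.
rewrite -(derive1_cdiff (cdiff_cst 0 t)); apply/esym/derive1_cdiff.
by apply: cdiff_near r0 _ hf => z /Hr/f0.
Qed.

Lemma dphi_one a v t : U t -> dphi t (sact a 1 v) = 0.
Proof.
move=> Ut; apply: cdiff0_near Ut _ (phi_cdiff _ Ut) => s Us.
by have /conformal_blockE[_ h _] := sphi.1 s Us; exact: h.
Qed.

Lemma dphi_eis n a v t : U t ->
  dphi t (sact a (eis_der n.+1 (eisP t)) v) = - (tau * phi t (sact a (eis_der n.+1 (eisX t)) v)).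
Proof.
move=> Ut; apply/eqP; rewrite -addr_eq0; apply/eqP.
apply: cdiff0_near Ut _ (phi_expand_cdiff n.+1 a v Ut) => s Us.
by have /conformal_blockE[_ _ h] := sphi.1 s Us; exact: h.
Qed.

Section Fiber.
Variable t : C.
Hypothesis Ut : U t.
Let phil := phi_linear Ut.
Local Notation killed := (killed (phi t)).

Lemma killed_one : killed 1.
Proof. by apply/(killed_sact phil) => a v; have /conformal_blockE[_ h _] := sphi.1 t Ut; exact: h. Qed.
Lemma killed_eis n : killed (eis_der n.+1 (eisP t)).
Proof. by apply/(killed_sact phil) => a v; have /conformal_blockE[_ _ h] := sphi.1 t Ut; exact: h. Qed.

Lemma killed_ell g : ell (eisP t) g -> killed g.
Proof.
have [al [be ew]] := eisP_weierstrass (UH Ut).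
apply: (N_ell ew).
- by move=> f h; exact: killedD.
- by move=> c f; exact: killedC.
- by move=> f; exact: killed_lD.
- exact: killed_one.
have := @killed_eis 0; rewrite /eis_der /= (_ : 1`! = 1)%N// expr1 divr1.
by rewrite rmorphN rmorph1 mulN1r.
Qed.

(** Since [phi] kills [b{g}] on every vector, including [omega{P} v], only the commutator counts,
    and the central term drops out. The scalar [(2 pi i)^2] in [T] cancels the one in
    [omega_commutator]. *)
Lemma phi_T h b g v : piece (voa_grading V) h b -> ell (eisP t) g ->
  phi t (T_operator t (act b (g * wt R h) v)) = - phi t (act b (eisP t * lD g * wt R h) v).
Proof.
move=> hb eg; have [al [be ew]] := eisP_weierstrass (UH Ut).
have kg := killed_ell eg.
have kj j : killed (iter j.+1 (@lD C) (eisP t) * g).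
  by apply: killed_ell; apply: ell_M => //; exact: (ell_lDP ew).
have e := omega_commutator phil v hb kj.
have t0 := two_pi_i_neq0 R.
rewrite T_operator_act (phiZ phil) (phiB phil) (phiZ phil) (kg _ _ v hb) mulr0 subr0.
move: e; rewrite (phiB phil) (kg _ _ _ hb) subr0 => ->.
by rewrite mulrA exprVn mulrN divff ?mulN1r// expf_neq0.
Qed.

Lemma nabla_linear : linear (nabla_xi phi t : W -> C^o).
Proof.
move=> c u v; rewrite /nabla_xi /xi -/(dphi t _) -/(dphi t _) -/(dphi t _).
rewrite (dphi_linear Ut) T_linear phil -![_ *: (_ : C^o)]/(_ * _).
move: (dphi t u) (dphi t v) (phi t (T_operator t u)) (phi t (T_operator t v)) tau^-1 (tau ^- 2).
by move=> *; ring.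
Qed.

Lemma nabla_block : conformal_block t (nabla_xi phi t).
Proof.
have t0 := two_pi_i_neq0 R.
apply/conformal_blockE; split; first exact: nabla_linear.
- apply/(killed_sact nabla_linear) => h b v hb.
  rewrite /nabla_xi /xi -/(dphi t _) phi_T//; last exact: ell_1.
  rewrite -(sact_piece _ _ hb) dphi_one// lD1 (mulr0 (eisP t)) mul0r act0 (phi0 phil).
  by rewrite oppr0 !mulr0 subr0.
move=> n; apply/(killed_sact nabla_linear) => h b v hb.
have [al [be ew]] := eisP_weierstrass (UH Ut).
set g := eis_der n.+1 (eisP t).
have eg : ell (eisP t) g by apply: ell_M; [exact: ell_C|exact: (ell_lDP ew)].
rewrite /nabla_xi /xi -/(dphi t _) phi_T// -(sact_piece _ _ hb) dphi_eis// (sact_piece _ _ hb).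
(* [ell_heat] in the normalisation of [eis_der]: the series [- xi g + (2 pi i)^-2 P g'] is elliptic,
   and its two terms are those of the derivative of [phi] and of [T]. *)
have := ell_M (ell_C (eisP t) ((-1) ^+ n.+1 / (n.+1`!)%:R)) (ell_heat ew (eisP_heat (UH Ut)) n (expf_neq0 2 t0)).
move=> /killed_ell/(_ h b v hb).
rewrite (_ : _ * wt R h = - (eis_der n.+1 (eisX t) * wt R h) + lC (tau ^+ 2)^-1 * (eisP t * lD g * wt R h)); last first.
  rewrite /g /eis_der lDZ iter_lDN raddfN -iterSr -iterS /=; ring.
rewrite actD actN actC (phiD phil) (phiN phil) (phiZ phil) => e.
by rewrite mulrN mulKf// mulrN opprK.
Qed.
End Fiber.

(** Holomorphy of the first term is that of a derivative; the second term is the case [n = 0] of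
    [phi_expand_cdiff], applied to the shifted conformal vector. *)
Lemma nabla_section : @block_section R V W U (nabla_xi phi).
Proof.
split=> [t Ut|v t Ut]; first exact: nabla_block.
have /derivable_cdiff[l hl] := holomorphic_derive oU (sphi.2 v) Ut.
apply/derivable_cdiff; rewrite /nabla_xi /xi.
have h2 := phi_expand_cdiff 0 (square_conformal_vector V) v Ut.
exists (tau^-1 * l - (tau ^+ 2)^-1 * (dphi t (sact (square_conformal_vector V) (eis_der 0 (eisP t)) v)
    + tau * phi t (sact (square_conformal_vector V) (eis_der 0 (eisX t)) v))).
apply: cdiffB; first exact: cdiffZ.
apply: cdiffZ; move: h2; congr (cdiff _ _ _); apply/funext => s.
by rewrite T_operatorE /eis_der fact0 divr1 rmorph1 mul1r.
Qed.
End SectionOver.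
End BlockConnection.

(** * The connection and its flatness *)

Section Connection.
Variables (R : realType) (V : voa R) (W : admissible_module V).
Local Notation C := (cplx R).
Local Notation field := (C -> W -> C).
Local Notation S := (@block_section R V W).
Implicit Types (U : set C) (f X Y : C -> C) (s : field).

Lemma open_upper_half_plane : open (@upper_half_plane R).
Proof.
rewrite openE => t t0; apply: (proj2 (@nbhs_md R t (@upper_half_plane R))).
exists (complex.Im t) => // z zt; have := md_Im (z - t).
by rewrite cImD cImN ler_norml /upper_half_plane /= => /andP[h _]; lra.
Qed.

Lemma xi_local U f g t : open U -> holomorphic_on U f -> U t -> {in U, f =1 g} -> xi f t = xi g t.
Proof.
move=> oU hf Ut fg; rewrite /xi; have [r r0 Hr] := open_disc oU Ut.
by rewrite (derive1_cdiff (cdiff_near r0 (fun z zt => fg z (mem_set (Hr z zt))) (holomorphic_cdiff hf Ut))).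
Qed.

Lemma holomorphicM U f g : holomorphic_on U f -> holomorphic_on U g ->
  holomorphic_on U (fun t => f t * g t).
Proof.
move=> hf hg t Ut; apply/derivable_cdiff; eexists.
exact: cdiffM (holomorphic_cdiff hf Ut) (holomorphic_cdiff hg Ut).
Qed.

Lemma xiD U f g t : holomorphic_on U f -> holomorphic_on U g -> U t ->
  xi (fun t => f t + g t) t = xi f t + xi g t.
Proof.
move=> hf hg Ut; rewrite /xi -mulrDr; congr (_ * _); apply: derive1_cdiff.
exact: cdiffD (holomorphic_cdiff hf Ut) (holomorphic_cdiff hg Ut).
Qed.
Lemma xiM U f g t : holomorphic_on U f -> holomorphic_on U g -> U t ->
  xi (fun t => f t * g t) t = xi f t * g t + f t * xi g t.
Proof.
move=> hf hg Ut; rewrite /xi.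
rewrite (derive1_cdiff (cdiffM (holomorphic_cdiff hf Ut) (holomorphic_cdiff hg Ut))).
by rewrite mulrDr mulrA mulrCA.
Qed.
Lemma xiZ U (c : C) f t : holomorphic_on U f -> U t -> xi (fun t => c * f t) t = c * xi f t.
Proof.
by move=> hf Ut; rewrite /xi (derive1_cdiff (cdiffZ c (holomorphic_cdiff hf Ut))) mulrCA.
Qed.

Lemma section_scale U f s : holomorphic_on U f -> S U s -> S U (scale_section f s).
Proof.
move=> hf [sc sh]; split=> [t Ut|v]; last exact: (@holomorphicM U f (fun t => s t v) hf (sh v)).
have [h1 h2 h3] := sc t Ut; split; rewrite /scale_section.
- by move=> c u v; rewrite h1 -!/(_ * _) mulrDr mulrCA.
- by move=> a v; rewrite h2 mulr0.
- by move=> a v m m2; rewrite h3// mulr0.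
Qed.

Lemma nabla_leibniz U f s t v : S U s -> holomorphic_on U f -> U t ->
  nabla_xi (scale_section f s) t v = xi f t * s t v + f t * nabla_xi s t v.
Proof.
move=> ss hf Ut; rewrite /nabla_xi /scale_section (xiM hf (ss.2 v) Ut).
by move: (xi _ t) (xi _ t) (s t _) (s t _) (_ ^-1) => a b x y z; ring.
Qed.

Lemma nabla_add U (c : C) s s' t v : S U s -> S U s' -> U t ->
  nabla_xi (fun t v => c * s t v + s' t v) t v = c * nabla_xi s t v + nabla_xi s' t v.
Proof.
move=> ss ss' Ut; rewrite /nabla_xi.
have hc : holomorphic_on U (fun t => c * s t v).
  by move=> z Uz; apply/derivable_cdiff; eexists; exact: cdiffZ (holomorphic_cdiff (ss.2 v) Uz).
rewrite (xiD hc (ss'.2 v) Ut) (xiZ c (ss.2 v) Ut).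
move: (xi _ t) (xi _ t) (s t _) (s' t _) (_ ^-1) => a b x y z; ring.
Qed.

Lemma nabla_local U s s' : open U -> S U s -> {in U, s =1 s'} -> {in U, nabla_xi s =1 nabla_xi s'}.
Proof.
move=> oU ss e t Ut; apply/funext => v; have et := e t Ut.
rewrite /nabla_xi et (@xi_local U (fun t => s t v) (fun t => s' t v) t oU (ss.2 v) (set_mem Ut))//.
by move=> z /e ->.
Qed.

Lemma nabla_sheaf_operator : is_sheaf_operator S (@nabla_xi R V W).
Proof.
split=> [U s oU UH ss|U s s' oU _ ss _ e|U c s s' oU UH ss ss' t Ut].
- exact: nabla_section oU UH ss.
- exact: nabla_local oU ss e.
- by apply/funext => v; apply: (nabla_add c v ss ss'); exact: set_mem.
Qed.

Lemma block_connection_connection : is_connection S (@block_connection R V W).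
Proof.
split.
- move=> X U s oU UH hX ss; exact: (@section_scale U X (nabla_xi s) hX (nabla_section oU UH ss)).
- move=> X X' U s s' oU UH hX hX' ss ss' eX es t Ut; apply/funext => v.
  by rewrite /block_connection /scale_section eX// (nabla_local oU ss es).
- move=> f X Y U s oU UH hf hX hY ss t Ut; apply/funext => v.
  by rewrite /block_connection /scale_section mulrDl mulrA.
- move=> X U c s s' oU UH hX ss ss' t Ut; apply/funext => v.
  rewrite /block_connection /scale_section (nabla_add c v ss ss' (set_mem Ut)).
  by rewrite mulrDr mulrCA.
- move=> X f U s oU UH hX hf ss t Ut; apply/funext => v.
  rewrite /block_connection {1}/scale_section (nabla_leibniz v ss hf (set_mem Ut)) /scale_section.
  by rewrite mulrDr mulrA [X t * (f t * _)]mulrCA.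
Qed.

(** Applying the Leibniz rule on both sides, the terms [X Y] times the second iterate of [nabla_xi]
    cancel, and the first-order terms are those of the bracket. *)
Lemma block_connection_flat : is_flat S (@block_connection R V W).
Proof.
move=> X Y U s oU UH hX hY ss t Ut; apply/funext => v.
have sn := nabla_section oU UH ss; have Ut' := set_mem Ut.
rewrite /block_connection {1 3 5}/scale_section.
rewrite (nabla_leibniz v sn hY Ut') (nabla_leibniz v sn hX Ut') /lie_bracket.
move: (nabla_xi (nabla_xi s) t v) (nabla_xi s t v) (xi X t) (xi Y t) => a b c d.
ring.
Qed.
End Connection.

Theorem proposition6p9 (R : realType) (V : voa R) (W : admissible_module V) :
  strongly_rational V -> irreducible_module W ->
  [/\ forall phi : cplx R -> W -> cplx R,
        block_section (@upper_half_plane R) phi ->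
        block_section (@upper_half_plane R) (nabla_xi phi),
      is_sheaf_operator (@block_section R V W) (@nabla_xi R V W),
      is_connection (@block_section R V W) (@block_connection R V W) &
      is_flat (@block_section R V W) (@block_connection R V W)].
Proof.
move=> _ _; split.
- by move=> phi; apply: nabla_section => //; exact: open_upper_half_plane.
- exact: nabla_sheaf_operator.
- exact: block_connection_connection.
- exact: block_connection_flat.
Qed.
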